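(* Assume that $H:\mathbb{R}^3\to\mathbb{R}$ satisfies (A0)-(A5) and either (B-i) or (B-ii) (all listed in the context). Let $T>0$, let $u_0:\mathbb{R}\to\mathbb{R}$ be Lipschitz continuous and, for $\varepsilon>0$, let $u^\varepsilon$ be the solution of $$u^\varepsilon_t+H\left(\frac t\varepsilon,\frac x\varepsilon,u^\varepsilon_x\right)=0\quad\text{for }(t,x)\in(0,T)\times\mathbb{R},\qquad u^\varepsilon(0,x)=u_0(x)\quad\text{for }x\in\mathbb{R}.$$ Then, as $\varepsilon\to0$, $u^\varepsilon$ converges locally uniformly to the unique flux-limited solution $u^0$ of $$\begin{cases}u^0_t+\bar H_L(u^0_x)=0,& t>0,\ x<0,\\ u^0_t+\bar H_R(u^0_x)=0,& t>0,\ x>0,\\ u^0_t+F_{\bar A}(u^0_x(t,0^-),u^0_x(t,0^+))=0,& t>0,\ x=0,\end{cases}$$ submitted to the initial condition $u^0(0,x)=u_0(x)$ for $x\in\mathbb{R}$, where $\bar H_L,\bar H_R$ are the homogenized Hamiltonians, $\bar A$ is the effective flux limiter and $F_{\bar A}$ is the effective junction function defined in the context.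
   Context: Assumptions on $H=H(t,x,p)$. (A0) $H:\mathbb{R}^3\to\mathbb{R}$ is continuous. (A1) $H(t+k,x,p)=H(t,x,p)$ for all $k\in\mathbb{Z}$, $(t,x,p)\in\mathbb{R}^3$. (A2) There is a modulus of continuity $\omega$ such that $H(t,x,p)-H(s,x,p)\le\omega\big(|t-s|(1+\max(H(s,x,p),0))\big)$ for all $t,s,x,p\in\mathbb{R}$. (A3) $\lim_{|q|\to+\infty}H(t,x,q)=+\infty$ uniformly in $(t,x)$. (A4) There is $\rho_0>0$ such that for all $x\in\mathbb{R}\setminus(-\rho_0,\rho_0)$ there is a continuous map $t\mapsto p^0(t,x)$ such that $H(t,x,\cdot)$ is non-increasing on $(-\infty,p^0(t,x))$ and non-decreasing on $(p^0(t,x),+\infty)$. (A5) There are two Hamiltonians $H_L,H_R$ such that $H(t,x+k,p)-H_L(t,x,p)\to0$ as $\mathbb{Z}\ni k\to-\infty$ and $H(t,x+k,p)-H_R(t,x,p)\to0$ as $\mathbb{Z}\ni k\to+\infty$, uniformly in $(t,x,p)\in[0,1]^2\times\mathbb{R}$, and $H_\alpha(t+k,x+j,p)=H_\alpha(t,x,p)$ for all $k,j\in\mathbb{Z}$, $(t,x,p)\in\mathbb{R}^3$, $\alpha\in\{L,R\}$. (B-i) For each $\alpha=L,R$, $H_\alpha$ does not depend on time and there is $p^0_\alpha$ (independent of $(t,x)$) such that $H_\alpha(x,\cdot)$ is non-increasing on $(-\infty,p^0_\alpha)$ and non-decreasing on $(p^0_\alpha,+\infty)$. (B-ii) For each $\alpha=L,R$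 and all $(t,x)$, $p\mapsto H_\alpha(t,x,p)$ is convex. Viscosity solutions. For a locally bounded function $u$, $u^*$ and $u_*$ are its upper and lower semi-continuous envelopes. $u$ is a sub-solution (resp. super-solution) of an equation if, whenever a $C^1$ test function $\varphi$ touches $u^*$ from above (resp. $u_*$ from below) at a point, $\varphi$ satisfies the equation at that point with $\le$ (resp. $\ge$). A solution is both; solutions may be discontinuous. Homogenized Hamiltonians. For $p\in\mathbb{R}$, $\alpha\in\{L,R\}$, $\bar H_\alpha(p)$ is the unique $\lambda\in\mathbb{R}$ for which there is a bounded $\mathbb{Z}^2$-periodic (in $(t,x)$) viscosity solution $v^\alpha$ of $v^\alpha_t+H_\alpha(t,x,p+v^\alpha_x)=\lambda$ in $\mathbb{R}\times\mathbb{R}$; the functions $\bar H_\alpha$ are continuous, coercive and quasi-convex (sublevel sets are convex). Effective flux limiter. $\bar A$ is the infimum of the set of $\lambda\in\mathbb{R}$ for which there is a sub-solution $w$, $1$-periodic in $t$, of $w_t+H(t,x,w_x)=\lambda$ in $\mathbb{R}\times\mathbb{R}$ (this set is non-empty and bounded from below). Effective junction function. Let $\bar p^0_\alpha\in\operatorname{argmin}\bar H_\alpha$; set $\bar H_\alpha^-(p)=\bar H_\alpha(p)$ if $p<\bar p^0_\alpha$ and $\bar H_\alpha^-(p)=\bar H_\alpha(\bar p^0_\alpha)$ if $p\ge\bar p^0_\alpha$; $\bar H_\alpha^+(p)=\bar H_\alpha(\bar p^0_\alpha)$ if $p\le\bar p^0_\alpha$ and $\bar H_\alpha^+(p)=\bar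 H_\alpha(p)$ if $p>\bar p^0_\alpha$. Then $F_{\bar A}(p_L,p_R):=\max(\bar A,\bar H_L^+(p_L),\bar H_R^-(p_R))$. Flux-limited solutions. In the limit problem, test functions are continuous on $(0,+\infty)\times\mathbb{R}$ with restrictions to $(0,+\infty)\times(-\infty,0]$ and to $(0,+\infty)\times[0,+\infty)$ of class $C^1$. A locally bounded $u$ is a flux-limited sub-solution (resp. super-solution) if whenever such a $\varphi$ touches $u^*$ from above (resp. $u_*$ from below) locally at $(t,x)$, $t>0$, the equation corresponding to the position of $x$ (namely $x<0$, $x>0$, or the junction equation at $x=0$, with $\varphi_x(t,0^\pm)$ the one-sided derivatives) holds for $\varphi$ at $(t,x)$ with $\le0$ (resp. $\ge0$). A flux-limited solution is both. Solutions of the Cauchy problems (for $u^\varepsilon$ and $u^0$) are the viscosity (resp. flux-limited) solutions in the usual comparison class of functions with at most linear growth in $x$, locally uniformly in time. *)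

(* Defs.v *)
From HB Require Import structures.
From mathcomp Require Import all_boot all_order all_algebra.
From mathcomp Require Import all_classical all_reals all_analysis.

Set Implicit Arguments.
Unset Strict Implicit.
Unset Printing Implicit Defensive.

Import Order.TTheory GRing.Theory Num.Theory.
Import numFieldNormedType.Exports.

Local Open Scope classical_set_scope.
Local Open Scope ring_scope.

(* Points of time-space are pairs z = (t, x) : R * R; Hamiltonians are curried
   functions of t, x, p. *)

Section Assumptions.
Context {R : realType}.
Implicit Types (H HL HR Ha : R -> R -> R -> R) (f omega : R -> R).

Definition A0 H : Prop := continuous (fun z : R * R * R => H z.1.1 z.1.2 z.2).

Definition A1 H : Prop := forall (k : int) t x p, H (t + k%:~R) x p = H t x p.

Definition modulus omega : Prop :=
  [/\ omega 0 = 0,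
      {in `[0, +oo[ &, {homo omega : r s / r <= s}} &
      omega r @[r --> 0^'+] --> (0 : R)].

Definition A2 H : Prop := exists omega, modulus omega /\
  forall t s x p, H t x p - H s x p <=
    omega (`|t - s| * (1 + Num.max (H s x p) 0)).

Definition A3 H : Prop := forall M : R, exists K : R, forall q, K <= `|q| ->
  forall t x, M <= H t x q.

Definition quasi_convex_at f (p0 : R) : Prop :=
  {in `]-oo, p0[ &, {homo f : p q / p <= q >-> q <= p}} /\
  {in `]p0, +oo[ &, {homo f : p q / p <= q}}.

Definition A4 H : Prop := exists2 rho0 : R, 0 < rho0 &
  forall x, x \notin `]- rho0, rho0[ ->
  exists2 p0 : R -> R, continuous p0 & forall t, quasi_convex_at (H t x) (p0 t).

Definition Z2_periodic Ha : Prop :=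
  forall (k j : int) t x p, Ha (t + k%:~R) (x + j%:~R) p = Ha t x p.

Definition A5 H HL HR : Prop :=
  [/\ forall e : R, 0 < e -> exists N : int, forall k : int, k <= N ->
        forall t x p, t \in `[0, 1] -> x \in `[0, 1] ->
        `|H t (x + k%:~R) p - HL t x p| < e,
      forall e : R, 0 < e -> exists N : int, forall k : int, N <= k ->
        forall t x p, t \in `[0, 1] -> x \in `[0, 1] ->
        `|H t (x + k%:~R) p - HR t x p| < e,
      Z2_periodic HL & Z2_periodic HR].

Definition Bi Ha : Prop :=
  (forall t s x p, Ha t x p = Ha s x p) /\
  exists p0 : R, forall t x, quasi_convex_at (Ha t x) p0.

Definition Bii Ha : Prop := forall t x,
  convex_function ([set: R] : set R^o) (Ha t x : R^o -> R^o).

End Assumptions.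

Section Viscosity.
Context {R : realType}.
Implicit Types (H Ha : R -> R -> R -> R) (u phi : R * R -> R).
Implicit Types (D Omega E : set (R * R)).

(* Envelopes of a function whose domain is D. The filter is not punctured, so
   usc_env D u is above u on D. *)
Definition usc_env D u (z : R * R) : \bar R :=
  limf_esup (EFin \o u) (within D (nbhs z)).

Definition lsc_env D u (z : R * R) : \bar R :=
  limf_einf (EFin \o u) (within D (nbhs z)).

Definition locally_bounded D u : Prop :=
  forall z, D z -> bounded_near u (within D (nbhs z)).

Definition dir_t : R * R := (1, 0).
Definition dir_x : R * R := (0, 1).

(* Directional derivative of the restriction of phi to E: one-sided when z is a
   boundary point of E and v is transverse to the boundary, and equal to the
   library's 'D_v phi z when z is interior to E (deriv_inE below). *)
Definition quot_in E (v : R * R) phi z : set_system R :=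
  (fun h : R => h^-1 * (phi (h *: v + z) - phi z)) @
    within [set h | E (h *: v + z)] 0^'.

Definition deriv_in E (v : R * R) phi z : R := lim (quot_in E v phi z).

Lemma deriv_inE E (v : R * R) phi z :
  nbhs z E -> deriv_in E v phi z = 'D_v phi z.
Proof.
move=> nE; rewrite /deriv_in /quot_in /derive; congr (lim (_ @ _)).
have cv : (fun h : R => h *: v + z) @ 0^' --> z.
  have cv0 : continuous (fun h : R => h *: v + z).
    by move=> h; apply: cvgD; [exact: scalel_continuous|exact: cvg_cst].
  have := cv0 0; rewrite /continuous_at scale0r add0r => c0.
  exact: cvg_trans (cvg_app _ (@nbhs_dnbhs _ _)) c0.
apply/seteqP; split=> A /= hA; last exact: cvg_within hA.
have nEh : \forall h \near (0 : R)^', E (h *: v + z) by exact: (cv _ nE).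
by apply: filterS2 nEh hA => h Eh; exact.
Qed.

(* For E open this is class C^1 on E; for E an open time interval times a closed
   half-line it is class C^1 up to the boundary x = 0, with one-sided
   derivatives in x there. *)
Definition C1_in E phi : Prop := forall v, v = dir_t \/ v = dir_x ->
  (forall z, E z -> cvg (quot_in E v phi z)) /\
  {within E, continuous (deriv_in E v phi)}.

Definition touches_above D u phi (z0 : R * R) : Prop :=
  usc_env D u z0 = (phi z0)%:E /\
  \forall z \near z0, D z -> (usc_env D u z <= (phi z)%:E)%E.

Definition touches_below D u phi (z0 : R * R) : Prop :=
  lsc_env D u z0 = (phi z0)%:E /\
  \forall z \near z0, D z -> ((phi z)%:E <= lsc_env D u z)%E.

(* The equation u_t + H(t, x, u_x) = lam in the open set Omega, for a function u
   defined on D, where Omega `<=` D. *)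
Definition subsolution Omega D H (lam : R) u : Prop :=
  locally_bounded D u /\
  forall phi z, C1_in Omega phi -> Omega z -> touches_above D u phi z ->
    deriv_in Omega dir_t phi z + H z.1 z.2 (deriv_in Omega dir_x phi z) <= lam.

Definition supersolution Omega D H (lam : R) u : Prop :=
  locally_bounded D u /\
  forall phi z, C1_in Omega phi -> Omega z -> touches_below D u phi z ->
    lam <= deriv_in Omega dir_t phi z + H z.1 z.2 (deriv_in Omega dir_x phi z).

Definition corrector Ha (p lam : R) (v : R * R -> R) : Prop :=
  let Hp t x q := Ha t x (p + q) in
  [/\ exists M : R, forall z, `|v z| <= M,
      forall (k j : int) t x, v (t + k%:~R, x + j%:~R) = v (t, x),
      subsolution setT setT Hp lam v & supersolution setT setT Hp lam v].

(* The unique lam for which there is a corrector (the default 0 of xget is used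
   only if there is none). *)
Definition Hbar Ha (p : R) : R :=
  xget 0 [set lam | exists v, corrector Ha p lam v].

Definition Abar H : R :=
  inf [set lam | exists2 w, forall t x, w (t + 1, x) = w (t, x) &
                            subsolution setT setT H lam w].

Definition argmin (h : R -> R) : set R := [set p0 | forall p, h p0 <= h p].

Definition decr_part (h : R -> R) (p0 p : R) : R := if p < p0 then h p else h p0.

Definition incr_part (h : R -> R) (p0 p : R) : R := if p <= p0 then h p0 else h p.

Definition junction_fun (A : R) (hL hR : R -> R) (p0L p0R pL pR : R) : R :=
  Num.max A (Num.max (incr_part hL p0L pL) (decr_part hR p0R pR)).

End Viscosity.

Section CauchyProblems.
Context {R : realType}.
Implicit Types (H : R -> R -> R -> R) (u phi : R * R -> R).
Implicit Types (T : \bar R).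

Definition strip T : set (R * R) := [set z | 0 <= z.1 /\ (z.1%:E < T)%E].
Definition open_strip T : set (R * R) := [set z | 0 < z.1 /\ (z.1%:E < T)%E].

Definition linear_growth T u : Prop := forall T' : R, (T'%:E < T)%E ->
  exists C : R, forall t x, 0 <= t -> t <= T' -> `|u (t, x)| <= C * (1 + `|x|).

(* The initial condition is imposed on both envelopes over [0, T) x R. It implies
   u (0, x) = u0 x and the continuity of u at (0, x). *)
Definition initial_condition T (u0 : R -> R) u : Prop := forall x,
  (usc_env (strip T) u (0%R, x) <= (u0 x)%:E)%E /\
  ((u0 x)%:E <= lsc_env (strip T) u (0%R, x))%E.

Definition cauchy_solution T H (u0 : R -> R) u : Prop :=
  [/\ subsolution (open_strip T) (strip T) H 0 u,
      supersolution (open_strip T) (strip T) H 0 u,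
      initial_condition T u0 u & linear_growth T u].

Definition left_half : set (R * R) := [set z | 0 < z.1 /\ z.2 <= 0].
Definition right_half : set (R * R) := [set z | 0 < z.1 /\ 0 <= z.2].

Definition junction_test phi : Prop :=
  [/\ {within open_strip +oo, continuous phi},
      C1_in left_half phi & C1_in right_half phi].

(* Left-hand side of the limit problem. At the junction, deriv_in left_half and
   deriv_in right_half give the one-sided derivatives in x. *)
Definition junction_op (hL hR : R -> R) (F : R -> R -> R) phi (z : R * R) : R :=
  deriv_in (open_strip +oo) dir_t phi z +
  (if z.2 < 0 then hL (deriv_in left_half dir_x phi z)
   else if 0 < z.2 then hR (deriv_in right_half dir_x phi z)
   else F (deriv_in left_half dir_x phi z) (deriv_in right_half dir_x phi z)).

Definition fl_subsolution (hL hR : R -> R) (F : R -> R -> R) u : Prop :=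
  locally_bounded (strip +oo) u /\
  forall phi z, junction_test phi -> open_strip +oo z ->
    touches_above (strip +oo) u phi z -> junction_op hL hR F phi z <= 0.

Definition fl_supersolution (hL hR : R -> R) (F : R -> R -> R) u : Prop :=
  locally_bounded (strip +oo) u /\
  forall phi z, junction_test phi -> open_strip +oo z ->
    touches_below (strip +oo) u phi z -> 0 <= junction_op hL hR F phi z.

Definition fl_cauchy_solution (hL hR : R -> R) (F : R -> R -> R)
  (u0 : R -> R) u : Prop :=
  [/\ fl_subsolution hL hR F u, fl_supersolution hL hR F u,
      initial_condition +oo u0 u & linear_growth +oo u].

End CauchyProblems.

(* Main.v *)
Require Import Defs.
From HB Require Import structures.
From mathcomp Require Import all_boot all_order all_algebra.
From mathcomp Require Import all_classical all_reals all_analysis.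
From mathcomp Require Import ring lra.

Set Implicit Arguments.
Unset Strict Implicit.
Unset Printing Implicit Defensive.

Import Order.TTheory GRing.Theory Num.Theory.
Import numFieldNormedType.Exports.

Local Open Scope classical_set_scope.
Local Open Scope ring_scope.

(* All notions are read through first order superjets, supersolutions being
   opposites of subsolutions of the reflected equation, and u^eps is studied
   through its upper and lower half-relaxed limits, which barriers u_0 +- C t keep
   finite and equal to u_0 at t = 0.

   Away from the junction the perturbed test function method applies, with
   correctors touched from below by paraboloids, so that adding a C^1 function
   to a corrector shifts its jets.

   At the junction, on the subsolution side, blowing up u^eps around points where
   a test function with time slope a is touched yields a time-periodic
   subsolution of the cell problem at level -a, so Abar <= -a; steep test
   functions give the inequality for the monotone parts of the effective
   Hamiltonians.

   On the supersolution side, the slopes of the test function are raised by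
   concave corrections to the critical ones. If the inequality failed, the lower
   limit could be compared with psi(t) + eps w(t/eps, x/eps), where w is a
   periodic subsolution at a level slightly above Abar whose growth at infinity
   is controlled by homogenization away from the junction.

   The two limits are then ordered by a comparison principle for flux-limited
   solutions: time is doubled first, then space, with a kink of critical slopes
   added to the penalization in x. Perron's method between the barriers gives existence. *)

(** * Semicontinuity, jets and half-relaxed limits *)

Section Semicontinuity.
Context {R : realType}.

(** The solutions may be discontinuous, and no compactness of the family is used: all limits are
    half-relaxed, and continuity is only recovered at the end, from the ordering of the two limits.
    Two features of the data shape the proof. (A2) bounds the variation of [H] in time relatively to
    the size of [H], so time and space have to be doubled at different scales, the scale [th'] of
    space being chosen after the scale [th] of time. And [Abar] is an infimum of levels of
    subsolutions: there is no corrector at the junction. On the subsolution side it is enough to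
    exhibit one periodic subsolution. On the supersolution side only subsolutions at levels above
    [Abar] are at hand, and their slopes at infinity are known through inequalities alone; the
    slopes of the test function must therefore be opened strictly beyond those slopes before
    anything can be compared. Finally, the kink in the comparison principle depends on the time
    slope at the contact point, which has to be frozen before space is doubled. *)

Definition usc {T : topologicalType} (u : T -> R) (z : T) : Prop :=
  forall e, 0 < e -> \forall y \near z, u y < u z + e.

Section General.
Context {T : topologicalType}.
Implicit Types (u v : T -> R) (X : set T).

Lemma continuous_usc u z : {for z, continuous u} -> usc u z.
Proof.
move=> cu e e0; have /cvgrPdist_lt/(_ _ e0) := cu.
apply: filterS => y; rewrite ltr_norml => /andP[h1 h2]; lra.
Qed.

Lemma uscD u v z : usc u z -> usc v z -> usc (fun y => u y + v y) z.
Proof.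
move=> hu hv e e0; have e2 : 0 < e / 2 by lra.
move: (hu _ e2) (hv _ e2); apply: filterS2 => y; lra.
Qed.

Lemma usc_near u v z : (\forall y \near z, u y = v y) -> usc u z -> usc v z.
Proof.
move=> uv hu e e0; rewrite -(nbhs_singleton uv).
move: uv (hu _ e0); apply: filterS2 => y -> //.
Qed.

Lemma usc_scale (k : R) u z : 0 <= k -> usc u z -> usc (fun y => k * u y) z.
Proof.
move=> k0 hu e e0; have ek : 0 < e / (k + 1) by rewrite divr_gt0//; lra.
move: (hu _ ek); apply: filterS => y h.
have : k * u y <= k * (u z + e / (k + 1)) by rewrite ler_wpM2l// ltW.
have : k * (e / (k + 1)) < e.
  by rewrite mulrA ltr_pdivrMr; nra.
lra.
Qed.

Lemma usc_maxr u v z : usc u z -> usc v z -> usc (fun y => Num.max (u y) (v y)) z.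
Proof.
move=> hu hv e e0; move: (hu _ e0) (hv _ e0); apply: filterS2 => y h1 h2.
by rewrite addr_maxl; rewrite gt_max !lt_max h1 h2 orbT.
Qed.

(** If the supremum [S] were not attained, the sets where u < c, open by semicontinuity and
    increasing as c tends to [S], would cover [X]; compactness would then give one c < S bounding
    u. *)
Lemma usc_compact_max X u : compact X -> X !=set0 -> (forall x, X x -> usc u x) ->
  exists2 x, X x & forall y, X y -> u y <= u x.
Proof.
move=> /compact_near_coveringP cX [x0 Xx0] hu.
have [M hM] : exists M, forall y, X y -> u y <= M.
  have : \forall M \near +oo, X `<=` [set y | u y <= M].
    apply: cX => x Xx.
    have hx := hu _ Xx 1 ltr01.
    exists ([set y | u y < u x + 1], [set M | u x + 1 <= M]) => /=.
      by split => //; exists (u x + 1); split => //; [exact: num_real|move=> y /ltW].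
    by move=> [y M] /= [h1 h2]; lra.
  by case=> M [_ hM]; exists (M + 1) => y; apply: hM => /=; lra.
pose S := sup (u @` X).
have hS y : X y -> u y <= S.
  move=> Xy; apply: ub_le_sup; last by exists y.
  by exists M => _ [w Xw <-]; exact: hM.
apply: contrapT => /forall2NP hn.
have lS x : X x -> u x < S.
  move=> Xx; rewrite lt_neqAle hS// andbT; apply/eqP => uS.
  by case: (hn x) => //; apply => y Xy; rewrite uS; exact: hS.
have : \forall c \near S^'-, X `<=` [set y | u y < c].
  apply: cX => x Xx.
  have d0 : 0 < (S - u x) / 2 by have := lS _ Xx; lra.
  exists ([set y | u y < u x + (S - u x) / 2], [set c | u x + (S - u x) / 2 < c]) => /=.
    split; first exact: hu.
    by apply: nbhs_left_gt; lra.
  by move=> [y c] /= [h1 h2]; lra.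
have : \forall c \near S^'-, c < S by exact: nbhs_left_lt.
move=> /filter_ex + ; move=> _ hc.
have hc2 : \forall c \near S^'-, c < S by exact: nbhs_left_lt.
have [c [h1 h2]] := filter_ex (filterI hc hc2).
have : S <= c.
  apply: ge_sup; first by exists (u x0); exists x0.
  by move=> _ [y Xy <-]; apply: ltW; exact: h1.
lra.
Qed.

Lemma usc_compact_bound X u : compact X -> (forall x, X x -> usc u x) ->
  exists M, forall y, X y -> u y <= M.
Proof.
move=> cX hu; have [->|/set0P X0] := eqVneq X set0; first by exists 0.
by have [x Xx hx] := usc_compact_max cX X0 hu; exists (u x).
Qed.

(* If g vanishes only where f <= M, then penalizing by n g brings the maximum
   of f down to M: the open sets {f - n g < M + e} increase and cover X. *)
Lemma penalized_max X (f g : T -> R) (M e : R) : compact X ->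
  (forall x, X x -> usc f x) -> continuous g -> (forall x, 0 <= g x) ->
  (forall x, X x -> g x = 0 -> f x <= M) -> 0 < e ->
  exists2 n0 : R, 0 < n0 & forall n x, n0 <= n -> X x -> f x - n * g x < M + e.
Proof.
move=> /compact_near_coveringP cX hf cg g0 hM e0.
have : \forall n \near (+oo : set_system R), X `<=` [set y | f y - n * g y < M + e].
  apply: cX => x Xx.
  have e2 : 0 < e / 2 by lra.
  have hfx := hf _ Xx _ e2.
  have [gx|gx] := eqVneq (g x) 0.
    exists ([set y | f y < f x + e / 2], [set n | 0 <= n]) => /=.
      by split => //; exact: nbhs_pinfty_ge (num_real _).
    move=> [y n] /= [h1 h2]; have := hM _ Xx gx; have := g0 y; nra.
  have gx0 : 0 < g x by rewrite lt_neqAle eq_sym gx g0.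
  have gx2 : 0 < g x / 2 by lra.
  have hg : \forall y \near x, g x / 2 < g y.
    have /cvgrPdist_lt/(_ _ gx2) := cg x.
    by apply: filterS => y; rewrite ltr_norml => /andP[h1 h2]; lra.
  pose n0 := (`|f x| + `|M| + e) / (g x / 2).
  exists ([set y | f y < f x + e / 2 /\ g x / 2 < g y], [set n | n0 <= n]) => /=.
    by split; [exact: filterI|exact: nbhs_pinfty_ge (num_real _)].
  move=> [y n] /= [[h1 h2] h3].
  have h4 : `|f x| + `|M| + e <= n * (g x / 2) by rewrite -ler_pdivrMr.
  have n00 : 0 <= n0 by rewrite divr_ge0//; [rewrite !addr_ge0//|]; lra.
  have h5 : n * (g x / 2) <= n * g y by rewrite ler_wpM2l//; lra.
  have := ler_norm (f x); have := ler_norm (- M); rewrite normrN; lra.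
case=> n0 [_ h]; exists (`|n0| + 1); first by rewrite ltr_wpDl.
move=> n x h1 Xx; apply: (h n) => //; have := ler_norm n0; lra.
Qed.

End General.

Lemma usc_comp {S T : topologicalType} (u : T -> R) (h : S -> T) z :
  {for z, continuous h} -> usc u (h z) -> usc (u \o h) z.
Proof. by move=> ch hu e e0; exact: ch (hu e e0). Qed.

Implicit Types z y : R * R.

Lemma nbhs_boxP z (A : set (R * R)) : nbhs z A <->
  exists2 d, 0 < d & forall y, `|y.1 - z.1| <= d -> `|y.2 - z.2| <= d -> A y.
Proof.
split => [/nbhs_ballP[d /= d0 h]|[d d0 h]].
  exists (d / 2); first by lra.
  move=> y h1 h2; apply: h; split => /=; rewrite /ball /= distrC; lra.
apply/nbhs_ballP; exists d => //= y [/= h1 h2].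
by apply: h; rewrite distrC ltW.
Qed.

Definition cbox z (r : R) : set (R * R) :=
  [set y | `|y.1 - z.1| <= r /\ `|y.2 - z.2| <= r].

Lemma cbox_center z r : 0 <= r -> cbox z r z.
Proof. by move=> r0; rewrite /cbox /= !subrr normr0. Qed.

Lemma nbhs_cbox z r : 0 < r -> nbhs z (cbox z r).
Proof. by move=> r0; apply/nbhs_boxP; exists r. Qed.

Lemma cbox_sub z r r' y : r <= r' -> cbox z r y -> cbox z r' y.
Proof. by move=> rr [h1 h2]; split; apply: le_trans rr. Qed.

Lemma cbox_trans z y x r r' r'' : r + r' <= r'' ->
  cbox z r y -> cbox y r' x -> cbox z r'' x.
Proof.
move=> hr [y1 y2] [x1 x2]; have := ler_normD (x.1 - y.1) (y.1 - z.1).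
have := ler_normD (x.2 - y.2) (y.2 - z.2).
by rewrite !addrA !subrK; split; lra.
Qed.

Definition rect (a b c d : R) : set (R * R) := `[a, b] `*` `[c, d].

Lemma compact_rect a b c d : compact (rect a b c d).
Proof. by apply: compact_setX; exact: segment_compact. Qed.

Lemma compact_cbox z r : compact (cbox z r).
Proof.
have -> : cbox z r = rect (z.1 - r) (z.1 + r) (z.2 - r) (z.2 + r).
  apply/seteqP; split => y; rewrite /cbox /rect /= !in_itv /=.
    by move=> [/ler_normlP[h1 h2] /ler_normlP[h3 h4]]; split; lra.
  by move=> [/andP[h1 h2] /andP[h3 h4]]; split; apply/ler_normlP; split; lra.
exact: compact_rect.
Qed.

Lemma cvg_pair1 z : {for z, continuous (fun y : R * R => y.1)}.
Proof. exact: cvg_fst. Qed.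

Lemma cvg_pair2 z : {for z, continuous (fun y : R * R => y.2)}.
Proof. exact: cvg_snd. Qed.

End Semicontinuity.

(** * Superjets and asymptotic touching *)

Section Jets.
Context {R : realType}.
Implicit Types (z y : R * R) (u : R * R -> R) (a p : R).

Definition lin z a p y : R := a * (y.1 - z.1) + p * (y.2 - z.2).
Definition nrm1 z y : R := `|y.1 - z.1| + `|y.2 - z.2|.
Definition sqd z y : R := (y.1 - z.1) ^+ 2 + (y.2 - z.2) ^+ 2.

(* First and second order superjets at z: they stand for test functions touching
   u from above, with time slope a and space slope p. *)
Definition sjet u z a p : Prop := forall e, 0 < e ->
  \forall y \near z, u y <= u z + lin z a p y + e * nrm1 z y.
Definition qjet u z a p : Prop := exists C,
  \forall y \near z, u y <= u z + lin z a p y + C * sqd z y.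

Lemma continuous_coord1 : continuous (fun y : R * R => y.1).
Proof. by move=> y; exact: cvg_pair1. Qed.

Lemma continuous_coord2 : continuous (fun y : R * R => y.2).
Proof. by move=> y; exact: cvg_pair2. Qed.

Lemma continuous_lin z a p : continuous (lin z a p).
Proof.
move=> y; apply: cvgD; apply: cvgM; try exact: cvg_cst.
  by apply: cvgB; [exact: continuous_coord1|exact: cvg_cst].
by apply: cvgB; [exact: continuous_coord2|exact: cvg_cst].
Qed.

Lemma continuous_nrm1 z : continuous (nrm1 z).
Proof.
move=> y; apply: cvgD; apply: cvg_norm.
  by apply: cvgB; [exact: continuous_coord1|exact: cvg_cst].
by apply: cvgB; [exact: continuous_coord2|exact: cvg_cst].
Qed.

Lemma continuous_sqd z : continuous (sqd z).
Proof.
move=> y; apply: cvgD; under eq_fun do rewrite expr2; rewrite expr2; apply: cvgM;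
  apply: cvgB; (exact: continuous_coord1 || exact: continuous_coord2 || exact: cvg_cst).
Qed.

Lemma nrm1_ge0 z y : 0 <= nrm1 z y.
Proof. by rewrite addr_ge0. Qed.

Lemma sqd_ge0 z y : 0 <= sqd z y.
Proof. by rewrite addr_ge0// sqr_ge0. Qed.

Lemma sqd_nrm1 z y : sqd z y <= nrm1 z y ^+ 2 <= 2 * sqd z y.
Proof.
rewrite /sqd /nrm1 -(real_normK (num_real (y.1 - z.1))).
rewrite -(real_normK (num_real (y.2 - z.2))).
have := normr_ge0 (y.1 - z.1); have := normr_ge0 (y.2 - z.2).
set A := `|y.1 - z.1|; set B := `|y.2 - z.2| => hB hA.
have := sqr_ge0 (A - B); nra.
Qed.

Lemma lin_bound z a p y : `|lin z a p y| <= (`|a| + `|p|) * nrm1 z y.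
Proof.
rewrite /lin /nrm1; apply: le_trans (ler_normD _ _) _; rewrite !normrM.
have := mulr_ge0 (normr_ge0 a) (normr_ge0 (y.2 - z.2)).
have := mulr_ge0 (normr_ge0 p) (normr_ge0 (y.1 - z.1)).
by rewrite mulrDl !mulrDr; lra.
Qed.

Lemma cbox_nrm1 z r y : nrm1 z y <= r -> cbox z r y.
Proof.
by rewrite /nrm1 /cbox /= => h; have := normr_ge0 (y.1 - z.1);
  have := normr_ge0 (y.2 - z.2); split; lra.
Qed.

Lemma nrm1_cbox z r y : cbox z r y -> nrm1 z y <= 2 * r.
Proof. by rewrite /nrm1 /cbox /= => -[]; lra. Qed.

Lemma qjet_sjet u z a p : qjet u z a p -> sjet u z a p.
Proof.
move=> [C hC] e e0; pose d := e / (`|C| + 1).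
have d0 : 0 < d by rewrite divr_gt0// ltr_wpDl.
have d2 : 0 < d / 2 by lra.
move: hC (nbhs_cbox z d2); apply: filterS2 => y h1 /nrm1_cbox h2.
apply: le_trans h1 _; rewrite lerD2l.
have /andP[h3 _] := sqd_nrm1 z y; have h4 := sqd_ge0 z y.
have h5 : C * sqd z y <= `|C| * sqd z y by rewrite ler_wpM2r// ler_norm.
have h6 : `|C| * sqd z y <= `|C| * (nrm1 z y * d).
  rewrite ler_wpM2l//; apply: le_trans h3 _; rewrite expr2.
  by rewrite ler_wpM2l// ?nrm1_ge0//; lra.
have h7 : `|C| * d <= e.
  rewrite /d mulrA ler_pdivrMr ?ltr_wpDl//; have := normr_ge0 C; nra.
have := nrm1_ge0 z y; nra.
Qed.

(* A polynomial penalization moves a first-order touching with errors to an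
   exact second-order touching at a nearby point. *)
Lemma touching_perturb (f : R * R -> R) z0 f0 a p (k r e : R) z' :
  0 < k -> 0 < r -> 0 <= e -> 12 * e <= k * r ->
  (forall y, cbox z0 r y -> usc f y) ->
  (forall y, cbox z0 r y -> f y <= f0 + lin z0 a p y + k * nrm1 z0 y + e) ->
  cbox z0 r z' -> 8 * k / r * sqd z0 z' <= e -> f0 + lin z0 a p z' - e <= f z' ->
  exists z1 a1 p1, [/\ nrm1 z0 z1 < r / 2, `|a1 - a| <= 8 * k, `|p1 - p| <= 8 * k,
     `|f z1 - (f0 + lin z0 a p z1)| <= k * r & qjet f z1 a1 p1].
Proof.
move=> k0 r0 e0 he uf hf z'b hz' hfz'.
(* With this coefficient a maximum at distance n >= r / 2 from z0 would give 4 k n <= 2 k n + 6 e,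
   which 12 e <= k r forbids; and for n < r / 2 the slopes move by at most 2 C n <= 8 k. *)
set C := 8 * k / r in hz' *.
have C0 : 0 < C by rewrite divr_gt0//; lra.
have Cr : C * r = 8 * k by rewrite /C divfK// gt_eqF.
clearbody C.
pose g y := f y + - (lin z0 a p y + C * sqd z0 y).
have ug y : cbox z0 r y -> usc g y.
  move=> yb; apply: uscD; first exact: uf.
  apply: continuous_usc; apply: cvgN; apply: cvgD; first exact: continuous_lin.
  by apply: cvgM; [exact: cvg_cst|exact: continuous_sqd].
have [z1 z1b hz1] := usc_compact_max (@compact_cbox _ z0 r)
  (ex_intro _ z0 (cbox_center z0 (ltW r0))) ug.
have h1 := hz1 _ z'b; rewrite /g in h1.
have h2 := hf _ z1b.
have /andP[h3 h4] := sqd_nrm1 z0 z1.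
have n0 := nrm1_ge0 z0 z1; have s0 := sqd_ge0 z0 z1.
set n := nrm1 z0 z1 in h2 h3 h4 n0 *; set s := sqd z0 z1 in h1 h3 h4 s0 *.
have h5 : C * s <= k * n + 3 * e by lra.
have h6 : C * n ^+ 2 <= 2 * (k * n + 3 * e).
  apply: le_trans (_ : C * (2 * s) <= _); first by rewrite ler_pM2l.
  by lra.
have hn : n < r / 2.
  rewrite ltNge; apply/negP => hn.
  have : C * (n * (r / 2)) <= C * n ^+ 2 by rewrite ler_pM2l// expr2 ler_wpM2l.
  have -> : C * (n * (r / 2)) = 4 * k * n by transitivity (C * r * n / 2); [field|rewrite Cr; field].
  nra.
have hC1 : forall x : R, `|x| <= n -> `|2 * C * x| <= 8 * k.
  move=> x hx; rewrite normrM ger0_norm ?mulr_ge0 ?ltW//.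
  have : C * `|x| <= C * (r / 2) by apply: ler_wpM2l; [exact: ltW|lra].
  nra.
exists z1, (a + 2 * C * (z1.1 - z0.1)), (p + 2 * C * (z1.2 - z0.2)); split => //.
- by rewrite [_ - a]addrC addKr hC1// /n /nrm1 lerDl.
- by rewrite [_ - p]addrC addKr hC1// /n /nrm1 lerDr.
- apply/ler_normlP; split; [|have : k * n <= k * (r / 2) by rewrite ler_pM2l// ltW];
    [have := mulr_ge0 (ltW C0) s0|]; nra.
- exists C; have : nbhs z1 (cbox z1 (r / 2)) by apply: nbhs_cbox; lra.
  apply: filterS => y [y1 y2].
  have yb : cbox z0 r y.
    have := ler_normD (y.1 - z1.1) (z1.1 - z0.1).
    have := ler_normD (y.2 - z1.2) (z1.2 - z0.2).
    rewrite !addrA !subrK /cbox /=.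
    have := normr_ge0 (z1.1 - z0.1); have := normr_ge0 (z1.2 - z0.2).
    by move: hn; rewrite /n /nrm1; split; lra.
  have := hz1 _ yb; rewrite /g /s /lin /sqd; lra.
Qed.

(** First order touching by a family, in the limit only: the upper bound holds up to errors that
    vanish along [F], and the value [f0] is approached near [z0] for indices in every set of [F].
    Unlike a jet of the limit, this notion survives uniformly small perturbations of the family,
    such as rescaled correctors. *)
Definition touching {I : Type} (F : set_system I) (u : I -> R * R -> R) z0 (f0 : R) a p :=
  (forall k, 0 < k -> exists2 r, 0 < r <= k & forall e, 0 < e ->
     \forall i \near F, forall y, cbox z0 r y ->
       u i y <= f0 + lin z0 a p y + k * nrm1 z0 y + e) /\
  (forall e A, 0 < e -> F A -> exists i y, [/\ A i, cbox z0 e y & f0 - e <= u i y]).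

(** The slope tolerance [k] is fixed first and determines [r]; the error [e1 = k r / 12] is the
    largest one that [touching_perturb] admits, and [e2], [e3] bring the near-contact point so close
    to [z0] that the paraboloid and the linear part cost at most [e1] there. *)
Lemma touching_qjet {I : Type} (F : set_system I) {FF : ProperFilter F}
    (u : I -> R * R -> R) z0 f0 a p :
  touching F u z0 f0 a p ->
  (exists2 r, 0 < r & \forall i \near F, forall y, cbox z0 r y -> usc (u i) y) ->
  forall e A, 0 < e -> F A -> exists i z1 a1 p1,
    [/\ A i, cbox z0 e z1, `|a1 - a| <= e /\ `|p1 - p| <= e, `|u i z1 - f0| <= e
      & qjet (u i) z1 a1 p1].
Proof.
move=> [hu hl] [r1 r10 hr1] e A e0 FA.
pose K := `|a| + `|p| + 1.
have K0 : 0 < K by rewrite ltr_wpDl// addr_ge0.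
have aK : `|a| + `|p| <= K by rewrite /K lerDl.
clearbody K.
pose k := Num.min (Num.min (e / 8) (Num.min 1 r1)) (e / (2 * K)).
have k0 : 0 < k by rewrite !lt_min ltr01 r10 !divr_gt0 ?mulr_gt0.
have k8 : k <= e / 8 by rewrite /k !ge_min lexx.
have kr1 : k <= r1 by rewrite /k !ge_min lexx !orbT.
have k1 : k <= 1 by rewrite /k !ge_min lexx !orbT.
have kK : k * K <= e / 2.
  have : k <= e / (2 * K) by rewrite /k ge_min lexx orbT.
  by rewrite ler_pdivlMr ?mulr_gt0//; lra.
clearbody k.
have [r /andP[r0 rk] hr] := hu _ k0.
pose e1 := k * r / 12.
have e10 : 0 < e1 by rewrite divr_gt0// mulr_gt0.
have e112 : 12 * e1 = k * r by rewrite /e1; field.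
clearbody e1.
have C0 : 0 < 8 * k / r by rewrite divr_gt0 ?mulr_gt0.
pose C := 8 * k / r; have hC : C = 8 * k / r by [].
rewrite -hC in C0; clearbody C.
pose e2 := Num.min (Num.min 1 (e1 / (4 * C + 1))) (Num.min r (e1 / (4 * K))).
have C1 : 0 < 4 * C + 1 by lra.
have e20 : 0 < e2 by rewrite /e2 !lt_min ltr01 r0 !divr_gt0 ?mulr_gt0.
have e21 : e2 <= 1 by rewrite /e2 !ge_min lexx.
have e2r : e2 <= r by rewrite /e2 !ge_min lexx !orbT.
have e2C : e2 * (4 * C + 1) <= e1.
  have : e2 <= e1 / (4 * C + 1) by rewrite /e2 !ge_min lexx !orbT.
  by rewrite ler_pdivlMr.
have e2K : e2 * (4 * K) <= e1.
  have : e2 <= e1 / (4 * K) by rewrite /e2 !ge_min lexx !orbT.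
  by rewrite ler_pdivlMr ?mulr_gt0.
clearbody e2.
pose e3 := Num.min e2 (e1 / 2).
have e30 : 0 < e3 by rewrite /e3 lt_min e20 /=; lra.
have [i [z' [[[Ai hi] ui] z'b hz']]] := hl e3 _ e30 (filterI (filterI FA (hr _ e10)) hr1).
have e3e2 : e3 <= e2 by rewrite ge_min lexx.
have e3e1 : e3 <= e1 / 2 by rewrite ge_min lexx orbT.
clearbody e3.
have z'b2 : cbox z0 e2 z' by case: z'b; split; lra.
have nz' := nrm1_cbox z'b.
have nz'0 := nrm1_ge0 z0 z'.
have linz' : `|lin z0 a p z'| <= e1 / 2.
  apply: le_trans (lin_bound _ _ _ _) _.
  apply: le_trans (_ : K * (2 * e3) <= _); last by nra.
  by apply: ler_pM => //; rewrite ?addr_ge0.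
have [z1 [a1 [p1 [h1 h2 h3 h4 h5]]]] : exists z1 a1 p1, [/\ nrm1 z0 z1 < r / 2,
     `|a1 - a| <= 8 * k, `|p1 - p| <= 8 * k,
     `|u i z1 - (f0 + lin z0 a p z1)| <= k * r & qjet (u i) z1 a1 p1].
  apply: (@touching_perturb (u i) z0 f0 a p k r e1 z') => //.
  - exact: ltW.
  - by rewrite e112.
  - by move=> y [y1 y2]; apply: ui; split; lra.
  - by case: z'b2; split; lra.
  - have /andP[h _] := sqd_nrm1 z0 z'; rewrite -hC.
    have : sqd z0 z' <= 4 * e2 ^+ 2.
      apply: le_trans h _; have -> : 4 * e2 ^+ 2 = (2 * e2) ^+ 2 by ring.
      by apply: lerXn2r; rewrite ?nnegrE//; lra.
    move=> h'; apply: le_trans (_ : C * (4 * e2 ^+ 2) <= _).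
      by rewrite ler_pM2l.
    nra.
  - by move: linz' => /ler_normlP[]; lra.
exists i, z1, a1, p1; split => //.
- apply: cbox_nrm1; lra.
- by split; lra.
- have hl1 : `|lin z0 a p z1| <= e / 2.
    apply: le_trans (lin_bound _ _ _ _) _; apply: le_trans kK; rewrite [k * K]mulrC.
    by apply: ler_pM => //; rewrite ?addr_ge0 ?nrm1_ge0//; lra.
  have -> : u i z1 - f0 = (u i z1 - (f0 + lin z0 a p z1)) + lin z0 a p z1 by ring.
  apply: le_trans (ler_normD _ _) _.
  have : k * r <= e / 8 * 1 by apply: ler_pM; rewrite ?(ltW k0) ?(ltW r0)//; exact: le_trans k1.
  lra.
Qed.

End Jets.

(** * Half-relaxed limits and semicontinuous envelopes *)

Section RelaxedLimits.
Context {R : realType}.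
Implicit Types (z y : R * R) (a p : R).

(* The upper half-relaxed limit of u along F. *)
Definition rsup {I : Type} (F : set_system I) (u : I -> R * R -> R) z : R :=
  inf [set s | \forall y \near z & i \near F, u i y <= s].

(** The upper semicontinuous envelope, seen as the half-relaxed limit of a constant family so that
    both share the same lemmas. *)
Definition env (u : R * R -> R) z : R := rsup (globally [set: unit]) (fun=> u) z.

(* Local bounds near z that make rsup the infimum of a nonempty, bounded below
   set at every point near z. *)
Definition locbd {I : Type} (F : set_system I) (u : I -> R * R -> R) z : Prop :=
  exists r M : R, [/\ 0 < r, (\forall i \near F, forall y, cbox z r y -> u i y <= M) &
    forall x, cbox z r x -> forall s,
      (\forall y \near x & i \near F, u i y <= s) -> - M <= s].

Section Filter.
Context {I : Type} (F : set_system I) {FF : ProperFilter F}.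
Implicit Types u : I -> R * R -> R.

Lemma locbd_bounded u z r M : 0 < r ->
  (\forall i \near F, forall y, cbox z r y -> `|u i y| <= M) -> locbd F u z.
Proof.
move=> r0 h; exists (r / 2), M; split; first by lra.
  apply: filterS h => i hi y yb.
  apply: le_trans (ler_norm _) _; apply: hi; apply: cbox_sub yb; lra.
move=> x xb s [[A B] [/= hA hB] hs].
have r2 : 0 < r / 2 by lra.
have [i [hi Bi]] := filter_ex (filterI h hB).
have := hs (x, i) (conj (nbhs_singleton hA) Bi) => /=.
have : `|u i x| <= M by apply: hi; apply: cbox_sub xb; lra.
by move=> /ler_normlP[]; lra.
Qed.

Lemma locbd_near u z : locbd F u z -> \forall y \near z, locbd F u y.
Proof.
move=> [r [M [r0 h1 h2]]]; have r2 : 0 < r / 2 by lra.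
apply: filterS (nbhs_cbox z r2) => y yb.
have hb x : cbox y (r / 2) x -> cbox z r x by apply: cbox_trans yb; lra.
exists (r / 2), M; split => //; first by apply: filterS h1 => i hi x /hb; exact: hi.
by move=> x /hb; exact: h2.
Qed.

Lemma rsup_le u z s : locbd F u z ->
  (\forall y \near z & i \near F, u i y <= s) -> rsup F u z <= s.
Proof.
move=> [r [M [r0 h1 h2]]] hs; apply: ge_inf => //.
by exists (- M) => x; apply: h2; exact: cbox_center (ltW r0).
Qed.

Lemma rsup_near u z s : locbd F u z -> rsup F u z < s ->
  \forall y \near z & i \near F, u i y <= s.
Proof.
move=> [r [M [r0 h1 h2]]] hs.
have hi : has_inf [set s | \forall y \near z & i \near F, u i y <= s].
  split; last by exists (- M) => x; apply: h2; exact: cbox_center (ltW r0).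
  exists M; exists (cbox z r, [set i | forall y, cbox z r y -> u i y <= M]) => /=.
    by split => //; exact: nbhs_cbox.
  by move=> [y i] /= [hy]; exact.
have e0 : 0 < s - rsup F u z by lra.
have [s' /= hs' s's] := inf_adherent e0 hi.
rewrite -/(rsup F u z) in s's.
apply: filterS hs' => -[y i] /= h; apply: le_trans h _; lra.
Qed.

Lemma rsup_ge u z s : locbd F u z -> s < rsup F u z ->
  forall A e, F A -> 0 < e -> exists i y, [/\ A i, cbox z e y & s < u i y].
Proof.
move=> lb hs A e FA e0; apply: contrapT => hn.
have : rsup F u z <= s; last by lra.
apply: rsup_le => //; exists (cbox z e, A); first by split => //; exact: nbhs_cbox.
move=> [y i] /= [hy Ai]; rewrite leNgt; apply/negP => h.
by apply: hn; exists i, y.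
Qed.

Lemma usc_rsup u z : locbd F u z -> usc (rsup F u) z.
Proof.
move=> lb e e0; have e2 : rsup F u z < rsup F u z + e / 2 by lra.
have [[A B] [/= hA hB] hs] := rsup_near lb e2.
move: (locbd_near lb) (nbhs_interior hA); apply: filterS2 => y ly hy.
apply: le_lt_trans (_ : rsup F u z + e / 2 < _); last by lra.
by apply: rsup_le => //; exists (A, B).
Qed.

Lemma rsup_sup u z s : locbd F u z -> rsup F u z < s ->
  \forall y \near z, \forall i \near F, u i y <= s.
Proof.
move=> lb /(rsup_near lb)[[A B] [/= hA hB] hs].
by apply: filterS hA => y Ay; apply: filterS hB => i Bi; exact: (hs (y, i)).
Qed.

(** The half-relaxed limit controls the family only near each point of the box; compactness of the
    box turns these local bounds into a single one, valid at all its points along [F]. *)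
Lemma rsup_touching u z a p : locbd F u z -> sjet (rsup F u) z a p ->
  touching F u z (rsup F u z) a p.
Proof.
move=> lb js; split=> [k k0|e A e0 FA]; last first.
  have [|i [y [Ai yb hy]]] := @rsup_ge u z (rsup F u z - e) lb _ A e FA e0; first by lra.
  by exists i, y; split => //; exact: ltW.
have /nbhs_boxP[d d0 hd] : \forall x \near z, locbd F u x /\
    rsup F u x <= rsup F u z + lin z a p x + k * nrm1 z x.
  by move: (locbd_near lb) (js _ k0); apply: filterS2.
exists (Num.min d k); first by rewrite lt_min d0 k0 ge_min lexx orbT.
move=> e e0.
apply: (iffLR (@compact_near_coveringP _ _) (@compact_cbox _ z (Num.min d k))) => x xb.
have [x1 x2] : cbox z d x by apply: cbox_sub xb; rewrite ge_min lexx.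
have [lx hx] := hd x x1 x2.
have e2 : rsup F u x < rsup F u x + e / 2 by lra.
have [[A B] [/= hA hB] hs] := rsup_near lx e2.
have /cvgrPdist_lt : (fun y => lin z a p y + k * nrm1 z y) @ x --> lin z a p x + k * nrm1 z x.
  apply: cvgD; first exact: continuous_lin.
  by apply: cvgM; [exact: cvg_cst|exact: continuous_nrm1].
have e2' : 0 < e / 2 by lra.
move=> /(_ _ e2') hc.
exists (A `&` [set y | `|lin z a p x + k * nrm1 z x - (lin z a p y + k * nrm1 z y)| < e / 2], B).
  by split => //=; exact: filterI.
move=> [y i] /= [[Ay /ltr_normlP[_ hy]] Bi].
have := hs (y, i) (conj Ay Bi) => /=; lra.
Qed.

(** A translation that the family undoes by relabelling its indices leaves the limit invariant. With
    the identity relabelling this transmits periodicity; with a shift of integer indices it creates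
    periodicity, as in the blow-up. *)
Lemma rsup_shift (s t : I -> I) u z h : cancel s t -> cancel t s ->
  (forall A, F A -> F [set i | A (s i)]) -> (forall A, F A -> F [set i | A (t i)]) ->
  (forall i y, u i (y + h) = u (s i) y) -> rsup F u (z + h) = rsup F u z.
Proof.
move=> st ts Fs Ft hu; congr inf; apply/seteqP; split => c /= [[A B] [/= hA hB] hs].
- exists ([set y | A (y + h)], [set i | B (t i)]) => /=; last first.
    by move=> [y i] /= [Ay Bi]; rewrite -(ts i) -hu; exact: (hs (y + h, t i)).
  split; last exact: Ft.
  have : (fun y => y + h) @ z --> z + h by apply: cvgD; [exact: cvg_id|exact: cvg_cst].
  by apply.
- exists ([set y | A (y - h)], [set i | B (s i)]) => /=; last first.
    move=> [y i] /= [Ay Bi]; rewrite -[y](subrK h) hu; exact: (hs (y - h, s i)).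
  split; last exact: Fs.
  have : (fun y => y - h) @ (z + h) --> z + h - h.
    by apply: cvgB; [exact: cvg_id|exact: cvg_cst].
  by rewrite addrK; apply.
Qed.

End Filter.

Lemma touching_perturbed {I : Type} (F : set_system I) {FF : Filter F}
    (u v : I -> R * R -> R) z f0 a p r0 : 0 < r0 ->
  touching F u z f0 a p ->
  (forall e, 0 < e -> \forall i \near F, forall y, cbox z r0 y -> `|u i y - v i y| <= e) ->
  touching F v z f0 a p.
Proof.
move=> r00 [hu hl] h; split => [k k0|e A e0 FA].
  have k1 : 0 < Num.min k r0 by rewrite lt_min k0 r00.
  have [r /andP[r1 r2] hr] := hu _ k1; exists r.
    by rewrite r1 (le_trans r2)// ge_min lexx.
  have rr0 : r <= r0 by rewrite (le_trans r2)// ge_min lexx orbT.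
  move=> e e0; have e2 : 0 < e / 2 by lra.
  move: (hr _ e2) (h _ e2); apply: filterS2 => i h1 h2 y yb.
  have := h1 _ yb; have /ler_normlP[] : `|u i y - v i y| <= e / 2.
    by apply: h2; case: yb; split; lra.
  have : Num.min k r0 * nrm1 z y <= k * nrm1 z y.
    by rewrite ler_wpM2r ?nrm1_ge0// ge_min lexx.
  lra.
have e2 : 0 < Num.min (e / 2) r0 by rewrite lt_min r00 divr_gt0.
have e2' : 0 < e / 2 by lra.
have [i [y [[Ai hi] [y1 y2] hy]]] := hl _ _ e2 (filterI FA (h _ e2')).
have m1 : Num.min (e / 2) r0 <= e / 2 by rewrite ge_min lexx.
have m2 : Num.min (e / 2) r0 <= r0 by rewrite ge_min lexx orbT.
exists i, y; split => //; first by split; lra.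
have /ler_normlP[] : `|u i y - v i y| <= e / 2 by apply: hi; split; lra.
lra.
Qed.

Section Envelope.
Implicit Types u : R * R -> R.

#[local] Instance globally_unit_proper : ProperFilter (globally [set: unit]) :=
  globally_properfilter (I : [set: unit] tt).

Definition bdat u z := exists r M : R, 0 < r /\ forall y, cbox z r y -> `|u y| <= M.

Lemma near_globally z (P : R * R -> Prop) :
  (\forall y \near z & i \near globally [set: unit], P y) <-> \forall y \near z, P y.
Proof.
split => [[[A B] [/= hA hB] hs]|h].
  by apply: filterS hA => y Ay; apply: (hs (y, tt)); split => //=; exact: hB.
by exists (P, setT) => // -[y i] [].
Qed.

Lemma bdat_locbd u z : bdat u z -> locbd (globally [set: unit]) (fun=> u) z.
Proof. by move=> [r [M [r0 h]]]; apply: (@locbd_bounded _ _ _ _ _ r M) => // i _. Qed.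

Lemma env_ge u z : bdat u z -> u z <= env u z.
Proof.
move=> b; rewrite leNgt; apply/negP => hlt.
have h2 : env u z < (env u z + u z) / 2 by lra.
have h3 : \forall y \near z, u y <= (env u z + u z) / 2.
  exact: (near_globally _ _).1 (rsup_near (bdat_locbd b) h2).
have /= h4 := nbhs_singleton h3.
by move: hlt h4; clear; lra.
Qed.

Lemma env_near u z s : bdat u z -> env u z < s -> \forall y \near z, u y <= s.
Proof. by move=> b h; apply: (near_globally _ _).1 (rsup_near (bdat_locbd b) h). Qed.

Lemma env_le u z s : bdat u z -> (\forall y \near z, u y <= s) -> env u z <= s.
Proof. by move=> b h; apply: rsup_le; [exact: bdat_locbd|apply/near_globally]. Qed.

Lemma usc_envelope u z : bdat u z -> usc (env u) z.
Proof. by move=> b; apply: usc_rsup; exact: bdat_locbd. Qed.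

Lemma env_usc u z : bdat u z -> usc u z -> env u z = u z.
Proof.
move=> b h; apply/eqP; rewrite eq_le env_ge// andbT.
apply/ler_addgt0Pr => e e0; apply: env_le => //.
by apply: filterS (h _ e0) => y /ltW.
Qed.

End Envelope.

End RelaxedLimits.

(** * Barriers for the Cauchy problem *)

Section Barriers.
Context {R : realType}.
Implicit Types (z y : R * R) (a p : R).

Lemma continuous_at_sqr {T : topologicalType} (f : T -> R) (y : T) :
  {for y, continuous f} -> {for y, continuous (fun x => f x ^+ 2)}.
Proof.
move=> c; have -> : (fun x => f x ^+ 2) = (fun x => f x * f x).
  by apply/funext => x; rewrite expr2.
exact: (cvgM c c).
Qed.

(** The square of the positive part lies below its tangent parabolas, so a maximum penalized by it
    still yields a second order jet. It serves to keep maxima away from a final time. *)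
Lemma posr_sqr_le (x x0 : R) : (Num.max x 0) ^+ 2 <=
  (Num.max x0 0) ^+ 2 + 2 * Num.max x0 0 * (x - x0) + (x - x0) ^+ 2.
Proof.
case: (leP x 0) => hx; case: (leP x0 0) => hx0.
- by rewrite expr0n /= mulr0 mul0r !add0r sqr_ge0.
- by have := sqr_ge0 x; nra.
- rewrite expr0n /= mulr0 mul0r !add0r.
  have : 0 <= x * - x0 by rewrite mulr_ge0// ?oppr_ge0// ltW.
  by have := sqr_ge0 x0; nra.
- by nra.
Qed.

Lemma continuous_posr_sqr (s1 : R) :
  continuous (fun y : R * R => (Num.max (y.1 - s1) 0) ^+ 2 : R).
Proof.
have c : continuous (fun y : R * R => Num.max (y.1 - s1) 0 : R).
  move=> y; apply: (@continuous_max _ _ (fun y : R * R => y.1 - s1) (cst 0)).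
    by apply: cvgB; [exact: continuous_coord1|exact: cvg_cst].
  exact: cvg_cst.
by move=> y; apply: (@continuous_at_sqr _ (fun y => Num.max (y.1 - s1) 0)); exact: c.
Qed.

(** Were the bound false, [g] minus (K + e) (s - s0) would exceed [B] at s1 for some e > 0. A large
    multiple of the squared positive part of s - s1 keeps the maximum away from s2, the bound at s0
    keeps it away from s0, and the lateral hypothesis moves it inside; the jet found there has slope
    at least K + e. The threshold [c0] restricts the hypotheses to large values of [g]. *)
Lemma slope_bound (g : R * R -> R) (s0 s2 c d B c0 K s1 r1 : R) :
  s0 <= s1 -> s1 < s2 -> c <= r1 <= d -> 0 <= K -> c0 <= B ->
  (forall y, rect s0 s2 c d y -> usc g y) ->
  (forall r, c <= r <= d -> g (s0, r) <= B) ->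
  (forall s r, s0 < s < s2 -> c <= r <= d -> c0 < g (s, r) ->
     exists2 r', c < r' < d & g (s, r) <= g (s, r')) ->
  (forall s r p, s0 < s < s2 -> c < r < d -> c0 < g (s, r) ->
     qjet g (s, r) p 0 -> p <= K) ->
  g (s1, r1) <= B + K * (s1 - s0).
Proof.
move=> s01 s12 r1cd K0 c0B ug gB h1 h2; rewrite leNgt; apply/negP => hlt.
have s01' : s0 < s1.
  rewrite lt_neqAle s01 andbT; apply/eqP => s0s1.
  by move: hlt (gB _ r1cd); rewrite s0s1; lra.
pose e := (g (s1, r1) - B - K * (s1 - s0)) / (2 * (s1 - s0)).
have e0 : 0 < e by apply: divr_gt0; lra.
have he : B < g (s1, r1) - (K + e) * (s1 - s0).
  have : e * (s1 - s0) = (g (s1, r1) - B - K * (s1 - s0)) / 2.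
    by rewrite /e; field; lra.
  by move: hlt; clear; lra.
clearbody e.
have [M hM] := usc_compact_bound (@compact_rect R s0 s2 c d) ug.
pose N := (`|M| + `|B| + 1) / (s2 - s1) ^+ 2.
have s21 : 0 < (s2 - s1) ^+ 2 by rewrite exprn_gt0// subr_gt0.
have N0 : 0 <= N by rewrite divr_ge0 ?addr_ge0// ltW.
have hN : M - N * (s2 - s1) ^+ 2 < B.
  have -> : N * (s2 - s1) ^+ 2 = `|M| + `|B| + 1 by rewrite /N divfK// gt_eqF.
  by move: (ler_norm M) (ler_norm (- B)); rewrite normrN; clear; lra.
clearbody N.
pose G y := g y + - ((K + e) * (y.1 - s0) + N * (Num.max (y.1 - s1) 0) ^+ 2).
have uG y : rect s0 s2 c d y -> usc G y.
  move=> yb; apply: uscD; first exact: ug.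
  apply: continuous_usc; apply: cvgN; apply: cvgD; apply: cvgM; try exact: cvg_cst.
    by apply: cvgB; [exact: continuous_coord1|exact: cvg_cst].
  exact: continuous_posr_sqr.
have z1b : rect s0 s2 c d (s1, r1) by rewrite /rect /= !in_itv /= s01 (ltW s12).
have [[s r] zb hz] := usc_compact_max (@compact_rect R s0 s2 c d)
  (ex_intro _ _ z1b) uG.
have [/= sb rb] : s0 <= s <= s2 /\ c <= r <= d by move: zb; rewrite /rect /= !in_itv.
have Gz : B < G (s, r).
  apply: lt_le_trans (hz _ z1b); rewrite /G /= subrr maxxx expr0n mulr0 addr0.
  exact: he.
have gz : G (s, r) <= g (s, r).
  rewrite /G /= gerBl addr_ge0// mulr_ge0// ?sqr_ge0//.
    by move: K0 e0; clear; lra.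
  by move: sb; clear; lra.
have ss0 : s0 < s.
  rewrite lt_neqAle; case/andP: sb => -> _; rewrite andbT; apply/eqP => s0s.
  by move: Gz gz (gB _ rb); rewrite s0s; clear; lra.
have ss2 : s < s2.
  rewrite lt_neqAle; case/andP: sb => _ ->; rewrite andbT; apply/eqP => s0s.
  move: Gz; rewrite /G /= s0s max_l; last by move: s12; clear; lra.
  have h : 0 <= (K + e) * (s2 - s0).
    by rewrite mulr_ge0//; [move: K0 e0|move: s01 s12]; clear; lra.
  by move: h hN (hM _ zb); rewrite s0s; clear; lra.
have sb' : s0 < s < s2 by rewrite ss0.
have [r' r'b hr'] := h1 s r sb' rb (le_lt_trans c0B (lt_le_trans Gz gz)).
have r'b2 : c <= r' <= d by case/andP: r'b => ? ?; rewrite !ltW.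
have gr' : c0 < g (s, r').
  by apply: lt_le_trans hr'; exact: le_lt_trans c0B (lt_le_trans Gz gz).
have : K + e + 2 * N * Num.max (s - s1) 0 <= K.
  apply: (h2 s r' _ sb' r'b gr'); exists N.
  pose dd := Num.min (Num.min (s - s0) (s2 - s)) (Num.min (r' - c) (d - r')).
  have dd0 : 0 < dd by rewrite !lt_min !subr_gt0 ss0 ss2; case/andP: r'b => -> ->.
  apply: filterS (nbhs_cbox (s, r') dd0) => y [/= /ler_normlP[y1 y2] /ler_normlP[y3 y4]].
  have yb : rect s0 s2 c d y.
    rewrite /rect /= !in_itv /=.
    have d1 : dd <= s - s0 by rewrite !ge_min lexx.
    have d2 : dd <= s2 - s by rewrite !ge_min lexx !orbT.
    have d3 : dd <= r' - c by rewrite !ge_min lexx !orbT.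
    have d4 : dd <= d - r' by rewrite !ge_min lexx !orbT.
    move: y1 y2 y3 y4 d1 d2 d3 d4; clear; split; lra.
  have := hz _ yb; rewrite /G /lin /sqd /=.
  have := posr_sqr_le (y.1 - s1) (s - s1).
  have -> : y.1 - s1 - (s - s1) = y.1 - s by ring.
  set P := Num.max (y.1 - s1) 0; set Q := Num.max (s - s1) 0.
  move=> h3 h4.
  have h5 : N * P ^+ 2 <= N * (Q ^+ 2 + 2 * Q * (y.1 - s) + (y.1 - s) ^+ 2).
    by rewrite ler_wpM2l.
  have h6 : 0 <= N * (y.2 - r') ^+ 2 by rewrite mulr_ge0// sqr_ge0.
  by move: h4 h5 h6 hr'; clear; lra.
have : 0 <= 2 * N * Num.max (s - s1) 0.
  by rewrite !mulr_ge0// le_max lexx orbT.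
by move: e0; clear; lra.
Qed.

Lemma qjetD (g h : R * R -> R) z a p b q C :
  (\forall y \near z, h y <= h z + lin z b q y + C * sqd z y) ->
  qjet g z a p -> qjet (fun y => g y + h y) z (a + b) (p + q).
Proof.
move=> hh [D hD]; exists (D + C); move: hh hD; apply: filterS2 => y.
by rewrite /lin; lra.
Qed.

Lemma qjet_eq (g h : R * R -> R) z a p b q :
  (forall y, g y = h y) -> a = b -> p = q -> qjet g z a p -> qjet h z b q.
Proof. by move=> /funext -> -> ->. Qed.

Lemma upper_barrier (U : R * R -> R) (s0 s2 x0 rho k m0 C s1 : R) :
  s0 <= s1 -> s1 < s2 -> 0 < rho -> 0 <= C ->
  (forall y, rect s0 s2 (x0 - rho) (x0 + rho) y -> usc U y) ->
  (forall x, `|x - x0| <= rho -> U (s0, x) <= m0 + k * (x - x0) ^+ 2) ->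
  (forall s x, s0 < s < s2 -> `|x - x0| = rho -> U (s, x) <= m0 + k * rho ^+ 2) ->
  (forall s x a p, s0 < s < s2 -> `|x - x0| < rho -> qjet U (s, x) a p -> a <= C) ->
  U (s1, x0) <= m0 + C * (s1 - s0).
Proof.
move=> s01 s12 rho0 C0 uU U0 Ul Uj.
pose q y := - (k * (y.2 - x0) ^+ 2) : R.
have -> : U (s1, x0) = U (s1, x0) + q (s1, x0).
  by rewrite /q /= subrr expr0n /= mulr0 subr0.
apply: (@slope_bound (fun y => U y + q y) s0 s2 (x0 - rho) (x0 + rho) m0 m0 C s1 x0) => //.
- by move: rho0; clear; lra.
- move=> y yb; apply: uscD; first exact: uU.
  apply: continuous_usc; apply: cvgN; apply: cvgM; first exact: cvg_cst.
  apply: (@continuous_at_sqr _ (fun y : R * R => y.2 - x0)).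
  by apply: cvgB; [exact: continuous_coord2|exact: cvg_cst].
- move=> r rb; rewrite /q /=.
  by have := U0 r; rewrite ler_norml => /(_ ltac:(move: rb; clear; lra)); lra.
- move=> s r sb rb; rewrite /q /= => h; exists r => //.
  have [rr|rr] := eqVneq (`|r - x0|) rho.
    have := Ul _ _ sb rr; rewrite -rr real_normK ?num_real//.
    by move: h; clear; lra.
  have : `|r - x0| < rho by rewrite lt_neqAle rr ler_norml; move: rb; clear; lra.
  by rewrite ltr_norml; clear; lra.
- move=> s r p sb rb _ /= hj; apply: (Uj s r p (0 + 2 * k * (r - x0)) sb).
    by rewrite ltr_norml; move: rb; clear; lra.
  have hq : \forall y \near (s, r), - q y <= - q (s, r) + lin (s, r) 0 (2 * k * (r - x0)) y
     + `|k| * sqd (s, r) y.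
    apply/nbhs_boxP; exists 1 => // y _ _; rewrite /q /lin /sqd /=.
    have h1 : k * (y.2 - r) ^+ 2 <= `|k| * (y.2 - r) ^+ 2.
      by rewrite ler_wpM2r ?sqr_ge0// ler_norm.
    have h2 : 0 <= `|k| * (y.1 - s) ^+ 2 by rewrite mulr_ge0// sqr_ge0.
    by move: h1 h2; clear; nra.
  apply: qjet_eq (qjetD hq hj) => [y||]; rewrite ?addr0//.
  by rewrite addrK.
Qed.

(** This is 2 A B <= A^2 + B^2 for the two square roots. The function is the smooth substitute for
    the absolute value in barriers and at the junction. *)
Lemma sqrt_tangent (c x x0 : R) : 0 < c ->
  Num.sqrt (c + x ^+ 2) <= Num.sqrt (c + x0 ^+ 2)
    + x0 / Num.sqrt (c + x0 ^+ 2) * (x - x0) + (x - x0) ^+ 2 / Num.sqrt (c + x0 ^+ 2) / 2.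
Proof.
move=> c0.
have h1 : 0 < c + x0 ^+ 2 by rewrite ltr_wpDr// sqr_ge0.
have h2 : 0 <= c + x ^+ 2 by rewrite addr_ge0 ?sqr_ge0// ltW.
have := sqr_sqrtr (ltW h1); have := sqr_sqrtr h2.
have : 0 < Num.sqrt (c + x0 ^+ 2) by rewrite sqrtr_gt0.
set A := Num.sqrt (c + x ^+ 2); set B := Num.sqrt (c + x0 ^+ 2) => B0 hA hB.
have -> : B + x0 / B * (x - x0) + (x - x0) ^+ 2 / B / 2 =
   (2 * B ^+ 2 + 2 * x0 * (x - x0) + (x - x0) ^+ 2) / (2 * B) by field; lra.
rewrite ler_pdivlMr; last by move: B0; clear; lra.
by have := sqr_ge0 (A - B); move: hA hB; clear; nra.
Qed.

Lemma sqrt_slope (c x : R) : 0 < c -> `|x / Num.sqrt (c + x ^+ 2)| <= 1.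
Proof.
move=> c0; have h1 : 0 < c + x ^+ 2 by rewrite ltr_wpDr// sqr_ge0.
have h2 : 0 < Num.sqrt (c + x ^+ 2) by rewrite sqrtr_gt0.
rewrite normrM normfV (ger0_norm (ltW h2)) ler_pdivrMr// mul1r.
by rewrite -sqrtr_sqr; apply: ler_wsqrtr; rewrite lerDr ltW.
Qed.

Lemma sqrt_ge_norm (c x : R) : 0 < c -> `|x| <= Num.sqrt (c + x ^+ 2).
Proof.
move=> c0; have h1 : 0 < c + x ^+ 2 by rewrite ltr_wpDr// sqr_ge0.
by rewrite -sqrtr_sqr; apply: ler_wsqrtr; rewrite lerDr ltW.
Qed.

End Barriers.

Section CauchyBarrier.
Context {R : realType}.
Implicit Types (z y : R * R) (a p : R).

Lemma continuous_sqrt_shift (c x1 : R) :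
  continuous (fun y : R * R => Num.sqrt (c + (y.2 - x1) ^+ 2)).
Proof.
move=> y; apply: (@continuous_comp _ _ _ (fun y : R * R => c + (y.2 - x1) ^+ 2) Num.sqrt).
  apply: cvgD; first exact: cvg_cst.
  apply: (@continuous_at_sqr _ _ (fun y : R * R => y.2 - x1)).
  by apply: cvgB; [exact: continuous_coord2|exact: cvg_cst].
exact: sqrt_continuous.
Qed.

(* Far from x1 the test function has steeper slopes, but there it also grows
   faster in time: finite speed of propagation on the compact range of slopes
   imposed by the linear growth. *)
Lemma cauchy_barrier (W : R * R -> R) (w0 : R -> R) (S L A : R) (M : R -> R) (t1 x1 : R) :
  0 <= L -> 0 <= A -> 0 <= M (L + 1) -> 0 <= t1 < S ->
  (forall y, 0 <= y.1 <= S -> usc W y) ->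
  (forall t x, 0 <= t <= S -> W (t, x) <= A * (1 + `|x|)) ->
  (forall x, W (0, x) <= w0 x) -> (forall x x', w0 x - w0 x' <= L * `|x - x'|) ->
  (forall t x a p P, 0 < t < S -> `|p| <= P -> qjet W (t, x) a p -> a <= M P) ->
  W (t1, x1) <= w0 x1 + M (L + 1) * t1.
Proof.
move=> L0 A0 C0 /andP[t10 t1S] uW gW W0 Lw0 jW.
have S0 : 0 < S by exact: le_lt_trans t1S.
set C := M (L + 1) in C0 *.
apply/ler_addgt0Pr => e e0.
(* Scale at which |x - x1| is smoothed; the cost at x1 is L d <= e. *)
pose d := e / (L + 1).
have d0 : 0 < d by rewrite divr_gt0// ltr_wpDl.
have Ld : L * d <= e.
  rewrite /d mulrA ler_pdivrMr ?ltr_wpDl//.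
  by move: L0 e0; clear; nra.
pose A' := A + 1; have A'0 : 0 < A' by rewrite ltr_wpDl.
(* For |X| <= sg rho the slope of the test function is at most L + 1, so that M (L + 1) applies.
   Further out the slope is at most L + 2 A' + 1, and the extra time derivative m X^2 >= M2 sg^2
   makes up for M3. *)
pose sg := (2 * (A' + 1))^-1.
have sg0 : 0 < sg by rewrite invr_gt0; move: A'0; clear; lra.
have hsg : sg * (2 * (A' + 1)) = 1.
  by rewrite /sg mulVf// gt_eqF//; move: A'0; clear; lra.
pose M3 := M (L + 2 * A' + 1).
pose M2 := (`|M3| + `|C| + 1) / sg ^+ 2.
have M20 : 0 < M2 by rewrite divr_gt0 ?exprn_gt0// ltr_wpDl ?addr_ge0.
have hM2 : M3 <= C + M2 * sg ^+ 2.
  have -> : M2 * sg ^+ 2 = `|M3| + `|C| + 1 by rewrite /M2 divfK// gt_eqF// exprn_gt0.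
  by move: (ler_norm M3) (ler_norm (- C)); rewrite normrN; clear; lra.
clearbody M2.
(* So wide that the quadratic term, at least A' rho on the lateral boundary, exceeds the linear
   growth of [W] there, while m S rho <= 1 / 2 keeps the slopes bounded independently of rho. *)
pose rho := 1 + A * (1 + `|x1|) + `|w0 x1| + 2 * M2 * S.
have rho1 : 1 <= rho.
  by rewrite /rho -!addrA lerDl !addr_ge0 ?mulr_ge0// ltW.
have rho0 : 0 < rho by exact: lt_le_trans rho1.
have hrho : A * (1 + `|x1|) + `|w0 x1| <= rho.
  by have := mulr_ge0 (ltW M20) (ltW S0); rewrite /rho; clear; lra.
have hrho2 : 2 * M2 * S <= rho.
  have := mulr_ge0 A0 (addr_ge0 ler01 (normr_ge0 x1)); have := normr_ge0 (w0 x1).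
  by rewrite /rho; clear; lra.
clearbody rho.
pose ka := A' / rho; pose m := M2 / rho ^+ 2.
have ka0 : 0 < ka by rewrite divr_gt0.
have m0 : 0 < m by rewrite divr_gt0// exprn_gt0.
have hka : ka * rho = A' by rewrite /ka divfK// gt_eqF.
have hm : m * rho ^+ 2 = M2 by rewrite /m divfK// gt_eqF// exprn_gt0.
clearbody ka m.
have d20 : 0 < d ^+ 2 by rewrite exprn_gt0.
pose h y := L * Num.sqrt (d ^+ 2 + (y.2 - x1) ^+ 2) + (ka + m * y.1) * (y.2 - x1) ^+ 2.
have ch : continuous h.
  move=> y; apply: cvgD; apply: cvgM; try exact: cvg_cst.
  - exact: continuous_sqrt_shift.
  - by apply: cvgD; [exact: cvg_cst|apply: cvgM; [exact: cvg_cst|exact: continuous_coord1]].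
  - apply: (@continuous_at_sqr _ _ (fun y : R * R => y.2 - x1)).
    by apply: cvgB; [exact: continuous_coord2|exact: cvg_cst].
pose g y := W y + - h y.
have hg : g (t1, x1) = W (t1, x1) - L * d.
  by rewrite /g /h /= subrr expr0n /= mulr0 !addr0 sqrtr_sqr ger0_norm// ltW.
have h_ge y : 0 <= y.1 -> L * `|y.2 - x1| + ka * (y.2 - x1) ^+ 2 <= h y.
  move=> y0; apply: lerD; first by rewrite ler_wpM2l// sqrt_ge_norm.
  by rewrite ler_wpM2r ?sqr_ge0// lerDl mulr_ge0// ltW.
suff : g (t1, x1) <= w0 x1 + C * (t1 - 0).
  by rewrite hg subr0; move: Ld; clear; lra.
apply: (@slope_bound _ g 0 S (x1 - rho) (x1 + rho) (w0 x1) (w0 x1) C t1 x1) => //.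
- by move: rho0; clear; lra.
- move=> y; rewrite /rect /= !in_itv /= => -[yb _]; apply: uscD; first exact: uW.
  by apply: continuous_usc; apply: cvgN; exact: ch.
- move=> r rb; have := h_ge (0, r) (lexx _); rewrite /g /=.
  have := W0 r; have := Lw0 r x1; have := mulr_ge0 (ltW ka0) (sqr_ge0 (r - x1)).
  by clear; lra.
- move=> s r /andP[sb1 sb2] rb hgr; exists r => //.
  suff : `|r - x1| < rho by rewrite ltr_norml; clear; lra.
  have : `|r - x1| <= rho by rewrite ler_norml; move: rb; clear; lra.
  rewrite le_eqVlt => /predU1P[rr|//].
  have := h_ge (s, r) (ltW sb1); move: hgr; rewrite /g /=.
  have -> : ka * (r - x1) ^+ 2 = A' * rho.
    by rewrite -hka -mulrA -expr2 -rr real_normK ?num_real.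
  have := gW s r; rewrite (ltW sb1) (ltW sb2) => /(_ isT).
  have h1 : A * (1 + `|r|) <= A * (1 + `|x1| + rho).
    apply: ler_wpM2l => //; have := ler_normD (r - x1) x1; rewrite subrK rr.
    by clear; lra.
  have := mulr_ge0 L0 (normr_ge0 (r - x1)).
  have := ler_norm (- w0 x1); rewrite normrN /A'.
  by move: h1 hrho; clear; lra.
- move=> s r a /[dup] sb /andP[sb1 sb2] rb _ hj.
  set X := r - x1.
  set B := Num.sqrt (d ^+ 2 + X ^+ 2).
  have B0 : 0 < B by rewrite sqrtr_gt0 ltr_wpDr// sqr_ge0.
  pose q := L * (X / B) + 2 * (ka + m * s) * X.
  have Xrho : `|X| <= rho by rewrite ler_norml /X; move: rb; clear; lra.
  have jW' : qjet W (s, r) (a + m * X ^+ 2) q.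
    pose D := L / B / 2 + ka + m * s + 2 * m * `|X| + m.
    have hh : \forall y \near (s, r), h y <= h (s, r) + lin (s, r) (m * X ^+ 2) q y
        + D * sqd (s, r) y.
      apply: filterS (@nbhs_cbox _ (s, r) 1 ltr01) => y [/= /ler_normlP[y1 y2] _].
      have := @sqrt_tangent R (d ^+ 2) (y.2 - x1) X d20.
      rewrite -/B /h /lin /sqd /= -/X -/B.
      have -> : y.2 - x1 = X + (y.2 - r) by rewrite /X; ring.
      have -> : y.1 = s + (y.1 - s) by ring.
      move: y1 y2; set xi := y.2 - r; set tau := y.1 - s.
      rewrite [s + tau - s]addrC addKr [X + xi - X]addrC addKr => y1 y2 h1.
      have h2 := ler_wpM2l L0 h1.
      have h3 : m * tau * xi ^+ 2 <= m * xi ^+ 2.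
        rewrite -mulrA ler_pM2l//; rewrite -[leRHS]mul1r ler_wpM2r ?sqr_ge0//.
      have h4 : 2 * m * X * tau * xi <= 2 * m * `|X| * (tau ^+ 2 + xi ^+ 2).
        have -> : 2 * m * X * tau * xi = 2 * m * (X * (tau * xi)) by ring.
        rewrite -!mulrA ler_pM2l// ler_pM2l//.
        apply: le_trans (ler_norm _) _; rewrite normrM ler_wpM2l//.
        rewrite normrM -(real_normK (num_real tau)) -(real_normK (num_real xi)).
        have := normr_ge0 tau; have := normr_ge0 xi; have := sqr_ge0 (`|tau| - `|xi|).
        by clear; nra.
      have h5 : 0 <= tau ^+ 2 * (L / B / 2 + ka + m * s + m).
        rewrite mulr_ge0 ?sqr_ge0// !addr_ge0 ?divr_ge0 ?mulr_ge0// ltW//.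
      rewrite /q /D; move: h2 h3 h4 h5; set Y := Num.sqrt _.
      have -> : L * (B + X / B * xi + xi ^+ 2 / B / 2)
        = L * B + L * (X / B) * xi + L / B / 2 * xi ^+ 2 by field; exact: lt0r_neq0.
      move: (L * (X / B)) (L / B / 2) => k1 k2; clear; lra.
    apply: qjet_eq (qjetD hh hj) => [y||]; rewrite ?add0r//.
    by rewrite /g subrK.
  have sq0 := sqr_ge0 X.
  have hslope : `|q| <= L + 2 * (ka + m * S) * `|X|.
    apply: le_trans (ler_normD _ _) _; apply: lerD.
      rewrite normrM ger0_norm// -[leRHS]mulr1 ler_wpM2l//.
      exact: sqrt_slope.
    rewrite normrM ler_wpM2r// ger0_norm; last by rewrite mulr_ge0 ?addr_ge0 ?mulr_ge0// ltW.
    by rewrite ler_pM2l// lerD2l ler_pM2l// ltW.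
  have hmS : m * S * rho <= 1 / 2.
    have -> : m * S * rho = M2 * S / rho.
      by rewrite -hm; field; exact: lt0r_neq0.
    by rewrite ler_pdivrMr//; move: hrho2; clear; lra.
  have mX0 : 0 <= m * X ^+ 2 by rewrite mulr_ge0// ltW.
  have kS0 : 0 <= ka + m * S by rewrite addr_ge0// ?mulr_ge0// ltW.
  have hkr : (ka + m * S) * rho <= A' + 1 / 2.
    by rewrite mulrDl hka; move: hmS; clear; lra.
  have [Xs|Xs] := leP `|X| (sg * rho).
    have q1 : `|q| <= L + 1.
      apply: le_trans hslope _; rewrite lerD2l.
      have h1 : (ka + m * S) * `|X| <= (ka + m * S) * (sg * rho) by rewrite ler_wpM2l.
      have h2 : sg * ((ka + m * S) * rho) <= sg * (A' + 1 / 2) by rewrite ler_pM2l.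
      have -> : 2 * (ka + m * S) * `|X| = 2 * ((ka + m * S) * `|X|) by ring.
      by move: h1 h2 hsg sg0; clear; lra.
    have := jW s r _ _ _ sb q1 jW'; rewrite -/C; move: mX0; clear; lra.
  have q1 : `|q| <= L + 2 * A' + 1.
    apply: le_trans hslope _.
    have h1 : (ka + m * S) * `|X| <= (ka + m * S) * rho by rewrite ler_wpM2l.
    have -> : 2 * (ka + m * S) * `|X| = 2 * ((ka + m * S) * `|X|) by ring.
    by move: h1 hkr; clear; lra.
  have := jW s r _ _ _ sb q1 jW'; rewrite -/M3.
  have : m * (sg * rho) ^+ 2 <= m * X ^+ 2.
    rewrite ler_pM2l// -[leRHS]real_normK ?num_real//.
    by rewrite lerXn2r// ?nnegrE ?mulr_ge0// ltW.
  rewrite exprMn mulrCA hm mulrC; move: hM2; clear; lra.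
Qed.

End CauchyBarrier.

(** * Structure of the Hamiltonians and doubling of variables *)

Section Hamiltonians.
Context {R : realType}.
Implicit Types (H : R -> R -> R -> R).

(** The form in which the assumptions enter the estimates. It is stable under translation of slopes,
    rescaling, reflection and passage to the limit at infinity; its continuity in time is that of
    (A2), relative to the size of [H]. *)
Record hamiltonian H : Prop := Hamiltonian {
  ham_bd : forall K, exists M, forall t x p, `|p| <= K -> `|H t x p| <= M;
  ham_co : A3 H;
  ham_uc : forall K e, 0 < e -> exists2 d, 0 < d & forall t x y p q,
    `|p| <= K -> `|x - y| <= d -> `|p - q| <= d -> `|H t x p - H t y q| <= e;
  ham_t : forall e, 0 < e -> exists2 d, 0 < d & forall t s x p,
    `|t - s| * (1 + Num.max (H s x p) 0) <= d -> H t x p <= H s x p + e }.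

Lemma ham_lb H : hamiltonian H -> exists2 C, 0 <= C & forall t x p, - C <= H t x p.
Proof.
move=> hH; have [K hK] := ham_co hH 0; have [M hM] := ham_bd hH K.
exists `|M| => // t x p; have [h|h] := leP K `|p|.
  by apply: le_trans (hK _ h t x); rewrite oppr_le0.
by have /ler_normlP[] := hM t x p (ltW h); have := ler_norm M; lra.
Qed.

Lemma ham_cont H K e : hamiltonian H -> 0 < e ->
  exists2 d, 0 < d & forall t s x y p q, `|p| <= K -> `|t - s| <= d ->
    `|x - y| <= d -> `|p - q| <= d -> `|H t x p - H s y q| <= e.
Proof.
move=> hH e0; have e2 : 0 < e / 2 by lra.
have [d1 d10 h1] := ham_uc hH K e2.
have [d2 d20 h2] := ham_t hH e2.
have [M hM] := ham_bd hH K.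
have M1 : 0 < 1 + `|M| by rewrite ltr_pwDl.
exists (Num.min d1 (d2 / (1 + `|M|))); first by rewrite lt_min d10 divr_gt0.
move=> t s x y p q hp ts xy pq.
have m1 : Num.min d1 (d2 / (1 + `|M|)) <= d1 by rewrite ge_min lexx.
have hxy := h1 s x y p q hp (le_trans xy m1) (le_trans pq m1).
have hb t' : Num.max (H t' x p) 0 <= `|M|.
  rewrite ge_max normr_ge0 andbT; apply: le_trans (ler_norm _) _.
  exact: le_trans (hM _ _ _ hp) (ler_norm _).
have ht t' s' : `|t' - s'| <= d2 / (1 + `|M|) -> H t' x p <= H s' x p + e / 2.
  move=> ts'; apply: h2; apply: le_trans (_ : `|t' - s'| * (1 + `|M|) <= _).
    by rewrite ler_wpM2l// lerD2l.
  by rewrite -ler_pdivlMr.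
have ts1 : `|t - s| <= d2 / (1 + `|M|) by rewrite (le_trans ts)// ge_min lexx orbT.
have := ht _ _ ts1; have := ht s t; rewrite distrC => /(_ ts1).
move: hxy => /ler_normlP[]; clear; move=> *; apply/ler_normlP; split; lra.
Qed.

Lemma ham_shift H p0 : hamiltonian H -> hamiltonian (fun t x p => H t x (p0 + p)).
Proof.
move=> hH; split.
- move=> K; have [M hM] := ham_bd hH (`|p0| + K); exists M => t x p hp.
  by apply: hM; apply: le_trans (ler_normD _ _) _; rewrite lerD2l.
- move=> M; have [K hK] := ham_co hH M; exists (K + `|p0|) => q hq t x.
  apply: hK; have := ler_normD (p0 + q) (- p0).
  by rewrite addrAC subrr add0r normrN; lra.
- move=> K e e0; have [d d0 hd] := ham_uc hH (`|p0| + K) e0; exists d => // t x y p q hp xy pq.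
  apply: hd => //; first by apply: le_trans (ler_normD _ _) _; rewrite lerD2l.
  by rewrite opprD addrACA subrr add0r.
- by move=> e e0; have [d d0 hd] := ham_t hH e0; exists d => // t s x p; exact: hd.
Qed.

(** Let b = 2 (t - s) / th. The first inequality bounds [H] at (t, x, P) by Lam + |b|, so the error
    in (A2) is governed by (1 + |Lam| + |b|) |t - s|, where |b| |t - s| = 2 (t - s)^2 / th is small
    with the penalty. Coercivity then bounds P in terms of th alone, and continuity in x is used on
    that bounded range: this is why [th0] depends on th. *)
Lemma doubling_error H e Lam : hamiltonian H -> 0 < e ->
  exists2 ka, 0 < ka & forall th, 0 < th <= 1 -> exists2 th0, 0 < th0 &
  forall th' t s x y P l, 0 < th' <= th0 -> l <= Lam ->
    (t - s) ^+ 2 / th + (x - y) ^+ 2 / th' <= ka ->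
    2 * (t - s) / th + H t x P <= l -> 2 * (t - s) / th + H s y P <= l + e.
Proof.
move=> hH e0; have e2 : 0 < e / 2 by lra.
have [d d0 hd] := ham_t hH e2.
have L3 : 0 < 3 + `|Lam| by rewrite ltr_pwDl.
pose k := Num.min 1 (d / (3 + `|Lam|)).
have k0 : 0 < k by rewrite lt_min ltr01 divr_gt0.
have k1 : k <= 1 by rewrite ge_min lexx.
have kd : k * (3 + `|Lam|) <= d by rewrite -ler_pdivlMr// ge_min lexx orbT.
clearbody k.
exists (k ^+ 2); first by rewrite exprn_gt0.
move=> th /andP[th0 th1].
have [K hK] := ham_co hH (Lam + 2 / th + 1).
have [d2 d20 h2] := ham_uc hH K e2.
exists (d2 ^+ 2); first by rewrite exprn_gt0.
move=> th' t s x y P l /andP[th'0 th'1] lL pen hsub.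
have p1 : 0 <= (t - s) ^+ 2 / th by rewrite divr_ge0 ?sqr_ge0// ltW.
have p2 : 0 <= (x - y) ^+ 2 / th' by rewrite divr_ge0 ?sqr_ge0// ltW.
have ts2 : (t - s) ^+ 2 <= k ^+ 2 * th.
  by rewrite -ler_pdivrMr//; move: p1 p2 pen; clear; lra.
have ts : `|t - s| <= k.
  rewrite -ler_sqr ?nnegrE ?(ltW k0)// real_normK ?num_real//.
  by apply: le_trans ts2 _; rewrite ler_piMr// sqr_ge0.
have xy : `|x - y| <= d2.
  rewrite -ler_sqr ?nnegrE ?(ltW d20)// real_normK ?num_real//.
  have : (x - y) ^+ 2 <= k ^+ 2 * th'.
    by rewrite -ler_pdivrMr//; move: p1 p2 pen; clear; lra.
  move=> h; apply: le_trans h (le_trans _ th'1).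
  by rewrite ler_piMl ?(ltW th'0)// expr_le1 ?(ltW k0).
set b := 2 * (t - s) / th in hsub *.
have bn : `|b| = 2 * `|t - s| / th.
  by rewrite /b !normrM normfV (ger0_norm (ltW th0)) ger0_norm.
have b2 : `|b| <= 2 / th.
  by rewrite bn ler_pdivrMr// divfK ?gt_eqF//; move: ts k1; clear; lra.
have hH1 : H t x P <= Lam + `|b|.
  by have := ler_norm (- b); rewrite normrN; move: hsub lL; clear; lra.
have PK : `|P| <= K.
  rewrite leNgt; apply/negP => /ltW/hK/(_ t x).
  by move: hH1 b2; clear; lra.
have hx := h2 s x y P P PK xy; rewrite subrr normr0 in hx.
have {hx}/ler_normlP[hx _] := hx (ltW d20).
have ht : H s x P <= H t x P + e / 2.
  apply: hd; rewrite distrC; apply: le_trans kd.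
  have h1 : Num.max (H t x P) 0 <= `|Lam| + `|b|.
    rewrite ge_max addr_ge0// andbT; apply: le_trans hH1 _.
    by rewrite lerD2r ler_norm.
  have h3 : `|t - s| * (1 + Num.max (H t x P) 0) <= `|t - s| * (1 + (`|Lam| + `|b|)).
    by rewrite ler_wpM2l// lerD2l.
  have h4 : `|t - s| * `|b| <= 2 * k.
    have -> : `|t - s| * `|b| = 2 * (`|t - s| ^+ 2 / th) by rewrite bn; ring.
    rewrite real_normK ?num_real//.
    have h : (t - s) ^+ 2 / th <= k ^+ 2 by rewrite ler_pdivrMr.
    have : k ^+ 2 <= k by rewrite expr2 ler_piMl// ltW.
    by move: h; clear; lra.
  have h5 : `|t - s| * (1 + `|Lam|) <= k * (1 + `|Lam|) by rewrite ler_wpM2r// addr_ge0.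
  by move: h3 h4 h5; clear; nra.
by move: ht hx hsub; clear; lra.
Qed.

Implicit Type w : (R * R) * (R * R).

Definition pen (th th' : R) w : R :=
  (w.1.1 - w.2.1) ^+ 2 / th + (w.1.2 - w.2.2) ^+ 2 / th'.

Lemma continuous_pen th th' : continuous (pen th th').
Proof.
have c1 : continuous (fun w => w.1.1 : R).
  by move=> w; apply: (@continuous_comp _ _ _ fst fst); exact: cvg_fst.
have c2 : continuous (fun w => w.2.1 : R).
  by move=> w; apply: (@continuous_comp _ _ _ snd fst); [exact: cvg_snd|exact: cvg_fst].
have c3 : continuous (fun w => w.1.2 : R).
  by move=> w; apply: (@continuous_comp _ _ _ fst snd); [exact: cvg_fst|exact: cvg_snd].
have c4 : continuous (fun w => w.2.2 : R).
  by move=> w; apply: (@continuous_comp _ _ _ snd snd); exact: cvg_snd.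
move=> w; apply: cvgD; apply: cvgM; try exact: cvg_cst.
  apply: (@continuous_at_sqr _ _ (fun w => w.1.1 - w.2.1)).
  by apply: cvgB; [exact: c1|exact: c2].
apply: (@continuous_at_sqr _ _ (fun w => w.1.2 - w.2.2)).
by apply: cvgB; [exact: c3|exact: c4].
Qed.

Lemma pen_ge0 th th' w : 0 <= th -> 0 <= th' -> 0 <= pen th th' w.
Proof. by move=> h h'; rewrite addr_ge0// divr_ge0// sqr_ge0. Qed.

Lemma pen_mono th th' ta ta' w : 0 < th -> 0 < th' -> th <= ta -> th' <= ta' ->
  pen ta ta' w <= pen th th' w.
Proof.
move=> t0 t'0 tt tt'; apply: lerD; apply: ler_wpM2l; rewrite ?sqr_ge0//.
  by rewrite lef_pV2// posrE (lt_le_trans t0).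
by rewrite lef_pV2// posrE (lt_le_trans t'0).
Qed.

Lemma pen_scale th w : 0 < th -> pen th th w = th^-1 * pen 1 1 w.
Proof. by move=> t0; rewrite /pen !divr1; ring. Qed.

Lemma pen0 w : pen 1 1 w = 0 -> w.1 = w.2.
Proof.
move: w => [[t x] [s y]]; rewrite /pen /= !divr1 => /eqP.
rewrite paddr_eq0 ?sqr_ge0// !sqrf_eq0 !subr_eq0.
by move=> /andP[/eqP -> /eqP ->].
Qed.

Definition doubled (W1 W2 : R * R -> R) th th' w : R :=
  W1 w.1 + W2 w.2 - pen th th' w.

Lemma doubled_qjets (W1 W2 : R * R -> R) th th' w :
  (\forall v \near w, doubled W1 W2 th th' v <= doubled W1 W2 th th' w) ->
  qjet W1 w.1 (2 * (w.1.1 - w.2.1) / th) (2 * (w.1.2 - w.2.2) / th') /\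
  qjet W2 w.2 (- (2 * (w.1.1 - w.2.1) / th)) (- (2 * (w.1.2 - w.2.2) / th')).
Proof.
move=> [[A B] [/= hA hB] hmax]; split; exists (`|th^-1| + `|th'^-1|).
  apply: filterS hA => y Ay.
  have := hmax (y, w.2) (conj Ay (nbhs_singleton hB)).
  rewrite /doubled /pen /lin /sqd /=.
  have := ler_wpM2r (sqr_ge0 (y.1 - w.1.1)) (ler_norm th^-1).
  have := ler_wpM2r (sqr_ge0 (y.2 - w.1.2)) (ler_norm th'^-1).
  have := mulr_ge0 (normr_ge0 th^-1) (sqr_ge0 (y.2 - w.1.2)).
  have := mulr_ge0 (normr_ge0 th'^-1) (sqr_ge0 (y.1 - w.1.1)).
  move: `|th^-1| `|th'^-1| => n1 n2; move: (th^-1) (th'^-1) => k1 k2; clear; lra.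
apply: filterS hB => y Ay.
have := hmax (w.1, y) (conj (nbhs_singleton hA) Ay).
rewrite /doubled /pen /lin /sqd /=.
have := ler_wpM2r (sqr_ge0 (y.1 - w.2.1)) (ler_norm th^-1).
have := ler_wpM2r (sqr_ge0 (y.2 - w.2.2)) (ler_norm th'^-1).
have := mulr_ge0 (normr_ge0 th^-1) (sqr_ge0 (y.2 - w.2.2)).
have := mulr_ge0 (normr_ge0 th'^-1) (sqr_ge0 (y.1 - w.2.1)).
move: `|th^-1| `|th'^-1| => n1 n2; move: (th^-1) (th'^-1) => k1 k2; clear; lra.
Qed.

Lemma usc_doubled0 (W1 W2 : R * R -> R) w : usc W1 w.1 -> usc W2 w.2 ->
  usc (fun w => W1 w.1 + W2 w.2) w.
Proof.
move=> u1 u2 e e0; have e2 : 0 < e / 2 by lra.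
exists ([set y | W1 y < W1 w.1 + e / 2], [set y | W2 y < W2 w.2 + e / 2]) => /=.
  by split; [exact: u1|exact: u2].
by move=> v /= [h1 h2]; lra.
Qed.

(** [penalized_max] controls W1 + W2 minus n0 times the penalty. Taking the coefficient 1 / th at
    least 2 n0 leaves half of the penalty over, which bounds it by 2 e1. The scale of space is then
    shrunk below what [doubling_error] allows. *)
Lemma doubling H (W1 W2 : R * R -> R) (P : set ((R * R) * (R * R))) e Lam M th1 zd :
  hamiltonian H -> 0 < e -> compact P -> 0 < th1 ->
  (forall w, P w -> usc W1 w.1) -> (forall w, P w -> usc W2 w.2) ->
  (forall z, P (z, z) -> W1 z + W2 z <= M) -> P (zd, zd) -> M <= W1 zd + W2 zd ->
  exists th th' w, [/\ 0 < th' <= th /\ th <= th1, P w,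
    (forall v, P v -> doubled W1 W2 th th' v <= doubled W1 W2 th th' w),
    pen th th' w <= e &
    forall l, l <= Lam ->
      2 * (w.1.1 - w.2.1) / th + H w.1.1 w.1.2 (2 * (w.1.2 - w.2.2) / th') <= l ->
      2 * (w.1.1 - w.2.1) / th + H w.2.1 w.2.2 (2 * (w.1.2 - w.2.2) / th') <= l + e].
Proof.
move=> hH e0 cP th10 u1 u2 dM Pd dd.
have [ka ka0 hka] := doubling_error Lam hH e0.
pose e1 := Num.min ka e / 2.
have e10 : 0 < e1 by rewrite divr_gt0// lt_min ka0.
have dM' w : P w -> pen 1 1 w = 0 -> W1 w.1 + W2 w.2 <= M.
  by case: w => z z' Pz /pen0 /= zz; rewrite -zz in Pz *; exact: dM.
have [n0 n00 hn0] := @penalized_max R _ P (fun w => W1 w.1 + W2 w.2) (pen 1 1) M e1 cP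
  (fun w Pw => usc_doubled0 (u1 w Pw) (u2 w Pw)) (@continuous_pen 1 1)
  (fun w => pen_ge0 w ler01 ler01)
  dM' e10.
pose th := Num.min (Num.min 1 th1) (2 * n0)^-1.
have th0 : 0 < th by rewrite !lt_min ltr01 th10 invr_gt0 mulr_gt0.
have th_1 : th <= 1 by rewrite !ge_min lexx.
have th_th1 : th <= th1 by rewrite !ge_min lexx !orbT.
have thn : 2 * n0 <= th^-1.
  rewrite -[2 * n0]invrK lef_pV2 ?posrE ?invr_gt0 ?mulr_gt0//.
  by rewrite ge_min lexx orbT.
clearbody th.
have th01 : 0 < th <= 1 by rewrite th0.
have [th0' th0'0 hth] := hka _ th01.
pose th' := Num.min th th0'.
have th'0 : 0 < th' by rewrite lt_min th0.
have th'th : th' <= th by rewrite ge_min lexx.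
have th'2 : th' <= th0' by rewrite ge_min lexx orbT.
clearbody th'.
have ud w : P w -> usc (doubled W1 W2 th th') w.
  move=> Pw; apply: uscD; first exact: usc_doubled0 (u1 w Pw) (u2 w Pw).
  by apply: continuous_usc; apply: cvgN; exact: continuous_pen.
have [w Pw hw] := usc_compact_max cP (ex_intro _ _ Pd) ud.
have hwM : M <= doubled W1 W2 th th' w.
  apply: le_trans dd (le_trans _ (hw _ Pd)).
  by rewrite /doubled /pen /= !subrr expr0n /= !mul0r addr0 subr0.
have pw : pen th th' w <= 2 * e1.
  have h1 := hn0 n0 w (lexx _) Pw.
  have h2 : 2 * (n0 * pen 1 1 w) <= pen th th' w.
    apply: (@le_trans _ _ (pen th th w)); last exact: pen_mono.
    rewrite (pen_scale w th0) mulrA; apply: ler_wpM2r => //.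
    exact: pen_ge0.
  by move: hwM h1 h2; rewrite /doubled; clear; lra.
have pk : pen th th' w <= ka.
  by apply: le_trans pw _; rewrite /e1 mulrC divfK// ge_min lexx.
exists th, th', w; split => //; first by rewrite th'0 th'th.
  by apply: le_trans pw _; rewrite /e1 mulrC divfK// ge_min lexx orbT.
by move=> l lL; apply: (hth th') => //; rewrite th'0 th'2.
Qed.

End Hamiltonians.

(** * Perron's method and the cell problem *)

Section Perron.
Context {R : realType}.
Implicit Types (z y : R * R) (a p : R) (u w f g : R * R -> R).

Lemma slope_limit (c m C d : R) : 0 < d ->
  (forall s, `|s| <= d -> c * s <= m * `|s| + C * s ^+ 2) -> `|c| <= m.
Proof.
move=> d0 hd; apply/ler_addgt0Pr => e e0.
have C1 : 0 < `|C| + 1 by rewrite ltr_wpDl.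
pose s := Num.min d (e / (`|C| + 1)).
have s0 : 0 < s by rewrite lt_min d0 divr_gt0.
have sd : s <= d by rewrite ge_min lexx.
have se : `|C| * s <= e.
  have : (`|C| + 1) * s <= e by rewrite mulrC -ler_pdivlMr// ge_min lexx orbT.
  by apply: le_trans; rewrite ler_wpM2r ?lerDl// ltW.
clearbody s.
have hs1 : `|s| <= d by rewrite gtr0_norm.
have hs2 : `|- s| <= d by rewrite normrN.
have := hd s hs1; have := hd (- s) hs2; rewrite normrN sqrrN gtr0_norm// => k2 k1.
have Cs : C * s ^+ 2 <= e * s.
  apply: le_trans (_ : `|C| * s ^+ 2 <= _); first by rewrite ler_wpM2r ?sqr_ge0 ?ler_norm.
  by rewrite expr2 mulrA ler_pM2r.
rewrite ler_norml -(ler_pM2r s0) -[X in _ && X](ler_pM2r s0).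
by apply/andP; split; move: k1 k2 Cs; clear; lra.
Qed.

Lemma lin_flat z a p C : (\forall y \near z, lin z a p y <= C * sqd z y) ->
  a = 0 /\ p = 0.
Proof.
move=> /nbhs_boxP[d d0 hd].
have flat c : (forall h, `|h| <= d -> c * h <= C * h ^+ 2) -> c = 0.
  move=> hc; apply/eqP; rewrite -normr_le0; apply: (@slope_limit c 0 C d d0) => h hh.
  by rewrite mul0r add0r; exact: hc.
split; apply: flat => h hh.
  have := hd (z.1 + h, z.2); rewrite /lin /sqd /= addrAC !subrr add0r normr0.
  by move=> /(_ hh (ltW d0)); rewrite expr0n /= mulr0 !addr0.
have := hd (z.1, z.2 + h); rewrite /lin /sqd /= [_ + h]addrC addrK !subrr normr0.
by move=> /(_ (ltW d0) hh); rewrite expr0n /= mulr0 !add0r.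
Qed.

Lemma env_adh u z (s e : R) : bdat u z -> s < env u z -> 0 < e ->
  exists2 y, cbox z e y & s < u y.
Proof.
move=> b hs e0.
have FA : globally [set: unit] setT by move=> ? _.
by have [_ [y [_ yb hy]]] := rsup_ge (bdat_locbd b) hs FA e0; exists y.
Qed.

Lemma bdatN u z : bdat u z -> bdat (fun y => - u y) z.
Proof. by move=> [r [M [r0 h]]]; exists r, M; split => // y /h; rewrite normrN. Qed.

Lemma bdat_squeeze f g u z : bdat f z -> bdat g z ->
  (\forall y \near z, f y <= u y <= g y) -> bdat u z.
Proof.
move=> [r [M [r0 h]]] [r' [M' [r'0 h']]] /nbhs_boxP[d d0 hd].
exists (Num.min (Num.min r r') d), (Num.max M M'); split; first by rewrite !lt_min r0 r'0.
move=> y yb.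
have /h/ler_normlP[h1 h2] : cbox z r y by apply: cbox_sub yb; rewrite !ge_min lexx.
have /h'/ler_normlP[h3 h4] : cbox z r' y by apply: cbox_sub yb; rewrite !ge_min lexx orbT.
have [y1 y2] : cbox z d y by apply: cbox_sub yb; rewrite !ge_min lexx orbT.
have /andP[h5 h6] := hd y y1 y2.
have m1 : M <= Num.max M M' by rewrite le_max lexx.
have m2 : M' <= Num.max M M' by rewrite le_max lexx orbT.
by apply/ler_normlP; split; move: h1 h2 h3 h4 h5 h6 m1 m2; clear; lra.
Qed.

Lemma env_mono u w z : bdat u z -> bdat w z -> (\forall y \near z, u y <= w y) ->
  env u z <= env w z.
Proof.
move=> bu bw uw; apply/ler_addgt0Pr => e e0; apply: env_le => //.
have h : env w z < env w z + e by lra.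
by move: uw (env_near bw h); apply: filterS2 => y; exact: le_trans.
Qed.

Lemma env_eq u w z : bdat w z -> (\forall y \near z, u y = w y) -> env u z = env w z.
Proof.
move=> bw uw; have bu : bdat u z.
  by apply: (bdat_squeeze bw bw); apply: filterS uw => y ->; rewrite lexx.
apply/le_anti/andP; split; apply: env_mono => //; apply: filterS uw => y -> //.
Qed.

Definition subsol (Om : set (R * R)) (G : R * R -> R -> R -> R) u : Prop :=
  forall z a p, Om z -> qjet u z a p -> a + G z (u z) p <= 0.
(* w is the opposite of a lower semicontinuous supersolution. *)
Definition supersol (Om : set (R * R)) (G : R * R -> R -> R -> R) w : Prop :=
  forall z a p, Om z -> qjet w z a p -> 0 <= - a + G z (- w z) (- p).

Definition jointly_continuous (Om : set (R * R)) (G : R * R -> R -> R -> R) : Prop :=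
  forall z r p, Om z -> forall e, 0 < e -> exists2 d, 0 < d & forall z' r' p',
    cbox z d z' -> `|r' - r| <= d -> `|p' - p| <= d -> `|G z' r' p' - G z r p| <= e.

Record barriers (Om : set (R * R)) (G : R * R -> R -> R -> R) f g : Prop := Barriers {
  barriers_open : open Om;
  barriers_cont : jointly_continuous Om G;
  barriers_bf : forall z, bdat f z;
  barriers_bg : forall z, bdat g z;
  barriers_le : forall z, f z <= g z;
  barriers_sub : subsol Om G (env f);
  barriers_super : supersol Om G (env (fun y => - g y)) }.

Definition perron_class Om G f g w :=
  (forall z, f z <= w z <= g z) /\ subsol Om G (env w).

Definition perron_sup Om G f g z := sup [set w z | w in perron_class Om G f g].

Lemma perron_class_low Om G f g (D : barriers Om G f g) : (perron_class Om G f g) f.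
Proof. have [oOm cG bf bg fg fsub gsuper] := D; by split => // z; rewrite lexx fg. Qed.

Lemma perron_class_bdat Om G f g (D : barriers Om G f g) w z : (perron_class Om G f g) w -> bdat w z.
Proof.
have [oOm cG bf bg fg fsub gsuper] := D.
by move=> [h _]; apply: (bdat_squeeze (bf z) (bg z)); apply/nbhs_boxP; exists 1.
Qed.

Lemma perron_sup_ub Om G f g (D : barriers Om G f g) w z : (perron_class Om G f g) w -> w z <= (perron_sup Om G f g) z.
Proof.
have [oOm cG bf bg fg fsub gsuper] := D.
move=> Sw; apply: ub_le_sup; last by exists w.
by exists (g z) => _ [v [h _] <-]; case/andP: (h z).
Qed.

Lemma perron_sup_adh Om G f g (D : barriers Om G f g) z e : 0 < e -> exists2 w, (perron_class Om G f g) w & (perron_sup Om G f g) z - e < w z.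
Proof.
have [oOm cG bf bg fg fsub gsuper] := D.
move=> e0; have hs : has_sup [set w z | w in (perron_class Om G f g)].
  split; first by exists (f z), f; [exact: perron_class_low|].
  by exists (g z) => _ [v [h _] <-]; case/andP: (h z).
by have [_ [w Sw <-] h] := sup_adherent e0 hs; exists w.
Qed.

Lemma perron_sup_bounds Om G f g (D : barriers Om G f g) z : f z <= (perron_sup Om G f g) z <= g z.
Proof.
have [oOm cG bf bg fg fsub gsuper] := D.
apply/andP; split; first by apply: perron_sup_ub => //; exact: perron_class_low.
apply: ge_sup; first by exists (f z), f; [exact: perron_class_low|].
by move=> _ [v [h _] <-]; case/andP: (h z).
Qed.

Lemma perron_sup_bdat Om G f g (D : barriers Om G f g) z : bdat (perron_sup Om G f g) z.
Proof.
have [oOm cG bf bg fg fsub gsuper] := D.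
by apply: (bdat_squeeze (bf z) (bg z)); apply/nbhs_boxP; exists 1 => // y _ _; exact: perron_sup_bounds.
Qed.

(** The class itself is the index set, with the filter [globally]: upper bounds then hold for all
    members, and touching asks for a single member close to the supremum. *)
Lemma perron_sup_sub Om G f g (D : barriers Om G f g) : subsol Om G (env (perron_sup Om G f g)).
Proof.
have [oOm cG bf bg fg fsub gsuper] := D.
move=> z a p Oz /qjet_sjet js.
have PF : ProperFilter (globally (perron_class Om G f g)) := globally_properfilter (perron_class_low D).
have ht : touching (globally (perron_class Om G f g)) (fun w => env w) z (env (perron_sup Om G f g) z) a p.
  split=> [k k0|e A e0 FA].
    have /nbhs_boxP[d d0 hd] := js _ k0.
    exists (Num.min d k); first by rewrite lt_min d0 k0 ge_min lexx orbT.
    move=> e e0 w Sw y yb.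
    have [y1 y2] : cbox z d y by apply: cbox_sub yb; rewrite ge_min lexx.
    apply: le_trans (_ : env (perron_sup Om G f g) y <= _).
      apply: env_mono; [exact: (perron_class_bdat D)|exact: (perron_sup_bdat D)|].
      by apply/nbhs_boxP; exists 1 => // x _ _; exact: (perron_sup_ub D).
    by have := hd y y1 y2; lra.
  have e2 : 0 < e / 2 by lra.
  have h : env (perron_sup Om G f g) z - e / 2 < env (perron_sup Om G f g) z by lra.
  have [y yb hy] := env_adh (perron_sup_bdat D z) h e0.
  have [w Sw hw] := perron_sup_adh D y e2.
  exists w, y; split => //; first exact: FA.
  have := env_ge (perron_class_bdat D y Sw); move: hw hy; clear; lra.
have us : exists2 r, 0 < r & \forall i \near globally (perron_class Om G f g), forall y, cbox z r y -> usc (env i) y.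
  by exists 1 => // w Sw y _; apply: usc_envelope; exact: (perron_class_bdat D).
apply/ler_addgt0Pr => e e0; rewrite add0r.
have e2 : 0 < e / 2 by lra.
have [d d0 hd] := cG z (env (perron_sup Om G f g) z) p Oz _ e2.
have /nbhs_boxP[d' d'0 hd'] : nbhs z Om by exact: open_nbhs_nbhs.
pose e1 := Num.min (Num.min d d') (e / 2).
have e10 : 0 < e1 by rewrite !lt_min d0 d'0.
have [w [z1 [a1 [p1 [Sw z1b [ha hp] hw jw]]]]] := touching_qjet ht us e10 (fun _ h => h).
have m1 : e1 <= d by rewrite !ge_min lexx.
have m2 : e1 <= d' by rewrite !ge_min lexx orbT.
have m3 : e1 <= e / 2 by rewrite !ge_min lexx orbT.
have Oz1 : Om z1 by case: (cbox_sub m2 z1b) => *; exact: hd'.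
have := (Sw).2 z1 a1 p1 Oz1 jw.
have /ler_normlP[] := hd z1 (env w z1) p1 (cbox_sub m1 z1b) (le_trans hw m1) (le_trans hp m1).
by move: ha m3 => /ler_normlP[]; clear; lra.
Qed.

Lemma perron_low_env Om G f g (D : barriers Om G f g) z : env (fun y => - g y) z <= (env (fun y => - perron_sup Om G f g y)) z.
Proof.
have [oOm cG bf bg fg fsub gsuper] := D.
apply: env_mono; [exact: (bdatN (bg z))|exact: (bdatN (perron_sup_bdat D z))|].
by apply/nbhs_boxP; exists 1 => // y _ _; rewrite lerN2; case/andP: (perron_sup_bounds D y).
Qed.

(** If the inequality failed at z0, the opposite of the touching paraboloid, bent strictly more and
    raised by [sg], would be a strict subsolution [Q] near z0, lying below the supremum outside the
    half box. The maximum of both would belong to the class and exceed the supremum somewhere near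
    z0. *)
Lemma perron_sup_super Om G f g (D : barriers Om G f g) : supersol Om G (env (fun y => - perron_sup Om G f g y)).
Proof.
have [oOm cG bf bg fg fsub gsuper] := D.
move=> z0 a p Oz [C hC]; rewrite leNgt; apply/negP => hlt.
(* In case of equality (a, p) would be a jet of the envelope of the opposite of [g], for which the
   inequality is known. The strict gap leaves room for the bump below [g]. *)
have gap : env (fun y => - g y) z0 < (env (fun y => - perron_sup Om G f g y)) z0.
  rewrite lt_neqAle perron_low_env// andbT; apply/eqP => heq.
  have : qjet (env (fun y => - g y)) z0 a p.
    exists C; apply: filterS hC => y; rewrite heq; exact: le_trans (perron_low_env D y).
  by move=> /(gsuper _ _ _ Oz); rewrite heq leNgt hlt.
set mu := - (env (fun y => - perron_sup Om G f g y)) z0 in hlt.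
pose C' := `|C| + 1.
pose Q0 y := mu - lin z0 a p y - C' * sqd z0 y.
have cQ0 : continuous Q0.
  move=> y; apply: cvgB; last by apply: cvgM; [exact: cvg_cst|exact: continuous_sqd].
  by apply: cvgB; [exact: cvg_cst|exact: continuous_lin].
have Q0z : Q0 z0 = mu by rewrite /Q0 /lin /sqd !subrr expr0n /= !mulr0 addr0 mulr0 !subr0.
pose th := - (- a + G z0 mu (- p)).
have th0 : 0 < th by rewrite oppr_gt0.
have th2 : 0 < th / 2 by lra.
have [d d0 hd] := cG z0 mu (- p) Oz _ th2.
have ug := usc_envelope (bdatN (bg z0)).
pose gp := (env (fun y => - perron_sup Om G f g y)) z0 - env (fun y => - g y) z0.
have gp0 : 0 < gp by rewrite subr_gt0.
have gp3 : 0 < gp / 3 by lra.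
have hq (e : R) : 0 < e -> \forall y \near z0, `|mu - Q0 y| <= e.
  by move=> e0; have /cvgrPdist_le/(_ _ e0) := cQ0 z0; rewrite Q0z.
have d2 : 0 < d / 2 by lra.
have /nbhs_boxP[r1 r10 hr1] : \forall y \near z0,
   [/\ Om y, (env (fun y => - perron_sup Om G f g y)) y <= (env (fun y => - perron_sup Om G f g y)) z0 + lin z0 a p y + C * sqd z0 y,
       `|mu - Q0 y| <= d / 2, `|mu - Q0 y| <= gp / 3
     & env (fun y => - g y) y < env (fun y => - g y) z0 + gp / 3].
  have nO : nbhs z0 Om by exact: open_nbhs_nbhs.
  have n3 : \forall y \near z0, `|mu - Q0 y| <= gp / 3 /\
      env (fun y => - g y) y < env (fun y => - g y) z0 + gp / 3.
    by move: (hq _ gp3) (ug _ gp3); apply: filterS2.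
  have n2 : \forall y \near z0, `|mu - Q0 y| <= d / 2 /\ Om y.
    by move: (hq _ d2) nO; apply: filterS2.
  by move: hC n2 n3; apply: filterS3 => y ? [? ?] [? ?].
have C'0 : 0 < C' by rewrite ltr_wpDl.
pose r := Num.min (Num.min r1 (d / (2 * C'))) (Num.min d (th / (8 * C'))).
have r0 : 0 < r by rewrite !lt_min r10 d0 !divr_gt0// ?mulr_gt0.
have rr1 : r <= r1 by rewrite !ge_min lexx.
have rd : r <= d by rewrite !ge_min lexx !orbT.
have rC : 2 * C' * r <= d by rewrite mulrC -ler_pdivlMr ?mulr_gt0// !ge_min lexx !orbT.
have rth : 8 * C' * r <= th by rewrite mulrC -ler_pdivlMr ?mulr_gt0// !ge_min lexx !orbT.
clearbody r.
pose sg := Num.min (Num.min (d / 2) (gp / 3)) (r ^+ 2 / 4).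
have sg0 : 0 < sg by rewrite !lt_min !divr_gt0// exprn_gt0.
have sgd : sg <= d / 2 by rewrite !ge_min lexx.
have sgg : sg <= gp / 3 by rewrite !ge_min lexx orbT.
have sgr : sg <= r ^+ 2 / 4 by rewrite !ge_min lexx !orbT.
clearbody sg.
pose Q y := Q0 y + sg.
have hbox y : cbox z0 r y -> [/\ Om y, (env (fun y => - perron_sup Om G f g y)) y <= (env (fun y => - perron_sup Om G f g y)) z0 + lin z0 a p y + C * sqd z0 y,
       `|mu - Q0 y| <= d / 2, `|mu - Q0 y| <= gp / 3
     & env (fun y => - g y) y < env (fun y => - g y) z0 + gp / 3].
  by move=> /(cbox_sub rr1)[]; exact: hr1.
have Qg y : cbox z0 r y -> Q y <= g y.
  move=> /hbox[_ _ _ /ler_normlP[h1 h2] h3].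
  have := env_ge (bdatN (bg y)); rewrite /Q; move: h1 h2 h3 sgg; rewrite /gp /mu; clear; lra.
have Qstrict y : cbox z0 r y ->
    - a - 2 * C' * (y.1 - z0.1) + G y (Q y) (- p - 2 * C' * (y.2 - z0.2)) < 0.
  move=> yb; have [_ _ /ler_normlP[h1 h2] _ _] := hbox y yb.
  have {h1 h2}h1 : `|Q y - mu| <= d.
    by apply/ler_normlP; rewrite /Q; move: h1 h2 sgd sg0; clear; split; lra.
  have hy (x : R) : `|x| <= r -> `|2 * C' * x| <= 2 * C' * r.
    by move=> hx; rewrite normrM ger0_norm ?ler_wpM2l// ?mulr_ge0// ltW.
  have [y1 y2] := yb.
  have h2 : `|- p - 2 * C' * (y.2 - z0.2) - - p| <= d.
    by rewrite addrAC subrr add0r normrN; apply: le_trans (hy _ y2) rC.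
  have /ler_normlP[_ h3] := hd y (Q y) _ (cbox_sub rd yb) h1 h2.
  have /ler_normlP[h4 _] := hy _ y1.
  by move: h3 h4 rth th0; rewrite /th; clear; lra.
have uQ y : cbox z0 r y -> ~ cbox z0 (r / 2) y -> Q y <= (perron_sup Om G f g) y.
  move=> yb ny; have [_ h1 _ _ _] := hbox y yb.
  have h2 := env_ge (bdatN (perron_sup_bdat D y)); rewrite -/(env (fun y => - perron_sup Om G f g y)) in h2.
  have h3 : r ^+ 2 / 4 <= sqd z0 y.
    have hsq (x : R) : ~ `|x| <= r / 2 -> r ^+ 2 / 4 <= x ^+ 2.
      move=> /negP; rewrite -ltNge => /ltW hx.
      have -> : r ^+ 2 / 4 = (r / 2) ^+ 2 by field.
      by rewrite -[x ^+ 2]real_normK ?num_real// lerXn2r// ?nnegrE// divr_ge0 ?(ltW r0).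
    have [y1|y1] := leP `|y.1 - z0.1| (r / 2); last first.
      apply: le_trans (hsq (y.1 - z0.1) _) _; first by apply/negP; rewrite -ltNge.
      by rewrite /sqd lerDl sqr_ge0.
    apply: le_trans (hsq (y.2 - z0.2) _) _; first by move=> ?; apply: ny.
    by rewrite /sqd lerDr sqr_ge0.
  have h4 : C * sqd z0 y <= `|C| * sqd z0 y by rewrite ler_wpM2r ?sqd_ge0// ler_norm.
  by move: h1 h2 h3 h4 sgr; rewrite /Q /Q0 /C' /mu; clear; lra.
pose w y := if `[< cbox z0 r y >] then Num.max ((perron_sup Om G f g) y) (Q y) else (perron_sup Om G f g) y.
have wu y : (perron_sup Om G f g) y <= w y by rewrite /w; case: asboolP => // _; rewrite le_max lexx.
have wg y : w y <= g y.
  by rewrite /w; case: asboolP => [/Qg h|_]; rewrite ?ge_max ?h ?andbT; case/andP: (perron_sup_bounds D y).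
have wf y : f y <= w y by apply: le_trans (wu y); case/andP: (perron_sup_bounds D y).
have bw y : bdat w y.
  by apply: (bdat_squeeze (bf y) (bg y)); apply/nbhs_boxP; exists 1 => // x _ _; rewrite wf wg.
have emono y : env (perron_sup Om G f g) y <= env w y.
  by apply: env_mono; [exact: perron_sup_bdat|exact: bw|apply/nbhs_boxP; exists 1].
have r2 : 0 < r / 2 by lra.
have Sw : (perron_class Om G f g) w.
  split=> [z|z b q Oz' jw]; first by rewrite wf wg.
  (* Either the envelope agrees at z with that of the supremum, whose jets are under control, or the
     smooth [Q] touches it from below at z and dictates its jet. *)
  suff hz : env w z <= env (perron_sup Om G f g) z \/
      (cbox z0 r z /\ nbhs z (cbox z0 r) /\ env w z <= Q z).
    have [le1|[zb [nzb le2]]] := hz.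
      have heq : env w z = env (perron_sup Om G f g) z by apply/le_anti; rewrite le1 emono.
      rewrite heq; apply: (perron_sup_sub D) => //; case: jw => E hE; exists E.
      by apply: filterS hE => y; rewrite heq; apply: le_trans; exact: emono.
    have Qw y : cbox z0 r y -> Q y <= env w y.
      move=> yb; apply: le_trans (env_ge (bw y)).
      by rewrite /w; case: asboolP => // _; rewrite le_max lexx orbT.
    have heq : env w z = Q z by apply/le_anti; rewrite le2 Qw.
    have [E hE] := jw.
    have [hb hq'] : - a - 2 * C' * (z.1 - z0.1) - b = 0 /\
        - p - 2 * C' * (z.2 - z0.2) - q = 0.
      apply: (@lin_flat z _ _ (E + C')); move: hE nzb; apply: filterS2 => y h1 h2.
      have := le_trans (Qw y h2) h1; rewrite heq /Q /Q0 /lin /sqd.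
      by clear; lra.
    have := Qstrict z zb; rewrite heq.
    have -> : b = - a - 2 * C' * (z.1 - z0.1) by move: hb; clear; lra.
    have -> : q = - p - 2 * C' * (z.2 - z0.2) by move: hq'; clear; lra.
    exact: ltW.
  have [zb|nzb] := pselect (cbox z0 (r / 2) z).
    have nz : nbhs z (cbox z0 r).
      apply: filterS (nbhs_cbox z r2) => y; apply: cbox_trans zb; lra.
    have : env w z <= Num.max (env (perron_sup Om G f g) z) (Q z).
      have um : usc (fun y => Num.max (env (perron_sup Om G f g) y) (Q y)) z.
        apply: usc_maxr; first exact: usc_envelope (perron_sup_bdat D z).
        by apply: continuous_usc; apply: cvgD; [exact: cQ0|exact: cvg_cst].
      apply/ler_addgt0Pr => e e0; apply: env_le => //.
      move: (um _ e0); apply: filterS => y /ltW; apply: le_trans.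
      rewrite /w; case: asboolP => _; rewrite ?ge_max ?le_max ?(env_ge (perron_sup_bdat D y))//= ?lexx ?orbT//.
    rewrite le_max => /orP[|h]; [by left|right; split => //].
    exact: nbhs_singleton nz.
  left; have -> // : env w z = env (perron_sup Om G f g) z; apply: env_eq; first exact: perron_sup_bdat.
  have oc : nbhs z (~` cbox z0 (r / 2)).
    apply: open_nbhs_nbhs; split => //; apply: closed_openC.
    by apply: compact_closed; [exact: norm_hausdorff|exact: compact_cbox].
  apply: filterS oc => y ny; rewrite /w; case: asboolP => // yb.
  by rewrite max_l// uQ.
have [y [yb uy]] : exists y, cbox z0 r y /\ (perron_sup Om G f g) y < Q y.
  have sg2 : 0 < sg / 2 by lra.
  have /nbhs_boxP[r3 r30 hr3] := hq _ sg2.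
  have h : (env (fun y => - perron_sup Om G f g y)) z0 - sg / 2 < (env (fun y => - perron_sup Om G f g y)) z0 by lra.
  have rr3 : 0 < Num.min r r3 by rewrite lt_min r0 r30.
  have [y yb hy] := env_adh (bdatN (perron_sup_bdat D z0)) h rr3.
  exists y; split; first by apply: cbox_sub yb; rewrite ge_min lexx.
  have [y1 y2] : cbox z0 r3 y by apply: cbox_sub yb; rewrite ge_min lexx orbT.
  by have /ler_normlP[] := hr3 y y1 y2; move: hy; rewrite /Q /mu; clear; lra.
have := perron_sup_ub D y Sw; rewrite /w; case: asboolP => // _.
by rewrite leNgt lt_max uy orbT.
Qed.

Lemma perron Om G f g (D : barriers Om G f g) : exists v, [/\ forall z, f z <= v z <= g z,
  subsol Om G (env v), supersol Om G (env (fun y => - v y)) &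
  forall w, (forall z, f z <= w z <= g z) -> subsol Om G (env w) -> forall z, w z <= v z].
Proof.
exists (perron_sup Om G f g); split; [exact: perron_sup_bounds|exact: perron_sup_sub|
  exact: perron_sup_super|by move=> w h1 h2 z; apply: perron_sup_ub].
Qed.

End Perron.

(** * Growth of periodic subsolutions in time and space *)

Section PeriodicSubsolutions.
Context {R : realType}.
Implicit Types (z y : R * R) (a p q l : R) (w v : R * R -> R) (H : R -> R -> R -> R).

Definition periodic2 w : Prop :=
  forall (k j : int) z, w (z.1 + k%:~R, z.2 + j%:~R) = w z.

Definition periodic1 w : Prop := forall (k : int) t x, w (t + k%:~R, x) = w (t, x).

Lemma periodic2W w : periodic2 w -> periodic1 w.
Proof. by move=> pw k t x; have := pw k 0 (t, x); rewrite addr0. Qed.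

(* u is a subsolution of u_t + H = l; v is a supersolution when - v is a
   subsolution for hneg H, with level - l. *)
Definition qsub (Om : set (R * R)) H l w : Prop :=
  forall z a q, Om z -> qjet w z a q -> a + H z.1 z.2 q <= l.

Definition hneg H t x q : R := - H t x (- q).

Lemma hnegK H : hneg (hneg H) = H.
Proof. by apply/funext => t; apply/funext => x; apply/funext => q; rewrite /hneg !opprK. Qed.

Definition ucont H : Prop := forall K e, 0 < e ->
  exists2 d, 0 < d & forall (t s x y p q : R), `|p| <= K -> `|t - s| <= d ->
    `|x - y| <= d -> `|p - q| <= d -> `|H t x p - H s y q| <= e.

Lemma ham_ucont H : hamiltonian H -> ucont H.
Proof. by move=> hH K e; exact: ham_cont. Qed.

Lemma hneg_ucont H : ucont H -> ucont (hneg H).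
Proof.
move=> hH K e e0; have [d d0 hd] := hH K e e0; exists d => // t s x y p q hp ts xy pq.
rewrite /hneg opprK addrC distrC; apply: hd; rewrite ?normrN//.
by rewrite opprK addrC distrC.
Qed.

Lemma int_shift (x c : R) : exists k : int, c <= x + k%:~R <= c + 1.
Proof.
exists (- Num.floor (x - c)); rewrite rmorphN /=.
have := floor_le (x - c); have := floorD1_gt (x - c); rewrite intrD /=; lra.
Qed.

Lemma periodic_max w : periodic2 w -> (forall z, usc w z) ->
  exists z, forall y, w y <= w z.
Proof.
move=> pw uw.
have n0 : @rect R 0 1 0 1 !=set0.
  by exists (0, 0); rewrite /rect /= !in_itv /= lexx ler01.
have [z _ hz] := usc_compact_max (@compact_rect R 0 1 0 1) n0 (fun z _ => uw z).
exists z => y; have [k hk] := int_shift y.1 0; have [j hj] := int_shift y.2 0.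
rewrite -(pw k j y); apply: hz; rewrite /rect /= !in_itv /=.
by rewrite !add0r in hk hj; rewrite hk hj.
Qed.

(** Space slopes are not controlled, so the sides are closed by a parabola in x of height |M| + |w
    (s0, x0)| at distance r, chosen small enough for semicontinuity to bound w (s0, x) by w (s0, x0)
    + e. *)
Lemma time_growth w (s0 s2 s1 x0 rho C : R) :
  s0 <= s1 -> s1 < s2 -> 0 < rho -> 0 <= C ->
  (forall y, rect s0 s2 (x0 - rho) (x0 + rho) y -> usc w y) ->
  (forall s x a p, s0 < s < s2 -> `|x - x0| < rho -> qjet w (s, x) a p -> a <= C) ->
  w (s1, x0) <= w (s0, x0) + C * (s1 - s0).
Proof.
move=> s01 s12 rho0 C0 uw jw.
have [M hM] := usc_compact_bound (@compact_rect R s0 s2 (x0 - rho) (x0 + rho)) uw.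
apply/ler_addgt0Pr => e e0.
have zb : rect s0 s2 (x0 - rho) (x0 + rho) (s0, x0).
  by rewrite /rect /= !in_itv /= lexx; move: s01 s12 rho0; clear; split; lra.
have /nbhs_boxP[d d0 hd] := uw _ zb _ e0.
pose r := Num.min d rho.
have r0 : 0 < r by rewrite lt_min d0.
have rd : r <= d by rewrite ge_min lexx.
have rr : r <= rho by rewrite ge_min lexx orbT.
clearbody r.
have sub y : rect s0 s2 (x0 - r) (x0 + r) y -> rect s0 s2 (x0 - rho) (x0 + rho) y.
  rewrite /rect /= !in_itv /= => -[-> h]; split => //.
  by move: h rr; clear; lra.
pose k := (`|M| + `|w (s0, x0)|) / r ^+ 2.
have kr : k * r ^+ 2 = `|M| + `|w (s0, x0)| by rewrite /k divfK// gt_eqF// exprn_gt0.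
have k0 : 0 <= k by rewrite divr_ge0 ?addr_ge0// exprn_ge0// ltW.
have : w (s1, x0) <= w (s0, x0) + e + C * (s1 - s0); last by clear; lra.
apply: (@upper_barrier _ w s0 s2 x0 r k) => //.
- by move=> y /sub; exact: uw.
- move=> x hx; apply: (@le_trans _ _ (w (s0, x0) + e)).
    by apply/ltW/hd => /=; rewrite ?subrr ?normr0 ?(ltW d0)//; apply: le_trans hx rd.
  by rewrite lerDl mulr_ge0// sqr_ge0.
- move=> s x sb hx; rewrite kr.
  have := hM (s, x); rewrite /rect /= !in_itv /=.
  have -> : s0 <= s <= s2 by case/andP: sb => *; rewrite !ltW.
  have -> : x0 - rho <= x <= x0 + rho.
    by move: hx rr => <- h; have := ler_norm (x - x0); have := ler_norm (- (x - x0));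
      rewrite normrN; move: h; clear; lra.
  move=> /(_ (conj isT isT)).
  by have := ler_norm M; have := ler_norm (- w (s0, x0)); rewrite normrN; move: e0; clear; lra.
- move=> s x a p sb hx; apply: jw => //; exact: lt_le_trans rr.
Qed.

Lemma qjet_swap w z a p : qjet (fun y => w (y.2, y.1)) (z.2, z.1) a p -> qjet w z p a.
Proof.
move=> [C /nbhs_boxP[d d0 hd]]; exists C; apply/nbhs_boxP; exists d => // y y1 y2.
by have := hd (y.2, y.1) y2 y1; rewrite /lin /sqd /= -!surjective_pairing; clear; lra.
Qed.

Lemma qjet_reflect w z a p : qjet (fun y => w (y.1, - y.2)) (z.1, - z.2) a p -> qjet w z a (- p).
Proof.
move=> [C /nbhs_boxP[d d0 hd]]; exists C; apply/nbhs_boxP; exists d => // y y1 y2.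
have := hd (y.1, - y.2) y1; rewrite /lin /sqd /= !opprK -!surjective_pairing.
have -> : - y.2 + z.2 = - (y.2 - z.2) by ring.
by rewrite normrN sqrrN => /(_ y2); clear; lra.
Qed.

Lemma usc_swap w z : usc w (z.2, z.1) -> usc (fun y => w (y.2, y.1)) z.
Proof.
move=> h e e0; have /nbhs_boxP[d d0 hd] := h e e0; apply/nbhs_boxP; exists d => // y y1 y2.
exact: hd.
Qed.

Lemma usc_reflect w z : usc w (z.1, - z.2) -> usc (fun y => w (y.1, - y.2)) z.
Proof.
move=> h e e0; have /nbhs_boxP[d d0 hd] := h e e0; apply/nbhs_boxP; exists d => // y y1 y2.
by apply: hd => //=; rewrite -opprD normrN.
Qed.

(* Along the maximizing times the time slope vanishes. *)
Lemma space_growth_right w K x0 x1 t1 : 0 <= K -> x0 <= x1 -> periodic1 w ->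
  (forall z, usc w z) ->
  (forall z p, x0 < z.2 -> qjet w z 0 p -> p <= K) ->
  exists t0, w (t1, x1) <= w (t0, x0) + K * (x1 - x0).
Proof.
move=> K0 x01 pw uw jw.
pose g y := w (y.2, y.1).
have ug z : usc g z by apply: usc_swap; exact: uw.
have nx : @rect R x0 x0 (-1) 2 !=set0.
  by exists (x0, 0); rewrite /rect /= !in_itv /= lexx; split => //; lra.
have [y0 [y01 y02] hy0] := @usc_compact_max _ _ (rect x0 x0 (-1) 2) g
  (@compact_rect R _ _ _ _)
  nx
  (fun z _ => ug z).
have {}y01 : y0.1 = x0 by move: y01; rewrite /= in_itv /= => /le_anti.
have [k hk] := int_shift t1 0; rewrite add0r in hk.
suff h : g (x1, t1 + k%:~R) <= g y0 + K * (x1 - x0).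
  by exists y0.2; move: h; rewrite /g /= pw y01.
apply: (@slope_bound _ g x0 (x1 + 1) (-1) 2 (g y0) (g y0)) => //.
- by rewrite ltrDl.
- by move: hk; clear; lra.
- move=> r rb; apply: hy0; rewrite /rect /= !in_itv /= lexx; split => //.
- move=> s r sb rb _; have [j hj] := int_shift r 0; rewrite add0r in hj.
  exists (r + j%:~R); first by move: hj; clear; lra.
  by rewrite /g /= pw.
- move=> s r p /andP[sb _] rb _ hj.
  by apply: (jw (r, s)) => //; apply: qjet_swap.
Qed.

Lemma space_growth w K x0 x1 t1 : 0 <= K -> periodic1 w -> (forall z, usc w z) ->
  (forall z p, qjet w z 0 p -> `|p| <= K) ->
  exists t0, w (t1, x1) <= w (t0, x0) + K * `|x1 - x0|.
Proof.
move=> K0 pw uw jw; have [x01|x01] := leP x0 x1.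
  rewrite ger0_norm ?subr_ge0//; apply: space_growth_right => //.
  by move=> z p _ /jw; exact: le_trans (ler_norm _).
pose g y := w (y.1, - y.2).
have [| | | |t0] := @space_growth_right g K (- x0) (- x1) t1 K0.
- by rewrite lerN2 ltW.
- by move=> k t x; rewrite /g /= pw.
- by move=> z; apply: usc_reflect; exact: uw.
- move=> z p _ hj; have := jw (z.1, - z.2) (- p); rewrite normrN.
  move=> h; apply: le_trans (ler_norm _) (h _).
  by apply: qjet_reflect; rewrite /= opprK -surjective_pairing.
rewrite /g /= !opprK => h; exists t0; rewrite ler0_norm ?subr_le0 ?(ltW x01)//.
by move: h; clear; lra.
Qed.

(** The space estimate leads from z to the abscissa of z', but at an uncontrolled time t0;
    periodicity brings t0 within one period after t', and the bound on time slopes covers what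
    remains. *)
Lemma periodic_osc H l C K w : 0 <= K -> 0 <= C -> periodic2 w ->
  (forall z, usc w z) -> (forall t x p : R, - C <= H t x p) ->
  (forall t x p, H t x p <= l -> `|p| <= K) -> 0 <= l -> qsub setT H l w ->
  forall z z', w z <= w z' + (l + C + K).
Proof.
move=> K0 C0 pw uw hC hK l0 sw [t x] [t' x'].
have [j hj] := int_shift x x'.
have -> : w (t, x) = w (t, x + j%:~R) by rewrite -(pw 0 j (t, x)) /= addr0.
have [|t0 h0] := @space_growth w K x' (x + j%:~R) t K0 (periodic2W pw) uw.
  by move=> z p hp; apply: (hK z.1 z.2); have := sw z 0 p I hp; rewrite add0r.
have [k hk] := int_shift t0 t'.
have := @time_growth w t' (t' + 2) (t0 + k%:~R) x' 1 (l + C).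
rewrite (periodic2W pw) => h1.
have {}h1 : w (t0, x') <= w (t', x') + (l + C) * (t0 + k%:~R - t').
  apply: h1 => //; try by move: hk l0 C0; clear; lra.
  move=> s x2 a p _ _ hj'; have := sw _ _ _ I hj'; have := hC s x2 p; rewrite /=.
  by clear; lra.
have h2 : (l + C) * (t0 + k%:~R - t') <= (l + C) * 1.
  by apply: ler_wpM2l; [rewrite addr_ge0|move: hk; clear; lra].
have h3 : K * `|x + j%:~R - x'| <= K * 1.
  by apply: ler_wpM2l => //; rewrite ler_norml; move: hj; clear; lra.
by move: h0 h1 h2 h3; clear; lra.
Qed.

Lemma ham_osc H l : hamiltonian H -> 0 <= l -> exists2 C0, 0 <= C0 & forall w,
  periodic2 w -> (forall z, usc w z) -> qsub setT H l w -> forall z z', w z <= w z' + C0.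
Proof.
move=> hH l0; have [C C0 hC] := ham_lb hH; have [K hK] := ham_co hH (l + 1).
exists (l + C + `|K|); first by rewrite !addr_ge0.
move=> w pw uw sw; apply: (@periodic_osc H l C `|K|) => //.
move=> t x p hp; rewrite leNgt; apply/negP => Kp.
have := hK p (le_trans (ler_norm K) (ltW Kp)) t x; move: hp; clear; lra.
Qed.

End PeriodicSubsolutions.

(** * The discounted cell problem *)

Section CellProblem.
Context {R : realType}.
Implicit Types (z : R * R) (w v : R * R -> R) (H : R -> R -> R -> R).

Lemma near_shift z h (P : R * R -> Prop) :
  (\forall y \near z, P (y + h)) <-> (\forall y \near (z + h), P y).
Proof.
split=> /nbhs_boxP[d d0 hd]; apply/nbhs_boxP; exists d => // y y1 y2.
  rewrite -[y](subrK h); apply: hd => /=.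
    by move: y1 => /=; rewrite opprD addrA addrAC.
  by move: y2 => /=; rewrite opprD addrA addrAC.
by apply: hd => /=; rewrite opprD addrACA subrr addr0.
Qed.

Lemma env_shift w z h : env (fun y => w (y + h)) z = env w (z + h).
Proof.
congr inf; apply/seteqP; split => s /= /near_globally hs; apply/near_globally.
  exact/(near_shift z h (fun y => w y <= s)).
exact/(near_shift z h (fun y => w y <= s)).
Qed.

Lemma qjet_shift w z h a p : qjet (fun y => w (y + h)) z a p -> qjet w (z + h) a p.
Proof.
move=> [C hC]; exists C.
apply/(near_shift z h (fun y => w y <= w (z + h) + lin (z + h) a p y + C * sqd (z + h) y)).
apply: filterS hC => y; rewrite /lin /sqd /=.
have -> : y.1 + h.1 - (z.1 + h.1) = y.1 - z.1 by ring.
by have -> : y.2 + h.2 - (z.2 + h.2) = y.2 - z.2 by ring.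
Qed.

Definition shift_invariant H (h : R * R) := forall z q, H (z.1 + h.1) (z.2 + h.2) q = H z.1 z.2 q.

(** The discount makes the equation strictly increasing in the unknown, so a positive maximum of W1
    + W2 contradicts the two equations at the doubled maximum. The second point ranges over a box
    larger than the cell; translating both points by the same integers then makes the maximum over
    [P] a local one. *)
Lemma torus_comparison H (dl Lam : R) (W1 W2 : R * R -> R) : hamiltonian H -> 0 < dl ->
  periodic2 W1 -> periodic2 W2 -> (forall z, usc W1 z) -> (forall z, usc W2 z) ->
  (forall z, - dl * W1 z <= Lam) ->
  (forall z a q, qjet W1 z a q -> a + H z.1 z.2 q <= - dl * W1 z) ->
  (forall z a q, qjet W2 z a q -> a + hneg H z.1 z.2 q <= - dl * W2 z) ->
  forall z, W1 z + W2 z <= 0.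
Proof.
move=> hH dl0 p1 p2 u1 u2 hL s1 s2.
have ps : periodic2 (fun z => W1 z + W2 z) by move=> k j z; rewrite p1 p2.
have [zd0 hzd0] := periodic_max ps (fun z => uscD (u1 z) (u2 z)).
have [k hk] := int_shift zd0.1 0; have [j hj] := int_shift zd0.2 0.
rewrite !add0r in hk hj.
pose zd := (zd0.1 + k%:~R, zd0.2 + j%:~R).
have hzd y : W1 y + W2 y <= W1 zd + W2 zd by rewrite p1 p2; exact: hzd0.
set M0 := W1 zd + W2 zd in hzd.
suff M00 : M0 <= 0 by move=> z; exact: le_trans (hzd z) M00.
rewrite leNgt; apply/negP => M00.
pose e := Num.min (dl * M0 / 2) (1 / 4).
have e0 : 0 < e by rewrite lt_min !divr_gt0 ?mulr_gt0.
have e1 : e <= dl * M0 / 2 by rewrite ge_min lexx.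
have e2 : e <= 1 / 4 by rewrite ge_min lexx orbT.
clearbody e.
pose P : set ((R * R) * (R * R)) := rect 0 1 0 1 `*` rect (-1) 2 (-1) 2.
have cP : compact P by apply: compact_setX; exact: compact_rect.
have PE (w : (R * R) * (R * R)) : P w <-> [/\ 0 <= w.1.1 <= 1, 0 <= w.1.2 <= 1, -1 <= w.2.1 <= 2
   & -1 <= w.2.2 <= 2].
  rewrite /P /rect /= !in_itv /=; split; first by case=> -[? ?] [? ?].
  by case.
have Pd : P (zd, zd) by apply/PE => /=; split => //; move: hk hj; clear; lra.
have [th [th' [w [[/andP[th'0 th'th] th1] Pw hw pw hl]]]] := @doubling R H W1 W2 P e Lam M0 1
  zd hH e0 cP ltr01 (fun x _ => u1 x.1) (fun x _ => u2 x.2) (fun z _ => hzd z) Pd (lexx M0).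
have th0 : 0 < th by exact: lt_le_trans th'th.
have hwM : M0 <= W1 w.1 + W2 w.2.
  apply: le_trans (_ : doubled W1 W2 th th' w <= _).
    apply: le_trans (hw _ Pd).
    by rewrite /doubled /pen /= !subrr expr0n /= !mul0r addr0 subr0.
  by rewrite /doubled gerBl pen_ge0// ltW.
have sq_le (x t : R) : 0 < t -> t <= 1 -> x ^+ 2 / t <= 1 / 4 -> `|x| <= 1 / 2.
  move=> t0 t1; rewrite ler_pdivrMr// => h.
  rewrite -ler_sqr ?nnegrE// ?divr_ge0// real_normK ?num_real//.
  by move: h t1; clear; nra.
have [/sq_le h1 /sq_le h2] : (w.1.1 - w.2.1) ^+ 2 / th <= 1 / 4 /\
    (w.1.2 - w.2.2) ^+ 2 / th' <= 1 / 4.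
  have q1 : 0 <= (w.1.1 - w.2.1) ^+ 2 / th by rewrite divr_ge0 ?sqr_ge0// ltW.
  have q2 : 0 <= (w.1.2 - w.2.2) ^+ 2 / th' by rewrite divr_ge0 ?sqr_ge0// ltW.
  by move: pw e2; rewrite /pen; move: q1 q2; clear; lra.
have {}h1 := h1 th0 th1; have {}h2 := h2 th'0 (le_trans th'th th1).
have [j1 j2] : qjet W1 w.1 (2 * (w.1.1 - w.2.1) / th) (2 * (w.1.2 - w.2.2) / th') /\
  qjet W2 w.2 (- (2 * (w.1.1 - w.2.1) / th)) (- (2 * (w.1.2 - w.2.2) / th')).
  apply: doubled_qjets.
  have e8 : 0 < 1 / 8 :> R by [].
  exists (cbox w.1 (1 / 8), cbox w.2 (1 / 8)) => /=.
    by split; exact: nbhs_cbox.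
  move=> [y y'] /= [[/ler_normlP[y1 y2] /ler_normlP[y3 y4]] [/ler_normlP[y5 y6] /ler_normlP[y7 y8]]].
  have [k' hk'] := int_shift y.1 0; have [j' hj'] := int_shift y.2 0.
  rewrite !add0r in hk' hj'.
  have := hw ((y.1 + k'%:~R, y.2 + j'%:~R), (y'.1 + k'%:~R, y'.2 + j'%:~R)).
  rewrite {1}/doubled /= p1 p2 /pen /=.
  have -> : y.1 + k'%:~R - (y'.1 + k'%:~R) = y.1 - y'.1 by ring.
  have -> : y.2 + j'%:~R - (y'.2 + j'%:~R) = y.2 - y'.2 by ring.
  apply; apply/PE => /=; split => //.
    by move: h1 hk' y1 y2 y5 y6 => /ler_normlP[]; clear; lra.
  by move: h2 hj' y3 y4 y7 y8 => /ler_normlP[]; clear; lra.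
have {}hl := hl _ (hL w.1) (s1 _ _ _ j1).
have := s2 _ _ _ j2; rewrite /hneg opprK.
have : dl * M0 <= dl * (W1 w.1 + W2 w.2) by rewrite ler_pM2l.
have : 0 < dl * M0 by rewrite mulr_gt0.
by move: hl e1; clear; lra.
Qed.

Lemma env_cst (c : R) z : env (fun=> c) z = c.
Proof.
have b : bdat (fun=> c) z by exists 1, `|c|.
by rewrite env_usc//; apply: continuous_usc; exact: cvg_cst.
Qed.

Lemma qjet_cst (c : R) z a p : qjet (fun=> c) z a p -> a = 0 /\ p = 0.
Proof.
move=> [C hC]; have [] := @lin_flat R z (- a) (- p) C; last first.
  by move=> /eqP + /eqP; rewrite !oppr_eq0 => /eqP -> /eqP ->.
by apply: filterS hC => y; rewrite /lin; lra.
Qed.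

Lemma jointly_continuous_ham H (dl l : R) Om : ucont H -> 0 <= dl ->
  jointly_continuous Om (fun z r q => dl * r + H z.1 z.2 q - l).
Proof.
move=> hH dl0 z r p _ e e0; have e2 : 0 < e / 2 by lra.
have [d d0 hd] := hH `|p| _ e2.
have dl1 : 0 < dl + 1 by rewrite ltr_wpDl.
exists (Num.min d (e / 2 / (dl + 1))); first by rewrite lt_min d0 divr_gt0.
move=> z' r' p' zz rr pp.
have m1 : Num.min d (e / 2 / (dl + 1)) <= d by rewrite ge_min lexx.
have [z1 z2] := cbox_sub m1 zz.
have := hd z.1 z'.1 z.2 z'.2 p p' (lexx _).
rewrite distrC [`|z.2 - _|]distrC [`|p - _|]distrC => /(_ z1 z2 (le_trans pp m1)) hH'.
have hr : dl * `|r' - r| <= e / 2.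
  have : `|r' - r| <= e / 2 / (dl + 1) by apply: le_trans rr _; rewrite ge_min lexx orbT.
  by rewrite ler_pdivlMr//; have := normr_ge0 (r' - r); clear; lra.
have -> : dl * r' + H z'.1 z'.2 p' - l - (dl * r + H z.1 z.2 p - l) =
  dl * (r' - r) - (H z.1 z.2 p - H z'.1 z'.2 p') by ring.
apply: le_trans (ler_normB _ _) _; rewrite normrM (ger0_norm dl0).
by move: hr hH'; clear; lra.
Qed.

(** The translate of v by a symmetry of the equation and of the barriers is a competitor, hence lies
    below the maximal subsolution v. *)
Lemma perron_shift G (f g v : R * R -> R) h :
  (forall z, f z <= v z <= g z) -> subsol setT G (env v) ->
  (forall w, (forall z, f z <= w z <= g z) -> subsol setT G (env w) -> forall z, w z <= v z) ->
  (forall z, f (z + h) = f z) -> (forall z, g (z + h) = g z) ->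
  (forall z r q, G (z + h) r q = G z r q) -> forall z, v (z + h) <= v z.
Proof.
move=> vb vsub vmax fh gh Gh z; apply: (vmax (fun y => v (y + h))) => [y|].
  by rewrite -(fh y) -(gh y); exact: vb.
have -> : env (fun y => v (y + h)) = (fun y => env v (y + h)).
  by apply/funext => y; rewrite env_shift.
by move=> y a p _ /qjet_shift hj; have := vsub _ _ _ I hj; rewrite Gh.
Qed.

(** Perron's method between the constants - M / dl and M / dl; comparison of the two envelopes makes
    the solution continuous. Invariance is stated for every symmetry of [H]: the integer periods
    and, for an autonomous [H], all time translations, from which (B-i) profits. *)
Lemma discounted H (dl M : R) : hamiltonian H -> Z2_periodic H -> 0 < dl ->
  (forall t x, `|H t x 0| <= M) ->
  exists v, [/\ forall h, shift_invariant H h -> forall z, v (z + h) = v z,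
    (forall z, usc v z) /\ (forall z, usc (fun y => - v y) z),
    forall z, `|dl * v z| <= M,
    forall z a q, qjet v z a q -> a + H z.1 z.2 q <= - dl * v z &
    forall z a q, qjet (fun y => - v y) z a q -> a + hneg H z.1 z.2 q <= dl * v z].
Proof.
move=> hH pH dl0 hM.
have M0 : 0 <= M by exact: le_trans (hM 0 0).
have Md : dl * (M / dl) = M by rewrite mulrC divfK// gt_eqF.
pose G (z : R * R) (r q : R) := dl * r + H z.1 z.2 q - 0.
have D : barriers setT G (fun=> - (M / dl)) (fun=> M / dl).
  split => //.
  - exact: openT.
  - by apply: jointly_continuous_ham; [exact: ham_ucont|exact: ltW].
  - by move=> z; exists 1, `|- (M / dl)|.
  - by move=> z; exists 1, `|M / dl|.
  - by move=> _; have := divr_ge0 M0 (ltW dl0); clear; lra.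
  - move=> z a p _; have -> : env (fun=> - (M / dl)) = (fun=> - (M / dl)).
      by apply/funext => y; rewrite env_cst.
    move=> /qjet_cst[-> ->]; rewrite /G mulrN Md.
    by have /ler_normlP[] := hM z.1 z.2; clear; lra.
  - move=> z a p _; have -> : env (fun=> - (M / dl)) = (fun=> - (M / dl)).
      by apply/funext => y; rewrite env_cst.
    move=> /qjet_cst[-> ->]; rewrite /G opprK oppr0 Md.
    by have /ler_normlP[] := hM z.1 z.2; clear; lra.
have [v [vb vsub vsup vmax]] := perron D.
have vb' z : `|v z| <= M / dl by rewrite ler_norml.
have bv z : bdat v z by exists 1, (M / dl).
have bvN z : bdat (fun y => - v y) z by apply: bdatN.
have inv_le h z : shift_invariant H h -> v (z + h) <= v z.
  move=> ih; apply: (perron_shift vb vsub vmax) => // y r q.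
  by rewrite /G /= ih.
have inv h : shift_invariant H h -> forall z, v (z + h) = v z.
  move=> ih z; apply/le_anti; rewrite inv_le//= -{1}[z](addrK h) inv_le//.
  by move=> y q /=; rewrite -(ih (y.1 - h.1, y.2 - h.2) q) /= !subrK.
have ipH (k j : int) : shift_invariant H (k%:~R, j%:~R) by move=> z q /=; exact: pH.
have pU : periodic2 (env v).
  move=> k j z; have := env_shift v z (k%:~R, j%:~R).
  by rewrite (_ : (fun y => v (y + _)) = v)//; apply/funext => y; exact: inv.
have pV : periodic2 (env (fun y => - v y)).
  move=> k j z; have := env_shift (fun y => - v y) z (k%:~R, j%:~R).
  by rewrite (_ : (fun y => - v (y + _)) = fun y => - v y)//; apply/funext => y; rewrite inv.
have cmp : forall z, env v z + env (fun y => - v y) z <= 0.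
  apply: (@torus_comparison H dl M) => //.
  - by move=> z; exact: usc_envelope.
  - by move=> z; exact: usc_envelope.
  - move=> z; have h : - (M / dl) <= env v z.
      by apply: le_trans (env_ge (bv z)); case/andP: (vb z).
    have : dl * - (M / dl) <= dl * env v z by rewrite ler_pM2l.
    by rewrite mulrN Md mulNr lerNl.
  - by move=> z a q /(vsub _ _ _ I); rewrite /G; clear; lra.
  - by move=> z a q /(vsup _ _ _ I); rewrite /G /hneg; clear; lra.
have eU z : env v z = v z.
  apply/le_anti; rewrite env_ge// andbT.
  by have := cmp z; have := env_ge (bvN z); clear; lra.
have eV z : env (fun y => - v y) z = - v z.
  apply/le_anti; rewrite env_ge// andbT.
  by have := cmp z; have := env_ge (bv z); clear; lra.
have eU' : env v = v by apply/funext.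
have eV' : env (fun y => - v y) = (fun y => - v y) by apply/funext.
exists v; split => //.
- by split => z; [rewrite -eU'|rewrite -eV']; exact: usc_envelope.
- by move=> z; rewrite normrM (gtr0_norm dl0) -Md ler_pM2l.
- by move=> z a q; rewrite -{1}eU' => /(vsub _ _ _ I); rewrite /G eU; clear; lra.
- move=> z a q; rewrite -{1}eV' => /(vsup _ _ _ I); rewrite /G eV /hneg opprK.
  by clear; lra.
Qed.

End CellProblem.

(** * Regular subsolutions and homogenization away from the junction *)

Section Regularization.
Context {R : realType}.
Implicit Types (z : R * R) (w v : R * R -> R) (H : R -> R -> R -> R).

Lemma periodic_uniform w (e : R) : periodic2 w -> (forall z, usc w z) ->
  (forall z, usc (fun y => - w y) z) -> 0 < e ->
  exists2 d, 0 < d & forall z h, cbox 0 d h -> `|w (z + h) - w z| <= e.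
Proof.
move=> pw uw uw' e0; have e2 : 0 < e / 2 by lra.
have near0 : \forall h \near (0 : R * R), forall z, rect 0 1 0 1 z -> `|w (z + h) - w z| <= e.
  have cov := (@compact_near_coveringP _ _).1 (@compact_rect R 0 1 0 1) (R * R)%type
    (nbhs (0 : R * R)) (fun h z => `|w (z + h) - w z| <= e) _.
  apply: cov => z _.
  have /nbhs_boxP[d1 d10 h1] := uw z _ e2.
  have /nbhs_boxP[d2 d20 h2] := uw' z _ e2.
  pose d := Num.min d1 d2 / 2.
  have d0 : 0 < d by rewrite divr_gt0// lt_min d10.
  have dd1 : d + d <= d1.
    have : Num.min d1 d2 <= d1 by rewrite ge_min lexx.
    by rewrite /d; clear; lra.
  have dd2 : d + d <= d2.
    have : Num.min d1 d2 <= d2 by rewrite ge_min lexx orbT.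
    by rewrite /d; clear; lra.
  clearbody d.
  exists (cbox z d, cbox 0 d); first by split; exact: nbhs_cbox.
  move=> [z' h] /= [hz hh].
  have dr : 0 + d <= d by rewrite add0r.
  have zh : cbox z' d (z' + h).
    by case: hh => /=; rewrite !subr0 => a b; split => /=; rewrite addrAC subrr add0r.
  have [a1 a2] := cbox_trans dd1 hz zh; have [b1 b2] := cbox_trans dd2 hz zh.
  have dle1 : d <= d1 by lra.
  have dle2 : d <= d2 by lra.
  have [a3 a4] := cbox_sub dle1 hz; have [b3 b4] := cbox_sub dle2 hz.
  move: (h1 _ a1 a2) (h1 _ a3 a4) (h2 _ b1 b2) (h2 _ b3 b4).
  by clear; move=> *; apply/ler_normlP; split; lra.
have /nbhs_boxP[d d0 hd] := near0.
exists d => // z h [h1 h2].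
have [k hk] := int_shift z.1 0; have [j hj] := int_shift z.2 0; rewrite !add0r in hk hj.
have := hd h h1 h2 (z.1 + k%:~R, z.2 + j%:~R).
have -> : w (z.1 + k%:~R, z.2 + j%:~R) = w z by exact: pw.
have -> : (z.1 + k%:~R, z.2 + j%:~R) + h = ((z + h).1 + k%:~R, (z + h).2 + j%:~R).
  by congr pair => /=; rewrite addrAC.
by rewrite pw; apply; rewrite /rect /= !in_itv /= hk hj.
Qed.

(** Sup-convolution with separate scales in time and space, as (A2) demands, and with shifts
    confined to the unit box, which bounds the space slopes by 2 / th'. *)
Definition sup_conv (th th' : R) w z : R :=
  sup [set w (z + h) - pen th th' (h, 0) | h in cbox 0 1].

Lemma continuous_shift z : continuous (fun h : R * R => z + h).
Proof. by move=> h; apply: cvgD; [exact: cvg_cst|exact: cvg_id]. Qed.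

Lemma continuous_pen0 (th th' : R) : continuous (fun h : R * R => pen th th' (h, 0)).
Proof.
move=> h; rewrite /pen /=; apply: cvgD; apply: cvgM; try exact: cvg_cst.
  apply: (@continuous_at_sqr _ _ (fun h : R * R => h.1 - 0)).
  by apply: cvgB; [exact: continuous_coord1|exact: cvg_cst].
apply: (@continuous_at_sqr _ _ (fun h : R * R => h.2 - 0)).
by apply: cvgB; [exact: continuous_coord2|exact: cvg_cst].
Qed.

Section SupConv.
Variables (th th' : R).

Lemma sup_conv_max w z : (forall z, usc w z) -> exists2 h, cbox 0 1 h &
  sup_conv th th' w z = w (z + h) - pen th th' (h, 0) /\
  forall h', cbox 0 1 h' -> w (z + h') - pen th th' (h', 0) <= w (z + h) - pen th th' (h, 0).
Proof.
move=> uw.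
have [h hb hh] := @usc_compact_max _ _ (cbox 0 1) (fun h => w (z + h) + - pen th th' (h, 0))
  (@compact_cbox R 0 1) (ex_intro _ 0 (cbox_center 0 ler01))
  (fun h _ => uscD (usc_comp (@continuous_shift z h) (uw (z + h)))
    (continuous_usc (cvgN (@continuous_pen0 th th' h)))).
exists h => //; split => //; apply/le_anti/andP; split.
  apply: ge_sup; first by exists (w (z + h) - pen th th' (h, 0)), h.
  by move=> _ [y yb <-]; exact: hh.
apply: ub_le_sup; last by exists h.
by exists (w (z + h) - pen th th' (h, 0)) => _ [y yb <-]; exact: hh.
Qed.

Lemma sup_conv_ge w z h : (forall z, usc w z) -> cbox 0 1 h ->
  w (z + h) - pen th th' (h, 0) <= sup_conv th th' w z.
Proof.
by move=> uw hb; have [h' _ [-> hh]] := sup_conv_max z uw; exact: hh.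
Qed.

End SupConv.

(** A maximizing shift h is small because |w| <= M, and then the penalty it pays is at most the
    oscillation of [w] over that distance, which uniform continuity makes smaller than ka. Keeping
    the point z + h fixed while moving z gives the paraboloid from below, with the slopes of the jet
    of [w] at z + h. *)
Lemma sup_conv_regular w (M ka : R) : periodic2 w -> (forall z, usc w z) ->
  (forall z, usc (fun y => - w y) z) -> (forall z, `|w z| <= M) -> 0 < ka ->
  exists2 th1, 0 < th1 & forall th th', 0 < th <= th1 -> 0 < th' <= th1 ->
  [/\ forall z, usc (sup_conv th th' w) z,
      forall z, w z <= sup_conv th th' w z <= w z + ka &
      forall z, exists h, [/\ pen th th' (h, 0) <= ka,
        qjet w (z + h) (2 * h.1 / th) (2 * h.2 / th'), `|h.2| <= 1 &
        exists C, \forall y \near z,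
          sup_conv th th' w z + lin z (2 * h.1 / th) (2 * h.2 / th') y - C * sqd z y
          <= sup_conv th th' w y]].
Proof.
move=> pw uw uw' wM ka0.
have [d0 d00 hd0] := periodic_uniform pw uw uw' ka0.
pose d := Num.min d0 (1 / 2).
have d_gt0 : 0 < d by rewrite lt_min d00 divr_gt0.
have dd0 : d <= d0 by rewrite ge_min lexx.
have d12 : d <= 1 / 2 by rewrite ge_min lexx orbT.
clearbody d.
have M0 : 0 <= M by exact: le_trans (wM 0).
have M1 : 0 < 2 * M + 1 by lra.
exists (d ^+ 2 / (2 * M + 1)); first by rewrite divr_gt0// exprn_gt0.
move=> th th' /andP[th0 th1] /andP[th'0 th'1].
have pen00 : pen th th' (0, 0) = 0 by rewrite /pen /= !subrr expr0n /= !mul0r addr0.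
have small z h : cbox 0 1 h ->
   (forall h', cbox 0 1 h' -> w (z + h') - pen th th' (h', 0) <= w (z + h) - pen th th' (h, 0)) ->
   cbox 0 d h /\ pen th th' (h, 0) <= ka.
  move=> hb /(_ 0 (cbox_center _ ler01)); rewrite addr0 pen00 subr0 => hp.
  have hp1 : pen th th' (h, 0) <= 2 * M.
    by move: hp (wM z) (wM (z + h)) => + /ler_normlP[? ?] /ler_normlP[? ?]; lra.
  have sq_d (x t : R) : 0 < t -> t <= d ^+ 2 / (2 * M + 1) -> x ^+ 2 / t <= 2 * M -> `|x| <= d.
    move=> t0; rewrite ler_pdivlMr// => ht; rewrite ler_pdivrMr// => hx.
    rewrite -ler_sqr ?nnegrE// ?(ltW d_gt0)// real_normK ?num_real//.
    by move: ht hx t0; clear; nra.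
  have q1 : 0 <= (h.1 - 0) ^+ 2 / th by rewrite divr_ge0 ?sqr_ge0// ltW.
  have q2 : 0 <= (h.2 - 0) ^+ 2 / th' by rewrite divr_ge0 ?sqr_ge0// ltW.
  have hd : cbox 0 d h.
    split => /=; [apply: (sq_d _ th)|apply: (sq_d _ th')] => //;
      by move: hp1 q1 q2; rewrite /pen /=; clear; lra.
  split => //; have /ler_normlP[_ h1] := hd0 z h (cbox_sub dd0 hd).
  by move: hp h1; clear; lra.
split.
- move=> z e e0; have e2 : 0 < e / 2 by lra.
  have [d1 d10 hd1] := periodic_uniform pw uw uw' e2.
  apply: filterS (nbhs_cbox z d10) => y [y1 y2].
  have [h hb [-> _]] := sup_conv_max th th' y uw.
  have := sup_conv_ge th th' z uw hb.
  have /ler_normlP[_] : `|w (z + h + (y - z)) - w (z + h)| <= e / 2.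
    by apply: hd1; split => /=; rewrite subr0.
  rewrite (_ : z + h + (y - z) = y + h); first by lra.
  by rewrite addrC addrA subrK.
- move=> z; have [h hb [he hh]] := sup_conv_max th th' z uw.
  apply/andP; split.
    by have := sup_conv_ge th th' z uw (cbox_center 0 ler01); rewrite addr0 pen00 subr0.
  have [hd _] := small z h hb hh; rewrite he.
  have /ler_normlP[_ h1] := hd0 z h (cbox_sub dd0 hd).
  by have := pen_ge0 (h, 0) (ltW th0) (ltW th'0); move: h1; clear; lra.
move=> z; have [h hb [he hh]] := sup_conv_max th th' z uw.
have [hd hp] := small z h hb hh.
have near1 (s : R * R) : cbox 0 (1 / 2) s -> cbox 0 1 (h + s).
  move=> [s1 s2]; case: hd => h1 h2; rewrite /= !subr0 in s1 s2 h1 h2.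
  split => /=; rewrite subr0; apply: le_trans (ler_normD _ _) _; lra.
have half0 : 0 < 1 / 2 :> R by [].
exists h; split => //; last first.
- exists (th^-1 + th'^-1); apply: filterS (nbhs_cbox z half0) => y [y1 y2].
  have hs : cbox 0 1 (h + (z - y)).
    by apply: near1; split => /=; rewrite subr0 distrC.
  have := sup_conv_ge th th' y uw hs.
  have -> : y + (h + (z - y)) = z + h by rewrite addrCA [y + _]addrC subrK addrC.
  rewrite he /pen /lin /sqd /= !subr0.
  have th_i : 0 <= th^-1 by rewrite invr_ge0 ltW.
  have th'_i : 0 <= th'^-1 by rewrite invr_ge0 ltW.
  have := mulr_ge0 th_i (sqr_ge0 (y.2 - z.2)).
  have := mulr_ge0 th'_i (sqr_ge0 (y.1 - z.1)).
  by move: (th^-1) (th'^-1) => k1 k2; clear; lra.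
- by case: hb => _; rewrite /= subr0.
exists (th^-1 + th'^-1); apply: filterS (nbhs_cbox (z + h) half0) => y [y1 y2].
have hs : cbox 0 1 (h + (y - (z + h))).
  by apply: near1; split => /=; rewrite subr0.
have := hh _ hs.
have -> : z + (h + (y - (z + h))) = y by rewrite addrA addrC subrK.
rewrite /pen /lin /sqd /= !subr0.
have th_i : 0 <= th^-1 by rewrite invr_ge0 ltW.
have th'_i : 0 <= th'^-1 by rewrite invr_ge0 ltW.
have := mulr_ge0 th_i (sqr_ge0 (y.2 - (z.2 + h.2))).
have := mulr_ge0 th'_i (sqr_ge0 (y.1 - (z.1 + h.1))).
by move: (th^-1) (th'^-1) => k1 k2; clear; lra.
Qed.

Definition doubling_ok H := forall l e : R, 0 < e -> exists2 ka, 0 < ka & forall th, 0 < th <= 1 ->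
  exists2 th0, 0 < th0 & forall th' z h q, 0 < th' <= th0 -> pen th th' (h, 0) <= ka ->
    2 * h.1 / th + H (z.1 + h.1) (z.2 + h.2) q <= l -> 2 * h.1 / th + H z.1 z.2 q <= l + e.

Lemma ham_doubling_ok H : hamiltonian H -> doubling_ok H.
Proof.
move=> hH l e e0; have [ka ka0 hka] := doubling_error l hH e0.
exists ka => // th hth; have [th0 th00 hth0] := hka th hth.
exists th0 => // th' z h q h1 h2 h3.
have := hth0 th' (z.1 + h.1) z.1 (z.2 + h.2) z.2 q l h1 (lexx _).
rewrite [z.1 + h.1 - z.1]addrC addKr [z.2 + h.2 - z.2]addrC addKr; apply => //.
by move: h2; rewrite /pen /= !subr0.
Qed.

(** The estimate on [H] transfers an upper bound. For the opposite Hamiltonian it is applied in the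
    other direction, from z to z + h, to the negation of the conclusion. *)
Lemma hneg_doubling_ok H : hamiltonian H -> doubling_ok (hneg H).
Proof.
move=> hH l e e0; have e2 : 0 < e / 2 by lra.
have [ka ka0 hka] := doubling_error (- l - e) hH e2.
exists ka => // th hth; have [th0 th00 hth0] := hka th hth.
exists th0 => // th' z h q h1 h2 h3; rewrite leNgt; apply/negP => h4.
have := hth0 th' z.1 (z.1 + h.1) z.2 (z.2 + h.2) (- q) (- l - e) h1 (lexx _).
rewrite !opprD !addrA !subrr !sub0r !sqrrN mulrN mulNr.
have -> : h.1 ^+ 2 / th + h.2 ^+ 2 / th' <= ka by move: h2; rewrite /pen /= !subr0.
by move=> /(_ isT); move: h3 h4 e0; rewrite /hneg; clear; lra.
Qed.

(* A subsolution touched from below by a paraboloid at every point: it can be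
   used as a test function. *)
Definition regular_sub H (l : R) w := [/\ forall z, usc w z,
  exists M, forall z, `|w z| <= M &
  exists K, forall z, exists b q C, [/\ `|q| <= K,
    (\forall y \near z, w z + lin z b q y - C * sqd z y <= w y) &
    b + H z.1 z.2 q <= l]].

(** The slopes below the sup-convolution at z are those of a jet of [w] at z + h, and [doubling_ok]
    brings the equation back to z at the cost e. Independence of time passes to the sup-convolution
    because translations commute with it. *)
Lemma regular_subsolution H (l e : R) w : doubling_ok H -> periodic2 w ->
  (forall z, usc w z) -> (forall z, usc (fun y => - w y) z) ->
  (forall z a q, qjet w z a q -> a + H z.1 z.2 q <= l) -> 0 < e ->
  exists w', [/\ regular_sub H (l + e) w', periodic2 w' &
    (forall s z, w (z.1 + s, z.2) = w z) -> forall s z, w' (z.1 + s, z.2) = w' z].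
Proof.
move=> hH pw uw uw' sw e0.
have [M hM] : exists M, forall z, `|w z| <= M.
  have [z1 h1] := periodic_max pw uw.
  have pw' : periodic2 (fun y => - w y) by move=> k j z; rewrite pw.
  have [z2 h2] := periodic_max pw' uw'.
  exists (`|w z1| + `|w z2|) => z; apply/ler_normlP.
  have := h1 z; have := h2 z; have := ler_norm (w z1); have := ler_norm (- w z2).
  have := normr_ge0 (w z1); have := normr_ge0 (w z2).
  by rewrite normrN; clear; split; lra.
have [ka ka0 hka] := hH l e e0.
have [th1 th10 hreg] := sup_conv_regular pw uw uw' hM ka0.
pose th := Num.min 1 th1.
have th0 : 0 < th by rewrite lt_min ltr01.
have thb : 0 < th <= 1 by rewrite th0 ge_min lexx.
have thb1 : 0 < th <= th1 by rewrite th0 ge_min lexx orbT.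
have [th0' th0'0 hth] := hka th thb.
pose th' := Num.min th0' th1.
have th'0 : 0 < th' by rewrite lt_min th0'0.
have thb' : 0 < th' <= th0' by rewrite th'0 ge_min lexx.
have thb1' : 0 < th' <= th1 by rewrite th'0 ge_min lexx orbT.
have [r1 r2 r3] := hreg th th' thb1 thb1'.
have inv (s : R * R) : (forall z, w (z + s) = w z) -> forall z, sup_conv th th' w (z + s) = sup_conv th th' w z.
  move=> hs z; congr sup; apply/seteqP; split => _ [h hb <-]; exists h => //.
    by rewrite addrAC hs.
  by rewrite addrAC hs.
exists (sup_conv th th' w); split.
- split => //.
    exists (M + ka) => z; have /andP[h1 h2] := r2 z; have /ler_normlP[h3 h4] := hM z.
    by apply/ler_normlP; move: h1 h2 h3 h4 ka0; clear; split; lra.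
  exists (2 / th') => z; have [h [hp hj h1 [C hC]]] := r3 z.
  exists (2 * h.1 / th), (2 * h.2 / th'), C; split => //.
    rewrite !normrM normfV (gtr0_norm th'0) (@ger0_norm _ (2 : R) (ler0n _ _)) ler_pM2r ?invr_gt0//.
    by move: h1; clear; lra.
  by apply: (hth th') => //; exact: sw hj.
- move=> k j z; apply: (inv (k%:~R, j%:~R)) => y; exact: pw.
- move=> hs s z; have := inv (s, 0) _ z.
  rewrite (_ : z + (s, 0) = (z.1 + s, z.2)); last by congr pair; rewrite /= addr0.
  by apply => y; rewrite -[RHS](hs s y); congr (w (_, _)); rewrite /= addr0.
Qed.

(** At a maximum of [W] + [w] the paraboloid below [w] is, up to sign, a test function above [W].
    Both inequalities are then read at the same point and slopes, with no doubling. *)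
Lemma level_comparison H (l l' : R) (W w : R * R -> R) : periodic2 W -> periodic2 w ->
  (forall z, usc W z) -> qsub setT H l W -> regular_sub (hneg H) l' w -> - l' <= l.
Proof.
move=> pW pw uW sW [uw _ [K hK]].
have ps : periodic2 (fun z => W z + w z) by move=> k j z; rewrite pW pw.
have [z hz] := periodic_max ps (fun z => uscD (uW z) (uw z)).
have [b [q [C [_ hC hE]]]] := hK z.
have hj : qjet W z (- b) (- q).
  exists C; apply: filterS hC => y; have := hz y.
  by rewrite /lin; clear; lra.
have := sW _ _ _ I hj; move: hE; rewrite /hneg; clear; lra.
Qed.

End Regularization.

(** * Vanishing discount and the ergodic constant *)

Section EffectiveHamiltonian.
Context {R : realType}.
Implicit Types (z : R * R) (w v : R * R -> R) (H : R -> R -> R -> R).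

Lemma touching_le {I : Type} (F : set_system I) {FF : ProperFilter F}
    (u : I -> R * R -> R) z (f0 a p B : R) : touching F u z f0 a p ->
  (exists2 r, 0 < r & \forall i \near F, forall y, cbox z r y -> usc (u i) y) ->
  (forall e : R, 0 < e -> exists2 r, 0 < r & \forall i \near F, forall y (a' p' : R),
     cbox z r y -> `|a' - a| <= r -> `|p' - p| <= r -> `|u i y - f0| <= r ->
     qjet (u i) y a' p' -> a' <= B + e) ->
  a <= B.
Proof.
move=> ht us hB; apply/ler_addgt0Pr => e e0; have e2 : 0 < e / 2 by lra.
have [r r0 hr] := hB _ e2.
have re0 : 0 < Num.min r (e / 2) by rewrite lt_min r0.
have [i [z1 [a1 [p1 [Ai zb [ha hp] hf hj]]]]] := touching_qjet ht us re0 hr.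
have m1 : Num.min r (e / 2) <= r by rewrite ge_min lexx.
have m2 : Num.min r (e / 2) <= e / 2 by rewrite ge_min lexx orbT.
have := Ai z1 a1 p1 (cbox_sub m1 zb) (le_trans ha m1) (le_trans hp m1) (le_trans hf m1) hj.
by move: (le_trans ha m2) => /ler_normlP[]; clear; lra.
Qed.

Lemma touching_qsub {I : Type} (F : set_system I) {FF : ProperFilter F}
    (u : I -> R * R -> R) z (f0 a p l r : R) H : ucont H -> touching F u z f0 a p ->
  0 < r -> (\forall i \near F, forall y, cbox z r y -> usc (u i) y) ->
  (forall e : R, 0 < e -> \forall i \near F, qsub (cbox z r) H (l + e) (u i)) ->
  a + H z.1 z.2 p <= l.
Proof.
move=> hH ht r0 us hs; rewrite -lerBrDr.
apply: (touching_le ht); first by exists r.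
move=> e e0; have e2 : 0 < e / 2 by lra.
have [d d0 hd] := hH `|p| _ e2.
exists (Num.min r d); first by rewrite lt_min r0.
have m1 : Num.min r d <= r by rewrite ge_min lexx.
have m2 : Num.min r d <= d by rewrite ge_min lexx orbT.
apply: filterS (hs _ e2) => i hi y a' p' yb ha hp _ hj.
have [y1 y2] := cbox_sub m2 yb.
have := hd z.1 y.1 z.2 y.2 p p' (lexx _).
rewrite distrC [`|z.2 - _|]distrC [`|p - _|]distrC => /(_ y1 y2 (le_trans hp m2)).
move=> /ler_normlP[_ h]; have := hi y a' p' (cbox_sub m1 yb) hj.
by move: h; clear; lra.
Qed.

Lemma regular_sub_le H l l' w : l <= l' -> regular_sub H l w -> regular_sub H l' w.
Proof.
move=> ll [u b [K hK]]; split => //; exists K => z.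
have [b' [q [C [h1 h2 h3]]]] := hK z; exists b', q, C; split => //; exact: le_trans ll.
Qed.

Lemma rsup_bounds {I : Type} (F : set_system I) {FF : ProperFilter F}
    (u : I -> R * R -> R) z (M : R) :
  (\forall i \near F, forall y, `|u i y| <= M) -> locbd F u z /\ `|rsup F u z| <= M.
Proof.
move=> hM.
have lb : locbd F u z.
  by apply: (@locbd_bounded _ _ _ _ _ _ 1 M) => //; apply: filterS hM => i hi y _; exact: hi.
split => //; apply/ler_normlP; split; last first.
  apply: rsup_le => //; exists (setT, [set i | forall y, `|u i y| <= M]).
    by split => //=; exact: filterT.
  by move=> [y i] /= [_ hi]; apply: le_trans (hi y); exact: ler_norm.
apply/ler_addgt0Pr => e e0; rewrite -lerBlDl.
have /filter_ex : \forall i \near F, forall y, `|u i y| <= M by [].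
move=> _; rewrite leNgt; apply/negP => hlt.
have h2 : rsup F u z < - M - e / 2 by lra.
have [i [hi h]] := filter_ex (filterI (nbhs_singleton (rsup_sup lb h2)) hM).
by have /ler_normlP[] := h z; move: hi e0; clear; lra.
Qed.

Definition time_invariant H := forall s t x q, H (t + s) x q = H t x q.

(** The first two items provide test functions at levels close to lam, for the equation and for its
    opposite; the third one continuous approximate correctors, which can be reflected or normalized;
    the last one an exact corrector, possibly discontinuous, as in the definition of [Hbar]. *)
Definition cell_spec H (lam : R) := [/\
  forall e : R, 0 < e -> exists w, [/\ regular_sub H (lam + e) w, periodic2 w &
    time_invariant H -> forall s z, w (z.1 + s, z.2) = w z],
  forall e : R, 0 < e -> exists w, regular_sub (hneg H) (- lam + e) w /\ periodic2 w,
  forall e : R, 0 < e -> exists v, [/\ periodic2 v, forall z, usc v z,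
    forall z, usc (fun y => - v y) z, qsub setT H (lam + e) v &
    qsub setT (hneg H) (- lam + e) (fun y => - v y)] &
  exists v, [/\ periodic2 v, (exists M, forall z, `|v z| <= M),
    qsub setT H lam (env v) & qsub setT (hneg H) (- lam) (env (fun y => - v y))]].

(** Discounted solutions oscillate by at most C0 uniformly in the discount, so they are subsolutions
    and supersolutions of the cell problem at levels within dl C0 of l dl. Normalized at the origin
    they have bounded half-relaxed limits, and Perron's method between these gives an exact
    corrector. *)
Lemma cell_problem H : hamiltonian H -> Z2_periodic H -> exists lam, cell_spec H lam.
Proof.
move=> hH pH.
have [M0 hM0] := ham_bd hH 0.
pose M := `|M0|.
have M_ge0 : 0 <= M by exact: normr_ge0.
have hM t x : `|H t x 0| <= M by apply: le_trans (hM0 t x 0 _) (ler_norm _); rewrite normr0.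
have [C0 C00 hC0] := ham_osc hH M_ge0.
pose props (dl : R) (v : R * R -> R) := [/\ forall h : R * R, shift_invariant H h -> forall z, v (z + h) = v z,
    (forall z, usc v z) /\ (forall z, usc (fun y => - v y) z),
    forall z, `|dl * v z| <= M,
    forall z a q, qjet v z a q -> a + H z.1 z.2 q <= - dl * v z &
    forall z a q, qjet (fun y => - v y) z a q -> a + hneg H z.1 z.2 q <= dl * v z].
have [vd hvd0] : exists vd : R -> R * R -> R,
    forall dl, periodic2 (vd dl) /\ (0 < dl -> props dl (vd dl)).
  have [|f hf] := @choice R (R * R -> R) (fun dl v => periodic2 v /\ (0 < dl -> props dl v)); last by exists f.
  move=> dl.
  have [dl0|dl0] := ltP 0 dl; last first.
    by exists (fun=> 0); split => // h; move: h; rewrite ltNge dl0.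
  have [v hv] := discounted hH pH dl0 hM; exists v; split => // k j z.
  by have [h _ _ _ _] := hv; apply: (h (k%:~R, j%:~R)) => y q /=; exact: pH.
have pv dl : periodic2 (vd dl) by have [] := hvd0 dl.
have hvd dl : 0 < dl -> props dl (vd dl) by have [] := hvd0 dl.
pose l dl := - (dl * vd dl 0).
have pvN dl : periodic2 (fun y => - vd dl y) by move=> k j z; rewrite pv.
have osc dl : 0 < dl -> forall z z', vd dl z <= vd dl z' + C0.
  move=> dl0; have [_ [u1 _] hb hs _] := hvd _ dl0; apply: (hC0 _ (pv dl)) => //.
  move=> z a q _ /hs; have /ler_normlP[h _] := hb z.
  by rewrite mulNr; move: h; clear; lra.
have sub dl : 0 < dl -> qsub setT H (l dl + dl * C0) (vd dl).
  move=> dl0; have [_ _ _ hs _] := hvd _ dl0 => z a q _ /hs.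
  have : dl * vd dl 0 <= dl * (vd dl z + C0) by rewrite ler_pM2l//; exact: osc.
  by rewrite /l; clear; lra.
have sup dl : 0 < dl -> qsub setT (hneg H) (- l dl + dl * C0) (fun y => - vd dl y).
  move=> dl0; have [_ _ _ _ hs] := hvd _ dl0 => z a q _ /hs.
  have : dl * vd dl z <= dl * (vd dl 0 + C0) by rewrite ler_pM2l//; exact: osc.
  by rewrite /l; clear; lra.
have rsub dl e : 0 < dl -> 0 < e -> exists w, [/\ regular_sub H (l dl + dl * C0 + e) w,
    periodic2 w & time_invariant H -> forall s z, w (z.1 + s, z.2) = w z].
  move=> dl0 e0; have [hi [u1 u2] _ _ _] := hvd _ dl0.
  have [w [w1 w2 w3]] := regular_subsolution (ham_doubling_ok hH) (pv dl) u1 u2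
    (fun z a q => sub _ dl0 z a q I) e0.
  exists w; split => // ti; apply: w3 => s z.
  rewrite -(hi (s, 0) _ z); last by move=> y q /=; rewrite addr0; exact: ti.
  by congr (vd dl (_, _)); rewrite /= addr0.
have rsup' dl e : 0 < dl -> 0 < e ->
    exists w, regular_sub (hneg H) (- l dl + dl * C0 + e) w /\ periodic2 w.
  move=> dl0 e0; have [_ [u1 u2] _ _ _] := hvd _ dl0.
  have [|w [w1 w2 _]] := regular_subsolution (hneg_doubling_ok hH) (pvN dl) u2 _
    (fun z a q => sup _ dl0 z a q I) e0; last by exists w.
  by move=> z; have := u1 z; rewrite (_ : (fun y => - - vd dl y) = vd dl)//;
    apply/funext => y; rewrite opprK.
(* Comparing a subsolution for one discount with a supersolution for another shows that the
   intervals of radius dl C0 about l dl meet pairwise. A common point lam is obtained without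
   extracting a subsequence. *)
have cauchy dl dl' : 0 < dl -> 0 < dl' -> l dl' - dl' * C0 <= l dl + dl * C0.
  move=> dl0 dl'0; apply/ler_addgt0Pr => e e0.
  have [w [w1 w2]] := rsup' _ _ dl'0 e0.
  have [_ [u1 _] _ _ _] := hvd _ dl0.
  have := level_comparison (pv dl) w2 u1 (sub _ dl0) w1.
  by clear; lra.
pose lam := reals.sup [set l dl - dl * C0 | dl in [set dl | 0 < dl]].
have lam1 dl : 0 < dl -> l dl - dl * C0 <= lam.
  move=> dl0; apply: ub_le_sup; last by exists dl.
  by exists (l dl + dl * C0) => _ [d /= d0 <-]; exact: cauchy.
have lam2 dl : 0 < dl -> lam <= l dl + dl * C0.
  move=> dl0; apply: ge_sup; first by exists (l dl - dl * C0), dl.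
  by move=> _ [d /= d0 <-]; exact: cauchy.
have small (e : R) : 0 < e -> exists2 dl, 0 < dl & 2 * (dl * C0) <= e.
  move=> e0; exists (e / (2 * (C0 + 1))).
    by rewrite divr_gt0// mulr_gt0// ltr_wpDl.
  have h : e / (2 * (C0 + 1)) * (C0 + 1) = e / 2 by field; rewrite gt_eqF// ltr_wpDl.
  have : 0 < e / (2 * (C0 + 1)) by rewrite divr_gt0// mulr_gt0// ltr_wpDl.
  by move: h; move: (e / (2 * (C0 + 1))) => x; clear; lra.
exists lam; split.
- move=> e e0; have e2 : 0 < e / 2 by lra.
  have [dl dl0 hdl] := small _ e2; have [w [w1 w2 w3]] := rsub _ _ dl0 e2.
  exists w; split => //; apply: regular_sub_le w1.
  by have := lam1 _ dl0; move: hdl; clear; lra.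
- move=> e e0; have e2 : 0 < e / 2 by lra.
  have [dl dl0 hdl] := small _ e2; have [w [w1 w2]] := rsup' _ _ dl0 e2.
  exists w; split => //; apply: regular_sub_le w1.
  by have := lam2 _ dl0; move: hdl; clear; lra.
- move=> e e0; have [dl dl0 hdl] := small _ e0.
  have [_ [u1 u2] _ _ _] := hvd _ dl0.
  exists (vd dl); split => // z a q _ hj.
    by have := sub _ dl0 z a q I hj; have := lam1 _ dl0; move: hdl; clear; lra.
  by have := sup _ dl0 z a q I hj; have := lam2 _ dl0; move: hdl; clear; lra.
pose u dl y := vd dl y - vd dl 0.
pose u' dl y := - u dl y.
have F0 : \forall dl \near (0 : R)^'+, 0 < dl by exact: nbhs_right_gt.
have ub : \forall dl \near (0 : R)^'+, forall y, `|u dl y| <= C0.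
  apply: filterS F0 => dl dl0 y; have := osc _ dl0 y 0; have := osc _ dl0 0 y.
  by rewrite /u; clear; move=> *; apply/ler_normlP; split; lra.
have ub' : \forall dl \near (0 : R)^'+, forall y, `|u' dl y| <= C0.
  by apply: filterS ub => dl h y; rewrite /u' normrN.
have qjetB w c z a q : qjet (fun y => w y - c) z a q -> qjet w z a q.
  by move=> [C hC]; exists C; apply: filterS hC => y; lra.
have small' (e : R) : 0 < e -> \forall dl \near (0 : R)^'+, 2 * (dl * C0) <= e.
  move=> e0; have [dl dl0 hdl] := small _ e0.
  have : \forall d \near (0 : R)^'+, d <= dl by exact: nbhs_right_le.
  move: F0; apply: filterS2 => d d0 h; apply: le_trans hdl.
  by rewrite ler_pM2l// ler_wpM2r.
have w1s : qsub setT H lam (rsup (0 : R)^'+ u).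
  move=> z a q _ /qjet_sjet hj; have [lb _] := rsup_bounds z ub.
  apply: (touching_qsub (ham_ucont hH) (rsup_touching lb hj) ltr01).
    apply: filterS F0 => dl dl0 y _; have [_ [u1 _] _ _ _] := hvd _ dl0.
    by apply: uscD; [exact: u1|apply: continuous_usc; exact: cvg_cst].
  move=> e e0; move: F0 (small' _ e0); apply: filterS2 => dl dl0 hdl y a' q' _ /qjetB hj'.
  have := sub _ dl0 y a' q' I hj'; have := lam1 _ dl0; move: hdl; clear; lra.
have w2s : qsub setT (hneg H) (- lam) (rsup (0 : R)^'+ u').
  move=> z a q _ /qjet_sjet hj; have [lb _] := rsup_bounds z ub'.
  apply: (touching_qsub (hneg_ucont (ham_ucont hH)) (rsup_touching lb hj) ltr01).
    apply: filterS F0 => dl dl0 y _; have [_ [_ u1] _ _ _] := hvd _ dl0.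
    rewrite /u' /u (_ : (fun y => - (_ - _)) = fun y => - vd dl y + vd dl 0); last first.
      by apply/funext => x; rewrite opprB addrC.
    by apply: uscD; [exact: u1|apply: continuous_usc; exact: cvg_cst].
  move=> e e0; move: F0 (small' _ e0); apply: filterS2 => dl dl0 hdl y a' q' _ hj'.
  have {}hj' : qjet (fun y => - vd dl y) y a' q'.
    apply: (qjetB _ (- vd dl 0)); apply: qjet_eq hj' => // x.
    by rewrite /u' /u opprB opprK addrC.
  have := sup _ dl0 y a' q' I hj'; have := lam2 _ dl0; move: hdl; clear; lra.
have p1 : periodic2 (rsup (0 : R)^'+ u).
  by move=> k j z; apply: (@rsup_shift _ _ _ id id _ z (k%:~R, j%:~R)) => // dl y; rewrite /u (pv dl k j y).
have p2 : periodic2 (rsup (0 : R)^'+ u').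
  by move=> k j z; apply: (@rsup_shift _ _ _ id id _ z (k%:~R, j%:~R)) => // dl y; rewrite /u' /u (pv dl k j y).
have b1 z : `|rsup (0 : R)^'+ u z| <= C0 by have [] := rsup_bounds z ub.
have b2 z : `|rsup (0 : R)^'+ u' z| <= C0 by have [] := rsup_bounds z ub'.
have us1 z : usc (rsup (0 : R)^'+ u) z by apply: usc_rsup; have [] := rsup_bounds z ub.
have us2 z : usc (rsup (0 : R)^'+ u') z by apply: usc_rsup; have [] := rsup_bounds z ub'.
(* The lower half-relaxed limit may lie below the upper one. Both are bounded by C0, so raising the
   lower one by 2 C0 orders them; the equation is insensitive to constants. *)
pose g z := - rsup (0 : R)^'+ u' z + 2 * C0.
pose G (z : R * R) (r q : R) := 0 * r + H z.1 z.2 q - lam.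
have bd1 z : bdat (rsup (0 : R)^'+ u) z by exists 1, C0.
have bg z : `|g z| <= 3 * C0.
  by have /ler_normlP[h1 h2] := b2 z; apply/ler_normlP; rewrite /g; move: h1 h2 C00; clear; split; lra.
have bd2 z : bdat g z by exists 1, (3 * C0).
have eg : env (fun y => - g y) = fun y => rsup (0 : R)^'+ u' y + - (2 * C0).
  have -> : (fun y => - g y) = fun y => rsup (0 : R)^'+ u' y + - (2 * C0).
    by apply/funext => y; rewrite /g opprD opprK.
  apply/funext => y; apply: env_usc; last first.
    by apply: uscD; [exact: us2|apply: continuous_usc; exact: cvg_cst].
  have [r [N [r0 h]]] := bdatN (bd2 y); exists r, N; split => // x /h.
  by rewrite /g opprD opprK.
have D : barriers setT G (rsup (0 : R)^'+ u) g.
  split => //.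
  - exact: openT.
  - by apply: jointly_continuous_ham; [exact: ham_ucont|].
  - move=> z; have /ler_normlP[h1 h2] := b1 z; have /ler_normlP[h3 h4] := b2 z.
    by rewrite /g; move: h1 h2 h3 h4; clear; lra.
  - have -> : env (rsup (0 : R)^'+ u) = rsup (0 : R)^'+ u.
      by apply/funext => y; exact: env_usc.
    by move=> z a q _ hj; have := w1s z a q I hj; rewrite /G mul0r add0r; clear; lra.
  - rewrite eg => z a q _ /qjetB hj; have := w2s z a q I hj.
    by rewrite /G mul0r add0r /hneg; clear; lra.
have [v [vb vsub vsup vmax]] := perron D.
have inv_le (k j : int) z : v (z + (k%:~R, j%:~R)) <= v z.
  apply: (perron_shift vb vsub vmax) => [y|y|y r q].
  - exact: p1.
  - by rewrite /g; congr (- _ + _); exact: p2.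
  - by rewrite /G /=; congr (_ + _ - _); exact: pH.
exists v; split.
- move=> k j z; apply/le_anti/andP; split; first exact: inv_le.
  have := inv_le (- k) (- j) (z.1 + k%:~R, z.2 + j%:~R).
  rewrite (_ : _ + _ = z)//; last by rewrite [z]surjective_pairing; congr pair;
    rewrite /= rmorphN /= addrK.
- exists (3 * C0) => z; have /andP[h1 h2] := vb z; have /ler_normlP[h3 h4] := b1 z.
  have /ler_normlP[h5 h6] := bg z; apply/ler_normlP.
  by move: h1 h2 h3 h4 h5 h6 C00; clear; split; lra.
- by move=> z a q _ hj; have := vsub z a q I hj; rewrite /G mul0r add0r; clear; lra.
- move=> z a q _ hj; have := vsup z a q I hj.
  by rewrite /G mul0r add0r /hneg; clear; lra.
Qed.


End EffectiveHamiltonian.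

(** * Quadratic test functions and jets *)

Section TestFunctions.
Context {R : realType}.
Implicit Types (z : R * R) (u w phi : R * R -> R) (H : R -> R -> R -> R).
Implicit Types (D Om E : set (R * R)).

Lemma within_nbhs D z : nbhs z D -> within D (nbhs z) = nbhs z.
Proof.
by move=> nD; apply: within_interior.
Qed.

Lemma locally_bounded_bdat D u z : locally_bounded D u -> nbhs z D -> bdat u z.
Proof.
move=> h nD; have := h z (nbhs_singleton nD); rewrite (within_nbhs nD).
move=> [M [_ hM]]; have M1 : M < M + 1 by rewrite ltrDl.
have /nbhs_boxP[d d0 hd] := hM _ M1.
by exists d, (M + 1); split => // y [y1 y2]; exact: hd.
Qed.

(** Bridge from the extended real envelopes of the definitions to [env], with which all estimates
    are made. *)
Lemma usc_env_interior D u z : nbhs z D -> bdat u z -> usc_env D u z = (env u z)%:E.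
Proof.
move=> nD b; rewrite /usc_env /limf_esup (within_nbhs nD); apply/le_anti/andP; split.
  apply/lee_addgt0Pr => e e0.
  have h : env u z < env u z + e by lra.
  apply: ge_ereal_inf; exists (ereal_sup [set (EFin \o u) x | x in [set y | u y <= env u z + e]]).
    by exists [set y | u y <= env u z + e] => //; exact: env_near.
  by apply: ge_ereal_sup => _ [y /= hy <-]; rewrite /= -EFinD lee_fin.
apply: le_ereal_inf_tmp => _ [A nA <-].
rewrite leNgt; apply/negP => hlt.
have hz : ((u z)%:E <= ereal_sup [set (EFin \o u) x | x in A])%E.
  by apply: ereal_sup_ubound; exists z => //; exact: nbhs_singleton.
move: hlt hz; case E : (ereal_sup _) => [s| |] //; rewrite lte_fin => hs _.
suff : env u z <= s by lra.
apply: env_le => //; apply: filterS nA => y Ay.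
by rewrite -lee_fin -E; apply: ereal_sup_ubound; exists y.
Qed.

Lemma lsc_env_opp D u z : lsc_env D u z = (- usc_env D (fun y => - u y)%R z)%E.
Proof. by rewrite /lsc_env /usc_env /limf_einf. Qed.

Lemma within_proper E v z : (forall d : R, 0 < d -> exists h, [/\ h != 0, `|h| < d & E (h *: v + z)]) ->
  ProperFilter (within [set h : R | E (h *: v + z)] 0^').
Proof.
move=> hE; apply: Build_ProperFilter_ex.
move=> A; rewrite /within /= /dnbhs /within /= => /nbhs_ballP[d /= d0 hd].
have [h [h0 hd' Eh]] := hE d d0.
exists h; apply: hd => //; by rewrite /ball /= sub0r normrN.
Qed.

Lemma quot_in_quadratic E v phi z (d C : R) :
  ProperFilter (within [set h : R | E (h *: v + z)] 0^') ->
  (forall h, E (h *: v + z) -> phi (h *: v + z) - phi z = h * d + C * h ^+ 2) ->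
  cvg (quot_in E v phi z) /\ deriv_in E v phi z = d.
Proof.
move=> PF hphi.
have cv : quot_in E v phi z --> d.
  apply/cvgrPdist_le => e e0; rewrite /quot_in.
  have C1 : 0 < `|C| + 1 by rewrite ltr_wpDl.
  have ec : 0 < e / (`|C| + 1) by rewrite divr_gt0.
  rewrite near_withinE /=; rewrite /dnbhs near_withinE.
  have := nbhsx_ballx (0 : R) _ ec; apply: filterS => h /=.
  rewrite /ball /= sub0r normrN => hd h0 Eh.
  rewrite (hphi h Eh).
  have -> : d - h^-1 * (h * d + C * h ^+ 2) = - (C * h) by field.
  rewrite normrN normrM; move: hd; rewrite ltr_pdivlMr//.
  by have := normr_ge0 h; clear; nra.
split; first by apply/cvg_ex; exists d.
by rewrite /deriv_in; apply: cvg_lim => //.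
Qed.

Lemma quadratic_C1 E phi (ft fx : R * R -> R) (C : R) :
  (forall z, E z -> forall d : R, 0 < d -> exists h, [/\ h != 0, `|h| < d & E (h *: dir_t + z)]) ->
  (forall z, E z -> forall d : R, 0 < d -> exists h, [/\ h != 0, `|h| < d & E (h *: dir_x + z)]) ->
  continuous ft -> continuous fx ->
  (forall z h, E z -> E (h *: dir_t + z) -> phi (h *: dir_t + z) - phi z = h * ft z + C * h ^+ 2) ->
  (forall z h, E z -> E (h *: dir_x + z) -> phi (h *: dir_x + z) - phi z = h * fx z + C * h ^+ 2) ->
  C1_in E phi /\ forall z, E z -> deriv_in E dir_t phi z = ft z /\ deriv_in E dir_x phi z = fx z.
Proof.
move=> pt px ct cx ht hx.
have dt z : E z -> cvg (quot_in E dir_t phi z) /\ deriv_in E dir_t phi z = ft z.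
  by move=> Ez; apply: (quot_in_quadratic (C := C)) => [|h]; [exact/within_proper/pt|exact: ht].
have dx z : E z -> cvg (quot_in E dir_x phi z) /\ deriv_in E dir_x phi z = fx z.
  by move=> Ez; apply: (quot_in_quadratic (C := C)) => [|h]; [exact/within_proper/px|exact: hx].
split; last by move=> z Ez; split; [exact: (dt z Ez).2|exact: (dx z Ez).2].
move=> v [->|->]; split => [z Ez|].
- exact: (dt z Ez).1.
- apply: (@subspace_eq_continuous _ _ _ ft); last exact: continuous_subspaceT.
  by move=> z; rewrite inE => Ez; have [_ /esym] := dt z Ez.
- exact: (dx z Ez).1.
- apply: (@subspace_eq_continuous _ _ _ fx); last exact: continuous_subspaceT.
  by move=> z; rewrite inE => Ez; have [_ /esym] := dx z Ez.
Qed.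

Lemma open_moves Om v z : open Om -> Om z -> forall d : R, 0 < d ->
  exists h, [/\ h != 0, `|h| < d & Om (h *: v + z)].
Proof.
move=> oO Oz d d0.
have cv : (fun h : R => h *: v + z) @ (0 : R) --> z.
  have -> : z = 0 *: v + z by rewrite scale0r add0r.
  by apply: cvgD; [exact: scalel_continuous|rewrite scale0r add0r; exact: cvg_cst].
have /cv : nbhs z Om by exact: open_nbhs_nbhs.
move=> /nbhs_ballP[r /= r0 hr].
have m0 : 0 < Num.min r d / 2 by rewrite divr_gt0// lt_min r0.
have m1 : Num.min r d <= r by rewrite ge_min lexx.
have m2 : Num.min r d <= d by rewrite ge_min lexx orbT.
exists (Num.min r d / 2); split; first by rewrite gt_eqF.
  by rewrite gtr0_norm//; move: m0 m2; clear; lra.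
by apply: hr; rewrite /ball /= sub0r normrN gtr0_norm//; move: m0 m1; clear; lra.
Qed.

Definition quad z (a p c C : R) y : R := c + lin z a p y + C * sqd z y.

Lemma dir_tE (h : R) z : h *: dir_t + z = (z.1 + h, z.2).
Proof.
have -> : h *: dir_t + z = (h * 1 + z.1, h * 0 + z.2) by [].
by rewrite mulr1 mulr0 add0r addrC.
Qed.

Lemma dir_xE (h : R) z : h *: dir_x + z = (z.1, z.2 + h).
Proof.
have -> : h *: dir_x + z = (h * 0 + z.1, h * 1 + z.2) by [].
by rewrite mulr1 mulr0 add0r [h + _]addrC.
Qed.

Lemma quad_dir_t z a p c C (h : R) y :
  quad z a p c C (h *: dir_t + y) - quad z a p c C y = h * (a + 2 * C * (y.1 - z.1)) + C * h ^+ 2.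
Proof.
rewrite dir_tE /quad /lin /sqd /=; ring.
Qed.

Lemma quad_dir_x z a p c C (h : R) y :
  quad z a p c C (h *: dir_x + y) - quad z a p c C y = h * (p + 2 * C * (y.2 - z.2)) + C * h ^+ 2.
Proof.
rewrite dir_xE /quad /lin /sqd /=; ring.
Qed.

Lemma quad_C1 Om z a p c C : open Om -> C1_in Om (quad z a p c C) /\
  forall y, Om y -> deriv_in Om dir_t (quad z a p c C) y = a + 2 * C * (y.1 - z.1) /\
     deriv_in Om dir_x (quad z a p c C) y = p + 2 * C * (y.2 - z.2).
Proof.
move=> oO; apply: (@quadratic_C1 _ _ (fun y => a + 2 * C * (y.1 - z.1))
  (fun y => p + 2 * C * (y.2 - z.2)) C).
- by move=> y Oy; exact: open_moves.
- by move=> y Oy; exact: open_moves.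
- move=> y; apply: cvgD; first exact: cvg_cst.
  by apply: cvgM; [exact: cvg_cst|apply: cvgB; [exact: continuous_coord1|exact: cvg_cst]].
- move=> y; apply: cvgD; first exact: cvg_cst.
  by apply: cvgM; [exact: cvg_cst|apply: cvgB; [exact: continuous_coord2|exact: cvg_cst]].
- by move=> y h _ _; exact: quad_dir_t.
- by move=> y h _ _; exact: quad_dir_x.
Qed.

Lemma near_nbhs_in Om D z : open Om -> Om `<=` D -> Om z -> nbhs z D.
Proof. by move=> oO OD Oz; apply: filterS OD _; exact: open_nbhs_nbhs. Qed.

Lemma touches_above_interior Om D u phi z : open Om -> Om `<=` D -> Om z ->
  locally_bounded D u ->
  (env u z = phi z /\ \forall y \near z, env u y <= phi y) <-> touches_above D u phi z.
Proof.
move=> oO OD Oz lb.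
have bd y : Om y -> bdat u y.
  by move=> Oy; apply: locally_bounded_bdat lb _; exact: near_nbhs_in Oy.
have eE y : Om y -> usc_env D u y = (env u y)%:E.
  by move=> Oy; apply: usc_env_interior; [exact: near_nbhs_in Oy|exact: bd].
have nO : \forall y \near z, Om y by exact: open_nbhs_nbhs.
split => [[h1 h2]|[h1 h2]].
  split; first by rewrite eE// h1.
  by move: nO h2; apply: filterS2 => y Oy h _; rewrite eE// lee_fin.
split; first by move: h1; rewrite eE// => -[].
by move: nO h2; apply: filterS2 => y Oy /(_ (OD y Oy)); rewrite eE// lee_fin.
Qed.

Lemma subsolution_qsub Om D H l u : open Om -> Om `<=` D ->
  subsolution Om D H l u -> qsub Om H l (env u).
Proof.
move=> oO OD [lb hs] z a p Oz [C hC].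
have [c1 hd] := quad_C1 z a p (env u z) C oO.
have hzz : lin z a p z = 0 /\ sqd z z = 0.
  by rewrite /lin /sqd !subrr expr0n /= !mulr0 addr0.
have ht : touches_above D u (quad z a p (env u z) C) z.
  apply/(touches_above_interior _ oO OD Oz lb); split => //.
  by rewrite /quad hzz.1 hzz.2 mulr0 !addr0.
have := hs _ z c1 Oz ht; have [-> ->] := hd z Oz.
by rewrite !subrr !mulr0 !addr0.
Qed.

Lemma supersolution_qsub Om D H l u : open Om -> Om `<=` D ->
  supersolution Om D H l u -> qsub Om (hneg H) (- l) (env (fun y => - u y)).
Proof.
move=> oO OD [lb hs] z a p Oz [C hC].
have lbN : locally_bounded D (fun y => - u y).
  move=> y Dy; have [M [Mr hM]] := lb y Dy; exists M; split => // x /hM.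
  by apply: filterS => t /=; rewrite normrN.
have eE y : Om y -> lsc_env D u y = (- env (fun x => - u x) y)%:E.
  move=> Oy; rewrite lsc_env_opp usc_env_interior//; first exact: near_nbhs_in Oy.
  by apply: locally_bounded_bdat lbN _; exact: near_nbhs_in Oy.
set w := env _ in hC eE *.
have [c1 hd] := quad_C1 z (- a) (- p) (- w z) (- C) oO.
have ht : touches_below D u (quad z (- a) (- p) (- w z) (- C)) z.
  split; first by rewrite eE// /quad /lin /sqd !subrr expr0n /= !mulr0 !addr0 mulr0 addr0.
  have nO : \forall y \near z, Om y by exact: open_nbhs_nbhs.
  move: nO hC; apply: filterS2 => y Oy h _; rewrite eE// lee_fin /quad.
  by move: h; rewrite /lin /sqd; clear; lra.
have := hs _ z c1 Oz ht; have [-> ->] := hd z Oz.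
by rewrite !subrr !mulr0 !addr0 /hneg; clear; lra.
Qed.

End TestFunctions.

(** * First order expansion of C^1 test functions *)

Section FirstOrderExpansion.
Context {R : realType}.
Implicit Types (z : R * R) (u w phi : R * R -> R) (H : R -> R -> R -> R).
Implicit Types (T X : set R).

Definition order_convex T := forall a b c : R, T a -> T b -> a <= c <= b -> T c.

(** The difference quotients are taken within [X], hence are one-sided at an end point such as x =
    0. The mean value theorem asks only for continuity at the ends, which bounded quotients give. *)
Lemma mvt_within X (g g' : R -> R) (a b : R) : order_convex X ->
  (forall s, X s -> (fun h : R => h^-1 * (g (h + s) - g s)) @ within [set h | X (h + s)] 0^' --> g' s) ->
  a < b -> X a -> X b -> exists2 c, a <= c <= b & g b - g a = g' c * (b - a).
Proof.
move=> cX dg ab Xa Xb.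
have quot s : X s -> forall e : R, 0 < e -> exists2 d, 0 < d & forall h, h != 0 -> `|h| < d ->
    X (h + s) -> `|g' s - h^-1 * (g (h + s) - g s)| < e.
  move=> Xs e e0; have /cvgrPdist_lt/(_ _ e0) := dg s Xs.
  rewrite near_withinE /= /dnbhs near_withinE => /nbhs_ballP[d /= d0 hd].
  by exists d => // h h0 hd' Xh; apply: hd => //; rewrite /ball /= sub0r normrN.
have [c /= cab hc] : exists2 c, c \in `]a, b[%R & g b - g a = g' c * (b - a).
  apply: MVT => //.
  - move=> s; rewrite in_itv /= => /andP[as_ sb].
    have Xs : X s by apply: (cX a b); rewrite ?ltW.
    have cv : (fun h : R => h^-1 *: (g (h *: 1 + s) - g s)) @ 0^' --> g' s.
      apply/cvgrPdist_lt => e e0; have [d d0 hd] := quot s Xs e e0.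
      rewrite /dnbhs near_withinE.
      have m0 : 0 < Num.min d (Num.min (s - a) (b - s)) by rewrite !lt_min d0 !subr_gt0 as_.
      have := nbhsx_ballx (0 : R) _ m0; apply: filterS => h.
      rewrite /ball /= sub0r normrN !lt_min => /and3P[h1 h2 h3] h0.
      have -> : h *: 1 = h :> R by exact: mulr1.
      apply: hd => //; apply: (cX a b) => //.
      by move: h2 h3; rewrite !ltr_norml; clear; lra.
    split; first by apply/cvg_ex; exists (g' s).
    exact: cvg_lim.
  - apply/subspace_continuousP => s /= sab.
    have Xs : X s by apply: (cX a b) => //; move: sab; rewrite in_itv.
    apply/cvgrPdist_lt => e e0; have [d d0 hd] := quot s Xs 1 ltr01.
    rewrite near_withinE.
    have G0 : 0 < `|g' s| + 1 by rewrite ltr_wpDl.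
    have m0 : 0 < Num.min d (e / (`|g' s| + 1)) by rewrite !lt_min d0 divr_gt0.
    have := nbhsx_ballx s _ m0; apply: filterS => y.
    rewrite /ball /= distrC lt_min => /andP[y1 y2] yab.
    have [->|ys] := eqVneq y s; first by rewrite subrr normr0.
    have h0 : y - s != 0 by rewrite subr_eq0.
    have := hd (y - s) h0 y1; rewrite subrK => hh.
    have {hh}hh : `|g' s - (y - s)^-1 * (g y - g s)| < 1.
      by apply: hh; apply: (cX a b) => //; move: yab; rewrite in_itv.
    have h3 : `|(y - s)^-1 * (g y - g s)| <= `|g' s| + 1.
      have := ler_normB (g' s) (g' s - (y - s)^-1 * (g y - g s)).
      by rewrite opprB addrCA subrr addr0; move: hh; clear; lra.
    rewrite distrC; apply: le_lt_trans (_ : (`|g' s| + 1) * `|y - s| < _).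
      have -> : g y - g s = (y - s)^-1 * (g y - g s) * (y - s) by field.
      by rewrite normrM ler_wpM2r.
    by rewrite mulrC -ltr_pdivlMr.
by exists c => //; move: cab; rewrite in_itv /= => /andP[? ?]; rewrite !ltW.
Qed.

Lemma mvt_within2 X (g g' : R -> R) (a b : R) : order_convex X ->
  (forall s, X s -> (fun h : R => h^-1 * (g (h + s) - g s)) @ within [set h | X (h + s)] 0^' --> g' s) ->
  X a -> X b -> exists c, [/\ X c, `|c - a| <= `|b - a| & g b - g a = g' c * (b - a)].
Proof.
move=> cX dg Xa Xb; case: (ltgtP a b) => [ab|ba|<-]; last first.
- by exists a; split => //; rewrite !subrr mulr0.
- have [c cab hc] := mvt_within cX dg ba Xb Xa; exists c; split; first exact: (cX b a).
    by rewrite !ler0_norm; move: cab; clear; lra.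
  by move: hc; clear; lra.
have [c cab hc] := mvt_within cX dg ab Xa Xb; exists c; split => //; first exact: (cX a b).
by rewrite !ger0_norm; move: cab; clear; lra.
Qed.

(** The increment is split along the path z, (y.1, z.2), y, which stays in the product; the mean
    value theorem on each leg leaves errors measured by the continuity of the partial derivatives,
    including up to the boundary. *)
Lemma C1_expansion T X phi z (e : R) : order_convex T -> order_convex X -> T z.1 -> X z.2 ->
  C1_in (T `*` X) phi -> 0 < e -> exists2 d, 0 < d & forall y, cbox z d y -> T y.1 -> X y.2 ->
  `|phi y - phi z - lin z (deriv_in (T `*` X) dir_t phi z) (deriv_in (T `*` X) dir_x phi z) y|
   <= e * nrm1 z y.
Proof.
move=> cT cX Tz Xz c1 e0; set E := T `*` X.
have [ct kt] := c1 _ (or_introl erefl); have [cx kx] := c1 _ (or_intror erefl).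
have Ez : E z by [].
have loc v : {within E, continuous (deriv_in E v phi)} -> exists2 d, 0 < d &
    forall y, cbox z d y -> E y -> `|deriv_in E v phi y - deriv_in E v phi z| <= e.
  move=> /subspace_continuousP/(_ z Ez)/cvgrPdist_le/(_ _ e0).
  rewrite near_withinE => /nbhs_boxP[d d0 hd]; exists d => // y [y1 y2] Ey.
  by rewrite distrC; exact: hd.
have [d1 d10 h1] := loc _ kt; have [d2 d20 h2] := loc _ kx.
exists (Num.min d1 d2); first by rewrite lt_min d10.
move=> y yb Ty Xy.
have [c [Xc cb hc]] : exists c, [/\ X c, `|c - z.2| <= `|y.2 - z.2| &
    phi (y.1, y.2) - phi (y.1, z.2) = deriv_in E dir_x phi (y.1, c) * (y.2 - z.2)].
  apply: (@mvt_within2 X (fun s => phi (y.1, s)) (fun s => deriv_in E dir_x phi (y.1, s))) => //.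
  move=> s Xs; have := cx (y.1, s) (conj Ty Xs).
  rewrite /deriv_in /quot_in => cv.
  have e1 : (fun h : R => h^-1 * (phi (h *: dir_x + (y.1, s)) - phi (y.1, s))) =
      (fun h : R => h^-1 * (phi (y.1, h + s) - phi (y.1, s))).
    by apply/funext => h; rewrite dir_xE /= [s + h]addrC.
  have e2 : [set h : R | E (h *: dir_x + (y.1, s))] = [set h | X (h + s)].
    apply/seteqP; split => h /=; rewrite dir_xE /E /= [s + h]addrC; first by case.
    by [].
  by move: cv; rewrite e1 e2.
have [c' [Tc cb' hc']] : exists c', [/\ T c', `|c' - z.1| <= `|y.1 - z.1| &
    phi (y.1, z.2) - phi (z.1, z.2) = deriv_in E dir_t phi (c', z.2) * (y.1 - z.1)].
  apply: (@mvt_within2 T (fun s => phi (s, z.2)) (fun s => deriv_in E dir_t phi (s, z.2))) => //.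
  move=> s Ts; have := ct (s, z.2) (conj Ts Xz).
  rewrite /deriv_in /quot_in => cv.
  have e1 : (fun h : R => h^-1 * (phi (h *: dir_t + (s, z.2)) - phi (s, z.2))) =
      (fun h : R => h^-1 * (phi (h + s, z.2) - phi (s, z.2))).
    by apply/funext => h; rewrite dir_tE /= [s + h]addrC.
  have e2 : [set h : R | E (h *: dir_t + (s, z.2))] = [set h | T (h + s)].
    apply/seteqP; split => h /=; rewrite dir_tE /E /= [s + h]addrC; first by case.
    by [].
  by move: cv; rewrite e1 e2.
have [m1 m2] : Num.min d1 d2 <= d1 /\ Num.min d1 d2 <= d2 by rewrite !ge_min !lexx !orbT.
have [y1 y2] := yb.
have hx : `|deriv_in E dir_x phi (y.1, c) - deriv_in E dir_x phi z| <= e.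
  by apply: h2 => //; split => /=; apply: le_trans m2 => //; exact: le_trans y2.
have ht : `|deriv_in E dir_t phi (c', z.2) - deriv_in E dir_t phi z| <= e.
  apply: h1 => //; split => /=; apply: le_trans m1; first exact: le_trans y1.
  by rewrite subrr normr0; exact: le_trans y1.
have -> : phi y - phi z - lin z (deriv_in E dir_t phi z) (deriv_in E dir_x phi z) y =
  (deriv_in E dir_t phi (c', z.2) - deriv_in E dir_t phi z) * (y.1 - z.1) +
  (deriv_in E dir_x phi (y.1, c) - deriv_in E dir_x phi z) * (y.2 - z.2).
  move: hc hc'; rewrite -!surjective_pairing /lin.
  by clear; lra.
apply: le_trans (ler_normD _ _) _; rewrite !normrM /nrm1 mulrDr.
by apply: lerD; rewrite ler_wpM2r.
Qed.

Lemma order_convexT : order_convex setT. Proof. by []. Qed.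

Lemma C1_expansionT phi z (e : R) : C1_in setT phi -> 0 < e ->
  exists2 d, 0 < d & forall y, cbox z d y ->
  `|phi y - phi z - lin z (deriv_in setT dir_t phi z) (deriv_in setT dir_x phi z) y|
   <= e * nrm1 z y.
Proof.
rewrite -setXTT => c1 e0.
have [d d0 hd] := C1_expansion (z := z) order_convexT order_convexT I I c1 e0.
by exists d => // y yb; exact: hd.
Qed.

Lemma C1_sjet phi w z : C1_in setT phi -> w z = phi z -> (\forall y \near z, w y <= phi y) ->
  sjet w z (deriv_in setT dir_t phi z) (deriv_in setT dir_x phi z).
Proof.
move=> c1 wz wphi e e0; have [d d0 hd] := C1_expansionT z c1 e0.
move: wphi (nbhs_cbox z d0); apply: filterS2 => y h1 h2.
by have /ler_normlP[] := hd y h2; rewrite wz; move: h1; clear; lra.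
Qed.

Lemma C1_sjetN phi w z : C1_in setT phi -> w z = - phi z -> (\forall y \near z, w y <= - phi y) ->
  sjet w z (- deriv_in setT dir_t phi z) (- deriv_in setT dir_x phi z).
Proof.
move=> c1 wz wphi e e0; have [d d0 hd] := C1_expansionT z c1 e0.
move: wphi (nbhs_cbox z d0); apply: filterS2 => y h1 h2.
by have /ler_normlP[] := hd y h2; rewrite wz /lin; move: h1; clear; lra.
Qed.

Lemma sjet_touching w z a p : sjet w z a p ->
  touching (globally [set: unit]) (fun=> w) z (w z) a p.
Proof.
move=> js; split => [k k0|e A e0 FA].
  have /nbhs_boxP[d d0 hd] := js _ k0.
  exists (Num.min d k); first by rewrite lt_min d0 k0 ge_min lexx orbT.
  move=> e e0 _ _ y yb; have [y1 y2] : cbox z d y by apply: cbox_sub yb; rewrite ge_min lexx.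
  by have := hd y y1 y2; lra.
by exists tt, z; split; [exact: FA|exact: cbox_center (ltW e0)|rewrite lerBlDr lerDl ltW].
Qed.

(** Quadratic test functions suffice: a first order touching of a constant family produces second
    order jets at nearby points with nearby slopes, and [H] is continuous. *)
Lemma qsub_sjet Om H l w z a p : ucont H -> open Om -> qsub Om H l w ->
  (\forall y \near z, usc w y) -> Om z -> sjet w z a p -> a + H z.1 z.2 p <= l.
Proof.
move=> hH oO hw uw Oz /sjet_touching ht.
have nO : \forall y \near z, Om y /\ usc w y.
  have nO : nbhs z Om by exact: open_nbhs_nbhs.
  by move: nO uw; apply: filterS2.
have /nbhs_boxP[r r0 hr] := nO.
have PF : ProperFilter (globally [set: unit]) := globally_properfilter (I : [set: unit] tt).
apply: (touching_qsub hH ht r0).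
  by move=> _ _ y [y1 y2]; have [] := hr y y1 y2.
move=> e e0 _ _ y a' q [y1 y2] hj; have [Oy _] := hr y y1 y2.
by apply: le_trans (hw y a' q Oy hj) _; rewrite lerDl ltW.
Qed.

Lemma bdat_locally_bounded u : (forall z, bdat u z) -> locally_bounded setT u.
Proof.
move=> b z _; have [r [M [r0 h]]] := b z; exists M; split; first exact: num_real.
move=> N /ltW MN; rewrite within_nbhs; last exact: filterT.
by apply: filterS (nbhs_cbox z r0) => y /h hy; exact: le_trans hy MN.
Qed.

Lemma qsub_subsolution H l u : ucont H -> (forall z, bdat u z) ->
  qsub setT H l (env u) -> subsolution setT setT H l u.
Proof.
move=> hH b hs; have lb := bdat_locally_bounded b; split => // phi z c1 _.
move=> /(touches_above_interior _ openT (@subsetT _ _) I lb)[h1 h2].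
apply: (@qsub_sjet setT H l (env u)) => //; first exact: openT.
  by apply/nbhs_boxP; exists 1 => // y _ _; exact: usc_envelope.
exact: C1_sjet.
Qed.

Lemma qsub_supersolution H l u : ucont H -> (forall z, bdat u z) ->
  qsub setT (hneg H) (- l) (env (fun y => - u y)) -> supersolution setT setT H l u.
Proof.
move=> hH b hs; have lb := bdat_locally_bounded b; split => // phi z c1 _ [h1 h2].
have eE y : lsc_env setT u y = (- env (fun x => - u x) y)%:E.
  by rewrite lsc_env_opp usc_env_interior//; [exact: filterT|exact: bdatN].
have := @qsub_sjet setT (hneg H) (- l) (env (fun y => - u y)) z
  (- deriv_in setT dir_t phi z) (- deriv_in setT dir_x phi z) (hneg_ucont hH) openT hs _ I _.
rewrite /hneg opprK -opprD lerN2; apply.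
  by apply/nbhs_boxP; exists 1 => // y _ _; apply: usc_envelope; exact: bdatN.
apply: C1_sjetN => //.
  by move: h1; rewrite eE => -[<-]; rewrite opprK.
apply: filterS h2 => y /(_ I); rewrite eE lee_fin; lra.
Qed.

End FirstOrderExpansion.

(** * Level, coercivity and continuity of the effective Hamiltonian *)

Section HbarProperties.
Context {R : realType}.
Implicit Types (z : R * R) (w v : R * R -> R) (H : R -> R -> R -> R).

Definition pshift H (p t x q : R) : R := H t x (p + q).

Lemma pshift_periodic H p : Z2_periodic H -> Z2_periodic (pshift H p).
Proof. by move=> pH k j t x q; rewrite /pshift pH. Qed.

Lemma regular_level H l W lam : cell_spec H lam -> periodic2 W -> (forall z, usc W z) ->
  (qsub setT H l W -> lam <= l) /\ (qsub setT (hneg H) l W -> - lam <= l).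
Proof.
move=> [ha hb _ _] pW uW; split => hs; apply/ler_addgt0Pr => e e0.
  have [w [w1 w2]] := hb e e0.
  by have := level_comparison pW w2 uW hs w1; clear; lra.
have [w [w1 w2 _]] := ha e e0.
by have := level_comparison pW w2 uW hs _; rewrite hnegK => /(_ _ w1); clear; lra.
Qed.

Lemma periodic2_env w : periodic2 w -> periodic2 (env w).
Proof.
move=> pw k j z; have := env_shift w z (k%:~R, j%:~R).
by rewrite (_ : (fun y => w (y + _)) = w)//; apply/funext => y; exact: (pw k j y).
Qed.

Lemma corrector_level H p lam lam' v : cell_spec (pshift H p) lam ->
  corrector H p lam' v -> lam' = lam.
Proof.
move=> hc [[M hM] pv hsub hsup].
have bv z : bdat v z by exists 1, M.
have p1 : periodic2 v by move=> k j [t x]; exact: pv.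
have p2 : periodic2 (fun y => - v y) by move=> k j z; rewrite p1.
apply/le_anti/andP; split.
  have := (regular_level (- lam') hc (periodic2_env p2)
    (fun z => usc_envelope (bdatN (bv z)))).2.
  rewrite lerN2; apply; apply: supersolution_qsub hsup => //; exact: openT.
have := (regular_level lam' hc (periodic2_env p1) (fun z => usc_envelope (bv z))).1.
by apply; apply: subsolution_qsub hsub => //; exact: openT.
Qed.

(** [Hbar] is a choice with a default value, so it must be shown that some level has a corrector in
    the sense of C^1 test functions; [corrector_level] then says that the chosen level is the one of
    the cell problem. *)
Lemma Hbar_spec H p : hamiltonian H -> Z2_periodic H -> cell_spec (pshift H p) (Hbar H p).
Proof.
move=> hH pH; have [lam hc] := cell_problem (ham_shift p hH) (pshift_periodic p pH).
suff -> : Hbar H p = lam by [].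
have [_ _ _ [v [v1 [M v2] v3 v4]]] := hc.
have bv z : bdat v z by exists 1, M.
have hcont := ham_ucont (ham_shift p hH).
have hv : corrector H p lam v.
  split; first by exists M.
  - by move=> k j t x; exact: (v1 k j (t, x)).
  - exact: qsub_subsolution.
  - exact: qsub_supersolution.
have [v' hv'] : [set lam | exists v, corrector H p lam v] (Hbar H p).
  by apply: (@xgetPex _ 0 [set lam | exists v, corrector H p lam v]); exists lam, v.
exact: corrector_level hv'.
Qed.

Section WithHamiltonian.
Variable H : R -> R -> R -> R.
Hypotheses (hH : hamiltonian H) (pH : Z2_periodic H).

Lemma qjet_max w z : (forall y, w y <= w z) -> qjet w z 0 0.
Proof.
move=> h; exists 0; apply/nbhs_boxP; exists 1 => // y _ _.
by rewrite /lin !mul0r !addr0; exact: h.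
Qed.

Lemma Hbar_between p : (exists z, H z.1 z.2 p <= Hbar H p) /\ (exists z, Hbar H p <= H z.1 z.2 p).
Proof.
have [_ _ _ [v [v1 [M v2] v3 v4]]] := Hbar_spec p hH pH.
have bv z : bdat v z by exists 1, M.
split.
  have [z hz] := periodic_max (periodic2_env v1) (fun z => usc_envelope (bv z)).
  exists z; have := v3 z 0 0 I (qjet_max hz).
  by rewrite /pshift add0r addr0.
have p2 : periodic2 (fun y => - v y) by move=> k j z; rewrite v1.
have [z hz] := periodic_max (periodic2_env p2) (fun z => usc_envelope (bdatN (bv z))).
exists z; have := v4 z 0 0 I (qjet_max hz).
by rewrite /hneg /pshift add0r oppr0 addr0 lerN2.
Qed.

Lemma Hbar_coercive (M : R) : exists K : R, forall p, K <= `|p| -> M <= Hbar H p.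
Proof.
have [K hK] := ham_co hH M; exists K => p hp.
have [[z hz] _] := Hbar_between p; exact: le_trans (hK p hp z.1 z.2) hz.
Qed.

End WithHamiltonian.

Lemma periodic_sub_limit {I : Type} (F : set_system I) {FF : ProperFilter F}
    (G : I -> R -> R -> R -> R) (G0 : R -> R -> R -> R) (u : I -> R * R -> R) (l M : R) :
  (forall z q e, 0 < e -> exists2 d, 0 < d & \forall i \near F, forall y q',
     cbox z d y -> `|q' - q| <= d -> G0 z.1 z.2 q <= G i y.1 y.2 q' + e) ->
  (forall i, periodic2 (u i)) -> (\forall i \near F, forall y, `|u i y| <= M) ->
  (\forall i \near F, forall y, usc (u i) y) -> (\forall i \near F, qsub setT (G i) l (u i)) ->
  exists w, [/\ periodic2 w, forall z, usc w z & qsub setT G0 l w].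
Proof.
move=> hG pu ub us hs; exists (rsup F u); split.
- by move=> k j z; apply: (@rsup_shift _ _ F id id u z (k%:~R, j%:~R)) => // i y; exact: (pu i k j y).
- by move=> z; apply: usc_rsup; have [] := rsup_bounds z ub.
move=> z a q _ /qjet_sjet hj; have [lb _] := rsup_bounds z ub.
rewrite -lerBrDr; apply: (touching_le (rsup_touching lb hj)).
  by exists 1 => //; apply: filterS us => i hi y _; exact: hi.
move=> e e0; have [d d0 hd] := hG z q e e0.
exists d => //; move: hd hs; apply: filterS2 => i h1 h2 y a' q' yb _ hq _ hj'.
by have := h1 y q' yb hq; have := h2 y a' q' Logic.I hj'; clear; lra.
Qed.

Lemma Hbar_osc H P : hamiltonian H -> exists C0 : R, forall p l w, `|p| <= P -> l <= P ->
  periodic2 w -> (forall z, usc w z) -> qsub setT (pshift H p) l w ->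
  forall z z', w z <= w z' + C0.
Proof.
move=> hH; have [C C0 hC] := ham_lb hH; have [K hK] := ham_co hH (`|P| + 1).
exists (`|P| + C + (`|K| + `|P|)) => p l w hp hl pw uw sw.
have KP : 0 <= `|K| + `|P| by rewrite addr_ge0.
apply: (@periodic_osc R (pshift H p) `|P| C (`|K| + `|P|)) => //.
- by move=> t x q; apply: hC.
- move=> t x q; rewrite /pshift => h.
  have : `|p + q| <= `|K|.
    rewrite leNgt; apply/negP => Kp.
    have := hK _ (le_trans (ler_norm K) (ltW Kp)) t x; move: h; clear; lra.
  have := ler_normB (p + q) p; rewrite addrAC subrr add0r.
  by move: hp (ler_norm P); clear; lra.
- by move=> z a q Iz hj; have := sw z a q Iz hj; move: hl (ler_norm P); clear; lra.
Qed.

(** Normalized approximate correctors are bounded uniformly for slopes near p. If the level kept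
    away from [Hbar H p] along slopes tending to p, their half-relaxed limit would be a periodic
    subsolution at slope p, for the equation or its opposite, at a level that comparison
    excludes. *)
Lemma Hbar_continuous H : hamiltonian H -> Z2_periodic H -> forall (p e : R), 0 < e ->
  exists2 d, 0 < d & forall p', `|p' - p| <= d -> `|Hbar H p' - Hbar H p| <= e.
Proof.
move=> hH pH p e e0.
have [M hM] := ham_bd hH (`|p| + 1).
pose P := Num.max (`|p| + 1) (`|M| + e).
have [C0 hC0] := Hbar_osc P hH.
have e2 : 0 < e / 2 by lra.
have [v hv] : exists v : R -> R * R -> R, forall p', [/\ periodic2 (v p'),
    forall z, usc (v p') z, forall z, usc (fun y => - v p' y) z,
    qsub setT (pshift H p') (Hbar H p' + e / 2) (v p') &
    qsub setT (hneg (pshift H p')) (- Hbar H p' + e / 2) (fun y => - v p' y)].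
  have [|f hf] := @choice R (R * R -> R) (fun p' v => [/\ periodic2 v, forall z, usc v z,
    forall z, usc (fun y => - v y) z, qsub setT (pshift H p') (Hbar H p' + e / 2) v &
    qsub setT (hneg (pshift H p')) (- Hbar H p' + e / 2) (fun y => - v y)]); last by exists f.
  by move=> p'; have [_ _ h _] := Hbar_spec p' hH pH; exact: h.
pose u p' y := v p' y - v p' 0.
have near1 : \forall p' \near p, `|p'| <= `|p| + 1.
  apply: filterS (nbhsx_ballx p 1 ltr01) => p'; rewrite /ball /= distrC => h.
  by have := ler_normD (p' - p) p; rewrite subrK; move: h; clear; lra.
have PM1 : `|p| + 1 <= P by rewrite le_max lexx.
have PM2 : `|M| + e <= P by rewrite le_max lexx orbT.
have ub : \forall p' \near p, forall y, `|u p' y| <= C0.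
  apply: filterS near1 => p' hp' y; have [v1 v2 _ v4 _] := hv p'.
  have [_ [z hz]] := Hbar_between hH pH p'.
  have hl : Hbar H p' + e / 2 <= P.
    have /ler_normlP[_ h] := hM z.1 z.2 p' hp'; have := ler_norm M.
    by move: h hz PM2 e0; clear; lra.
  have osc := hC0 p' _ _ (le_trans hp' PM1) hl v1 v2 v4.
  by have := osc y 0; have := osc 0 y; rewrite /u; clear; move=> *; apply/ler_normlP; split; lra.
have pu p' : periodic2 (u p') by move=> k j z; rewrite /u; have [-> _ _ _ _] := hv p'.
have qjetB w c z a q : qjet (fun y => w y - c) z a q -> qjet w z a q.
  by move=> [C hC]; exists C; apply: filterS hC => y; lra.
have contG (z : R * R) (q e' : R) : 0 < e' -> exists2 d, 0 < d & \forall p' \near p,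
    forall y q', cbox z d y -> `|q' - q| <= d ->
    `|pshift H p z.1 z.2 q - pshift H p' y.1 y.2 q'| <= e'.
  move=> e'0; have [d d0 hd] := ham_cont (`|p + q|) hH e'0.
  have d2 : 0 < d / 2 by lra.
  exists (d / 2) => //; apply: filterS (nbhsx_ballx p _ d2) => p'; rewrite /ball /= => hp y q' [y1 y2] hq.
  apply: hd; rewrite ?lexx//; try by rewrite distrC; move: y1 y2 d0; clear; lra.
  rewrite opprD addrACA; apply: le_trans (ler_normD _ _) _; rewrite [`|q - _|]distrC.
  by move: hp hq; clear; lra.
have ge1 : \forall p' \near p, Hbar H p' <= Hbar H p + e.
  apply: contrapT => hn.
  (* The trace of the neighbourhoods of p on the bad slopes; it is a proper filter exactly because
     the bound fails arbitrarily close to p. *)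
  pose F := within [set p' | Hbar H p + e < Hbar H p'] (nbhs p).
  have FF : Filter F by exact: within_filter.
  have PF : ProperFilter F.
    split => // F0; apply: hn; move: F0; rewrite /F /within /=; apply: filterS => p' h.
    by rewrite leNgt; apply/negP => /h.
  have FN (A : set R) : (\forall p' \near p, A p') -> F A.
    by rewrite /F /within /=; apply: filterS => p' hA _.
  have FW (A : set R) : (forall p', Hbar H p + e < Hbar H p' -> A p') -> F A.
    by move=> hA; apply: filterS hA _; exact: withinT.
  have [|||||w [w1 w2 w3]] := @periodic_sub_limit R F _ (fun p' => hneg (pshift H p')) (hneg (pshift H p))
    (fun p' y => - u p' y) (- (Hbar H p + e / 2)) C0.
  - move=> z q e' e'0; have [d d0 hd] := contG z (- q) _ e'0.
    exists d => //; apply: FN; apply: filterS hd => p' hp y q' yb hq.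
    have := hp y (- q') yb; rewrite -opprD normrN => /(_ hq)/ler_normlP[].
    by rewrite /hneg; clear; lra.
  - by move=> p' k j z; rewrite pu.
  - by apply: FN; apply: filterS ub => p' h y; rewrite normrN.
  - apply: FN; apply: filterE => p' y; have [_ _ v3 _ _] := hv p'.
    rewrite /u (_ : (fun y => - (_ - _)) = fun y => - v p' y + v p' 0); last first.
      by apply/funext => x; rewrite opprB addrC.
    by apply: uscD; [exact: v3|apply: continuous_usc; exact: cvg_cst].
  - apply: FW => p' hlt z a q _ hj.
    have [_ _ _ _ v5] := hv p'.
    have hj' : qjet (fun y => - v p' y) z a q.
      apply: (qjetB _ (- v p' 0)); apply: qjet_eq hj => // x.
      by rewrite /u opprB opprK addrC.
    by have := v5 z a q I hj'; move: hlt; clear; lra.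
  have := (regular_level (- (Hbar H p + e / 2)) (Hbar_spec p hH pH) w1 w2).2 w3.
  by move: e0; clear; lra.
have ge2 : \forall p' \near p, Hbar H p - e <= Hbar H p'.
  apply: contrapT => hn.
  pose F := within [set p' | Hbar H p' < Hbar H p - e] (nbhs p).
  have FF : Filter F by exact: within_filter.
  have PF : ProperFilter F.
    split => // F0; apply: hn; move: F0; rewrite /F /within /=; apply: filterS => p' h.
    by rewrite leNgt; apply/negP => /h.
  have FN (A : set R) : (\forall p' \near p, A p') -> F A.
    by rewrite /F /within /=; apply: filterS => p' hA _.
  have FW (A : set R) : (forall p', Hbar H p' < Hbar H p - e -> A p') -> F A.
    by move=> hA; apply: filterS hA _; exact: withinT.
  have [|||||w [w1 w2 w3]] := @periodic_sub_limit R F _ (fun p' => pshift H p') (pshift H p)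
    u (Hbar H p - e / 2) C0.
  - move=> z q e' e'0; have [d d0 hd] := contG z q _ e'0.
    exists d => //; apply: FN; apply: filterS hd => p' hp y q' yb hq.
    by have /ler_normlP[] := hp y q' yb hq; clear; lra.
  - exact: pu.
  - exact: FN.
  - apply: FN; apply: filterE => p' y; have [_ v2 _ _ _] := hv p'.
    by apply: uscD; [exact: v2|apply: continuous_usc; exact: cvg_cst].
  - apply: FW => p' hlt z a q _ /qjetB hj.
    by have [_ _ _ v4 _] := hv p'; have := v4 z a q I hj; move: hlt; clear; lra.
  have := (regular_level (Hbar H p - e / 2) (Hbar_spec p hH pH) w1 w2).1 w3.
  by move: e0; clear; lra.
have /nbhs_ballP[d /= d0 hd] : \forall p' \near p, Hbar H p' <= Hbar H p + e /\ Hbar H p - e <= Hbar H p'.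
  by move: ge1 ge2; apply: filterS2.
exists (d / 2); first by lra.
move=> p' hp; have [|h1 h2] := hd p'; first by rewrite /ball /= distrC; move: hp d0; clear; lra.
by apply/ler_normlP; split; move: h1 h2; clear; lra.
Qed.

(* A convex combination of regular subsolutions is again touched from below by
   paraboloids, hence can be compared with the supersolution at the combined
   slope. *)
Lemma Hbar_combination H (p1 p2 th e : R) : hamiltonian H -> Z2_periodic H ->
  0 <= th <= 1 -> 0 < e -> exists z b1 b2 q1 q2,
  [/\ time_invariant H -> b1 = 0 /\ b2 = 0, b1 + H z.1 z.2 q1 <= Hbar H p1 + e,
      b2 + H z.1 z.2 q2 <= Hbar H p2 + e &
      Hbar H (th * p1 + (1 - th) * p2) <=
        th * b1 + (1 - th) * b2 + H z.1 z.2 (th * q1 + (1 - th) * q2)].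
Proof.
move=> hH pH /andP[th0 th1] e0; set p := th * p1 + (1 - th) * p2.
have [h1 _ _ _] := Hbar_spec p1 hH pH; have [w1 [[u1 _ [K1 hK1]] pw1 ti1]] := h1 e e0.
have [h2 _ _ _] := Hbar_spec p2 hH pH; have [w2 [[u2 _ [K2 hK2]] pw2 ti2]] := h2 e e0.
have [_ _ _ [v [v1 [M v2] _ v4]]] := Hbar_spec p hH pH.
have bv z : bdat v z by exists 1, M.
have p2' : periodic2 (fun y => - v y) by move=> k j z; rewrite v1.
have th1' : 0 <= 1 - th by rewrite subr_ge0.
pose W z := env (fun y => - v y) z + (th * w1 z + (1 - th) * w2 z).
have pW : periodic2 W by move=> k j z; rewrite /W (periodic2_env p2') pw1 pw2.
have uW z : usc W z.
  apply: uscD; first exact: usc_envelope (bdatN (bv z)).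
  by apply: uscD; apply: usc_scale.
have [z hz] := periodic_max pW uW.
have [b1 [q1 [C1 [_ hC1 hE1]]]] := hK1 z; have [b2 [q2 [C2 [_ hC2 hE2]]]] := hK2 z.
(* A paraboloid below a function independent of time has no time slope. This is what lets (B-i) work
   without convexity. *)
have noslope w b q C : (\forall y \near z, w z + lin z b q y - C * sqd z y <= w y) ->
    (forall s z, w (z.1 + s, z.2) = w z) -> b = 0.
  move=> /nbhs_boxP[d d0 hd] ti; have [] // := @lin_flat R z b 0 `|C| _.
  apply/nbhs_boxP; exists d => // y y1 _.
  have := hd (y.1, z.2) y1; rewrite /= subrr normr0 => /(_ (ltW d0)).
  have -> : w (y.1, z.2) = w z by rewrite -(ti (y.1 - z.1) z); congr (w (_, _)); rewrite addrC subrK.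
  rewrite /lin /sqd /= subrr expr0n /= !mulr0 !mul0r !addr0.
  have := mulr_ge0 (normr_ge0 C) (sqr_ge0 (y.2 - z.2)).
  have := ler_wpM2r (sqr_ge0 (y.1 - z.1)) (ler_norm C).
  by clear; lra.
exists z, b1, b2, (p1 + q1), (p2 + q2); split => //.
- move=> ti; split; [apply: noslope hC1 _|apply: noslope hC2 _].
    by apply: ti1 => s t x q; exact: ti.
  by apply: ti2 => s t x q; exact: ti.
have hj : qjet (env (fun y => - v y)) z (- (th * b1 + (1 - th) * b2)) (- (th * q1 + (1 - th) * q2)).
  exists (th * C1 + (1 - th) * C2); move: hC1 hC2; apply: filterS2 => y k1 k2.
  have := ler_wpM2l th0 k1; have := ler_wpM2l th1' k2; have := hz y.
  by rewrite /W /lin; clear; lra.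
have := v4 z _ _ I hj; rewrite /hneg /pshift opprK.
have -> : p + (th * q1 + (1 - th) * q2) = th * (p1 + q1) + (1 - th) * (p2 + q2) by rewrite /p; ring.
by clear; lra.
Qed.

End HbarProperties.

(** * Quasi-convexity and the perturbed test function method *)

Section InteriorHomogenization.
Context {R : realType}.
Implicit Types (z : R * R) (w v : R * R -> R) (H : R -> R -> R -> R) (h : R -> R).

Record limit_hamiltonian h : Prop := LimitHamiltonian {
  lham_cont : forall p e : R, 0 < e -> exists2 d, 0 < d & forall p', `|p' - p| <= d -> `|h p' - h p| <= e;
  lham_co : forall M : R, exists K : R, forall p, K <= `|p| -> M <= h p;
  lham_qc : forall p1 p p2 : R, p1 <= p <= p2 -> h p <= Num.max (h p1) (h p2) }.

Lemma limit_hamiltonian_reflect h : limit_hamiltonian h -> limit_hamiltonian (fun p => h (- p)).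
Proof.
move=> hh; split.
- move=> p e e0; have [d d0 hd] := lham_cont hh (- p) e0; exists d => // p' hp.
  by apply: hd; rewrite -opprD normrN.
- by move=> M; have [K hK] := lham_co hh M; exists K => p hp; apply: hK; rewrite normrN.
- move=> p1 p p2 /andP[h1 h2]; rewrite maxC; apply: (lham_qc hh).
  by rewrite !lerN2 h1 h2.
Qed.

Lemma between_convex (p1 p p2 : R) : p1 <= p <= p2 ->
  exists2 th : R, 0 <= th <= 1 & p = th * p1 + (1 - th) * p2.
Proof.
move=> /andP[h1 h2]; have [e|ne] := eqVneq p1 p2.
  exists 1; first by rewrite ler01 lexx.
  by apply/le_anti; move: h1 h2; rewrite e; clear; lra.
have d0 : 0 < p2 - p1 by rewrite subr_gt0 lt_neqAle ne (le_trans h1).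
exists ((p2 - p) / (p2 - p1)).
  rewrite divr_ge0 ?subr_ge0// ?(le_trans h1)//= ler_pdivrMr// mul1r.
  by move: h1; clear; lra.
by field; rewrite gt_eqF.
Qed.

Lemma quasi_convex_le (f : R -> R) (p0 : R) : quasi_convex_at f p0 ->
  (forall (p e : R), 0 < e -> exists2 d, 0 < d & forall p', `|p' - p| <= d -> `|f p' - f p| <= e) ->
  forall p1 p p2, p1 <= p <= p2 -> f p <= Num.max (f p1) (f p2).
Proof.
move=> [hl hr] cf p1 p p2 /andP[h1 h2]; rewrite le_max.
case: (ltgtP p p0) => [pp0|p0p|pp0].
- by rewrite hl//= in_itv /= ?(le_lt_trans h1).
- by rewrite [X in _ || X]hr ?orbT//= in_itv /= andbT ?(lt_le_trans p0p).
move: h1; rewrite le_eqVlt => /predU1P[->|p1p]; first by rewrite lexx.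
apply/orP; left; apply/ler_addgt0Pr => e e0.
have [d d0 hd] := cf p e e0.
pose q := Num.max p1 (p - d).
have q1 : p1 <= q by rewrite le_max lexx.
have q2 : p - d <= q by rewrite le_max lexx orbT.
have q3 : q < p by rewrite gt_max p1p /=; move: d0; clear; lra.
have : f q <= f p1.
  by apply: hl => //; rewrite in_itv /= -pp0 ?(le_lt_trans q1).
have /ler_normlP[] : `|f q - f p| <= e.
  by apply: hd; rewrite distrC ger0_norm; move: q2 q3; clear; lra.
by clear; lra.
Qed.

(** [Hbar_combination] leaves a combination of time slopes and a value of [H] at a combined slope.
    Under (B-i) the time slopes vanish and quasi-convexity of [H] concludes; under (B-ii) convexity
    splits the value of [H], and each part is paired with its own time slope. *)
Lemma Hbar_limit_hamiltonian H : hamiltonian H -> Z2_periodic H -> Bi H \/ Bii H ->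
  limit_hamiltonian (Hbar H).
Proof.
move=> hH pH hB; split; first exact: Hbar_continuous.
  exact: Hbar_coercive.
move=> p1 p p2 /between_convex[th thb ->].
apply/ler_addgt0Pr => e e0.
have [z [b1 [b2 [q1 [q2 [ti h1 h2 h3]]]]]] := Hbar_combination p1 p2 hH pH thb e0.
apply: le_trans h3 _.
have m1 : Hbar H p1 <= Num.max (Hbar H p1) (Hbar H p2) by rewrite le_max lexx.
have m2 : Hbar H p2 <= Num.max (Hbar H p1) (Hbar H p2) by rewrite le_max lexx orbT.
case: hB => [[tinv [p0 qc]]|cx].
  have [b10 b20] : b1 = 0 /\ b2 = 0 by apply: ti => s t x q; exact: tinv.
  rewrite b10 b20 !mulr0 !add0r; rewrite b10 b20 !add0r in h1 h2.
  have cf (q e' : R) : 0 < e' -> exists2 d, 0 < d & forall q', `|q' - q| <= d ->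
      `|H z.1 z.2 q' - H z.1 z.2 q| <= e'.
    move=> e'0; have [d d0 hd] := ham_cont `|q| hH e'0; exists d => // q' hq.
    rewrite distrC; apply: hd; rewrite ?subrr ?normr0 ?(ltW d0)//.
    by rewrite distrC.
  have qcl := quasi_convex_le (qc z.1 z.2) cf.
  have [q12|q21] := leP q1 q2.
    apply: le_trans (qcl q1 _ q2 _) _.
      by move: thb q12; clear; move=> /andP[? ?] ?; apply/andP; split; nra.
    by rewrite ge_max; move: h1 h2 m1 m2; clear; move=> *; apply/andP; split; lra.
  apply: le_trans (qcl q2 _ q1 _) _.
    by move: thb q21; clear; move=> /andP[? ?] ?; apply/andP; split; nra.
  by rewrite ge_max; move: h1 h2 m1 m2; clear; move=> *; apply/andP; split; lra.
case/andP: thb => th0 th1.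
have hcx : H z.1 z.2 (th * q1 + (1 - th) * q2) <= th * H z.1 z.2 q1 + (1 - th) * H z.1 z.2 q2.
  by have := cx z.1 z.2 (Itv01 th0 th1) q1 q2 (mem_setT _) (mem_setT _); rewrite convRE.
have th1' : 0 <= 1 - th by rewrite subr_ge0.
have := ler_wpM2l th0 h1; have := ler_wpM2l th1' h2.
have := ler_wpM2l th0 m1; have := ler_wpM2l th1' m2.
by move: hcx; clear; lra.
Qed.

Lemma continuous_div (e : R) : e != 0 -> continuous (fun y : R * R => (y.1 / e, y.2 / e)).
Proof.
move=> e0 y A /nbhs_boxP[d d0 hd]; apply/nbhs_boxP.
have ne0 : 0 < `|e| by rewrite normr_gt0.
exists (d * `|e|); first exact: mulr_gt0.
move=> y' h1 h2; apply: hd => /=;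
  by rewrite -mulrBl normrM normfV ler_pdivrMr.
Qed.

(** The rescaled [w] is added to the family instead of being subtracted from the test function: it
    is uniformly small, so touching persists. As [w] is touched from below by paraboloids, every jet
    of the sum gives a jet of [U], shifted by the slopes of [w], whose inequality turns the
    oscillating Hamiltonian into lam. *)
Lemma interior_homogenization H Ha (p a f0 lam l r : R) z0 (U : R -> R * R -> R) :
  ucont Ha -> 0 < r ->
  (forall e, 0 < e -> exists w, regular_sub (hneg (pshift Ha p)) (- lam + e) w) ->
  (forall e : R, 0 < e -> \forall eps \near (0 : R)^'+, forall y q, cbox z0 r y ->
     Ha (y.1 / eps) (y.2 / eps) q <= H (y.1 / eps) (y.2 / eps) q + e) ->
  (\forall eps \near (0 : R)^'+, forall y, cbox z0 r y -> usc (U eps) y) ->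
  (\forall eps \near (0 : R)^'+, forall y a q, cbox z0 r y -> qjet (U eps) y a q ->
     a + H (y.1 / eps) (y.2 / eps) q <= l) ->
  touching (0 : R)^'+ U z0 f0 a p -> a + lam <= l.
Proof.
move=> hHa r0 hw hHH us hs ht; rewrite -lerBrDr.
apply/ler_addgt0Pr => e e0; have e5 : 0 < e / 5 by lra.
have [w [uw [M hM] [K hK]]] := hw _ e5.
pose W eps y := eps * w (y.1 / eps, y.2 / eps).
have F0 : \forall eps \near (0 : R)^'+, 0 < eps by exact: nbhs_right_gt.
have ht' : touching (0 : R)^'+ (fun eps y => U eps y + W eps y) z0 f0 a p.
  apply: touching_perturbed ltr01 ht _ => e' e'0.
  have M1 : 0 < `|M| + 1 by rewrite ltr_wpDl.
  have : \forall eps \near (0 : R)^'+, eps <= e' / (`|M| + 1).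
    by apply: nbhs_right_le; rewrite divr_gt0.
  move: F0; apply: filterS2 => eps eps0 heps y _.
  rewrite opprD addrA subrr add0r normrN /W normrM gtr0_norm//.
  apply: le_trans (_ : eps * (`|M| + 1) <= _); last by rewrite -ler_pdivlMr.
  rewrite ler_pM2l//; apply: le_trans (hM _) _.
  by have := ler_norm M; clear; lra.
apply: (touching_le ht').
  exists r => //; move: us F0; apply: filterS2 => eps hu eps0 y yb.
  apply: uscD; first exact: hu.
  apply: usc_scale; first exact: ltW.
  by apply: (@usc_comp _ _ _ w (fun y : R * R => (y.1 / eps, y.2 / eps))); [apply: continuous_div; rewrite gt_eqF|exact: uw].
move=> e' e'0.
have [d d0 hd] := hHa (`|p| + K) _ e5.
exists (Num.min r d); first by rewrite lt_min r0.
have m1 : Num.min r d <= r by rewrite ge_min lexx.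
have m2 : Num.min r d <= d by rewrite ge_min lexx orbT.
have hHH' := hHH _ e5; move: hHH' hs F0; apply: filterS3 => eps h1 h2 eps0 y a1 p1 yb _ hp _ [C hC].
have yr := cbox_sub m1 yb.
set ze := (y.1 / eps, y.2 / eps).
have [b [q [C' [qK hC' hE]]]] := hK ze.
have hj : qjet (U eps) y (a1 - b) (p1 - q).
  exists (C + C' / eps).
  have hC'' : \forall x \near y, w ze + lin ze b q (x.1 / eps, x.2 / eps)
      - C' * sqd ze (x.1 / eps, x.2 / eps) <= w (x.1 / eps, x.2 / eps).
    by apply: (continuous_div _ hC'); rewrite gt_eqF.
  move: hC hC''; apply: filterS2 => x k1 k2.
  have k3 := ler_wpM2l (ltW eps0) k2.
  have eqs : eps * (w ze + lin ze b q (x.1 / eps, x.2 / eps) - C' * sqd ze (x.1 / eps, x.2 / eps))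
     = W eps y + lin y b q x - C' / eps * sqd y x.
    by rewrite /W /lin /sqd /ze /=; field; rewrite gt_eqF.
  rewrite eqs in k3; move: k1 k3; rewrite /W /lin.
  by move: (eps * w _) (eps * w (x.1 / eps, _)) => A1 A2; clear; lra.
have h3 := h2 y _ _ yr hj.
have h4 := h1 y (p1 - q) yr.
have pq : `|p - q| <= `|p| + K by apply: le_trans (ler_normB _ _) _; rewrite lerD2l.
have /ler_normlP[h5 h6] : `|Ha ze.1 ze.2 (p - q) - Ha ze.1 ze.2 (p1 - q)| <= e / 5.
  apply: hd => //; rewrite ?subrr ?normr0 ?(ltW d0)//.
  rewrite opprB addrA subrK distrC; exact: le_trans hp m2.
move: hE h3 h4 h5 h6; rewrite /hneg /pshift /ze /=; move: e0 e'0.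
by clear; lra.
Qed.

End InteriorHomogenization.

(** * Effective equations on the half-lines *)

Section EffectiveHamiltonians.
Context {R : realType}.
Implicit Types (z y : R * R) (a p q l : R) (w v : R * R -> R) (H : R -> R -> R -> R) (h : R -> R).

Definition hscale H (e t x q : R) : R := H (t / e) (x / e) q.
Definition hrefl H (t x p : R) : R := H t (- x) (- p).
Definition hoppo h p : R := - h (- p).

Definition asymptotic_right H Ha := forall e : R, 0 < e ->
  exists N : R, forall t x p, N <= x -> `|H t x p - Ha t x p| <= e.

(* [h] is the Hamiltonian of the limit equation in [x > 0]. *)
Definition effective_right H h := forall (U : R -> R * R -> R) z0 (r l f0 a p : R),
  0 < r -> 0 < z0.2 ->
  (\forall eps \near (0 : R)^'+, forall y, cbox z0 r y -> usc (U eps) y) ->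
  (\forall eps \near (0 : R)^'+, qsub (cbox z0 r) (hscale H eps) l (U eps)) ->
  touching (0 : R)^'+ U z0 f0 a p -> a + h p <= l.

Lemma hscale_close H Ha z (r e : R) : asymptotic_right H Ha -> 0 < z.2 -> r <= z.2 / 2 -> 0 < e ->
  \forall eps \near (0 : R)^'+, forall y q, cbox z r y ->
     `|hscale H eps y.1 y.2 q - hscale Ha eps y.1 y.2 q| <= e.
Proof.
move=> hH z0 rz e0; have [N hN] := hH e e0.
have M0 : 0 < `|N| + 1 by rewrite ltr_wpDl.
have : \forall eps \near (0 : R)^'+, eps <= z.2 / 2 / (`|N| + 1).
  by apply: nbhs_right_le; rewrite !divr_gt0.
have : \forall eps \near (0 : R)^'+, 0 < eps by exact: nbhs_right_gt.
apply: filterS2 => eps eps0; rewrite ler_pdivlMr// => heps y q [_ /ler_normlP[h1 _]].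
apply: hN; rewrite ler_pdivlMr// mulrC; apply: le_trans (_ : eps * (`|N| + 1) <= _).
  by rewrite ler_pM2l//; have := ler_norm N; clear; lra.
by apply: le_trans heps _; move: h1 rz; clear; lra.
Qed.

Lemma hneg_pshift H p : hneg (pshift (hneg H) p) = pshift H (- p).
Proof.
by apply/funext => t; apply/funext => x; apply/funext => q;
  rewrite /hneg /pshift opprK opprB addrC.
Qed.

(** The perturbed test function is a regular subsolution of the opposite cell problem, and cell
    problems provide these on both sides; hence one argument [aux] for the equation and for its
    opposite. *)
Lemma asymptotic_effective H Ha : hamiltonian Ha -> Z2_periodic Ha -> asymptotic_right H Ha ->
  effective_right H (Hbar Ha) /\ effective_right (hneg H) (hoppo (Hbar Ha)).
Proof.
move=> hHa pHa hH.
have aux H1 Ha1 p lam : (forall e : R, 0 < e ->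
      exists w, regular_sub (hneg (pshift Ha1 p)) (- lam + e) w) -> ucont Ha1 ->
    asymptotic_right H1 Ha1 -> forall (U : R -> R * R -> R) z0 (r l f0 a : R),
  0 < r -> 0 < z0.2 ->
  (\forall eps \near (0 : R)^'+, forall y, cbox z0 r y -> usc (U eps) y) ->
  (\forall eps \near (0 : R)^'+, qsub (cbox z0 r) (hscale H1 eps) l (U eps)) ->
  touching (0 : R)^'+ U z0 f0 a p -> a + lam <= l.
  move=> hw uHa hH1 U z0 r l f0 a r0 z00 us hs ht.
  pose r' := Num.min r (z0.2 / 2).
  have r'1 : r' <= r by rewrite ge_min lexx.
  have r'2 : r' <= z0.2 / 2 by rewrite ge_min lexx orbT.
  apply: (@interior_homogenization _ H1 Ha1 p a f0 lam l r' z0 U) => //.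
  - by rewrite lt_min r0 divr_gt0.
  - move=> e e0; have := hscale_close hH1 z00 r'2 e0.
    apply: filterS => eps he y q yb; have := he y q yb.
    by rewrite /hscale => /ler_normlP[]; clear; lra.
  - by apply: filterS us => eps hu y yb; apply: hu; exact: cbox_sub yb.
  - by apply: filterS hs => eps hu y a' q yb; apply: hu; exact: cbox_sub yb.
split=> U z0 r l f0 a p; [apply: (aux H Ha)|apply: (aux (hneg H) (hneg Ha))].
- by move=> e e0; have [_ /(_ e e0)[w [? _]] _ _] := Hbar_spec p hHa pHa; exists w.
- exact: ham_ucont.
- exact: hH.
- move=> e e0; have [/(_ e e0)[w [? _ _]] _ _ _] := Hbar_spec (- p) hHa pHa; exists w.
  by rewrite hneg_pshift /hoppo opprK.
- exact/hneg_ucont/ham_ucont.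
- move=> e e0; have [N hN] := hH e e0; exists N => t x q Nx.
  by rewrite /hneg -opprD normrN hN.
Qed.

Definition refl y : R * R := (y.1, - y.2).

Lemma reflK : involutive refl.
Proof. by move=> y; rewrite /refl /= opprK -surjective_pairing. Qed.

Lemma cbox_refl z r y : cbox (refl z) r y -> cbox z r (refl y).
Proof. by rewrite /cbox /refl /= -opprD normrN opprK. Qed.

Lemma touching_refl {I : Type} (F : set_system I) {FF : Filter F} (U : I -> R * R -> R) z f0 a p :
  touching F U z f0 a p -> touching F (fun i y => U i (refl y)) (refl z) f0 a (- p).
Proof.
move=> [h1 h2]; split.
  move=> k k0; have [r rk hr] := h1 k k0; exists r => // e e0.
  have := hr e e0; apply: filterS => i hi y yb; apply: le_trans (hi _ (cbox_refl yb)) _.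
  rewrite /lin /nrm1 /refl /= -opprD normrN opprK.
  by rewrite (_ : - p * (y.2 + z.2) = p * - (y.2 + z.2)); [rewrite opprD|ring].
move=> e A e0 FA; have [i [y [Ai yb hy]]] := h2 e A e0 FA.
exists i, (refl y); split; rewrite ?reflK//.
by apply: cbox_refl; rewrite reflK.
Qed.

End EffectiveHamiltonians.

(** * The junction condition: subsolution side *)

Section JunctionSlopes.
Context {R : realType}.
Implicit Types (z y : R * R) (a p q l eta : R) (u w v : R * R -> R) (h : R -> R).

Definition kink (pL pR : R) y : R := if y.2 < 0 then pL * y.2 else pR * y.2.

Lemma kinkE pL pR y : kink pL pR y = pL * y.2 + (pR - pL) * Num.max y.2 0.
Proof.
rewrite /kink; case: ltP => h; last by ring.
by rewrite mulr0 addr0.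
Qed.

Lemma kink_refl pL pR y : kink pL pR (refl y) = kink (- pR) (- pL) y.
Proof.
rewrite /kink /refl /= oppr_lt0; case: ltgtP => [h|h|h]; rewrite ?mulrN ?mulNr//.
by rewrite -h !mulr0.
Qed.

Lemma kinkN pL pR y : kink (- pL) (- pR) y = - kink pL pR y.
Proof. by rewrite /kink; case: ifP; rewrite mulNr. Qed.

Lemma kink0 pL pR t : kink pL pR (t, 0) = 0.
Proof. by rewrite /kink /= ltxx mulr0. Qed.

Lemma kink_gt pL pR y : 0 <= y.2 -> kink pL pR y = pR * y.2.
Proof. by rewrite /kink ltNge => ->. Qed.

Lemma kink_lt pL pR y : y.2 <= 0 -> kink pL pR y = pL * y.2.
Proof. by rewrite /kink le_eqVlt => /predU1P[->|->//]; rewrite ltxx !mulr0. Qed.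

Lemma continuous_kink pL pR : continuous (kink pL pR).
Proof.
rewrite (_ : kink pL pR = fun y => pL * y.2 + (pR - pL) * Num.max y.2 0); last first.
  by apply/funext => y; exact: kinkE.
move=> y; apply: cvgD; apply: cvgM; try exact: cvg_cst.
  exact: continuous_coord2.
apply: (@continuous_max R _ (fun y : R * R => y.2 : R^o) (fun=> 0) y).
  exact: continuous_coord2.
exact: cvg_cst.
Qed.

(** A smooth approximation of |x| - x: it tends to 0 at plus infinity and to slope -2 at minus
    infinity, with slope -1 and value eta at the origin. *)
Definition hinge eta (x : R) : R := Num.sqrt (eta ^+ 2 + x ^+ 2) - x.

Lemma hinge_ge eta x : 0 < eta -> Num.max 0 (- (2 * x)) <= hinge eta x.
Proof.
move=> e0; have e2 : 0 < eta ^+ 2 by rewrite exprn_gt0.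
have := sqrt_ge_norm x e2; rewrite ler_norml /hinge ge_max => /andP[h1 h2].
by apply/andP; split; move: h1 h2; set s := Num.sqrt _; clear; lra.
Qed.

Lemma hinge0 eta : 0 < eta -> hinge eta 0 = eta.
Proof. by move=> e0; rewrite /hinge expr0n addr0 subr0 sqrtr_sqr gtr0_norm. Qed.

Lemma continuous_hinge eta : continuous (hinge eta).
Proof.
move=> x; apply: cvgB; last exact: cvg_id.
apply: (@continuous_comp _ _ _ (fun x : R => eta ^+ 2 + x ^+ 2) Num.sqrt); last exact: sqrt_continuous.
apply: cvgD; first exact: cvg_cst.
by apply: (@continuous_at_sqr R R^o (fun x : R => x)); exact: cvg_id.
Qed.

Definition hinge_slope eta (x : R) : R := x / Num.sqrt (eta ^+ 2 + x ^+ 2) - 1.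

Lemma hinge_slope_bounds eta x : 0 < eta ->
  [/\ hinge_slope eta x <= 0, x <= 0 -> hinge_slope eta x <= - 1 & 0 <= x -> - 1 <= hinge_slope eta x].
Proof.
move=> e0; have e2 : 0 < eta ^+ 2 by rewrite exprn_gt0.
have : 0 < Num.sqrt (eta ^+ 2 + x ^+ 2) by rewrite sqrtr_gt0 ltr_wpDr ?sqr_ge0.
have := sqrt_slope x e2; rewrite /hinge_slope ler_norml => /andP[h1 h2] s0; split.
- by rewrite subr_le0.
- move=> x0; have : x / Num.sqrt (eta ^+ 2 + x ^+ 2) <= 0.
    by rewrite mulr_le0_ge0// invr_ge0 ltW.
  by move: (x / _) => k; clear; lra.
- move=> x0; have : 0 <= x / Num.sqrt (eta ^+ 2 + x ^+ 2) by rewrite divr_ge0// ltW.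
  by move: (x / _) => k; clear; lra.
Qed.

Lemma hinge_tangent eta x0 : 0 < eta -> exists2 C, 0 <= C & forall x,
  hinge eta x <= hinge eta x0 + hinge_slope eta x0 * (x - x0) + C * (x - x0) ^+ 2.
Proof.
move=> e0; have e2 : 0 < eta ^+ 2 by rewrite exprn_gt0.
have s0 : 0 < Num.sqrt (eta ^+ 2 + x0 ^+ 2) by rewrite sqrtr_gt0 ltr_wpDr ?sqr_ge0.
exists ((Num.sqrt (eta ^+ 2 + x0 ^+ 2))^-1 / 2); first by rewrite !mulr_ge0 ?invr_ge0 ?ltW.
move=> x; have := sqrt_tangent x x0 e2; rewrite /hinge /hinge_slope.
move: s0; set s := Num.sqrt (_ + x0 ^+ 2); set s' := Num.sqrt _ => s0.
move: (x0 / s) => k; have -> : (x - x0) ^+ 2 / s / 2 = s^-1 / 2 * (x - x0) ^+ 2.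
  by field; rewrite gt_eqF.
by move: (s^-1 / 2 * _) => k'; clear; lra.
Qed.

(** By quasi-convexity [decr_part h p0 p] is the minimum of [h] over slopes up to p, which is how it
    enters the junction condition. *)
Lemma decr_part_le h p0 q p : limit_hamiltonian h -> argmin h p0 -> q <= p ->
  decr_part h p0 p <= h q.
Proof.
move=> hh hm qp; rewrite /decr_part; case: ltP => pp0; last exact: hm.
have /(lham_qc hh) : q <= p <= p0 by rewrite qp ltW.
by rewrite le_max => /orP[//|] h1; apply: le_trans h1 _; exact: hm.
Qed.

Lemma decr_part_shift h p0 p e : limit_hamiltonian h -> argmin h p0 -> 0 < e ->
  exists2 d, 0 < d & forall p', p' <= p + d -> decr_part h p0 p - e <= h p'.
Proof.
move=> hh hm e0; have [d d0 hd] := lham_cont hh p e0; exists d => // p' p'd.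
rewrite lerBlDr; have [pp|pp] := leP p' p.
  by apply: le_trans (decr_part_le hh hm pp) _; rewrite lerDl ltW.
apply: le_trans (decr_part_le hh hm (lexx p)) _.
have /ler_normlP[] : `|h p' - h p| <= e.
  by apply: hd; rewrite ger0_norm; move: pp p'd; clear; lra.
by clear; lra.
Qed.

Lemma incr_part_refl h p0 p : incr_part h p0 p = decr_part (fun q => h (- q)) (- p0) (- p).
Proof. by rewrite /incr_part /decr_part ltrN2 !opprK; case: (ltgtP p p0) => // ->. Qed.

Lemma argmin_refl h p0 : argmin h p0 -> argmin (fun q => h (- q)) (- p0).
Proof. by move=> hm q; rewrite opprK; exact: hm. Qed.

(** The test function, of slope slightly above [pR] plus N times a hinge, stays above the kink. A
    contact at x > 0 has a slope at most pR + ka, where the equation gives the decreasing part up to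
    e; a contact at x <= 0 has a slope below - K because N exceeds all the slopes involved, and
    there coercivity gives the same bound on the time slope. *)
Lemma right_slope U h (p0 t0 a pL pR : R) :
  limit_hamiltonian h -> argmin h p0 ->
  (\forall y \near (t0, (0 : R)), usc U y) ->
  (\forall y \near (t0, (0 : R)), 0 < y.2 -> forall b q, qjet U y b q -> b + h q <= 0) ->
  (forall M : R, exists K : R, \forall y \near (t0, (0 : R)), forall b q, qjet U y b q ->
     q <= - K -> b <= - M) ->
  sjet (fun y => U y - kink pL pR y) (t0, 0) a 0 ->
  a + decr_part h p0 pR <= 0.
Proof.
move=> hh hm us hs co hj; set z0 := (t0, 0) in us hs co hj.
rewrite -lerBrDr sub0r; apply/ler_addgt0Pr => e e0.
have [ka ka0 hka] := decr_part_shift pR hh hm e0.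
have [K hK] := co (decr_part h p0 pR).
set N := `|pL| + `|pR| + ka + `|K| + 1.
have N0 : 0 < N by rewrite /N ltr_wpDl// !addr_ge0// ltW.
pose f eta y : R := U y - (pR + ka / 2) * y.2 - N * hinge eta y.2.
have F0 : \forall eta \near (0 : R)^'+, 0 < eta by exact: nbhs_right_gt.
have f_le eta y : 0 < eta -> f eta y <= U y - kink pL pR y.
  move=> eta0; have := hinge_ge y.2 eta0; rewrite ge_max => /andP[h1 h2].
  rewrite /f -addrA lerD2l -opprD lerN2; case: (leP 0 y.2) => y0.
    rewrite (kink_gt _ _ y0) mulrDl -addrA lerDl addr_ge0// mulr_ge0//.
      by rewrite divr_ge0// ltW.
    exact: ltW.
  rewrite (kink_lt _ _ (ltW y0)).
  have := ler_wpM2l (ltW N0) h2.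
  have := ler_norm pL; have := ler_norm (- pL); have := ler_norm pR; have := ler_norm (- pR); rewrite !normrN.
  have : 0 <= `|K| by []. move: y0 ka0; rewrite /N; clear.
  move: (hinge _ _) (`|pL|) (`|pR|) (`|K|) => b l1 l2 k y0 ka0 k0 h1 h2 h3 h4.
  by move=> hb; nra.
have uf : \forall y \near z0, forall eta, usc (f eta) y.
  apply: filterS us => y uy eta; apply: uscD.
    apply: uscD => //; apply: continuous_usc.
    apply: cvgN; apply: cvgM; [exact: cvg_cst|exact: continuous_coord2].
  apply: continuous_usc; apply: cvgN; apply: cvgM; first exact: cvg_cst.
  apply: (@continuous_comp _ _ _ (fun y : R * R => y.2) (hinge eta)); first exact: continuous_coord2.
  exact: continuous_hinge.
have ht : touching (0 : R)^'+ f z0 (U z0) a 0.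
  split.
    move=> k k0; have /nbhs_boxP[r r0 hr] := hj k k0.
    exists (Num.min r k); first by rewrite lt_min r0 k0 ge_min lexx orbT.
    move=> e' e'0; apply: filterS F0 => eta eta0 y [y1 y2].
    apply: le_trans (f_le eta y eta0) _.
    apply: le_trans (hr y _ _) _.
    - by apply: le_trans y1 _; rewrite ge_min lexx.
    - by apply: le_trans y2 _; rewrite ge_min lexx.
    by rewrite kink0 subr0 lerDl ltW.
  move=> e' A e'0 FA.
  have hN : \forall eta \near (0 : R)^'+, eta <= e' / N by apply: nbhs_right_le; rewrite divr_gt0.
  have /filter_ex[eta [Ae eta0 he]] : \forall eta \near (0 : R)^'+, [/\ A eta, 0 < eta & eta <= e' / N].
    by move: FA F0 hN; apply: filterS3.
  exists eta, z0; split => //; first exact/cbox_center/ltW.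
  rewrite /f /z0 /= hinge0// mulr0 subr0 lerD2l lerN2.
  by move: he; rewrite ler_pdivlMr// mulrC.
apply: (touching_le ht).
  have /nbhs_boxP[r r0 hr] := uf; exists r => //.
  by apply: nearW => eta y [y1 y2]; exact: hr.
move=> e' e'0.
have /nbhs_boxP[r r0 hr] : \forall y \near z0,
    (0 < y.2 -> forall b q, qjet U y b q -> b + h q <= 0) /\
    (forall b q, qjet U y b q -> q <= - K -> b <= - decr_part h p0 pR).
  by move: hs hK; apply: filterS2.
exists (Num.min r (ka / 2)); first by rewrite lt_min r0 divr_gt0.
apply: filterS F0 => eta eta0 y a' p' [y1 y2] _ hp' _ hjf.
have mr : Num.min r (ka / 2) <= r by rewrite ge_min lexx.
have [hs' hK'] := hr y (le_trans y1 mr) (le_trans y2 mr).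
have [C C0 hC] := hinge_tangent y.2 eta0.
have hjU : qjet U y a' (p' + (pR + ka / 2 + N * hinge_slope eta y.2)).
  have := @qjetD _ (f eta) (fun y => (pR + ka / 2) * y.2 + N * hinge eta y.2) y a' p' 0
    (pR + ka / 2 + N * hinge_slope eta y.2) (N * C) _ hjf.
  have H1 : \forall y0 \near y, (pR + ka / 2) * y0.2 + N * hinge eta y0.2 <=
      (pR + ka / 2) * y.2 + N * hinge eta y.2 +
      lin y 0 (pR + ka / 2 + N * hinge_slope eta y.2) y0 + N * C * sqd y y0.
    apply/nbhs_boxP; exists 1 => // x _ _.
    have := ler_wpM2l (ltW N0) (hC x.2).
    have := mulr_ge0 (mulr_ge0 (ltW N0) C0) (sqr_ge0 (x.1 - y.1)).
    rewrite /lin /sqd mul0r add0r; move: (hinge _ _) (hinge _ _) => b1 b2; clear; nra.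
  move=> /(_ H1); apply: qjet_eq; rewrite ?addr0// => x.
  by rewrite /f; ring.
have hp2 : p' <= ka / 2.
  move: hp'; rewrite subr0 => h1; apply: le_trans (ler_norm _) (le_trans h1 _).
  by rewrite ge_min lexx orbT.
have [b1 b2 _] := hinge_slope_bounds y.2 eta0.
have [y0|y0] := ltP 0 y.2.
  have h1 := hs' y0 _ _ hjU.
  have h2 := hka (p' + (pR + ka / 2 + N * hinge_slope eta y.2)).
  have : p' + (pR + ka / 2 + N * hinge_slope eta y.2) <= pR + ka.
    have : N * hinge_slope eta y.2 <= 0 by rewrite mulr_ge0_le0// ltW.
    by move: hp2; clear; lra.
  by move=> /h2; move: h1 e'0; clear; lra.
have := hK' _ _ hjU; have : p' + (pR + ka / 2 + N * hinge_slope eta y.2) <= - K.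
  have := ler_wpM2l (ltW N0) (b2 y0).
  have := ler_norm pR; have := ler_norm K; have : 0 <= `|pL| by [].
  by move: hp2; rewrite /N; clear; lra.
by move=> h1 /(_ h1); move: e0 e'0; clear; lra.
Qed.

End JunctionSlopes.

(** * Levels of time-periodic subsolutions *)

Section FluxLimiter.
Context {R : realType}.
Implicit Types (z y : R * R) (a p q l : R) (w v : R * R -> R) (H : R -> R -> R -> R).

Lemma periodic1E w : (forall t x, w (t + 1, x) = w (t, x)) -> periodic1 w.
Proof.
move=> pw; have pn (n : nat) t x : w (t + n%:R, x) = w (t, x).
  by elim: n t => [|n IH] t; rewrite ?addr0// -natr1 addrA pw.
case=> n t x; first exact: pn.
by rewrite NegzE rmorphN /= -[LHS](pn n.+1) subrK.
Qed.

Lemma periodic1_env w : periodic1 w -> periodic1 (env w).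
Proof.
move=> pw k t x; have := env_shift w (t, x) (k%:~R, 0).
rewrite (_ : (fun y => w (y + _)) = w); last first.
  apply/funext => -[s y]; rewrite -[RHS](pw k); congr w.
  by apply/pair_equal_spec; rewrite /= ?addr0.
by move=> ->; congr env; apply/pair_equal_spec; rewrite /= addr0.
Qed.

Lemma periodic_rect w (c d : R) : c <= d -> periodic1 w -> (forall z, usc w z) ->
  exists2 z, c <= z.2 <= d & forall y, c <= y.2 <= d -> w y <= w z.
Proof.
move=> cd pw uw.
have [|z [z1 z2] hz] := @usc_compact_max _ _ (rect 0 1 c d) w (@compact_rect R 0 1 c d) _ (fun x _ => uw x).
  by exists (0, c); split; rewrite /= in_itv /= lexx ?ler01 ?cd.
exists z => [|y hy]; first by move: z2; rewrite /= in_itv.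
have [k hk] := int_shift y.1 0; rewrite add0r in hk.
rewrite (surjective_pairing y) -(pw k); apply: hz.
by split; rewrite /= in_itv.
Qed.

(** Subtracting a steep N x^2 confines the maximum to |x| < 1. By periodicity it is a maximum over
    all times, so the time slope vanishes and the level is at least a value of [H]. *)
Lemma periodic_sub_level H l w (C : R) : (forall t x p, - C <= H t x p) ->
  periodic1 w -> (forall z, usc w z) -> qsub setT H l w -> - C <= l.
Proof.
move=> hC pw uw hw.
have m11 : (-1 : R) <= 1 by lra.
have [z1 _ hz1] := periodic_rect m11 pw uw.
pose N := `|w z1 - w (0, 0)| + 1.
have hN : w z1 - w (0, 0) < N.
  by rewrite /N; have := ler_norm (w z1 - w (0, 0)); clear; lra.
pose f y := w y + (- (N * sqd (y.1, 0) y)).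
have fE y : f y = w y - N * y.2 ^+ 2 by rewrite /f /sqd /= subrr expr0n add0r subr0.
have pf : periodic1 f by move=> k t x; rewrite !fE pw.
have uf z : usc f z.
  rewrite (_ : f = fun y => w y + - (N * y.2 ^+ 2)); last by apply/funext => y; exact: fE.
  apply: uscD => //; apply: continuous_usc; apply: cvgN; apply: cvgM; first exact: cvg_cst.
  by apply: (@continuous_at_sqr _ _ (fun y : R * R => y.2)); exact: continuous_coord2.
have [z zb hz] := periodic_rect m11 pf uf.
have h0 : f (0, 0) <= f z by apply: hz => /=; rewrite lerN10 ler01.
have zi : -1 < z.2 < 1.
  rewrite -ltr_norml lt_neqAle ler_norml zb andbT; apply/negP => /eqP z21.
  have z2 : z.2 ^+ 2 = 1 by rewrite -real_normK ?num_real// z21 expr1n.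
  move: h0; rewrite !fE /= z2 expr0n /=; have := hz1 z zb; move: hN; clear; lra.
have hj : qjet w z 0 (2 * N * z.2).
  exists N; have e0 : 0 < Num.min (1 - z.2) (z.2 + 1).
    by rewrite lt_min; move: zi; clear => /andP[? ?]; apply/andP; split; lra.
  apply/nbhs_boxP; exists (Num.min (1 - z.2) (z.2 + 1)) => // y _.
  rewrite le_min => /andP[y1 y2].
  have := hz y; rewrite !fE /lin /sqd.
  have -> : -1 <= y.2 <= 1 by move: y1 y2; clear; rewrite !ler_norml => /andP[? ?] /andP[? ?]; apply/andP; split; lra.
  move=> /(_ isT).
  have : 0 <= N * (y.1 - z.1) ^+ 2 by rewrite mulr_ge0 ?sqr_ge0// addr_ge0.
  clear; nra.
by have := hw z 0 (2 * N * z.2) Logic.I hj; rewrite add0r; apply: le_trans.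
Qed.

Definition Abar_set H := [set l | exists2 w : R * R -> R, forall t x, w (t + 1, x) = w (t, x) &
                            subsolution setT setT H l w].

Lemma Abar_sub_env H l w : (forall t x, w (t + 1, x) = w (t, x)) ->
  subsolution setT setT H l w ->
  [/\ periodic1 (env w), forall z, usc (env w) z & qsub setT H l (env w)].
Proof.
move=> pw hw; have bw z : bdat w z.
  by apply: (@locally_bounded_bdat _ setT); [exact: hw.1|exact: filterT].
split; first exact/periodic1_env/periodic1E.
  by move=> z; exact: usc_envelope.
by apply: (subsolution_qsub _ _ hw) => //; exact: openT.
Qed.

Lemma Abar_set_bounded H : hamiltonian H -> Abar_set H !=set0 /\ has_lbound (Abar_set H).
Proof.
move=> hH; split; last first.
  have [C _ hC] := ham_lb hH; exists (- C) => l [w pw hw].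
  have [h1 h2 h3] := Abar_sub_env pw hw; exact: periodic_sub_level h1 h2 h3.
have [M hM] := ham_bd hH 0; exists M, (fun=> 0) => //.
apply: qsub_subsolution; first exact: ham_ucont.
  by move=> z; exists 1, 0; split => // y _; rewrite normr0.
move=> z a q _ hj; have [-> ->] : a = 0 /\ q = 0.
  by apply: (@qjet_cst R 0 z); apply: qjet_eq hj => // y; rewrite env_cst.
by rewrite add0r; apply: le_trans (ler_norm _) _; apply: hM; rewrite normr0.
Qed.

Lemma Abar_le H l w : hamiltonian H -> (forall t x, w (t + 1, x) = w (t, x)) ->
  (forall z, usc w z) -> (forall z, bdat w z) -> qsub setT H l w -> Abar H <= l.
Proof.
move=> hH pw uw bw hw; have [_ hl] := Abar_set_bounded hH.
apply: (ge_inf hl); exists w => //; apply: qsub_subsolution => //; first exact: ham_ucont.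
by rewrite (_ : env w = w)//; apply/funext => z; rewrite env_usc.
Qed.

Lemma Abar_lt H l : hamiltonian H -> Abar H < l ->
  exists w, [/\ periodic1 w, forall z, usc w z & qsub setT H l w].
Proof.
move=> hH hl; have [h0 hb] := Abar_set_bounded hH.
have lt0 : 0 < l - Abar H by rewrite subr_gt0.
have [l' [w pw hw]] := inf_adherent lt0 (conj h0 hb).
rewrite addrC subrK => l'l; have [h1 h2 h3] := Abar_sub_env pw hw.
exists (env w); split => // z a q Oz hj; exact: le_trans (h3 z a q Oz hj) (ltW l'l).
Qed.

End FluxLimiter.

(** * Blow-up at the junction *)

Section BlowUp.
Context {R : realType}.
Implicit Types (z y : R * R) (a b p q l eps : R) (w v : R * R -> R) (H : R -> R -> R -> R).

(** A family localized in time: at most [c0] near both ends of the window, but with values at least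
    c1 > c0 arbitrarily close to x = 0. Its large values are thus attained at interior times. *)
Record blowup_family H l (t0 r rho c0 c1 : R) (g : R -> R * R -> R) : Prop := BlowupFamily {
  bf_r : 0 < r;
  bf_rho : 0 < rho;
  bf_c : c0 < c1;
  bf_usc : \forall eps \near (0 : R)^'+, forall y, `|y.1 - t0| <= r -> `|y.2| <= rho ->
    usc (g eps) y;
  bf_out : \forall eps \near (0 : R)^'+, forall y, r / 2 <= `|y.1 - t0| <= r -> `|y.2| <= rho ->
    g eps y <= c0;
  bf_jet : \forall eps \near (0 : R)^'+, forall y b q, `|y.1 - t0| <= r -> `|y.2| <= rho ->
    qjet (g eps) y b q -> b + H (y.1 / eps) (y.2 / eps) q <= l;
  bf_anchor : forall (A : set R) (e : R), 0 < e -> (0 : R)^'+ A ->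
    exists eps y, [/\ A eps, `|y.1 - t0| <= r, `|y.2| <= e & c1 <= g eps y] }.

(** Values above [c0] occur at interior times of the window, where a maximum in time has zero time
    slope; this is why only jets with that time slope are constrained. The estimate is [slope_bound]
    with time and space exchanged, on the right of x1 and, by reflection, on its left. *)
Lemma window_slope (g : R * R -> R) (t0 r rho c0 K x1 x2 B t : R) : 0 < r -> 0 < rho -> 0 <= K ->
  (forall y, `|y.1 - t0| <= r -> `|y.2| <= rho -> usc g y) ->
  (forall y, r / 2 <= `|y.1 - t0| <= r -> `|y.2| <= rho -> g y <= c0) ->
  (forall y q, `|y.1 - t0| <= r -> `|y.2| <= rho -> qjet g y 0 q -> `|q| <= K) ->
  `|x1| <= rho / 2 -> `|x2| <= rho / 2 -> c0 <= B ->
  (forall s, `|s - t0| <= r / 2 -> g (s, x1) <= B) -> `|t - t0| <= r / 2 ->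
  g (t, x2) <= B + K * `|x2 - x1|.
Proof.
move=> r0 rho0 K0.
have aux (g1 : R * R -> R) (y1 y2 : R) : y1 <= y2 ->
  (forall y, `|y.1 - t0| <= r -> `|y.2| <= rho -> usc g1 y) ->
  (forall y, r / 2 <= `|y.1 - t0| <= r -> `|y.2| <= rho -> g1 y <= c0) ->
  (forall y q, `|y.1 - t0| <= r -> `|y.2| <= rho -> qjet g1 y 0 q -> `|q| <= K) ->
  `|y1| <= rho / 2 -> `|y2| <= rho / 2 -> c0 <= B ->
  (forall s, `|s - t0| <= r / 2 -> g1 (s, y1) <= B) -> `|t - t0| <= r / 2 ->
  g1 (t, y2) <= B + K * (y2 - y1).
  move=> y12 ug og jg hy1 hy2 cB hB ht.
  have box s x : y1 <= s <= rho -> t0 - r / 2 <= x <= t0 + r / 2 ->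
      [/\ `|x - t0| <= r / 2, `|x - t0| <= r & `|s| <= rho].
    move: r0 rho0 hy1; rewrite !ler_norml; clear => r0 rho0 /andP[? ?] /andP[? ?] /andP[? ?].
    by split; apply/andP; split; lra.
  apply: (@slope_bound R (fun y => g1 (y.2, y.1)) y1 rho (t0 - r / 2) (t0 + r / 2) B c0 K y2 t) => //.
  - by move: hy2 rho0; rewrite ler_norml; clear; lra.
  - by move: ht; rewrite ler_norml; clear => /andP[? ?]; apply/andP; split; lra.
  - move=> y [/=]; rewrite !in_itv /= => h1 h2; have [b1 b2 b3] := box _ _ h1 h2.
    exact/usc_swap/ug.
  - move=> x hx /=; have [//|b1 _ _] := box y1 x _ hx; last exact: hB.
    by rewrite lexx; move: hy1 rho0; rewrite ler_norml; clear; lra.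
  - move=> s x /andP[hs1 hs2] hx /= hg; exists x => //.
    have [|b1 b2 b3] := box s x _ hx; first by rewrite !ltW.
    have : `|x - t0| < r / 2.
      rewrite ltNge; apply/negP => h3; move: hg; rewrite ltNge => /negP; apply.
      by apply: og => //=; rewrite h3.
    by rewrite ltr_norml; clear => /andP[? ?]; apply/andP; split; lra.
  move=> s x p /andP[hs1 hs2] /andP[hx1 hx2] hg hj.
  have [||b1 b2 b3] := box s x; try by rewrite !ltW.
  have : qjet g1 (x, s) 0 p by apply: qjet_swap.
  by move=> /jg h; apply: le_trans (ler_norm _) _; exact: h.
move=> ug og jg h1 h2 cB hB ht; have [x12|x21] := leP x1 x2.
  by rewrite ger0_norm ?subr_ge0//; exact: (aux g).
rewrite ltr0_norm ?subr_lt0// opprB.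
have -> : x1 - x2 = - x2 - - x1 by rewrite opprK addrC.
have -> : g (t, x2) = (g \o refl) (t, - x2) by rewrite /refl /= opprK.
apply: aux; rewrite ?lerN2 ?(ltW x21) ?normrN//.
- by move=> y y1 y2; apply: usc_reflect; apply: (ug (refl y)); rewrite //= normrN.
- by move=> y y1 y2; apply: og => //=; rewrite normrN.
- move=> y q y1 y2 hj; have : qjet g (refl y) 0 (- q).
    by apply: qjet_reflect; rewrite /= opprK -surjective_pairing.
  by move=> /jg; rewrite /= !normrN; apply.
by move=> s hs; rewrite /refl /= opprK; exact: hB.
Qed.


(** The integer k moves time by whole periods of [H], so that all these blow-ups at scale eps solve
    the same equation. *)
Definition blow_map (eps : R) (k : int) y : R * R := (eps * (y.1 + k%:~R), eps * y.2).

Lemma blow_map_near (eps : R) k y (A : set (R * R)) : 0 < eps ->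
  (\forall x \near blow_map eps k y, A x) <-> (\forall x \near y, A (blow_map eps k x)).
Proof.
move=> e0; split=> /nbhs_boxP[d d0 hd]; apply/nbhs_boxP.
  exists (d / eps) => [|x h1 h2]; first exact: divr_gt0.
  apply: hd; rewrite /= -mulrBr normrM gtr0_norm// mulrC -ler_pdivlMr//.
  by rewrite opprD addrACA subrr addr0.
exists (d * eps) => [|x h1 h2]; first exact: mulr_gt0.
have -> : x = blow_map eps k (x.1 / eps - k%:~R, x.2 / eps).
  by rewrite /blow_map /= subrK ![eps * _]mulrC !divfK ?gt_eqF// -surjective_pairing.
apply: hd => /=.
  have -> : x.1 / eps - k%:~R - y.1 = (x.1 - eps * (y.1 + k%:~R)) / eps.
    by field; rewrite gt_eqF.
  by rewrite normrM normfV (gtr0_norm e0) ler_pdivrMr.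
have -> : x.2 / eps - y.2 = (x.2 - eps * y.2) / eps by field; rewrite gt_eqF.
by rewrite normrM normfV (gtr0_norm e0) ler_pdivrMr.
Qed.

(** The family is rescaled about [mu], its maximal value on the axis x = 0 in the window. The space
    estimate bounds the blow-ups above locally; row maxima together with the bound on time slopes
    bound their supremum over integer shifts below. The relaxed limit over eps and all shifts is
    therefore finite, 1-periodic in time, and a subsolution at level l. *)
Lemma blowup_Abar H l t0 r rho c0 c1 g : hamiltonian H -> A1 H ->
  blowup_family H l t0 r rho c0 c1 g -> Abar H <= l.
Proof.
move=> hH pH [r0 rho0 c01 nu no nj na].
have [K0 hK0] := ham_co hH (`|l| + 1); pose K := `|K0|; have K_ge0 : 0 <= K by exact: normr_ge0.
have [C C0 hC] := ham_lb hH.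
pose C' := `|l| + C; have C'0 : 0 <= C' by rewrite addr_ge0.
pose c2 := (c0 + c1) / 2.
have c02 : c0 < c2 by move: c01; rewrite /c2; clear; lra.
have c21 : c2 < c1 by move: c01; rewrite /c2; clear; lra.
(* Times of maximum on the axis, kept only when the maximum is at least the intermediate value [c2].
   For scales without such a time [mu] is meaningless, and these scales are discarded below. *)
pose anch eps : set R := [set s | [/\ `|s - t0| <= r / 2, c2 <= g eps (s, 0) &
  forall t, `|t - t0| <= r / 2 -> g eps (t, 0) <= g eps (s, 0)]].
pose mu eps : R := g eps (xget t0 (anch eps), 0).
pose good eps := [/\ 0 < eps, forall y, `|y.1 - t0| <= r -> `|y.2| <= rho -> usc (g eps) y,
  forall y, r / 2 <= `|y.1 - t0| <= r -> `|y.2| <= rho -> g eps y <= c0 &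
  forall y b q, `|y.1 - t0| <= r -> `|y.2| <= rho ->
    qjet (g eps) y b q -> b + H (y.1 / eps) (y.2 / eps) q <= l].
have ngood : \forall eps \near (0 : R)^'+, good eps.
  have n0 : \forall eps \near (0 : R)^'+, 0 < eps by exact: nbhs_right_gt.
  have n1 : \forall eps \near (0 : R)^'+, 0 < eps /\ forall y, `|y.1 - t0| <= r -> `|y.2| <= rho -> usc (g eps) y.
    by move: n0 nu; apply: filterS2.
  by move: n1 no nj; apply: filterS3 => eps [? ?] ? ?; split.
have slope eps x1 x2 B t : good eps -> `|x1| <= rho / 2 -> `|x2| <= rho / 2 -> c0 <= B ->
    (forall s, `|s - t0| <= r / 2 -> g eps (s, x1) <= B) -> `|t - t0| <= r / 2 ->
    g eps (t, x2) <= B + K * `|x2 - x1|.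
  move=> [e0 ug og jg]; apply: window_slope (r0) (rho0) (K_ge0) ug og _ => y q y1 y2 hj.
  rewrite leNgt; apply/negP => hq.
  have hq' : K0 <= `|q| by apply: le_trans (ler_norm _) (ltW hq).
  have := jg y 0 q y1 y2 hj; have := hK0 q hq' (y.1 / eps) (y.2 / eps).
  by have := ler_norm l; clear; lra.
have rows eps x : good eps -> `|x| <= rho / 2 -> exists2 s, `|s - t0| <= r / 2 &
    forall t, `|t - t0| <= r / 2 -> g eps (t, x) <= g eps (s, x).
  move=> [e0 ug _ _] hx.
  have win s : `|s - t0| <= r / 2 <-> t0 - r / 2 <= s <= t0 + r / 2.
    by rewrite ler_norml; split; clear => /andP[? ?]; apply/andP; split; lra.
  have inr y : rect (t0 - r / 2) (t0 + r / 2) x x y -> y.2 = x /\ `|y.1 - t0| <= r / 2.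
    case: y => y1 y2 [/=]; rewrite !in_itv /= => /win h1 h2; split => //.
    by apply/le_anti; rewrite andbC.
  have [||[s y2] /inr[/= -> hs] hm] := @usc_compact_max _ _ (rect (t0 - r / 2) (t0 + r / 2) x x)
    (g eps) (@compact_rect R _ _ _ _).
  - exists (t0, x); split; rewrite /= in_itv /= ?lexx//.
    by apply/win; rewrite subrr normr0 divr_ge0// ltW.
  - move=> y /inr[h1 h2]; apply: ug; first by apply: le_trans h2 _; move: r0; clear; lra.
    by rewrite h1; apply: le_trans hx _; move: rho0; clear; lra.
  by exists s => // t ht; apply: hm; split; rewrite /= in_itv /= ?lexx//; apply/win.
have anchP eps : anch eps !=set0 -> [/\ `|xget t0 (anch eps) - t0| <= r / 2, c2 <= mu eps &
    forall t, `|t - t0| <= r / 2 -> g eps (t, 0) <= mu eps].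
  by case=> s hs; have := @xgetPex _ t0 (anch eps) (ex_intro _ s hs).
(* The filter lets eps tend to 0 among anchored scales and leaves k entirely free, so the upper
   limit is also a supremum over time shifts. [bf_anchor], with the space estimate down to x = 0,
   makes it proper. *)
pose Fk (A : set (R * int)) : set R := [set eps | anch eps !=set0 -> forall k, A (eps, k)].
pose F : set_system (R * int) := [set A | (0 : R)^'+ (Fk A)].
have FF : Filter F.
  split; first by apply: (@filterS _ (0 : R)^'+ _ good (Fk setT)).
  - move=> A B; apply: (@filterS2 _ (0 : R)^'+ _ (Fk A) (Fk B) (Fk (A `&` B))).
    by move=> eps h1 h2 ha k; split; [exact: h1|exact: h2].
  - move=> A B AB; apply: (@filterS _ (0 : R)^'+ _ (Fk A) (Fk B)).
    by move=> eps h1 ha k; apply: AB; exact: h1.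
have F1 (P : R -> Prop) : (\forall eps \near (0 : R)^'+, P eps) -> F [set i | P i.1].
  by apply: (@filterS _ (0 : R)^'+ _ P (Fk [set i | P i.1])) => eps h _ k.
have F2 : F [set i | good i.1 /\ anch i.1 !=set0].
  by apply: (@filterS _ (0 : R)^'+ _ good (Fk [set i | good i.1 /\ anch i.1 !=set0])).
have rho2 : `|0 : R| <= rho / 2 by rewrite normr0 divr_ge0// ltW.
have PF : ProperFilter F.
  apply: Build_ProperFilter_ex => A FA.
  pose e := Num.min (rho / 2) ((c1 - c2) / (K + 1)).
  have K1 : 0 < K + 1 by rewrite ltr_wpDl.
  have e0 : 0 < e by rewrite lt_min !divr_gt0// subr_gt0.
  have nA : \forall eps \near (0 : R)^'+, good eps /\ (anch eps !=set0 -> forall k, A (eps, k)).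
    by move: ngood FA; apply: filterS2.
  have [eps [y [[ge hA] y1 y2 hy]]] := na _ _ e0 nA.
  exists (eps, 0%R); apply: hA.
  have [s hs hm] := rows eps 0 ge rho2.
  have e1 : e <= rho / 2 by rewrite ge_min lexx.
  have y2' := le_trans y2 e1.
  have y1' : `|y.1 - t0| <= r / 2.
    rewrite leNgt; apply/negP => h; have [_ _ og _] := ge.
    have := og y; rewrite y1 (ltW h) => /(_ isT).
    have h3 : `|y.2| <= rho by apply: le_trans y2' _; move: rho0; clear; lra.
    by move=> /(_ h3); move: hy c01; clear; lra.
  have cB : c0 <= Num.max c0 (g eps (s, 0)) by rewrite le_max lexx.
  have := slope eps 0 y.2 _ y.1 ge rho2 y2' cB _ y1'.
  rewrite -surjective_pairing subr0 => hsl.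
  have {}hsl : g eps y <= Num.max c0 (g eps (s, 0)) + K * `|y.2|.
    by apply: hsl => t ht; rewrite le_max hm ?orbT.
  have hKe : K * `|y.2| <= c1 - c2.
    apply: le_trans (_ : (K + 1) * e <= _).
      by apply: ler_pM => //; rewrite lerDl.
    by rewrite mulrC -ler_pdivlMr// ge_min lexx orbT.
  have hc2 : c2 <= Num.max c0 (g eps (s, 0)) by move: hsl hKe hy; clear; lra.
  exists s; split => //; move: hc2; rewrite le_max => /orP[|//].
  by move: c02; clear; lra.
(* Truncation at [c0] extends [g] to all times and keeps it upper semicontinuous, since [g] is at
   most [c0] near the ends of the window. *)
pose G eps y : R := if `|y.1 - t0| <= r then Num.max c0 (g eps y) else c0.
pose fam (i : R * int) y : R := (G i.1 (blow_map i.1 i.2 y) - mu i.1) / i.1.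
have G_ub eps y : good eps -> anch eps !=set0 -> `|y.2| <= rho / 2 ->
    G eps y <= mu eps + K * `|y.2|.
  move=> ge /anchP[_ hmu hm] y2.
  have c0m : c0 <= mu eps + K * `|y.2|.
    by apply: le_trans (ltW (lt_le_trans c02 hmu)) _; rewrite lerDl mulr_ge0.
  rewrite /G; case: ifP => // y1; rewrite ge_max c0m /=.
  have [y1'|y1'] := leP (`|y.1 - t0|) (r / 2).
    have := slope eps 0 y.2 (mu eps) y.1 ge rho2 y2 (ltW (lt_le_trans c02 hmu)) hm y1'.
    by rewrite -surjective_pairing subr0.
  apply: le_trans c0m; have [_ _ og _] := ge; apply: og; first by rewrite y1 ltW.
  by apply: le_trans y2 _; move: rho0; clear; lra.
pose x0 := Num.min (rho / 2) ((c2 - c0) / (K + 1) / 2).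
have K1 : 0 < K + 1 by rewrite ltr_wpDl.
have x00 : 0 < x0 by rewrite lt_min !divr_gt0// subr_gt0.
have x01 : x0 <= rho / 2 by rewrite ge_min lexx.
have x0K (x : R) : `|x| <= x0 -> K * `|x| <= (c2 - c0) / 2.
  move=> hx; apply: le_trans (_ : (K + 1) * x0 <= _).
    by apply: ler_pM => //; rewrite lerDl.
  rewrite mulrC -ler_pdivlMr// [_ / 2 / _]mulrAC.
  by rewrite ge_min lexx orbT.
have g_lb eps x : good eps -> anch eps !=set0 -> `|x| <= x0 ->
    exists2 s, `|s - t0| <= r / 2 & mu eps - K * `|x| <= g eps (s, x).
  move=> ge ha hx; have [hs hmu hm] := anchP _ ha.
  have [s s1 s2] := rows eps x ge (le_trans hx x01).
  exists s => //.
  have cB : c0 <= Num.max c0 (g eps (s, x)) by rewrite le_max lexx.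
  have := slope eps x 0 _ _ ge (le_trans hx x01) rho2 cB _ hs.
  rewrite sub0r normrN => hsl.
  have {}hsl : mu eps <= Num.max c0 (g eps (s, x)) + K * `|x|.
    by apply: hsl => t ht; rewrite le_max s2 ?orbT.
  have := x0K x hx; rewrite lerBlDr; apply: contraTT; rewrite -!ltNge => h3.
  have : Num.max c0 (g eps (s, x)) = c0 \/ Num.max c0 (g eps (s, x)) = g eps (s, x).
    by case: (leP c0 (g eps (s, x))); [right|left].
  by case=> h4; move: hsl h3; rewrite h4; move: hmu c02; clear; lra.
have g_time eps s t x : good eps -> `|x| <= rho / 2 -> t0 - r <= t -> t <= s -> s <= t0 + r / 2 ->
    g eps (s, x) <= g eps (t, x) + C' * (s - t).
  move=> [e0 ug _ jg] hx ht ts hs.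
  have bx s' x' : t <= s' <= t0 + r -> `|x' - x| <= rho / 2 -> `|s' - t0| <= r /\ `|x'| <= rho.
    move: hx ht ts hs; rewrite !ler_norml; clear => /andP[? ?] ? ? ? /andP[? ?] /andP[? ?].
    by split; apply/andP; split; lra.
  apply: (@time_growth _ (g eps) t (t0 + r) s x (rho / 2) C') => //.
  - by move: hs r0; clear; lra.
  - exact: divr_gt0.
  - move=> y [/=]; rewrite !in_itv /= => h1 h2.
    have [] := bx y.1 y.2 h1; last by move=> ? ?; exact: ug.
    by rewrite ler_norml; move: h2; clear => /andP[? ?]; apply/andP; split; lra.
  move=> s' x' a p /andP[h1 h2] h3 hj; have [|b1 b2] := bx s' x' _ (ltW h3).
    by rewrite !ltW.
  have := jg (s', x') a p b1 b2 hj; have := hC (s' / eps) (x' / eps) p => /=.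
  by rewrite /C'; have := ler_norm l; clear; lra.
have small (M d : R) : 0 <= M -> 0 < d -> F [set i | i.1 * M <= d].
  move=> M0 d0; have M1 : 0 < M + 1 by rewrite ltr_wpDl.
  have n1 : \forall eps \near (0 : R)^'+, 0 < eps /\ eps <= d / (M + 1).
    have n0 : \forall eps \near (0 : R)^'+, 0 < eps by exact: nbhs_right_gt.
    have n2 : \forall eps \near (0 : R)^'+, eps <= d / (M + 1).
      by apply: nbhs_right_le; rewrite divr_gt0.
    by move: n0 n2; apply: filterS2.
  apply: (filterS _ (F1 _ n1)) => i /= [i0]; rewrite ler_pdivlMr// => hi.
  by apply: le_trans hi; rewrite ler_pM2l// lerDl.
have G_usc eps y : good eps -> `|y.2| <= rho / 2 -> usc (G eps) y.
  move=> [e0 ug og _] y2; have rho4 : 0 < rho / 2 by rewrite divr_gt0.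
  have [y1|y1] := ltP (`|y.1 - t0|) r.
    apply: (@usc_near _ _ (fun y => Num.max c0 (g eps y))).
      apply/nbhs_boxP; exists (r - `|y.1 - t0|); first by rewrite subr_gt0.
      move=> x h1 _; rewrite /G ifT//.
      rewrite -[x.1](subrK y.1) -addrA; apply: le_trans (ler_normD _ _) _.
      by move: h1; clear; lra.
    apply: usc_maxr; first by apply: continuous_usc; exact: cvg_cst.
    by apply: ug; [exact: ltW|apply: le_trans y2 _; move: rho0; clear; lra].
  apply: (@usc_near _ _ (fun=> c0)); last by apply: continuous_usc; exact: cvg_cst.
  apply/nbhs_boxP; exists (Num.min (r / 2) (rho / 2)); first by rewrite lt_min !divr_gt0.
  move=> x h1 h2; rewrite /G; case: ifP => // hx; apply/esym/max_idPl; apply: og.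
    rewrite hx andbT; have : `|y.1 - t0| <= `|x.1 - t0| + `|x.1 - y.1|.
      by move: (ler_distD x.1 y.1 t0); rewrite [`|y.1 - x.1|]distrC; clear; lra.
    move: h1; rewrite le_min => /andP[h1 _]; move: h1 y1; clear; lra.
  have : `|x.2| <= `|x.2 - y.2| + `|y.2| by apply: le_trans (ler_normD _ _); rewrite subrK.
  by move: h2; rewrite le_min => /andP[_ h2]; move: h2 y2; clear; lra.
have fam_usc i y : good i.1 -> i.1 * `|y.2| <= rho / 2 -> usc (fam i) y.
  move=> ge hy; have [e0 _ _ _] := ge.
  rewrite (_ : fam i = fun y => i.1^-1 * G i.1 (blow_map i.1 i.2 y) + (- mu i.1 / i.1)).
    apply: uscD; last by apply: continuous_usc; exact: cvg_cst.
    apply: usc_scale; first by rewrite invr_ge0 ltW.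
    have uG : usc (G i.1) (blow_map i.1 i.2 y).
      by apply: G_usc => //=; rewrite normrM gtr0_norm.
    by move=> e1 e10; exact: iffLR (blow_map_near i.2 y _ e0) (uG e1 e10).
  by apply/funext => x; rewrite /fam mulrDl mulNr mulrC.
have F_ex (A : set (R * int)) : F A -> exists eps, [/\ good eps, anch eps !=set0 & forall k, A (eps, k)].
  move=> FA; have F3 : F [set i | [/\ good i.1, anch i.1 !=set0 & forall k, A (i.1, k)]].
    apply: (@filterS2 _ (0 : R)^'+ _ good (Fk A) (Fk _)) ngood FA.
    by move=> eps h1 h2 ha k; split => //; exact: h2.
  by have [i [h1 h2 h3]] := filter_ex F3; exists i.1.
have rho20 : 0 < rho / 2 by rewrite divr_gt0.
have box2 z y (d : R) : cbox z d y -> `|y.2| <= `|z.2| + d.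
  move=> [_ h]; have : `|y.2| <= `|y.2 - z.2| + `|z.2| by apply: le_trans (ler_normD _ _); rewrite subrK.
  by move: h; clear; lra.
have lb z : locbd F fam z.
  have z1 : 0 <= `|z.2| + 1 by rewrite addr_ge0.
  exists 1, (K * (`|z.2| + 1) + C'); split => //.
    move: F2 (small _ _ z1 rho20); apply: filterS2 => -[eps k] /= [ge ha] hs y hy.
    have [e0 _ _ _] := ge; have y2 := box2 _ _ _ hy.
    rewrite /fam ler_pdivrMr// lerBlDr.
    have hb : `|(blow_map eps k y).2| <= rho / 2.
      by rewrite /= normrM gtr0_norm//; apply: le_trans hs; rewrite ler_pM2l.
    apply: le_trans (G_ub _ _ ge ha hb) _.
    rewrite addrC lerD2r /= normrM gtr0_norm// mulrCA mulrC ler_pM2r//.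
    by apply: le_trans (_ : K * (`|z.2| + 1) <= _); [rewrite ler_wpM2l|rewrite lerDl].
  move=> x hx s [[A B] [/= hA hB] hs].
  have r2 : 0 < r / 2 by rewrite divr_gt0.
  have [eps [ge ha hk]] := F_ex _ (filterI hB (filterI (small _ _ z1 x00) (small _ _ ler01 r2))).
  have [e0 _ _ _] := ge; have x2 := box2 _ _ _ hx.
  have [_ [/= h1 h2]] := hk 0%R; rewrite mulr1 in h2.
  have ex0 : `|eps * x.2| <= x0.
    by rewrite normrM gtr0_norm//; apply: le_trans h1; rewrite ler_pM2l.
  have [s' hs' hg] := g_lb eps (eps * x.2) ge ha ex0.
  (* This shift places x at most one period before the time s' of the row maximum; in the original
     variables the delay is at most eps, and the growth in time costs C' eps. *)
  have [k /andP[k1 k2]] := int_shift x.1 (s' / eps - 1).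
  have [Bk _] := hk k; have := hs (x, (eps, k)) (conj (nbhs_singleton hA) Bk) => /=.
  apply: le_trans.
  pose t := eps * (x.1 + k%:~R).
  have t1 : s' - eps <= t.
    have : eps * (s' / eps - 1) <= t by rewrite ler_pM2l.
    by rewrite mulrBr mulr1 mulrC divfK ?gt_eqF.
  have t2 : t <= s'.
    have : t <= eps * (s' / eps - 1 + 1) by rewrite ler_pM2l.
    by rewrite subrK mulrC divfK ?gt_eqF.
  move: (hs'); rewrite ler_norml => /andP[s1 s2].
  have t3 : t0 - r <= t by move: t1 s1 h2; clear; lra.
  have s3 : s' <= t0 + r / 2 by move: s2; clear; lra.
  have gt := g_time eps s' t (eps * x.2) ge (le_trans ex0 x01) t3 t2 s3.
  have Gt : g eps (t, eps * x.2) <= G eps (blow_map eps k x).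
    rewrite /G ifT; first by rewrite /blow_map le_max lexx orbT.
    by rewrite ler_norml /blow_map /= -/t; move: t2 t3 s3 r0; clear => *; apply/andP; split; lra.
  rewrite /fam ler_pdivlMr// lerBrDr; apply: le_trans Gt.
  have h3 : C' * (s' - t) <= C' * eps by rewrite ler_wpM2l//; move: t1; clear; lra.
  have h4 : K * `|eps * x.2| <= K * (`|z.2| + 1) * eps.
    by rewrite normrM gtr0_norm// [eps * _]mulrC mulrA; apply: ler_wpM2r; [exact: ltW|exact: ler_wpM2l].
  have -> : - (K * (`|z.2| + 1) + C') * eps = - (K * (`|z.2| + 1) * eps) - C' * eps by ring.
  by move: gt hg h3 h4; move: (C' * (s' - t)) (K * (_ + 1) * eps) => u1 u2; clear; lra.
have pw t x : rsup F fam (t + 1, x) = rsup F fam (t, x).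
  have -> : (t + 1, x) = (t, x) + (1, 0) :> R * R by congr (_, _); rewrite /= ?addr0.
  apply: (@rsup_shift R _ F (fun i => (i.1, i.2 + 1)) (fun i => (i.1, i.2 - 1))).
  - by move=> [e k] /=; rewrite addrK.
  - by move=> [e k] /=; rewrite subrK.
  - by move=> A; apply: (@filterS _ (0 : R)^'+ _ (Fk A) (Fk _)) => e h ha k; exact: h.
  - by move=> A; apply: (@filterS _ (0 : R)^'+ _ (Fk A) (Fk _)) => e h ha k; exact: h.
  move=> [e k] y; rewrite /fam /blow_map /= addr0 intrD.
  by rewrite -[y.1 + 1 + _]addrA [1 + _]addrC.
apply: (Abar_le hH pw) => [z|z|z b q _ hj].
- exact: usc_rsup (lb z).
- have [d [M [d0 hM1 hM2]]] := lb z; exists (d / 2), (`|M|); split; first by rewrite divr_gt0.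
  move=> y yb; have yd : cbox z d y by apply: cbox_sub yb; move: d0; clear; lra.
  have d2 : 0 < d / 2 by rewrite divr_gt0.
  have ny : nbhs y (cbox z d).
    by apply: filterS (nbhs_cbox y d2) => x xb; apply: cbox_trans yb xb; lra.
  have ub : rsup F fam y <= M.
    apply: rsup_le; first exact: lb.
    exists (cbox z d, [set i | forall y, cbox z d y -> fam i y <= M]); first by split.
    by move=> [x i] /= [h1 h2]; exact: h2.
  have lbM : - M <= rsup F fam y.
    apply/ler_addgt0Pr => e e0; apply: (hM2 _ yd).
    by apply: rsup_near; [exact: lb|rewrite ltrDl].
  have := ler_norm M; rewrite ler_norml; move: ub lbM; clear => *; apply/andP; split; lra.
have ht : touching F fam z (rsup F fam z) b q by apply: rsup_touching (lb z) (qjet_sjet hj).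
have z1 : 0 <= `|z.2| + 1 by rewrite addr_ge0.
rewrite -lerBrDr; apply: (@touching_le _ _ F PF fam z _ b q _ ht).
  exists 1 => //; move: F2 (small _ _ z1 rho20); apply: filterS2 => i [ge ha] hs y hy.
  have [e0 _ _ _] := ge; apply: fam_usc => //; apply: le_trans hs.
  by rewrite ler_pM2l//; exact: box2.
move=> e e_gt0; have [d d0 hd] := ham_ucont hH `|q| e_gt0.
exists (Num.min 1 d); first by rewrite lt_min ltr01.
have m1 : Num.min 1 d <= 1 by rewrite ge_min lexx.
have m2 : Num.min 1 d <= d by rewrite ge_min lexx orbT.
have w2 : 0 <= `|rsup F fam z| + 2 by rewrite addr_ge0.
have c20 : 0 < c2 - c0 by rewrite subr_gt0.
move: F2 (small _ _ z1 rho20) (small _ _ w2 c20); apply: filterS3.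
move=> -[eps k] /= [ge ha] hs hs2 y b' q' hy _ hq hf [C1 hC1].
have [e0 ug og jg] := ge; have y2 := box2 _ _ _ (cbox_sub m1 hy).
set Y := blow_map eps k y.
have Y2 : `|Y.2| <= rho / 2.
  by rewrite /= normrM gtr0_norm//; apply: le_trans hs; rewrite ler_pM2l.
have Y2' : `|Y.2| <= rho by apply: le_trans Y2 _; move: rho0; clear; lra.
(* At [c0] or below the rescaled value would be at most (c0 - c2) / eps, while it is within 1 of the
   finite limit. The truncation is hence inactive near contacts. *)
have GY : c0 < G eps Y.
  rewrite ltNge; apply/negP => h.
  have : fam (eps, k) y <= - (`|rsup F fam z| + 2).
    rewrite /fam /= -/Y ler_pdivrMr// mulNr mulrC.
    have [_ hmu _] := anchP _ ha; move: hs2 h hmu; clear; lra.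
  have /ler_normlP[h1 _] := le_trans hf m1.
  by have := ler_norm (- rsup F fam z); rewrite normrN; move: h1; clear; lra.
have [Y1 gY] : `|Y.1 - t0| <= r /\ G eps Y = g eps Y.
  move: GY; rewrite /G; case: ifP => [h|_]; last by rewrite ltxx.
  by rewrite lt_max ltxx /= => h1; split => //; apply/max_idPr/ltW.
have Y1' : `|Y.1 - t0| < r / 2.
  rewrite ltNge; apply/negP => h; move: GY; rewrite gY ltNge => /negP; apply.
  by apply: og => //; rewrite h.
have nY : \forall x \near Y, `|x.1 - t0| <= r.
  apply/nbhs_boxP; exists (r / 2); first by rewrite divr_gt0.
  move=> x h1 _; rewrite -[x.1](subrK Y.1) -addrA; apply: le_trans (ler_normD _ _) _.
  by move: h1 Y1'; clear; lra.
have hjY : qjet (g eps) Y b' q'.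
  exists (C1 / eps); apply/(blow_map_near k y _ e0).
  move/(blow_map_near k y _ e0): nY => nY.
  move: nY hC1; apply: filterS2 => x x1 hx.
  have hG : g eps (blow_map eps k x) <= G eps (blow_map eps k x).
    by rewrite /G x1 le_max lexx orbT.
  apply: le_trans hG _; rewrite -gY.
  have fE x' : G eps (blow_map eps k x') = eps * fam (eps, k) x' + mu eps.
    by rewrite /fam /= mulrC divfK ?gt_eqF// subrK.
  have := ler_wpM2l (ltW e0) hx; rewrite fE /Y fE.
  set f1 := fam _ x; set f2 := fam _ y.
  have -> : eps * (f2 + lin y b' q' x + C1 * sqd y x) =
    eps * f2 + lin (blow_map eps k y) b' q' (blow_map eps k x)
      + C1 / eps * sqd (blow_map eps k y) (blow_map eps k x).
    by rewrite /lin /sqd /blow_map /=; field; rewrite gt_eqF.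
  by move: (lin _ _ _ _) (C1 / eps * _) => L S; clear; lra.
have := jg Y b' q' Y1 Y2' hjY.
have -> : Y.1 / eps = y.1 + k%:~R by rewrite /= mulrC mulKf ?gt_eqF.
have -> : Y.2 / eps = y.2 by rewrite /= mulrC mulKf ?gt_eqF.
rewrite pH => h1.
have [hy1 hy2] := cbox_sub m2 hy.
have /ler_normlP[_ h2] : `|H z.1 z.2 q - H y.1 y.2 q'| <= e.
  by apply: hd; rewrite // distrC//; exact: le_trans hq m2.
by move: h1 h2; clear; lra.
Qed.

End BlowUp.

(** * The flux limiter inequality for subsolutions *)

Section JunctionFlux.
Context {R : realType}.
Implicit Types (z y : R * R) (a b p q l eps : R) (w v : R * R -> R) (H : R -> R -> R -> R).

Lemma kink_le (pL pR : R) y : `|kink pL pR y| <= (`|pL| + `|pR|) * `|y.2|.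
Proof. by rewrite /kink; case: ifP => _; rewrite normrM ler_wpM2r// ?lerDl ?lerDr. Qed.

Lemma parabola_tangent (a M t0 : R) y x :
  a * (x.1 - t0) + M * (x.1 - t0) ^+ 2 <= a * (y.1 - t0) + M * (y.1 - t0) ^+ 2 +
    lin y (a + 2 * M * (y.1 - t0)) 0 x + `|M| * sqd y x.
Proof.
have h1 : 0 <= `|M| * (x.2 - y.2) ^+ 2 by rewrite mulr_ge0 ?sqr_ge0.
have h2 : M * (x.1 - y.1) ^+ 2 <= `|M| * (x.1 - y.1) ^+ 2.
  by rewrite ler_wpM2r ?sqr_ge0 ?ler_norm.
by move: h1 h2; rewrite /lin /sqd; move: (`|M|) => m; clear; lra.
Qed.

(** Subtracting a (t - t0) brings the level to - a. The parabola with coefficient 4 k / r pulls the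
    ends of the window down by more than the touching error k |t - t0|, at the price of a time slope
    at most 8 k <= e; [rho] is so small that the kink and the error in x weigh at most k r / 16. *)
Lemma junction_Abar H (U : R -> R * R -> R) (t0 f0 a pL pR r0 : R) : hamiltonian H -> A1 H ->
  0 < r0 -> (\forall eps \near (0 : R)^'+, forall y, cbox (t0, 0) r0 y -> usc (U eps) y) ->
  (\forall eps \near (0 : R)^'+, qsub (cbox (t0, 0) r0) (hscale H eps) 0 (U eps)) ->
  touching (0 : R)^'+ (fun eps y => U eps y - kink pL pR y) (t0, 0) f0 a 0 -> Abar H <= - a.
Proof.
move=> hH pH r00 us qs [ht1 ht2]; apply/ler_addgt0Pr => e e0.
pose k := Num.min r0 (e / 8).
have k0 : 0 < k by rewrite lt_min r00 divr_gt0.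
have kr0 : k <= r0 by rewrite ge_min lexx.
have ke : 8 * k <= e.
  have : k <= e / 8 by rewrite ge_min lexx orbT.
  by clear; lra.
clearbody k.
have [r /andP[r_gt0 rk] hr] := ht1 k k0.
have kr : 0 < k * r by exact: mulr_gt0.
pose P := `|pL| + `|pR|; have P0 : 0 <= P by rewrite addr_ge0.
have Pk : 0 < P + k by rewrite ltr_wpDl.
pose rho := Num.min r (k * r / 16 / (P + k)).
have rho0 : 0 < rho by rewrite lt_min r_gt0 !divr_gt0.
have rhor : rho <= r by rewrite ge_min lexx.
have rhoP (x : R) : `|x| <= rho -> (P + k) * `|x| <= k * r / 16.
  by rewrite le_min => /andP[_]; rewrite ler_pdivlMr// mulrC.
clearbody rho.
pose g eps y := U eps y - (a * (y.1 - t0) + 4 * k / r * (y.1 - t0) ^+ 2).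
have inbox y : `|y.1 - t0| <= r -> `|y.2| <= rho -> cbox (t0, 0) r y.
  by move=> h1 h2; split => //=; rewrite subr0 (le_trans h2).
have sub0 y : cbox (t0, 0) r y -> cbox (t0, 0) r0 y by apply: cbox_sub; exact: le_trans kr0.
apply: (@blowup_Abar R H (- a + e) t0 r rho (f0 - 3 * (k * r) / 8) (f0 - k * r / 4) g) => //.
split => //.
- by move: kr; clear; lra.
- apply: filterS us => eps hu y h1 h2; apply: uscD; first exact/hu/sub0/inbox.
  apply: continuous_usc; apply: cvgN; apply: cvgD; apply: cvgM; try exact: cvg_cst.
    by apply: cvgB; [exact: continuous_coord1|exact: cvg_cst].
  apply: (@continuous_at_sqr _ _ (fun y : R * R => y.1 - t0)).
  by apply: cvgB; [exact: continuous_coord1|exact: cvg_cst].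
- have e1 : 0 < k * r / 16 by rewrite divr_gt0.
  apply: filterS (hr _ e1) => eps hu y /andP[h1 h2] h3.
  have := hu y (inbox y h2 h3); have := kink_le pL pR y; rewrite ler_norml => /andP[_ hk].
  have := rhoP _ h3; rewrite /g /lin /nrm1 /= mul0r addr0 subr0.
  have hsq : 2 * k * `|y.1 - t0| <= 4 * k / r * (y.1 - t0) ^+ 2.
    rewrite -(real_normK (num_real (y.1 - t0))); move: (`|y.1 - t0|) h1 => s h1.
    have -> : 4 * k / r * s ^+ 2 = 2 * k * s * (2 * s / r) by field; rewrite gt_eqF.
    have s0 : 0 <= s by move: h1 r_gt0; clear; lra.
    rewrite ler_peMr ?mulr_ge0// ?(ltW k0)// ler_pdivlMr// mul1r.
    by move: h1; clear; lra.
  have h5 : k * r <= k * (2 * `|y.1 - t0|) by rewrite ler_pM2l//; move: h1; clear; lra.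
  move: hk hsq h5; rewrite -/P; clearbody P; move: (4 * k / r * _) (a * _) => A2 A3.
  by clear; lra.
- apply: filterS qs => eps hq y b q h1 h2 hj; have yb := inbox y h1 h2.
  have hjU : qjet (U eps) y (b + (a + 2 * (4 * k / r) * (y.1 - t0))) q.
    have := @qjetD _ (g eps) (fun y => a * (y.1 - t0) + 4 * k / r * (y.1 - t0) ^+ 2) y b q
      (a + 2 * (4 * k / r) * (y.1 - t0)) 0 `|4 * k / r| _ hj.
    move=> hjD; apply: qjet_eq (hjD _); rewrite ?addr0//; first by move=> x; rewrite /g subrK.
    by apply/nbhs_boxP; exists 1 => // x _ _; exact: parabola_tangent.
  have := hq y _ _ (sub0 _ yb) hjU; rewrite /hscale.
  have : - (8 * k) <= 2 * (4 * k / r) * (y.1 - t0).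
    have -> : 2 * (4 * k / r) * (y.1 - t0) = 8 * k * ((y.1 - t0) / r) by field; rewrite gt_eqF.
    have : -1 <= (y.1 - t0) / r.
      by rewrite ler_pdivlMr// mulN1r; move: h1; rewrite ler_norml => /andP[].
    by move: k0; clear; move: (_ / r) => s k0 hs; nra.
  by move: ke; clear; lra.
move=> A e2 e20 FA.
pose Q := 1 + P + `|a| + 4 * k; have Q0 : 0 < Q.
  by rewrite /Q; move: P0 k0 (normr_ge0 a); clear; lra.
pose e' := Num.min (Num.min e2 r) (k * r / 4 / Q).
have e'0 : 0 < e' by rewrite !lt_min e20 r_gt0 !divr_gt0.
have [eps [y [Ae [y1 y2] hy]]] := ht2 e' A e'0 FA.
have e'1 : e' <= e2 by rewrite !ge_min lexx.
have e'2 : e' <= r by rewrite !ge_min lexx orbT.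
have e'3 : Q * e' <= k * r / 4 by rewrite mulrC -ler_pdivlMr// ge_min lexx orbT.
clearbody e'; rewrite /= subr0 in y1 y2.
exists eps, y; split => //; [exact: le_trans e'2|exact: le_trans e'1|].
have := kink_le pL pR y; rewrite ler_norml -/P => /andP[hk _].
have hk2 : P * `|y.2| <= P * e' by rewrite ler_wpM2l.
have ha : a * (y.1 - t0) <= `|a| * e'.
  by apply: le_trans (ler_norm _) _; rewrite normrM ler_wpM2l.
have hs : 4 * k / r * (y.1 - t0) ^+ 2 <= 4 * k * e'.
  rewrite -(real_normK (num_real (y.1 - t0))) expr2.
  have h1 : `|y.1 - t0| * `|y.1 - t0| <= r * e' by apply: ler_pM => //; exact: le_trans e'2.
  have k4 : 0 <= 4 * k / r by rewrite divr_ge0 ?mulr_ge0// ltW.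
  apply: le_trans (ler_wpM2l k4 h1) _; rewrite mulrA divfK ?gt_eqF//.
move: hk hk2 ha hs e'3 hy; rewrite /g /Q; clearbody P.
move: (4 * k / r * _) (a * _) (`|a|) => B1 B2 B3.
by clear; lra.
Qed.

End JunctionFlux.

(** * The junction condition: supersolution side *)

Section SubsolutionGrowth.
Context {R : realType}.
Implicit Types (z y : R * R) (a b p q l eps : R) (w v : R * R -> R) (H : R -> R -> R -> R).

Lemma periodic1_osc H l w : hamiltonian H -> periodic1 w -> (forall z, usc w z) ->
  qsub setT H l w -> exists C K : R, [/\ 0 <= C, 0 <= K &
    forall s x t y : R, w (s, x) <= w (t, y) + C + K * `|x - y|].
Proof.
move=> hH pw uw hw.
have [K0 hK0] := ham_co hH (`|l| + 1); have [C0 C00 hC] := ham_lb hH.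
have Ct : 0 <= `|l| + C0 by rewrite addr_ge0.
exists (`|l| + C0), `|K0|; split=> // s x t y.
have [t0 ht0] : exists t0, w (s, x) <= w (t0, y) + `|K0| * `|x - y|.
  apply: (@space_growth R w `|K0| y x s) => // z p hj; rewrite leNgt; apply/negP => hp.
  have hp' : K0 <= `|p| by apply: le_trans (ler_norm _) (ltW hp).
  have := hw z 0 p Logic.I hj; have := hK0 p hp' z.1 z.2; have := ler_norm l.
  by clear; lra.
have [k /andP[k1 k2]] := int_shift t (t0 - 1); rewrite subrK in k2.
have : w (t0, y) <= w (t + k%:~R, y) + (`|l| + C0) * (t0 - (t + k%:~R)).
  apply: (@time_growth R w (t + k%:~R) (t0 + 1) t0 y 1) => //; first by lra.
  move=> s' x' a p _ _ hj; have := hw _ a p Logic.I hj; have := hC s' x' p.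
  by have := ler_norm l; rewrite /=; clear; lra.
rewrite pw => h.
have : (`|l| + C0) * (t0 - (t + k%:~R)) <= `|l| + C0.
  by rewrite ler_piMr//; move: k1; clear; lra.
by move: ht0 h; move: ((`|l| + C0) * (t0 - _)) (`|K0| * _) => A1 A2; clear; lra.
Qed.

Lemma qjet_scale w eps y a q : 0 < eps ->
  qjet (fun y : R * R => eps * w (y.1 / eps, y.2 / eps)) y a q -> qjet w (y.1 / eps, y.2 / eps) a q.
Proof.
move=> e0; set x := (_ / eps, _ / eps); have bE x' : ((blow_map eps 0 x').1 / eps, (blow_map eps 0 x').2 / eps) = x'.
  by rewrite /blow_map /= addr0 ![eps * _]mulrC !mulfK ?gt_eqF// -surjective_pairing.
have -> : y = blow_map eps 0 x.
  by rewrite /blow_map /x /= addr0 ![eps * _]mulrC !divfK ?gt_eqF// -surjective_pairing.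
move=> [C hC]; exists (eps * C).
apply: filterS (iffLR (blow_map_near 0 x _ e0) hC) => x'; rewrite !bE => hx.
rewrite -(ler_pM2l e0); apply: le_trans hx _.
by rewrite le_eqVlt; apply/orP; left; apply/eqP; rewrite /lin /sqd /blow_map /= !addr0; ring.
Qed.

Lemma qsub_scale H l w eps Om : 0 < eps -> qsub setT H l w ->
  qsub Om (hscale H eps) l (fun y => eps * w (y.1 / eps, y.2 / eps)).
Proof. by move=> e0 hw z a q _ /(qjet_scale e0)/hw; apply. Qed.

Lemma usc_rescale w eps y : 0 < eps -> (forall z, usc w z) ->
  usc (fun y : R * R => eps * w (y.1 / eps, y.2 / eps)) y.
Proof.
move=> e0 uw; apply: usc_scale; first exact: ltW.
apply: (@usc_comp R _ _ w (fun y : R * R => (y.1 / eps, y.2 / eps))); last exact: uw.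
by apply: continuous_div; rewrite gt_eqF.
Qed.

(** The blow-down eps w (t / eps, x / eps) has a relaxed limit [W] that does not depend on time, is
    at most 0 at x = 0, and satisfies the effective equation on the right, so its slopes are at most
    q and W (0, 1) <= q. Reading this at eps = 1 / y gives the bound for large y; the oscillation
    estimate covers bounded y and all times. *)
Lemma sub_growth H h l (q dl : R) w : hamiltonian H -> effective_right H h ->
  periodic1 w -> (forall z, usc w z) -> qsub setT H l w ->
  (forall p, h p <= l -> p <= q) -> 0 < dl ->
  exists C, forall t y : R, 0 <= y -> w (t, y) <= C + (q + dl) * y.
Proof.
move=> hH hh pw uw hw hq dl0.
have [C [K [C0 K0 hCK]]] := periodic1_osc hH pw uw hw.
pose U eps y : R := eps * w (y.1 / eps, y.2 / eps).
have F1 : \forall eps \near (0 : R)^'+, 0 < eps by exact: nbhs_right_gt.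
have osc eps (s x t y : R) : 0 < eps -> U eps (s, x) <= U eps (t, y) + eps * C + K * `|x - y|.
  move=> e0; have := hCK (s / eps) (x / eps) (t / eps) (y / eps).
  rewrite -mulrBl normrM normfV (gtr0_norm e0) => h1.
  have := ler_wpM2l (ltW e0) h1; rewrite /U /= !mulrDr.
  have -> : eps * (K * (`|x - y| / eps)) = K * `|x - y| by field; rewrite gt_eqF.
  by [].
have lb z : locbd (0 : R)^'+ U z.
  pose M := `|w (0, 0)| + C + K * (`|z.2| + 1).
  apply: (@locbd_bounded R _ _ _ U z 1 M) => //.
  have F2 : \forall eps \near (0 : R)^'+, eps <= 1 by apply: nbhs_right_le.
  move: F1 F2; apply: filterS2 => eps e0 e1 y [_ hy].
  have U0 : `|U eps (0, 0)| <= `|w (0, 0)|.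
    by rewrite /U !mul0r normrM gtr0_norm// ler_piMl.
  have y2 : `|y.2| <= `|z.2| + 1.
    by move: hy (ler_distD z.2 y.2 0); rewrite !subr0; clear; lra.
  have h1 := osc eps y.1 y.2 0 0 e0; have h2 := osc eps 0 0 y.1 y.2 e0.
  rewrite -surjective_pairing ?subr0 ?sub0r ?normrN in h1 h2.
  have h3 : eps * C <= C by rewrite ler_piMl.
  have h4 : K * `|y.2| <= K * (`|z.2| + 1) by rewrite ler_wpM2l.
  move: U0 h1 h2 h3 h4; rewrite /M !ler_norml; move: (K * _) (K * _) => A1 A2.
  by clear => /andP[? ?] *; apply/andP; split; lra.
pose W := rsup (0 : R)^'+ U.
have eC (e : R) : 0 < e -> \forall eps \near (0 : R)^'+, 0 < eps /\ eps * C <= e.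
  move=> e0; have C1 : 0 < C + 1 by rewrite ltr_wpDl.
  have F2 : \forall eps \near (0 : R)^'+, eps <= e / (C + 1).
    by apply: nbhs_right_le; rewrite divr_gt0.
  move: F1 F2; apply: filterS2 => eps e1; rewrite ler_pdivlMr// => he; split => //.
  by apply: le_trans he; rewrite ler_pM2l// lerDl.
have W_osc (s x t y : R) : W (s, x) <= W (t, y) + K * `|x - y|.
  apply/ler_addgt0Pr => e e0; have e3 : 0 < e / 3 by lra.
  have [[A B] /= [hA hB] hs] : \forall y' \near (t, y) & eps \near (0 : R)^'+, U eps y' <= W (t, y) + e / 3.
    by apply: rsup_near; [exact: lb|rewrite ltrDl].
  have Kp : 0 < K + 1 by rewrite ltr_wpDl.
  apply: rsup_le => //.
  exists ([set x' | `|x'.2 - x| <= e / 3 / (K + 1)], B `&` [set eps | 0 < eps /\ eps * C <= e / 3]) => /=.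
    split; last by apply: filterI => //; exact: eC.
    by apply/nbhs_boxP; exists (e / 3 / (K + 1)) => //; rewrite divr_gt0.
  move=> [[s' x'] eps] /= [hx [Be [eps0 heps]]].
  have := hs ((t, y), eps) (conj (nbhs_singleton hA) Be) => /=.
  have := osc eps s' x' t y eps0.
  have h1 : K * `|x' - y| <= K * `|x - y| + e / 3.
    have : `|x' - y| <= `|x' - x| + `|x - y| by exact: ler_distD.
    move: hx; rewrite ler_pdivlMr// => h2 /(ler_wpM2l K0).
    have : `|x' - x| * K <= `|x' - x| * (K + 1) by rewrite ler_wpM2l// lerDl.
    by move: h2; clear; lra.
  by move: heps h1; clear; lra.
have W0 (t : R) : W (t, 0) <= 0.
  apply/ler_addgt0Pr => e e0; rewrite add0r; have e3 : 0 < e / 3 by lra.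
  apply: rsup_le => //.
  have Kp : 0 < K + 1 by rewrite ltr_wpDl.
  have F2 : \forall eps \near (0 : R)^'+, eps * `|w (0, 0)| <= e / 3.
    have C1 : 0 < `|w (0, 0)| + 1 by rewrite ltr_wpDl.
    have F3 : \forall eps \near (0 : R)^'+, eps <= e / 3 / (`|w (0, 0)| + 1).
      by apply: nbhs_right_le; rewrite divr_gt0.
    move: F1 F3; apply: filterS2 => eps e1; rewrite ler_pdivlMr// => he.
    by apply: le_trans he; rewrite ler_pM2l// lerDl.
  exists ([set x' | `|x'.2| <= e / 3 / (K + 1)], [set eps | 0 < eps /\ eps * C <= e / 3] `&` [set eps | eps * `|w (0, 0)| <= e / 3]) => /=.
    split; last by apply: filterI => //; exact: eC.
    apply/nbhs_boxP; exists (e / 3 / (K + 1)) => [|x' _]; first by rewrite divr_gt0.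
    by rewrite /= subr0.
  move=> [[s' x'] eps] /= [hx [[eps0 heps] hw0]].
  have := osc eps s' x' 0 0 eps0; rewrite subr0.
  have h1 : K * `|x'| <= e / 3.
    by move: hx; rewrite ler_pdivlMr// mulrC; apply: le_trans; rewrite ler_wpM2r// lerDl.
  have h2 : U eps (0, 0) <= e / 3.
    by apply: le_trans hw0; rewrite /U !mul0r ler_pM2l// ler_norm.
  by move: heps h1 h2; clear; lra.
have uW z : usc W z by exact: usc_rsup.
have jW z (p : R) : 0 < z.2 -> qjet W z 0 p -> p <= q.
  move=> z0 hj; apply: hq; rewrite -[h p]add0r.
  apply: (hh U z 1 l (W z) 0 p) => //.
  - by apply: filterS F1 => eps e0 y _; exact: usc_rescale.
  - by apply: filterS F1 => eps e0; exact: qsub_scale.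
  by apply: rsup_touching => //; exact: qjet_sjet.
(* [space_growth_right] takes a nonnegative slope bound; the tilt turns q into q + |q|. *)
pose f y := W y + `|q| * y.2.
have W1 : W (0, 1) <= q.
  have uf z : usc f z.
    apply: uscD => //; apply: continuous_usc.
    by apply: cvgM; [exact: cvg_cst|exact: continuous_coord2].
  have pf : periodic1 f.
    move=> k t x; rewrite /f /=; congr (_ + _).
    by apply/le_anti/andP; split; have := W_osc (t + k%:~R) x t x; have := W_osc t x (t + k%:~R) x;
      rewrite subrr normr0 mulr0 !addr0.
  have qp : 0 <= q + `|q| by rewrite -lerBlDl sub0r -normrN ler_norm.
  have [|t0] := @space_growth_right R f (q + `|q|) 0 1 0 qp ler01 pf uf.
    move=> z p z0 hj; rewrite -lerBlDr; apply: (jW z) => //.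
    have := @qjetD R f (fun y => - (`|q| * y.2)) z 0 p 0 (- `|q|) 0 _ hj.
    move=> hjD; apply: qjet_eq (hjD _); rewrite ?addr0//; first by move=> x; rewrite /f addrK.
    by apply/nbhs_boxP; exists 1 => // x _ _; rewrite /lin; lra.
  by rewrite /f /= mulr0 mulr1 addr0 subr0 mulr1; have := W0 t0; clear; lra.
have : W (0, 1) < q + dl by apply: le_lt_trans W1 _; rewrite ltrDl.
move=> /(rsup_near (lb _)) [[A B] /= [/nbhs_singleton hA hB] hs].
have [e0 e00 he0] : exists2 e0, 0 < e0 & forall eps, 0 < eps <= e0 -> B eps.
  move: hB; rewrite /at_right /within /= => /nbhs_ballP[d d0 hd].
  exists (d / 2); first by rewrite divr_gt0.
  move=> eps /andP[e1 e2]; apply: hd => //.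
  by rewrite /ball /= sub0r normrN gtr0_norm//; move: d0 e2 => /= d0 e2; lra.
pose Y := e0^-1; have Y0 : 0 < Y by rewrite invr_gt0.
have far (y : R) : Y <= y -> w (0, y) <= (q + dl) * y.
  move=> hy; have y0 : 0 < y by exact: lt_le_trans hy.
  have By : B y^-1.
    by apply: he0; rewrite invr_gt0 y0/= -[e0]invrK lef_pV2 ?posrE ?invr_gt0.
  have := hs ((0, 1), y^-1) (conj hA By); rewrite /= /U /= mul0r mul1r invrK.
  by rewrite mulrC ler_pdivrMr.
pose M := `|w (0, 0)| + C + K * Y + `|q + dl| * Y.
exists (C + M) => t y y0.
have h0 : w (t, y) <= w (0, y) + C by have := hCK t y 0 y; rewrite subrr normr0 mulr0 addr0.
have M0 : 0 <= M.
  by rewrite /M !addr_ge0// mulr_ge0// ltW.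
have [yY|Yy] := leP Y y.
  by have := far y yY; move: h0 M0; clear; lra.
have h1 : w (0, y) <= M - `|q + dl| * Y.
  have := hCK 0 y 0 0; rewrite subr0 (ger0_norm y0) /M addrK.
  have : K * y <= K * Y by rewrite ler_wpM2l// ltW.
  by have := ler_norm (w (0, 0)); move: (K * y) (K * Y) => A1 A2; clear; lra.
have h2 : - (`|q + dl| * Y) <= (q + dl) * y.
  have : `|(q + dl) * y| <= `|q + dl| * Y by rewrite normrM (ger0_norm y0) ler_wpM2l// ltW.
  by rewrite ler_norml => /andP[].
by move: h0 h1 h2; clear; lra.
Qed.

End SubsolutionGrowth.

(** * Critical slopes and concave corrections *)

Section CriticalSlopes.
Context {R : realType}.
Implicit Types (z y : R * R) (a b p q l eps eta : R) (w v : R * R -> R) (H : R -> R -> R -> R) (h : R -> R).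

Lemma ham_scale H eps : 0 < eps -> hamiltonian H -> hamiltonian (hscale H eps).
Proof.
move=> e0 [h1 h2 h3 h4]; split.
- by move=> K; have [M hM] := h1 K; exists M => t x p; exact: hM.
- by move=> M; have [K hK] := h2 M; exists K => q hq t x; exact: hK.
- move=> K e e1; have [d d0 hd] := h3 K e e1; exists (Num.min d (d * eps)).
    by rewrite lt_min d0 mulr_gt0.
  move=> t x y p q hp; rewrite !le_min => /andP[_ hx] /andP[hq _]; apply: hd => //.
  by rewrite -mulrBl normrM normfV (gtr0_norm e0) ler_pdivrMr.
move=> e e1; have [d d0 hd] := h4 e e1; exists (d * eps); first exact: mulr_gt0.
move=> t s x p hts; apply: hd.
rewrite -mulrBl normrM normfV (gtr0_norm e0) mulrAC ler_pdivrMr//.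
Qed.

Lemma ham_refl H : hamiltonian H -> hamiltonian (hrefl H).
Proof.
move=> [h1 h2 h3 h4]; split.
- by move=> K; have [M hM] := h1 K; exists M => t x p hp; apply: hM; rewrite normrN.
- by move=> M; have [K hK] := h2 M; exists K => q hq t x; apply: hK; rewrite normrN.
- move=> K e e1; have [d d0 hd] := h3 K e e1; exists d => // t x y p q hp hx hq.
  by apply: hd; rewrite ?normrN// -opprD normrN.
by move=> e e1; have [d d0 hd] := h4 e e1; exists d => // t s x p; exact: hd.
Qed.

Lemma qsub_refl H l w : qsub setT H l w -> qsub setT (hrefl H) l (fun y => w (refl y)).
Proof.
move=> hw z a q _ hj; have : qjet w (refl z) a (- q).
  apply: qjet_reflect; rewrite -/(refl (refl z)) reflK.
  by apply: qjet_eq hj.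
by move=> /hw; apply.
Qed.

Lemma crit_slope h (p0 l : R) : limit_hamiltonian h -> h p0 < l ->
  exists m, [/\ p0 <= m, h m = l & forall p, h p <= l -> p <= m].
Proof.
move=> hh hl; pose S := [set p | h p <= l].
have [K hK] := lham_co hh (l + 1).
have Sb p : S p -> p <= `|K|.
  rewrite /S /= => hp; rewrite leNgt; apply/negP => h1.
  have : K <= `|p| by apply: le_trans (ler_norm K) (le_trans (ltW h1) (ler_norm p)).
  by move=> /hK; move: hp; clear; lra.
have hS : has_sup S by split; [exists p0; exact: ltW|exists `|K| => p; exact: Sb].
have Sub p : S p -> p <= reals.sup S by move=> hp; apply: sup_upper_bound.
exists (reals.sup S); split => //; first by apply: Sub; exact: ltW.
apply/le_anti/andP; split; apply/ler_addgt0Pr => e e0;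
  have [d d0 hd] := lham_cont hh (reals.sup S) e0.
  have [p hp hpS] := sup_adherent d0 hS.
  have /ler_normlP[h1 _] : `|h p - h (reals.sup S)| <= e.
    by apply: hd; rewrite distrC ger0_norm ?subr_ge0 ?Sub//; move: hpS; clear; lra.
  by move: hp h1; rewrite /S /=; clear; lra.
have /ler_normlP[_ h1] : `|h (reals.sup S + d) - h (reals.sup S)| <= e.
  by apply: hd; rewrite addrAC subrr add0r ger0_norm// ltW.
rewrite leNgt; apply/negP => h2.
have : S (reals.sup S + d) by rewrite /S /=; move: h1 h2; clear; lra.
by move=> /Sub; move: d0; clear; lra.
Qed.

Definition hinges (DL DR eta : R) y : R :=
  DR * (eta - hinge eta (Num.max y.2 0)) + DL * (eta - hinge eta (Num.max (- y.2) 0)).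

Lemma hinges_right DL DR eta y : 0 < eta -> 0 <= y.2 ->
  hinges DL DR eta y = DR * (eta - hinge eta y.2).
Proof.
move=> e0 y0; rewrite /hinges (max_idPl y0) (_ : Num.max (- y.2) 0 = 0).
  by rewrite hinge0// subrr mulr0 addr0.
by apply/max_idPr; rewrite oppr_le0.
Qed.

Lemma hinges_left DL DR eta y : 0 < eta -> y.2 <= 0 ->
  hinges DL DR eta y = DL * (eta - hinge eta (- y.2)).
Proof.
move=> e0 y0; rewrite /hinges (max_idPr y0) (_ : Num.max (- y.2) 0 = - y.2).
  by rewrite hinge0// subrr mulr0 add0r.
by apply/max_idPl; rewrite oppr_ge0.
Qed.

Lemma continuous_hinges DL DR eta : continuous (hinges DL DR eta).
Proof.
have cm (f : R * R -> R) : continuous f -> continuous (fun y => hinge eta (Num.max (f y) 0)).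
  move=> cf y; apply: (@continuous_comp _ _ _ (fun y => Num.max (f y) 0) (hinge eta)).
    by apply: (@continuous_max R _ (fun y => f y : R^o) (fun=> 0) y); [exact: cf|exact: cvg_cst].
  exact: continuous_hinge.
move=> y; apply: cvgD; apply: cvgM; try exact: cvg_cst; apply: cvgB; try exact: cvg_cst.
  by apply: cm; exact: continuous_coord2.
by apply: cm => x; apply: cvgN; exact: continuous_coord2.
Qed.

(* Concave corrections of the test function, steepest at the junction, raise its
   slopes there to qL and qR; contacts off the junction are excluded because the
   slopes in between lie below the level of the equation. *)
Lemma lift_slopes V hL hR (t0 b l pL pR qL qR d : R) :
  (\forall y \near (t0, (0 : R)), usc V y) ->
  (\forall y \near (t0, (0 : R)), 0 < y.2 -> forall a q, qjet V y a q -> a + hoppo hR q <= 0) ->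
  (\forall y \near (t0, (0 : R)), y.2 < 0 -> forall a q, qjet V y a q -> a + hoppo hL q <= 0) ->
  sjet (fun y => V y + kink pL pR y) (t0, 0) (- b) 0 ->
  l < - b -> 0 < d -> qL <= pL -> pR <= qR ->
  (forall p, pR - d <= p <= qR + d -> hR p <= l) ->
  (forall p, qL - d <= p <= pL + d -> hL p <= l) ->
  forall e, 0 < e -> exists t1 b1 k, [/\ `|t1 - t0| <= e, `|b1 - b| <= e, `|k| <= e &
    qjet (fun y => V y + kink (qL - k) (qR - k) y) (t1, 0) (- b1) 0].
Proof.
move=> us sR sL hj lb d0 qpL qpR hhR hhL e e0; set z0 := (t0, 0) in us sR sL hj.
pose DR := qR - pR; have DR0 : 0 <= DR by rewrite subr_ge0.
pose DL := pL - qL; have DL0 : 0 <= DL by rewrite subr_ge0.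
pose f eta y := V y + (kink pL pR y + hinges DL DR eta y).
have F0 : \forall eta \near (0 : R)^'+, 0 < eta by exact: nbhs_right_gt.
have uf : \forall y \near z0, forall eta, usc (f eta) y.
  apply: filterS us => y uy eta; apply: uscD => //; apply: continuous_usc.
  by apply: cvgD; [exact: continuous_kink|exact: continuous_hinges].
have D1 : 0 < DR + DL + 1 by exact: ltr_wpDl (addr_ge0 DR0 DL0) ltr01.
have ht : touching (0 : R)^'+ f z0 (V z0) (- b) 0.
  split; last first.
    move=> e' A e'0 FA.
    have /filter_ex[eta [Ae eta0]] : \forall eta \near (0 : R)^'+, A eta /\ 0 < eta.
      by move: FA F0; apply: filterS2.
    exists eta, z0; split => //; first exact/cbox_center/ltW.
    by rewrite /f kink0 add0r hinges_right// hinge0// subrr mulr0 addr0 lerBlDr lerDl ltW.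
  move=> k k0; have /nbhs_boxP[r r0 hr] := hj k k0.
  exists (Num.min r k); first by rewrite lt_min r0 k0 ge_min lexx orbT.
  move=> e' e'0.
  have F2 : \forall eta \near (0 : R)^'+, eta <= e' / (DR + DL + 1).
    by apply: nbhs_right_le; rewrite divr_gt0.
  move: F0 F2; apply: filterS2 => eta eta0; rewrite ler_pdivlMr// => he y [y1 y2].
  have m : Num.min r k <= r by rewrite ge_min lexx.
  have := hr y (le_trans y1 m) (le_trans y2 m); rewrite kink0 addr0 => h1; rewrite /f addrA.
  apply: le_trans (_ : V y + kink pL pR y + e' <= _); last by rewrite lerD2r.
  rewrite lerD2l /hinges; apply: le_trans he.
  have h2 x : eta - hinge eta x <= eta.
    by have := hinge_ge x eta0; rewrite ge_max => /andP[? _]; rewrite lerBlDr lerDl.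
  have := ler_wpM2l DR0 (h2 (Num.max y.2 0)); have := ler_wpM2l DL0 (h2 (Num.max (- y.2) 0)).
  by move: (DR * (_ - _)) (DL * (_ - _)) => A1 A2; move: eta0; clear; nra.
have /nbhs_boxP[r r0 hr] : \forall y \near z0,
    (0 < y.2 -> forall a q, qjet V y a q -> a + hoppo hR q <= 0) /\
    (y.2 < 0 -> forall a q, qjet V y a q -> a + hoppo hL q <= 0).
  by move: sR sL; apply: filterS2.
pose e' := Num.min (Num.min e r) (Num.min d ((- b - l) / 2)).
have e'0 : 0 < e' by rewrite !lt_min e0 r0 d0 divr_gt0// subr_gt0.
have [eta [z1 [a1 [p1 [eta0 z1b [ha hp] _ hjf]]]]] : exists eta z1 a1 p1,
    [/\ 0 < eta, cbox z0 e' z1, `|a1 - - b| <= e' /\ `|p1 - 0| <= e', `|f eta z1 - V z0| <= e' & qjet (f eta) z1 a1 p1].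
  apply: (touching_qjet ht) => //.
  have /nbhs_boxP[r' r'0 hr'] := uf; exists r' => //.
  by apply: nearW => eta y [y1 y2]; exact: hr'.
have e1 : e' <= e by rewrite !ge_min lexx.
have e2 : e' <= r by rewrite !ge_min lexx orbT.
have e3 : e' <= d by rewrite !ge_min lexx !orbT.
have e4 : e' <= (- b - l) / 2 by rewrite !ge_min lexx !orbT.
clearbody e'; rewrite opprK in ha; rewrite subr0 in hp.
have al : l < a1.
  by move: ha e4 lb; rewrite ler_norml; clear => /andP[? ?]; lra.
have [hR1 hL1] := hr z1 (le_trans z1b.1 e2) (le_trans z1b.2 e2).
have VE y : V y = f eta y + (- kink pL pR y - hinges DL DR eta y).
  by rewrite /f; move: (kink _ _ _) (hinges _ _ _ _) => *; ring.
(* On the junction the tangent parabolas of the hinges at 0, of slope -1, replace the corrections by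
   the kink of slopes qL, qR. Off the junction the contact slope lies, up to d, between the old and
   the raised slope, where the Hamiltonian is at most l < a1. *)
case: (ltgtP 0 z1.2) => [z1p|z1n|z10]; last first.
- exists z1.1, (- a1), p1; rewrite opprK; split.
  + exact: le_trans z1b.1 e1.
  + by rewrite -normrN opprB addrC opprK; exact: le_trans ha e1.
  + exact: le_trans hp e1.
  have -> : (z1.1, 0) = z1 by rewrite z10 -surjective_pairing.
  have [C C0 hC] := hinge_tangent 0 eta0.
  have s0 : hinge_slope eta 0 = - 1 by rewrite /hinge_slope mul0r sub0r.
  have := @qjetD R (f eta) (fun y => kink (qL - p1) (qR - p1) y - kink pL pR y - hinges DL DR eta y)
    z1 a1 p1 0 (- p1) ((DR + DL) * C) _ hjf.
  move=> hjD; apply: qjet_eq (hjD _); rewrite ?addr0 ?subrr//.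
    by move=> y; rewrite VE; move: (kink pL _ _) (kink _ _ _) (hinges _ _ _ _) => *; ring.
  have z10' : z1 = (z1.1, 0) by rewrite z10 -surjective_pairing.
  apply/nbhs_boxP; exists 1 => // y _ _; rewrite {1 2 3}z10' !kink0 subrr.
  rewrite [hinges _ _ _ (z1.1, 0)]hinges_right// hinge0// subrr mulr0 subrr add0r /lin /sqd -z10 subr0 mul0r add0r.
  have hy1 : 0 <= C * (y.1 - z1.1) ^+ 2 by rewrite mulr_ge0 ?sqr_ge0.
  have hy2 : 0 <= C * y.2 ^+ 2 by rewrite mulr_ge0 ?sqr_ge0.
  case: (leP 0 y.2) => y0.
    rewrite !(kink_gt _ _ y0) hinges_right//.
    have := ler_wpM2l DR0 (hC y.2); rewrite hinge0// s0 subr0.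
    have := mulr_ge0 DR0 hy1; have := mulr_ge0 DL0 hy1; have := mulr_ge0 DL0 hy2.
    rewrite /DR /DL; move: (hinge _ _) => B; clear; lra.
  rewrite !(kink_lt _ _ (ltW y0)) hinges_left ?(ltW y0)//.
  have := ler_wpM2l DL0 (hC (- y.2)); rewrite hinge0// s0 subr0 sqrrN.
  have := mulr_ge0 DR0 hy1; have := mulr_ge0 DL0 hy1; have := mulr_ge0 DR0 hy2.
  rewrite /DR /DL; move: (hinge _ _) => B; clear; lra.
- exfalso; have [C C0 hC] := hinge_tangent (- z1.2) eta0.
  have [s1 _ s2] := hinge_slope_bounds (- z1.2) eta0.
  have s3 : -1 <= hinge_slope eta (- z1.2) by apply: s2; rewrite oppr_ge0 ltW.
  have hjV : qjet V z1 a1 (p1 - pL - DL * hinge_slope eta (- z1.2)).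
    have := @qjetD R (f eta) (fun y => - kink pL pR y - hinges DL DR eta y) z1 a1 p1 0
      (- pL - DL * hinge_slope eta (- z1.2)) (DL * C) _ hjf.
    move=> hjD; apply: qjet_eq (hjD _); rewrite ?addr0 ?addrA//.
    apply/nbhs_boxP; exists (- z1.2); first by rewrite oppr_gt0.
    move=> y _ hy; have y0 : y.2 <= 0 by move: hy; rewrite ler_norml; clear; lra.
    rewrite !kink_lt ?(ltW z1n)// !hinges_left ?(ltW z1n)// /lin /sqd.
    have := ler_wpM2l DL0 (hC (- y.2)).
    have := mulr_ge0 (mulr_ge0 DL0 C0) (sqr_ge0 (y.1 - z1.1)).
    by move: (hinge _ _) (hinge _ _) (hinge_slope _ _) => B1 B2 s; clear; lra.
  have := hL1 z1n _ _ hjV; rewrite /hoppo.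
  have : hL (- (p1 - pL - DL * hinge_slope eta (- z1.2))) <= l.
    apply: hhL; move: hp e3; rewrite ler_norml.
    have := ler_wpM2l DL0 s3; have := ler_wpM2l DL0 s1; rewrite /DL.
    move: (_ * hinge_slope _ _) => B; clear => h1 h2 /andP[? ?] ?; apply/andP; split; lra.
  by move: al; clear; lra.
exfalso; have [C C0 hC] := hinge_tangent z1.2 eta0.
have [s1 _ s2] := hinge_slope_bounds z1.2 eta0.
have s3 : -1 <= hinge_slope eta z1.2 by apply: s2; rewrite ltW.
have hjV : qjet V z1 a1 (p1 - pR + DR * hinge_slope eta z1.2).
  have := @qjetD R (f eta) (fun y => - kink pL pR y - hinges DL DR eta y) z1 a1 p1 0
    (- pR + DR * hinge_slope eta z1.2) (DR * C) _ hjf.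
  move=> hjD; apply: qjet_eq (hjD _); rewrite ?addr0 ?addrA//.
  apply/nbhs_boxP; exists z1.2 => //.
  move=> y _ hy; have y0 : 0 <= y.2 by move: hy; rewrite ler_norml; clear; lra.
  rewrite !kink_gt ?(ltW z1p)// !hinges_right ?(ltW z1p)// /lin /sqd.
  have := ler_wpM2l DR0 (hC y.2).
  have := mulr_ge0 (mulr_ge0 DR0 C0) (sqr_ge0 (y.1 - z1.1)).
  by move: (hinge _ _) (hinge _ _) (hinge_slope _ _) => B1 B2 s; clear; lra.
have := hR1 z1p _ _ hjV; rewrite /hoppo.
have : hR (- (p1 - pR + DR * hinge_slope eta z1.2)) <= l.
  apply: hhR; move: hp e3; rewrite ler_norml.
  have := ler_wpM2l DR0 s3; have := ler_wpM2l DR0 s1; rewrite /DR.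
  move: (_ * hinge_slope _ _) => B; clear => h1 h2 /andP[? ?] ?; apply/andP; split; lra.
by move: al; clear; lra.
Qed.

End CriticalSlopes.

(** * Strict comparison at the junction *)

Section JunctionSuper.
Context {R : realType}.
Implicit Types (z y : R * R) (a b p q l eps : R) (w v : R * R -> R) (H : R -> R -> R -> R) (h : R -> R).

Lemma kink_lip (pL pR : R) y x : kink pL pR y <= kink pL pR x + (`|pL| + `|pR|) * nrm1 x y.
Proof.
have h1 : `|y.2 - x.2| <= nrm1 x y by rewrite lerDr.
have hL : pL * (y.2 - x.2) <= `|pL| * nrm1 x y.
  by apply: le_trans (ler_norm _) _; rewrite normrM ler_wpM2l.
have hR : pR * (y.2 - x.2) <= `|pR| * nrm1 x y.
  by apply: le_trans (ler_norm _) _; rewrite normrM ler_wpM2l.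
have L0 := mulr_ge0 (normr_ge0 pL) (nrm1_ge0 x y); have R0 := mulr_ge0 (normr_ge0 pR) (nrm1_ge0 x y).
have hL2 (s : R) : `|s| <= nrm1 x y -> pL * s <= `|pL| * nrm1 x y.
  by move=> hs; apply: le_trans (ler_norm _) _; rewrite normrM ler_wpM2l.
have hR2 (s : R) : `|s| <= nrm1 x y -> pR * s <= `|pR| * nrm1 x y.
  by move=> hs; apply: le_trans (ler_norm _) _; rewrite normrM ler_wpM2l.
move: (h1); rewrite ler_norml => /andP[h2 h3]; rewrite /kink; case: ltP => y0; case: ltP => x0.
- by move: hL R0; clear; lra.
- have /hL2 : `|y.2| <= nrm1 x y by rewrite ler_norml; apply/andP; split; move: h2 h3 x0 y0; clear; lra.
  have /hR2 : `|- x.2| <= nrm1 x y by rewrite ler_norml; apply/andP; split; move: h2 h3 x0 y0; clear; lra.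
  by clear; lra.
- have /hR2 : `|y.2| <= nrm1 x y by rewrite ler_norml; apply/andP; split; move: h2 h3 x0 y0; clear; lra.
  have /hL2 : `|- x.2| <= nrm1 x y by rewrite ler_norml; apply/andP; split; move: h2 h3 x0 y0; clear; lra.
  by clear; lra.
by move: hR L0; clear; lra.
Qed.

(** psi + eps w is a strict subsolution on the box, psi having time slope near b. Its growth slopes
    mL, mR lie strictly inside qL, qR, so its sum with [W] is small on the sides; the parabola in
    psi makes it small at the ends in time. The maximum is then interior, and doubling contradicts
    the equation for [W]. *)
Lemma junction_strict_comparison H (W : R -> R * R -> R) w (t0 f0 b l r0 qL qR mL mR C K : R) :
  hamiltonian H -> 0 < r0 ->
  (\forall eps \near (0 : R)^'+, forall y, cbox (t0, 0) r0 y -> usc (W eps) y) ->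
  (\forall eps \near (0 : R)^'+, qsub (cbox (t0, 0) r0) (hneg (hscale H eps)) 0 (W eps)) ->
  touching (0 : R)^'+ (fun eps y => W eps y + kink qL qR y) (t0, 0) f0 (- b) 0 ->
  (forall z, usc w z) -> qsub setT H l w ->
  (forall y, w y <= C + kink mL mR y) -> (forall y, - C - K * `|y.2| <= w y) ->
  0 <= C -> 0 <= K -> qL < mL -> mR < qR -> l < - b -> False.
Proof.
move=> hH r00 us qs [ht1 ht2] uw qw wub wlb C0 K0 qmL mqR lb.
pose m := Num.min (qR - mR) (mL - qL).
have m0 : 0 < m by rewrite lt_min !subr_gt0 mqR.
have mk y : kink mL mR y - kink qL qR y <= - (m * `|y.2|).
  have mR' : m <= qR - mR by rewrite ge_min lexx.
  have mL' : m <= mL - qL by rewrite ge_min lexx orbT.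
  case: (leP 0 y.2) => y0.
    by rewrite !kink_gt// ger0_norm//; have := ler_wpM2r y0 mR'; clear; lra.
  have y0' : 0 <= - y.2 by rewrite oppr_ge0 ltW.
  by rewrite !(kink_lt _ _ (ltW y0)) ltr0_norm//; have := ler_wpM2r y0' mL'; clear; lra.
clearbody m.
pose k := Num.min r0 (Num.min (m / 4) ((- b - l) / 16)).
have bl0 : 0 < - b - l by rewrite subr_gt0.
have k0 : 0 < k by rewrite !lt_min r00 !divr_gt0.
have kr0 : k <= r0 by rewrite ge_min lexx.
have km : 4 * k <= m.
  have : k <= m / 4 by rewrite !ge_min lexx orbT.
  by clear; lra.
have kl : 16 * k <= - b - l.
  have : k <= (- b - l) / 16 by rewrite !ge_min lexx !orbT.
  by clear; lra.
clearbody k.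
have [r /andP[r_gt0 rk] hr] := ht1 k k0.
have kr : 0 < k * r by exact: mulr_gt0.
pose M := 4 * k / r; have M0 : 0 < M by rewrite /M divr_gt0// mulr_gt0.
have Mr : M * r = 4 * k by rewrite /M divfK ?gt_eqF.
have sub0 y : cbox (t0, 0) r y -> cbox (t0, 0) r0 y by apply: cbox_sub; exact: le_trans kr0.
(* a Lipschitz constant for the explicit upper bound of psi + eps w *)
pose L := `|b| + 8 * k + (`|mL| + `|mR|).
have L0 : 0 < L by rewrite /L ltr_wpDr ?addr_ge0// ltr_wpDl// mulr_gt0.
pose e1 := k * r / 16; have e10 : 0 < e1 by rewrite divr_gt0.
pose Q := 1 + `|b| + 4 * k + (`|qL| + `|qR|) + K.
have Q0 : 0 < Q.
  by rewrite /Q ltr_wpDr// ltr_wpDr ?addr_ge0// ltr_wpDl ?mulr_gt0// addr_ge0.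
pose e2 := Num.min r (k * r / 4 / Q); have e20 : 0 < e2 by rewrite lt_min r_gt0 !divr_gt0.
have C1 : 0 < C + 1 by rewrite ltr_wpDl.
have : \forall eps \near (0 : R)^'+, [/\ 0 < eps, eps * C <= e1,
    forall y, cbox (t0, 0) r y -> W eps y + kink qL qR y <= f0 + lin (t0, 0) (- b) 0 y + k * nrm1 (t0, 0) y + e1,
    forall y, cbox (t0, 0) r0 y -> usc (W eps) y & qsub (cbox (t0, 0) r0) (hneg (hscale H eps)) 0 (W eps)].
  have F1 : \forall eps \near (0 : R)^'+, 0 < eps by exact: nbhs_right_gt.
  have F2 : \forall eps \near (0 : R)^'+, eps <= e1 / (C + 1) by apply: nbhs_right_le; rewrite divr_gt0.
  have F3 : \forall eps \near (0 : R)^'+, 0 < eps /\ eps * C <= e1.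
    move: F1 F2; apply: filterS2 => eps h1; rewrite ler_pdivlMr// => h2; split => //.
    by apply: le_trans h2; rewrite ler_pM2l// lerDl.
  have F4 : \forall eps \near (0 : R)^'+, (forall y, cbox (t0, 0) r0 y -> usc (W eps) y) /\
      qsub (cbox (t0, 0) r0) (hneg (hscale H eps)) 0 (W eps).
    by move: us qs; apply: filterS2.
  by move: F3 (hr e1 e10) F4; apply: filterS3 => eps [? ?] ? [? ?]; split.
move=> nA; have [eps [ya [[eps0 epsC hub uW qW] yab hya]]] := ht2 e2 _ e20 nA.
pose psi y : R := b * (y.1 - t0) + (- M) * (y.1 - t0) ^+ 2.
pose we y := eps * w (y.1 / eps, y.2 / eps).
pose W1 y := we y + psi y.
have kinkD (pL pR : R) y : kink pL pR (y.1 / eps, y.2 / eps) = kink pL pR y / eps.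
  by rewrite /kink /= pmulr_llt0 ?invr_gt0//; case: ifP => _; rewrite mulrA.
have we_ub y : we y <= e1 + kink mL mR y.
  apply: le_trans (ler_wpM2l (ltW eps0) (wub _)) _.
  by rewrite mulrDr kinkD [eps * (_ / _)]mulrC divfK ?gt_eqF// lerD2r.
have we_lb y : - e1 - K * `|y.2| <= we y.
  apply: le_trans (ler_wpM2l (ltW eps0) (wlb _)).
  rewrite /= normrM normfV (gtr0_norm eps0) mulrBr mulrN.
  have -> : eps * (K * (`|y.2| / eps)) = K * `|y.2| by field; rewrite gt_eqF.
  by rewrite lerD2r lerN2.
have psi_lip y x : cbox (t0, 0) r y -> cbox (t0, 0) r x -> psi x <= psi y + (`|b| + 8 * k) * nrm1 y x.
  move=> [y1 _] [x1 _]; rewrite /= in y1 x1.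
  have h1 : `|x.1 - y.1| <= nrm1 y x by rewrite lerDl.
  have h2 : b * (x.1 - y.1) <= `|b| * nrm1 y x.
    by apply: le_trans (ler_norm _) _; rewrite normrM ler_wpM2l.
  have h3 : - M * (x.1 - y.1) * (x.1 - t0 + (y.1 - t0)) <= 8 * k * nrm1 y x.
    apply: le_trans (ler_norm _) _; rewrite !normrM normrN (gtr0_norm M0).
    have h4 : `|x.1 - t0 + (y.1 - t0)| <= 2 * r.
      by apply: le_trans (ler_normD _ _) _; move: x1 y1; clear; lra.
    have -> : 8 * k = M * (2 * r) by rewrite mulrCA Mr; ring.
    by rewrite -mulrA -[M * (2 * r) * _]mulrA ler_pM2l// mulrC; apply: ler_pM.
  by move: h2 h3; rewrite /psi; clear; lra.
have W1_ub y : cbox (t0, 0) r y -> forall x, cbox (t0, 0) r x ->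
    W1 x <= psi y + kink mL mR y + e1 + L * nrm1 y x.
  move=> yb x xb; have := psi_lip y x yb xb; have := kink_lip mL mR x y; have := we_ub x.
  by rewrite /W1 /L; move: (nrm1 _ _) => N; clear; lra.
(* Outside the inner box the sum is lower than the value found near the centre by a fixed multiple
   of k r: on the sides thanks to the margin m >= 4 k between slopes, in time thanks to M r = 4
   k. *)
have diag y : cbox (t0, 0) r y -> 3 * r / 4 <= `|y.1 - t0| \/ 3 * r / 4 <= `|y.2| ->
    psi y + kink mL mR y + e1 + W eps y <= f0 - 5 * (k * r) / 4.
  move=> yb hy; have := hub y yb; have := mk y; case: yb => /= y1 y2.
  rewrite subr0 in y2.
  have h1 : - (m * `|y.2|) <= - (4 * k * `|y.2|) by rewrite lerN2 ler_wpM2r.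
  rewrite /lin /nrm1 /psi /= mul0r addr0 subr0 -(real_normK (num_real (y.1 - t0))).
  move: (`|y.1 - t0|) (`|y.2|) (normr_ge0 (y.1 - t0)) (normr_ge0 y.2) y1 y2 hy h1.
  move=> s x s0 x0 s1 x1 hy h1.
  have kx : 0 <= k * x by rewrite mulr_ge0// ltW.
  have sq : M * (s - r / 8) ^+ 2 = M * s ^+ 2 - k * s + k * r / 16.
    by rewrite /M; field; rewrite gt_eqF.
  have sq0 : 0 <= M * (s - r / 8) ^+ 2 by rewrite mulr_ge0 ?sqr_ge0// ltW.
  have hx : 3 * r / 4 <= x -> 9 / 4 * (k * r) <= 3 * (k * x).
    by move=> h; have := ler_wpM2l (ltW k0) h; clear; lra.
  have hs : 3 * r / 4 <= s -> 3 / 2 * (k * r) <= M * s ^+ 2 - k * s.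
    move=> h; have h2 : 0 <= M * (s - 3 * r / 4) * (s + r / 2).
      apply: mulr_ge0; first (apply: mulr_ge0; first exact: ltW).
        by move: h; clear; lra.
      by move: s0 r_gt0; clear; lra.
    have -> : M * s ^+ 2 - k * s = M * (s - 3 * r / 4) * (s + r / 2) + 3 / 2 * (k * r).
      by rewrite /M; field; rewrite gt_eqF.
    by rewrite lerDr.
  rewrite /e1 [- M * _]mulNr; move: kx sq sq0 h1; move: (M * (s - _) ^+ 2) (M * s ^+ 2) hs => S1 S2 hs.
  case: hy => hy; first by have := hs hy; clear; lra.
  by have := hx hy; clear; lra.
pose z0 : R * R := (t0, 0).
have z0b : cbox z0 r z0 by apply: cbox_center; exact: ltW.
have uW1 y : usc W1 y.
  apply: uscD; first exact: usc_rescale.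
  apply: continuous_usc; apply: cvgD; apply: cvgM; try exact: cvg_cst.
    by apply: cvgB; [exact: continuous_coord1|exact: cvg_cst].
  apply: (@continuous_at_sqr _ _ (fun y : R * R => y.1 - t0)).
  by apply: cvgB; [exact: continuous_coord1|exact: cvg_cst].
have [||zd zdb hzd] := @usc_compact_max _ _ (cbox z0 r) (fun y => W1 y + W eps y) (@compact_cbox R z0 r).
- by exists z0.
- by move=> y yb; apply: uscD => //; exact/uW/sub0.
have anchor : f0 - 5 * (k * r) / 16 <= W1 zd + W eps zd.
  have e2r : e2 <= r by rewrite ge_min lexx.
  have e2Q : Q * e2 <= k * r / 4 by rewrite mulrC -ler_pdivlMr// ge_min lexx orbT.
  apply: le_trans (hzd ya (cbox_sub e2r yab)).
  case: yab => /= y1 y2; rewrite subr0 in y2.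
  have h1 := we_lb ya.
  have h2 := kink_le qL qR ya; rewrite ler_norml in h2; case/andP: h2 => _ h2.
  have h3 : (`|qL| + `|qR|) * `|ya.2| <= (`|qL| + `|qR|) * e2 by rewrite ler_wpM2l// addr_ge0.
  have h4 : K * `|ya.2| <= K * e2 by rewrite ler_wpM2l.
  have h5 : - (`|b| * e2) <= b * (ya.1 - t0).
    have : `|b * (ya.1 - t0)| <= `|b| * e2 by rewrite normrM ler_wpM2l.
    by rewrite ler_norml => /andP[].
  have h6 : M * (ya.1 - t0) ^+ 2 <= 4 * k * e2.
    rewrite -Mr -(real_normK (num_real (ya.1 - t0))) expr2 -mulrA ler_pM2l//.
    by apply: ler_pM => //; exact: le_trans e2r.
  rewrite /W1 /psi mulNr; move: e2Q hya h1 h2 h3 h4 h5 h6; rewrite /Q /e1.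
  move: (kink _ _ _) (we _) (M * _) (b * _) (`|qL|) (`|qR|) (`|b|) => B1 B2 B3 B4 B5 B6 B7.
  by clear; lra.
(* The level of psi + eps w on the box, where the time slope of psi differs from b by at most 8 k;
   it is negative because 16 k <= - b - l. *)
pose l2 := l + b + 8 * k.
have l20 : l2 < 0 by rewrite /l2; move: kl k0; clear; lra.
pose dl := Num.min (r / 8) (k * r / 32 / L).
have dl0 : 0 < dl by rewrite lt_min !divr_gt0.
have dlr : dl <= r / 8 by rewrite ge_min lexx.
have dlL : L * (dl + dl) <= k * r / 16.
  have : dl <= k * r / 32 / L by rewrite ge_min lexx orbT.
  by rewrite ler_pdivlMr// mulrC mulrDr; move: (L * dl) => A; clear; lra.
clearbody dl.
(* The square forces the doubled points to be within [dl] of each other, hence both well inside the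
   box; the other term keeps the doubling error below half of the strict level. *)
pose e3 := Num.min (dl ^+ 2) (- l2 / 2).
have e30 : 0 < e3 by rewrite lt_min exprn_gt0//= divr_gt0// oppr_gt0.
pose P : set ((R * R) * (R * R)) := cbox z0 r `*` cbox z0 r.
have cP : compact P by apply: compact_setX; exact: compact_cbox.
have [th [th' [v [[/andP[th'0 th'th] th1] [Pv1 Pv2] hmax hpen hdbl]]]] :=
  @doubling R (hscale H eps) W1 (W eps) P e3 l2 (W1 zd + W eps zd) 1 zd
    (ham_scale eps0 hH) e30 cP ltr01 (fun (v : (R * R) * (R * R)) _ => uW1 v.1)
    (fun (v : (R * R) * (R * R)) (Pv : P v) => uW _ (sub0 _ Pv.2)) (fun z (Pz : P (z, z)) => hzd z Pz.1)
    (conj zdb zdb) (lexx _).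
have th0 : 0 < th by exact: lt_le_trans th'th.
have close (x s : R) : 0 < s <= 1 -> x ^+ 2 / s <= pen th th' v -> `|x| <= dl.
  move=> /andP[s0 s1] hx; have : x ^+ 2 <= dl ^+ 2.
    have : x ^+ 2 / s <= dl ^+ 2 by apply: le_trans hx (le_trans hpen _); rewrite ge_min lexx.
    rewrite ler_pdivrMr// => h; apply: le_trans h _.
    by rewrite ler_piMr// sqr_ge0.
  by rewrite -(real_normK (num_real x)) ler_pXn2r// ?nnegrE// ltW.
have v1 : `|v.1.1 - v.2.1| <= dl.
  by apply: (close _ th); rewrite ?th0// /pen lerDl divr_ge0 ?sqr_ge0// ltW.
have v2 : `|v.1.2 - v.2.2| <= dl.
  apply: (close _ th'); rewrite ?th'0 ?(le_trans th'th)//.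
  by rewrite /pen lerDr divr_ge0 ?sqr_ge0// ltW.
have hv : f0 - 5 * (k * r) / 16 <= W1 v.1 + W eps v.2.
  apply: le_trans anchor _; have := hmax (zd, zd) (conj zdb zdb).
  have := @pen_ge0 R th th' v (ltW th0) (ltW th'0).
  rewrite /doubled /pen /= !subrr expr0n /= !mul0r.
  by clear; lra.
have hn : L * nrm1 v.2 v.1 <= k * r / 16.
  by apply: le_trans dlL; rewrite ler_pM2l// lerD.
have hW1 := W1_ub _ Pv2 _ Pv1.
have [i1 i2] : `|v.2.1 - t0| < 3 * r / 4 /\ `|v.2.2| < 3 * r / 4.
  split; rewrite ltNge; apply/negP => h.
    have := diag _ Pv2 (or_introl h); move: hv hn hW1 kr; clear; lra.
  by have := diag _ Pv2 (or_intror h); move: hv hn hW1 kr; clear; lra.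
have in2 y : cbox v.2 (r / 8) y -> cbox z0 r y.
  move=> hy; apply: (@cbox_trans R z0 v.2 y (3 * r / 4) (r / 8)) => //.
    by move: r_gt0; clear; lra.
  by split; rewrite /= ?subr0 ltW.
have in1 y : cbox v.1 (r / 8) y -> cbox z0 r y.
  move=> hy; apply: (@cbox_trans R z0 v.1 y (7 * r / 8) (r / 8)) => //; first by lra.
  have h1 := ler_distD v.2.1 v.1.1 t0.
  have h2 := ler_distD v.2.2 v.1.2 0; rewrite !subr0 in h2.
  split; rewrite /= ?subr0.
    by apply: le_trans h1 _; move: v1 dlr i1; clear; lra.
  by apply: le_trans h2 _; move: v2 dlr i2; clear; lra.
have r8 : 0 < r / 8 by rewrite divr_gt0.
have [hj1 hj2] : qjet W1 v.1 (2 * (v.1.1 - v.2.1) / th) (2 * (v.1.2 - v.2.2) / th') /\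
    qjet (W eps) v.2 (- (2 * (v.1.1 - v.2.1) / th)) (- (2 * (v.1.2 - v.2.2) / th')).
  apply: doubled_qjets; exists (cbox v.1 (r / 8), cbox v.2 (r / 8)).
    by split => /=; exact: nbhs_cbox.
  by move=> [x1 x2] /= [h1 h2]; apply: hmax; split => /=; [exact: in1|exact: in2].
have hjw : qjet we v.1 (2 * (v.1.1 - v.2.1) / th + (- b + 2 * M * (v.1.1 - t0))) (2 * (v.1.2 - v.2.2) / th').
  have := @qjetD R W1 (fun y => - b * (y.1 - t0) + M * (y.1 - t0) ^+ 2) v.1 _ _
    (- b + 2 * M * (v.1.1 - t0)) 0 `|M| _ hj1.
  move=> hjD; apply: qjet_eq (hjD _); rewrite ?addr0//.
    by move=> y; rewrite /W1 /psi; move: (we y) => B; ring.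
  by exists (setT, setT); [split => /=; exact: filterT|move=> y _; exact: parabola_tangent].
have := qsub_scale (Om := setT) eps0 qw Logic.I hjw => h1.
have hdt : - (8 * k) <= 2 * M * (v.1.1 - t0).
  have -> : 8 * k = 2 * (M * r) by rewrite Mr; ring.
  have : - r <= v.1.1 - t0 by case: Pv1 => /=; rewrite ler_norml => /andP[].
  by move=> /(ler_wpM2l (ltW M0)); move: (v.1.1 - t0) => s; clear; lra.
have h2 : 2 * (v.1.1 - v.2.1) / th + hscale H eps v.1.1 v.1.2 (2 * (v.1.2 - v.2.2) / th') <= l2.
  move: h1 hdt; rewrite /l2; move: (2 * _ / th) (2 * M * _) (hscale _ _ _ _ _) => A1 A2 A3.
  by clear; lra.
have h3 := hdbl l2 (lexx _) h2.
have := qW _ _ _ (sub0 _ Pv2) hj2; rewrite /hneg opprK => h4.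
have : e3 <= - l2 / 2 by rewrite ge_min lexx orbT.
by move: h3 h4 l20; move: (2 * _ / th) (hscale _ _ _ _ _) => A1 A2; clear; lra.
Qed.

End JunctionSuper.

(** * The supersolution inequality at the junction *)

Section JunctionSupersolution.
Context {R : realType}.
Implicit Types (z y : R * R) (a b p q l eps : R) (w v : R * R -> R) (H : R -> R -> R -> R) (h : R -> R).

(** The left half-line is described through the reflected Hamiltonian, so that arguments are made on
    the right only. *)
Record effective H hL hR : Prop := Effective {
  eff_R : effective_right H hR;
  eff_Rn : effective_right (hneg H) (hoppo hR);
  eff_L : effective_right (hrefl H) (fun p => hL (- p));
  eff_Ln : effective_right (hneg (hrefl H)) (hoppo (fun p => hL (- p))) }.

Lemma effective_left H h (U : R -> R * R -> R) z0 (r l f0 a p : R) :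
  effective_right (hrefl H) (fun p => h (- p)) -> 0 < r -> z0.2 < 0 ->
  (\forall eps \near (0 : R)^'+, forall y, cbox z0 r y -> usc (U eps) y) ->
  (\forall eps \near (0 : R)^'+, qsub (cbox z0 r) (hscale H eps) l (U eps)) ->
  touching (0 : R)^'+ U z0 f0 a p -> a + h p <= l.
Proof.
move=> hh r0 z0n us qs ht; rewrite -[p]opprK.
apply: (hh (fun eps y => U eps (refl y)) (refl z0) r l f0 a (- p)) => //.
- by rewrite /= oppr_gt0.
- by apply: filterS us => eps hu y /cbox_refl yb; apply: usc_reflect; exact: hu.
- apply: filterS qs => eps hq y a' q /cbox_refl yb hj.
  have : qjet (U eps) (refl y) a' (- q).
    by apply: qjet_reflect; rewrite -/(refl (refl y)) reflK; apply: qjet_eq hj.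
  by move=> /(hq _ _ _ yb); rewrite /hscale /hrefl /= mulNr.
exact: touching_refl.
Qed.

(** m and s are the largest slopes where [h] is at most l1 and l2; the values l1 and l2 being
    attained there, m < s. With p' = min p s, the bound on [decr_part] and quasi-convexity keep [h]
    at most l2 from p' to s, and continuity at both ends leaves a margin d below l3. *)
Lemma crit_band h (p0 p l1 l2 l3 : R) : limit_hamiltonian h -> argmin h p0 ->
  decr_part h p0 p < l1 -> l1 < l2 -> l2 < l3 ->
  exists m s d p', [/\ m < s /\ 0 < d, p' <= p, p' <= s, forall q, h q <= l1 -> q <= m &
    forall q, p' - d <= q <= s + d -> h q <= l3].
Proof.
move=> hh hm dl1 l12 l23.
have p0l : h p0 < l1.
  by apply: le_lt_trans dl1; rewrite /decr_part; case: ifP => // _; exact: hm.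
have [m [p0m hml mP]] := crit_slope hh p0l.
have [s [p0s hsl sP]] := crit_slope hh (lt_trans p0l l12).
have ms : m < s.
  rewrite lt_neqAle sP ?hml ?(ltW l12)// andbT.
  by apply/eqP => e; move: hml hsl l12; rewrite e; clear; lra.
pose p' := Num.min p s.
have p'p : p' <= p by rewrite ge_min lexx.
have p's : p' <= s by rewrite ge_min lexx orbT.
have hp' : h p' <= l2.
  rewrite /p'; case: (leP p s) => ps; last by rewrite hsl.
  have [pp0|p0p] := ltP p p0.
    by move: dl1; rewrite /decr_part pp0; move: l12; clear; lra.
  have : p0 <= p <= s by rewrite p0p.
  by move=> /(lham_qc hh); rewrite hsl le_max => /orP[|//]; move: p0l l12; clear; lra.
have l0 : 0 < l3 - l2 by rewrite subr_gt0.
have [d1 d10 hd1] := lham_cont hh p' l0; have [d2 d20 hd2] := lham_cont hh s l0.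
exists m, s, (Num.min d1 d2), p'; split => //.
  by split=> //; rewrite lt_min d10.
move=> q hq; have m1 : Num.min d1 d2 <= d1 by rewrite ge_min lexx.
have m2 : Num.min d1 d2 <= d2 by rewrite ge_min lexx orbT.
have {}hq : p' - d1 <= q <= s + d2 by move: hq m1 m2; clear => /andP[? ?] ? ?; apply/andP; split; lra.
apply: le_trans (lham_qc hh hq) _; rewrite ge_max.
have /ler_normlP[_ h1] : `|h (p' - d1) - h p'| <= l3 - l2.
  by apply: hd1; rewrite addrAC subrr sub0r normrN gtr0_norm.
have /ler_normlP[_ h2] : `|h (s + d2) - h s| <= l3 - l2.
  by apply: hd2; rewrite addrAC subrr add0r gtr0_norm.
by apply/andP; split; [move: h1 hp'|move: h2; rewrite hsl]; clear; lra.
Qed.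

Lemma locbdD {I : Type} (F : set_system I) {FF : ProperFilter F} (u : I -> R * R -> R) (c : R * R -> R) z :
  continuous c -> locbd F u z -> locbd F (fun i y => u i y + c y) z.
Proof.
move=> cc [r [M [r0 h1 h2]]].
have /nbhs_boxP[d d0 hd] : \forall y \near z, `|c y - c z| < 1.
  have /cvgrPdist_lt /(_ 1 ltr01) := cc z.
  by apply: filterS => y; rewrite distrC.
pose N := `|c z| + 1.
have hN y : cbox z d y -> `|c y| <= N.
  move=> [y1 y2]; have := hd y y1 y2; have : `|c y| <= `|c y - c z| + `|c z|.
    by apply: le_trans (ler_normD _ _); rewrite subrK.
  by rewrite /N; clear; lra.
have m1 : Num.min r d / 2 <= r.
  have : Num.min r d <= r by rewrite ge_min lexx.
  by move: r0; clear; lra.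
have m2 : Num.min r d / 2 < d.
  have : Num.min r d <= d by rewrite ge_min lexx orbT.
  by move: d0; clear; lra.
exists (Num.min r d / 2), (`|M| + 2 * N + 1); split.
- by rewrite divr_gt0// lt_min r0.
- apply: filterS h1 => i hi y yb; have := hi y (cbox_sub m1 yb).
  have := hN y (cbox_sub (ltW m2) yb); rewrite ler_norml => /andP[_]; have := ler_norm M.
  have : 0 <= N by rewrite addr_ge0.
  by clear; lra.
move=> x xb s [[A B] /= [hA hB] hs].
have hc : \forall y \near x, `|c y - c x| < 1.
  have /cvgrPdist_lt /(_ 1 ltr01) := cc x.
  by apply: filterS => y; rewrite distrC.
have : - M <= s + N + 1.
  apply: (h2 x (cbox_sub m1 xb)).
  exists (A `&` [set y | `|c y - c x| < 1], B); first by split => //=; exact: filterI.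
  move=> [y i] /= [[Ay hy] Bi]; have := hs (y, i) (conj Ay Bi) => /=.
  have := hN x (cbox_sub (ltW m2) xb); move: hy; rewrite ltr_norml ler_norml.
  by clear => /andP[? ?] /andP[? ?]; lra.
have := ler_norm M; have : 0 <= N by rewrite addr_ge0.
by clear; lra.
Qed.

Lemma rsupD_le {I : Type} (F : set_system I) {FF : ProperFilter F} (u : I -> R * R -> R) (c : R * R -> R) z :
  continuous c -> locbd F u z -> rsup F (fun i y => u i y + c y) z <= rsup F u z + c z.
Proof.
move=> cc lb; apply/ler_addgt0Pr => e e0; have e2 : 0 < e / 2 by lra.
apply: rsup_le; first exact: locbdD.
have : rsup F u z < rsup F u z + e / 2 by rewrite ltrDl.
move=> /(rsup_near lb)[[A B] /= [hA hB] hs].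
have hc : \forall y \near z, `|c y - c z| < e / 2.
  have /cvgrPdist_lt /(_ _ e2) := cc z.
  by apply: filterS => y; rewrite distrC.
exists (A `&` [set y | `|c y - c z| < e / 2], B); first by split => //=; exact: filterI.
move=> [y i] /= [[Ay hy] Bi]; have := hs (y, i) (conj Ay Bi) => /=.
by move: hy; rewrite ltr_norml; clear => /andP[? ?]; lra.
Qed.

Lemma rsupD {I : Type} (F : set_system I) {FF : ProperFilter F} (u : I -> R * R -> R) (c : R * R -> R) z :
  continuous c -> locbd F u z -> rsup F (fun i y => u i y + c y) z = rsup F u z + c z.
Proof.
move=> cc lb; apply/le_anti; rewrite rsupD_le//=.
have cN : continuous (fun y => - c y) by move=> y; apply: cvgN; exact: cc.
have := @rsupD_le I F FF (fun i y => u i y + c y) (fun y => - c y) z cN (locbdD cc lb).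
have -> : (fun i y => u i y + c y - c y) = u.
  by apply/funext => i; apply/funext => y; rewrite addrK.
by rewrite lerBrDr; apply.
Qed.

Lemma touching_kink (W : R -> R * R -> R) (t0 a pL pR r0 : R) : 0 < r0 ->
  (forall y, cbox (t0, 0) r0 y -> locbd (0 : R)^'+ W y) ->
  sjet (fun y => rsup (0 : R)^'+ W y + kink pL pR y) (t0, 0) a 0 ->
  touching (0 : R)^'+ (fun eps y => W eps y + kink pL pR y) (t0, 0)
    (rsup (0 : R)^'+ W (t0, 0)) a 0.
Proof.
move=> r00 lb hj; have ck := @continuous_kink R pL pR.
have lb0 := lb _ (cbox_center (t0, 0) (ltW r00)).
have -> : rsup (0 : R)^'+ W (t0, 0) = rsup (0 : R)^'+ (fun eps y => W eps y + kink pL pR y) (t0, 0).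
  by rewrite rsupD// kink0 addr0.
apply: rsup_touching; first exact: locbdD.
move=> e e0; move: (hj e e0) (nbhs_cbox (t0, 0) r00); apply: filterS2 => y h1 yb.
by rewrite !rsupD//; exact: lb.
Qed.

(** By contradiction: [lift_slopes] replaces the slopes of the test function by ones slightly
    perturbed from the critical slopes sL, sR, and [junction_strict_comparison] opposes to it a
    periodic subsolution whose growth slopes, from [sub_growth], are strictly smaller. *)
Lemma junction_supersolution H hL hR (p0L p0R t0 r0 b pL pR : R) (W : R -> R * R -> R) :
  hamiltonian H -> A1 H -> effective H hL hR ->
  limit_hamiltonian hL -> limit_hamiltonian hR -> argmin hL p0L -> argmin hR p0R ->
  0 < r0 -> (\forall eps \near (0 : R)^'+, forall y, cbox (t0, 0) r0 y -> usc (W eps) y) ->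
  (\forall eps \near (0 : R)^'+, qsub (cbox (t0, 0) r0) (hneg (hscale H eps)) 0 (W eps)) ->
  (forall y, cbox (t0, 0) r0 y -> locbd (0 : R)^'+ W y) ->
  sjet (fun y => rsup (0 : R)^'+ W y + kink pL pR y) (t0, 0) (- b) 0 ->
  0 <= b + junction_fun (Abar H) hL hR p0L p0R pL pR.
Proof.
move=> hH pH he hhL hhR mL mR r00 us qs lb hj.
set mu := junction_fun _ _ _ _ _ _ _.
rewrite -oppr_le0 opprD leNgt; apply/negP => lt0.
pose g := - b - mu; have g0 : 0 < g by [].
(* l1 > Abar is the level of the periodic subsolution and of its growth slopes; l2 > l1 defines the
   raised slopes, which are thus strictly larger; l3 < - b absorbs the continuity errors in
   between. *)
pose l1 := mu + g / 4; pose l2 := mu + g / 2; pose l3 := mu + 3 * g / 4.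
have l12 : l1 < l2 by rewrite /l1 /l2; move: g0; clear; lra.
have l23 : l2 < l3 by rewrite /l2 /l3; move: g0; clear; lra.
have l3b : l3 < - b by move: g0; rewrite /l3 /g; clear; lra.
have mul1 : mu < l1 by rewrite /l1; move: g0; clear; lra.
have A1l : Abar H < l1 by apply: le_lt_trans mul1; rewrite /mu /junction_fun le_max lexx.
have R1l : decr_part hR p0R pR < l1.
  by apply: le_lt_trans mul1; rewrite /mu /junction_fun !le_max lexx !orbT.
have L1l : decr_part (fun p => hL (- p)) (- p0L) (- pL) < l1.
  by rewrite -incr_part_refl; apply: le_lt_trans mul1; rewrite /mu /junction_fun !le_max lexx !orbT.
have [nR [sR [dR [pR' [[nsR dR0] pR'1 pR'2 nRP bR]]]]] := crit_band hhR mR R1l l12 l23.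
have [nL [sL [dL [pL' [[nsL dL0] pL'1 pL'2 nLP bL]]]]] :=
  crit_band (limit_hamiltonian_reflect hhL) (argmin_refl mL) L1l l12 l23.
pose V := rsup (0 : R)^'+ W.
have inner y : cbox (t0, 0) (r0 / 2) y ->
    (\forall eps \near (0 : R)^'+, forall x, cbox y (r0 / 2) x -> usc (W eps) x) /\
    (\forall eps \near (0 : R)^'+, qsub (cbox y (r0 / 2)) (hneg (hscale H eps)) 0 (W eps)).
  move=> yb; have sub x : cbox y (r0 / 2) x -> cbox (t0, 0) r0 x.
    by apply: cbox_trans yb; lra.
  split; first by apply: filterS us => eps hu x xb; exact/hu/sub.
  by apply: filterS qs => eps hq x a q xb; apply: hq; exact: sub.
have r2 : 0 < r0 / 2 by rewrite divr_gt0.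
have r2r : r0 / 2 <= r0 by move: r00; clear; lra.
have n2 := nbhs_cbox (t0, 0) r2.
have uV : \forall y \near (t0, (0 : R)), usc V y.
  by apply: filterS n2 => y yb; apply: usc_rsup; apply: lb; exact: cbox_sub yb.
have sVR : \forall y \near (t0, (0 : R)), 0 < y.2 -> forall a q, qjet V y a q -> a + hoppo hR q <= 0.
  apply: filterS n2 => y yb y0 a q hjy; have [h1 h2] := inner y yb.
  apply: (eff_Rn he r2 y0 h1 h2 (f0 := V y)).
  by apply: rsup_touching; [exact: lb (cbox_sub r2r yb)|exact: qjet_sjet].
have sVL : \forall y \near (t0, (0 : R)), y.2 < 0 -> forall a q, qjet V y a q -> a + hoppo hL q <= 0.
  apply: filterS n2 => y yb y0 a q hjy; have [h1 h2] := inner y yb.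
  apply: (@effective_left (hneg H) (hoppo hL) W y (r0 / 2) 0 (V y) a q (eff_Ln he) r2 y0 h1 h2).
  by apply: rsup_touching; [exact: lb (cbox_sub r2r yb)|exact: qjet_sjet].
have hj' : sjet (fun y => V y + kink (- pL') pR' y) (t0, 0) (- b) 0.
  move=> e e0; apply: filterS (hj e e0) => y; rewrite !kink0.
  apply: le_trans; rewrite lerD2l; case: (leP 0 y.2) => y0.
    by rewrite !kink_gt// ler_wpM2r.
  rewrite !(kink_lt _ _ (ltW y0)) ler_wnM2r ?(ltW y0)//.
  by move: pL'1; clear; lra.
pose d := Num.min dL dR; have d0 : 0 < d by rewrite lt_min dL0.
have ddL : d <= dL by rewrite ge_min lexx.
have ddR : d <= dR by rewrite ge_min lexx orbT.
(* The perturbation k of the raised slopes is at most a quarter of the gaps s - n, whereas the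
   subsolution grows with the midpoint slopes: the order stays strict. Likewise the time slope moves
   by at most g / 4. *)
pose e := Num.min (Num.min ((sR - nR) / 4) ((sL - nL) / 4)) (Num.min (g / 4) (r0 / 2)).
have e0 : 0 < e by rewrite !lt_min !divr_gt0 // subr_gt0.
have e1 : e <= (sR - nR) / 4 by rewrite !ge_min lexx.
have e2 : e <= (sL - nL) / 4 by rewrite !ge_min lexx !orbT.
have e3 : e <= g / 4 by rewrite !ge_min lexx !orbT.
have e4 : e <= r0 / 2 by rewrite !ge_min lexx !orbT.
clearbody e d.
have [||||t1 [b1 [k [ht1 hb1 hk hj1]]]] := lift_slopes uV sVR sVL hj' l3b d0
    (qL := - sL) (qR := sR) _ _ _ _ e0.
- by rewrite lerN2.
- exact: pR'2.
- by move=> p /andP[h1 h2]; apply: bR; move: h1 h2 ddR; clear => *; apply/andP; split; lra.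
- move=> p /andP[h1 h2]; rewrite -[p]opprK; apply: bL.
  by move: h1 h2 ddL; clear => *; apply/andP; split; lra.
have t1b : cbox (t0, 0) (r0 / 2) (t1, 0).
  by split; rewrite /= ?subrr ?normr0 ?(ltW r2)//; exact: le_trans e4.
have [us1 qs1] := inner _ t1b.
have lb1 y : cbox (t1, 0) (r0 / 2) y -> locbd (0 : R)^'+ W y.
  by move=> yb; apply: lb; apply: cbox_trans t1b yb; lra.
have ht := touching_kink r2 lb1 (qjet_sjet hj1).
have [w [pw uw qw]] := Abar_lt hH A1l.
have [C0 [K [C00 K0 hosc]]] := periodic1_osc hH pw uw qw.
have dlR : 0 < (sR - nR) / 2 by rewrite divr_gt0// subr_gt0.
have dlL : 0 < (sL - nL) / 2 by rewrite divr_gt0// subr_gt0.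
have [CR hCR] := sub_growth hH (eff_R he) pw uw qw nRP dlR.
have pw' : periodic1 (fun y => w (refl y)) by move=> j t x; rewrite /refl /= pw.
have uw' z : usc (fun y => w (refl y)) z by apply: usc_reflect; exact: uw.
have [CL hCL] := sub_growth (ham_refl hH) (eff_L he) pw' uw' (qsub_refl qw) nLP dlL.
pose C := `|CR| + `|CL| + (`|w (0, 0)| + C0).
apply: (@junction_strict_comparison R H W w t1 (V (t1, 0)) b1 l1 (r0 / 2) (- sL - k) (sR - k)
  (- (nL + (sL - nL) / 2)) (nR + (sR - nR) / 2) C K hH r2 us1 qs1 ht uw qw) => //.
- move=> y; case: (leP 0 y.2) => y0.
    rewrite kink_gt// (surjective_pairing y); apply: le_trans (hCR _ _ y0) _.
    rewrite lerD2r /C -addrA; apply: le_trans (ler_norm _) _.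
    by rewrite lerDl !addr_ge0.
  have y0' : 0 <= - y.2 by rewrite oppr_ge0 ltW.
  rewrite (kink_lt _ _ (ltW y0)); have := hCL y.1 (- y.2) y0'.
  rewrite /refl /= opprK -surjective_pairing => h; apply: le_trans h _.
  rewrite mulrN -mulNr lerD2r /C [`|CR| + _]addrC -addrA; apply: le_trans (ler_norm _) _.
  by rewrite lerDl !addr_ge0.
- move=> y; have := hosc 0 0 y.1 y.2; rewrite -surjective_pairing sub0r normrN.
  have := ler_norm (- w (0, 0)); rewrite normrN; rewrite /C.
  have := normr_ge0 CR; have := normr_ge0 CL.
  by move: (K * _) => A; clear; lra.
- by rewrite /C !addr_ge0.
- by move: hk e2 nsL; rewrite ler_norml; clear => /andP[? ?] *; lra.
- by move: hk e1 nsR; rewrite ler_norml; clear => /andP[? ?] *; lra.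
by move: hb1 e3 l12 l23 l3b; rewrite ler_norml /l1 /g; move: g0; rewrite /g; clear => ? /andP[? ?] *; lra.
Qed.

End JunctionSupersolution.

(** * Comparison for flux-limited solutions *)

Section FluxLimitedJets.
Context {R : realType}.
Implicit Types (z y : R * R) (a b p q l : R) (u w v : R * R -> R) (h : R -> R).

(** At the junction the kink is removed first and the jet has zero space slope, so ordinary jets
    also represent test functions with two one-sided derivatives. *)
Definition fl_sub_at hL hR (F : R -> R -> R) u z : Prop :=
  [/\ 0 < z.2 -> forall a q, qjet u z a q -> a + hR q <= 0,
      z.2 < 0 -> forall a q, qjet u z a q -> a + hL q <= 0 &
      z.2 = 0 -> forall a pL pR, qjet (fun y => u y - kink pL pR y) z a 0 -> a + F pL pR <= 0].

(* [w] is the opposite of a supersolution. *)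
Definition fl_super_at hL hR (F : R -> R -> R) w z : Prop :=
  [/\ 0 < z.2 -> forall a q, qjet w z a q -> a + hoppo hR q <= 0,
      z.2 < 0 -> forall a q, qjet w z a q -> a + hoppo hL q <= 0 &
      z.2 = 0 -> forall a pL pR, qjet (fun y => w y + kink pL pR y) z a 0 -> a <= F pL pR].

Lemma kink_jet_pos u (pL pR : R) z a r : 0 < z.2 ->
  qjet (fun y => u y - kink pL pR y) z a r -> qjet u z a (r + pR).
Proof.
move=> z0 hj; have := @qjetD R _ (kink pL pR) z a r 0 pR 0 _ hj.
move=> hjD; apply: qjet_eq (hjD _); rewrite ?addr0//; first by move=> y; rewrite subrK.
apply/nbhs_boxP; exists z.2 => // y _ hy; have y0 : 0 <= y.2.
  by move: hy; rewrite ler_norml; clear; lra.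
by rewrite !kink_gt ?(ltW z0)// /lin; lra.
Qed.

Lemma kink_jet_neg u (pL pR : R) z a r : z.2 < 0 ->
  qjet (fun y => u y - kink pL pR y) z a r -> qjet u z a (r + pL).
Proof.
move=> z0 hj; have := @qjetD R _ (kink pL pR) z a r 0 pL 0 _ hj.
move=> hjD; apply: qjet_eq (hjD _); rewrite ?addr0//; first by move=> y; rewrite subrK.
apply/nbhs_boxP; exists (- z.2); first by rewrite oppr_gt0.
move=> y _ hy; have y0 : y.2 <= 0.
  by move: hy; rewrite ler_norml; clear; lra.
by rewrite !kink_lt ?(ltW z0)// /lin; lra.
Qed.

Lemma kink_jet_tilt u (pL pR : R) z a r s :
  qjet (fun y => u y - kink pL pR y) z a (r + s) ->
  qjet (fun y => u y - kink (pL + s) (pR + s) y) z a r.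
Proof.
move=> hj; have := @qjetD R _ (fun y => - (s * y.2)) z a (r + s) 0 (- s) 0 _ hj.
move=> hjD; apply: qjet_eq (hjD _); rewrite ?addr0 ?addrK//.
  by move=> y; rewrite /kink; case: ifP => _; ring.
by apply/nbhs_boxP; exists 1 => // y _ _; rewrite /lin; lra.
Qed.

Lemma kink_jetN u (pL pR : R) z a r : qjet (fun y => u y + kink pL pR y) z a r ->
  qjet (fun y => u y - kink (- pL) (- pR) y) z a r.
Proof. by apply: qjet_eq => // y; rewrite kinkN opprK. Qed.

Lemma kink_flat u z a q : qjet u z a q -> qjet (fun y => u y - kink q q y) z a 0.
Proof.
move=> hj; have := @qjetD R _ (fun y => - (q * y.2)) z a q 0 (- q) 0 _ hj.
move=> hjD; apply: qjet_eq (hjD _); rewrite ?addr0 ?subrr//.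
  by move=> y; rewrite /kink; case: ifP.
by apply/nbhs_boxP; exists 1 => // y _ _; rewrite /lin; lra.
Qed.

(** q is the critical slope at level mu if mu exceeds the minimum of [h]. Otherwise no slope has a
    value below mu, both claims are void and q = 0 is arbitrary. *)
Lemma crit_exists h (p0 mu : R) : limit_hamiltonian h ->
  exists q, (forall p, h p < mu -> argmin h p0 -> p <= q) /\
    forall p, argmin h p0 -> decr_part h p0 p < mu -> p <= q -> h p <= mu.
Proof.
move=> hh; have [lt0|ge0] := ltP (h p0) mu.
  have [q [p0q hq qP]] := crit_slope hh lt0; exists q; split.
    by move=> p hp _; apply: qP; exact: ltW.
  move=> p hm hp pq; move: hp; rewrite /decr_part; case: (ltP p p0) => pp0 hp; first exact: ltW.
  have /(lham_qc hh) : p0 <= p <= q by rewrite pp0.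
  by rewrite hq le_max => /orP[h1|//]; exact: le_trans h1 (ltW lt0).
exists 0; split=> p; first by move=> hp hm; have := hm p; move: hp ge0; clear; lra.
move=> hm hp _; exfalso; have : h p0 <= decr_part h p0 p.
  by rewrite /decr_part; case: ifP => // _; exact: hm.
by move: hp ge0; clear; lra.
Qed.

(** Here - a1 < mu < a2 separates the two equations. With both points on one side, the uniform
    continuity of the Hamiltonian concludes. If z1 is off the junction and z2 is not on its side,
    the subsolution slope is at most critical, against the sign of r1. If z1 is on the junction and
    z2 is off, the flux condition and the sign of r1 put the slope in the region where the
    Hamiltonian is at most mu, against mu < a2. If both are on the junction the two flux conditions
    have equal slopes. *)
Lemma fl_core hL hR (A p0L p0R a1 a2 r1 r2 e d mu qL qR : R) u w z1 z2 :
  fl_sub_at hL hR (junction_fun A hL hR p0L p0R) u z1 ->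
  fl_super_at hL hR (junction_fun A hL hR p0L p0R) w z2 ->
  qjet (fun y => u y - kink qL qR y) z1 a1 r1 ->
  qjet (fun y => w y + kink qL qR y) z2 a2 r2 ->
  0 <= e -> e < a1 + a2 -> - a1 < mu -> mu < a2 -> `|r1 + r2| <= d ->
  (forall p p', hR p' <= - a1 -> `|p - p'| <= d -> hR p <= hR p' + e) ->
  (forall p p', hL p' <= - a1 -> `|p - p'| <= d -> hL p <= hL p' + e) ->
  (forall p, hR p < mu -> p <= qR) ->
  (forall p, decr_part hR p0R p < mu -> p <= qR -> hR p <= mu) ->
  (forall p, hL p < mu -> qL <= p) ->
  (forall p, incr_part hL p0L p < mu -> qL <= p -> hL p <= mu) ->
  (0 < z1.2 -> z2.2 <= 0 -> 0 < r1) -> (z1.2 < 0 -> 0 <= z2.2 -> r1 < 0) ->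
  (z1.2 = 0 -> [/\ r2 = - r1, 0 < z2.2 -> r1 <= 0, z2.2 < 0 -> 0 <= r1 & z2.2 = 0 -> r1 = 0]) ->
  False.
Proof.
move=> [sR sL s0] [pR pL p0] j1 j2 e0 ea amu mua rd mR mL cR cR' cL cL' x1 x2 x3.
have j2' := kink_jetN j2.
have F_R p1 p2 : decr_part hR p0R p2 <= junction_fun A hL hR p0L p0R p1 p2.
  by rewrite /junction_fun !le_max lexx !orbT.
have F_L p1 p2 : incr_part hL p0L p1 <= junction_fun A hL hR p0L p0R p1 p2.
  by rewrite /junction_fun !le_max lexx !orbT.
case: (ltgtP z1.2 0) => [z1n|z1p|z10].
- have h1 := sL z1n _ _ (kink_jet_neg z1n j1).
  have [z20|z2n] := leP 0 z2.2.
    have : hL (r1 + qL) < mu by move: h1 amu; clear; lra.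
    by move=> /cL; have := x2 z1n z20; clear; lra.
  have := pL z2n _ _ (kink_jet_neg z2n j2'); rewrite /hoppo => h2.
  have := mL (qL - r2) (r1 + qL).
  have -> : qL - r2 - (r1 + qL) = - (r1 + r2) by ring.
  rewrite normrN => h3; have : hL (r1 + qL) <= - a1 by move: h1; clear; lra.
  move=> h4; have := h3 h4 rd; move: h1 h2 ea.
  by rewrite (_ : - (r2 + - qL) = qL - r2); [clear; lra|ring].
- have h1 := sR z1p _ _ (kink_jet_pos z1p j1).
  have [z20|z2p] := leP z2.2 0.
    have : hR (r1 + qR) < mu by move: h1 amu; clear; lra.
    by move=> /cR; have := x1 z1p z20; clear; lra.
  have := pR z2p _ _ (kink_jet_pos z2p j2'); rewrite /hoppo => h2.
  have := mR (qR - r2) (r1 + qR).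
  have -> : qR - r2 - (r1 + qR) = - (r1 + r2) by ring.
  rewrite normrN => h3; have : hR (r1 + qR) <= - a1 by move: h1; clear; lra.
  move=> h4; have := h3 h4 rd; move: h1 h2 ea.
  by rewrite (_ : - (r2 - qR) = qR - r2); [clear; lra|ring].
have [r21 x4 x5 x6] := x3 z10.
have j1' : qjet (fun y => u y - kink (qL + r1) (qR + r1) y) z1 a1 0.
  by apply: kink_jet_tilt; rewrite add0r.
have h1 := s0 z10 _ _ _ j1'.
case: (ltgtP z2.2 0) => [z2n|z2p|z20].
- have := pL z2n _ _ (kink_jet_neg z2n j2'); rewrite r21 /hoppo => h2.
  have i1 : incr_part hL p0L (qL + r1) < mu.
    by have := F_L (qL + r1) (qR + r1); move: h1 amu; clear; lra.
  have i2 : qL <= qL + r1 by rewrite lerDl; exact: x5.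
  have := cL' _ i1 i2; move: h2 mua; rewrite (_ : - (- r1 - qL) = qL + r1); last by ring.
  by clear; lra.
- have := pR z2p _ _ (kink_jet_pos z2p j2'); rewrite r21 /hoppo => h2.
  have i1 : decr_part hR p0R (qR + r1) < mu.
    by have := F_R (qL + r1) (qR + r1); move: h1 amu; clear; lra.
  have i2 : qR + r1 <= qR by have := x4 z2p; clear; lra.
  have := cR' _ i1 i2; move: h2 mua; rewrite (_ : - (- r1 - qR) = qR + r1); last by ring.
  by clear; lra.
have r10 := x6 z20; rewrite r21 r10 oppr0 in j2.
have := p0 z20 _ _ _ j2; move: h1; rewrite r10 !addr0.
by move: ea e0; clear; lra.
Qed.

End FluxLimitedJets.

(** * The comparison principle *)

Section FluxLimitedComparison.
Context {R : realType}.
Implicit Types (z y : R * R) (a b p q l : R) (u w : R * R -> R) (h : R -> R).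

(** Values at most La confine p' to a compact interval by coercivity, on which continuity is
    uniform. *)
Lemma limit_modulus h (La e : R) : limit_hamiltonian h -> 0 < e -> exists2 d, 0 < d &
  forall p p', h p' <= La -> `|p - p'| <= d -> h p <= h p' + e.
Proof.
move=> hh e0; have e2 : 0 < e / 2 by rewrite divr_gt0.
have [K0 hK] := lham_co hh (La + 1); pose K := `|K0|.
have cK : compact (`[- K, K] : set R) by exact: segment_compact.
have : \forall d \near (0 : R)^'+, (`[- K, K] : set R) `<=` [set p' | forall p, `|p - p'| <= d -> h p <= h p' + e].
  apply: (iffLR (@compact_near_coveringP _ _) cK) => x _.
  have [d d0 hd] := lham_cont hh x e2.
  exists ([set y | `|y - x| <= d / 2], [set d' | d' <= d / 2]) => /=.
    split; last by apply: nbhs_right_le; rewrite divr_gt0.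
    apply: filterS (nbhsx_ballx x (d / 2) _) => [y|]; last by rewrite divr_gt0.
    by rewrite /ball /= distrC => /ltW.
  move=> [y d'] /= [h1 h2] p h3.
  have /ler_normlP[_ h4] : `|h p - h x| <= e / 2.
    by apply: hd; have := ler_distD y p x; move: h1 h2 h3; clear; lra.
  have /ler_normlP[h5 _] : `|h y - h x| <= e / 2.
    by apply: hd; move: h1 d0; clear; lra.
  by move: h4 h5; clear; lra.
have : \forall d \near (0 : R)^'+, 0 < d by exact: nbhs_right_gt.
move=> n0 n1; have /filter_ex[d [d0 hd]] : \forall d \near (0 : R)^'+, 0 < d /\
    (`[- K, K] : set R) `<=` [set p' | forall p, `|p - p'| <= d -> h p <= h p' + e].
  by move: n0 n1; apply: filterS2.
exists d => // p p' hp' hpp; apply: hd => //=.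
rewrite in_itv /= -ler_norml leNgt; apply/negP => h1.
have : K0 <= `|p'| by apply: le_trans (ler_norm _) (ltW h1).
by move=> /hK; move: hp'; clear; lra.
Qed.

Lemma sqr_le_norm (x d : R) : 0 <= d -> x ^+ 2 <= d ^+ 2 -> `|x| <= d.
Proof. by move=> d0; rewrite -(real_normK (num_real x)) ler_pXn2r// ?nnegrE. Qed.

(** The maximum over doubled times at equal abscissas fixes the time slope [la], hence [mu] and its
    critical slopes. The kink built from them is antisymmetric in the two points and vanishes at
    equal abscissas, so [penalized_max] still brings the maximum of the fully doubled function back
    to [M], and the contact points fall under [fl_core]. *)
Lemma fl_comparison hL hR (A p0L p0R C T : R) u w (u0 : R -> R) :
  limit_hamiltonian hL -> limit_hamiltonian hR -> argmin hL p0L -> argmin hR p0R -> 0 <= C ->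
  (forall z, z.1 < T -> usc u z) -> (forall z, z.1 < T -> usc w z) ->
  (forall t x, 0 <= t < T -> u (t, x) <= u0 x + C * t) ->
  (forall t x, 0 <= t < T -> w (t, x) <= - u0 x + C * t) ->
  (forall z, 0 < z.1 < T -> fl_sub_at hL hR (junction_fun A hL hR p0L p0R) u z) ->
  (forall z, 0 < z.1 < T -> fl_super_at hL hR (junction_fun A hL hR p0L p0R) w z) ->
  forall t x, 0 <= t < T -> u (t, x) + w (t, x) <= 0.
Proof.
move=> hhL hhR mL mR C0 uu uw bu bw su sw t1 x1 /andP[t1_ge0 t1T].
rewrite leNgt; apply/negP; set sg := u (t1, x1) + w (t1, x1) => sg0.
have t10 : 0 < t1.
  rewrite lt_neqAle t1_ge0 andbT; apply/eqP => e; move: sg0; rewrite /sg -e.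
  have h0 : 0 <= (0 : R) < T by rewrite lexx e.
  by have := bu 0 x1 h0; have := bw 0 x1 h0; rewrite mulr0; clear; lra.
pose T2 := (t1 + T) / 2.
have t1T2 : t1 < T2 by rewrite /T2; move: t1T; clear; lra.
have T2T : T2 < T by rewrite /T2; move: t1T; clear; lra.
have T20 : 0 < T2 by exact: lt_trans t1T2.
clearbody T2.
pose B := 2 * C * T2; have B0 : 0 <= B by rewrite /B !mulr_ge0// ltW.
have CB t : t <= T2 -> 2 * (C * t) <= B.
  by move=> h; rewrite /B -mulrA ler_pM2l// ler_wpM2l.
(* The penalty would be B + 1 at time T2, more than the barriers allow at a maximum; it vanishes up
   to time t1. *)
pose N := (B + 1) / (T2 - t1) ^+ 2.
have T21 : 0 < (T2 - t1) ^+ 2 by rewrite exprn_gt0// subr_gt0.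
have N0 : 0 < N by rewrite divr_gt0// ltr_wpDl.
have NB : N * (T2 - t1) ^+ 2 = B + 1 by rewrite /N divfK ?gt_eqF.
clearbody N.
(* If one of the times is 0, the barriers leave at most C s - s^2 / th <= C^2 th / 4, where s is the
   other time; this choice makes it at most sg / 16, below M >= sg / 2. *)
pose th := sg / (4 * (C ^+ 2 + 1)).
have C21 : 0 < C ^+ 2 + 1 by rewrite ltr_wpDl// sqr_ge0.
have th0 : 0 < th by rewrite /th divr_gt0// mulr_gt0.
have thC : C ^+ 2 * th <= sg / 4.
  apply: le_trans (_ : (C ^+ 2 + 1) * th <= _); first by rewrite ler_wpM2r ?lerDl// ltW.
  by rewrite /th le_eqVlt; apply/orP; left; apply/eqP; field; rewrite gt_eqF.
clearbody th.
pose eta := sg / (8 * (T2 + 1)).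
have T2p : 0 < T2 + 1 by rewrite ltr_wpDl// ltW.
have eta0 : 0 < eta by rewrite /eta divr_gt0// mulr_gt0.
have etaT : eta * t1 <= sg / 8.
  apply: le_trans (_ : eta * (T2 + 1) <= _).
    by rewrite ler_pM2l//; move: t1T2; clear; lra.
  by rewrite /eta le_eqVlt; apply/orP; left; apply/eqP; field; rewrite gt_eqF.
clearbody eta.
have e4 : 0 < eta / 4 by rewrite divr_gt0.
have [dR dR0 hdR] := limit_modulus (2 * T2 / th + 1) hhR e4.
have [dL dL0 hdL] := limit_modulus (2 * T2 / th + 1) hhL e4.
pose d := Num.min dL dR; have d0 : 0 < d by rewrite lt_min dL0.
have ddL : d <= dL by rewrite ge_min lexx.
have ddR : d <= dR by rewrite ge_min lexx orbT.
clearbody d.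
(* Localization in x: it costs at most sg / 8 at x1, and its slope 2 be |x| is at most d / 4
   wherever be x^2 <= B, d being the slope tolerance of the Hamiltonians. *)
pose be := Num.min 1 (Num.min (sg / 8 / (x1 ^+ 2 + 1)) ((d / 8) ^+ 2 / (B + 1))).
have x11 : 0 < x1 ^+ 2 + 1 by rewrite ltr_wpDl// sqr_ge0.
have B1 : 0 < B + 1 by rewrite ltr_wpDl.
have be0 : 0 < be by rewrite !lt_min ltr01 !divr_gt0// exprn_gt0// divr_gt0.
have be1 : be <= 1 by rewrite ge_min lexx.
have bex : be * x1 ^+ 2 <= sg / 8.
  apply: le_trans (_ : be * (x1 ^+ 2 + 1) <= _); first by rewrite ler_pM2l// lerDl.
  by rewrite -ler_pdivlMr// !ge_min lexx !orbT.
have beB : be * (B + 1) <= (d / 8) ^+ 2 by rewrite -ler_pdivlMr// !ge_min lexx !orbT.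
clearbody be.
pose rho := (B + 1) / be + `|x1| + 2.
have rho1 : (B + 1) / be <= rho - 1.
  by rewrite /rho; have := normr_ge0 x1; clear; lra.
have rho2 : 1 <= rho - 1.
  have : 0 <= (B + 1) / be by rewrite divr_ge0// ltW.
  by rewrite /rho; have := normr_ge0 x1; clear; lra.
have rhox : `|x1| <= rho.
  have : 0 <= (B + 1) / be by rewrite divr_ge0// ltW.
  by rewrite /rho; clear; lra.
clearbody rho.
pose Xr := @rect R 0 T2 (- rho) rho.
have XrP y : Xr y <-> [/\ 0 <= y.1, y.1 <= T2 & `|y.2| <= rho].
  rewrite /Xr /rect /= !in_itv /= ler_norml; split.
    by case=> /andP[? ?] ?.
  by case=> ? ? ?; split => //; apply/andP.
pose X : set ((R * R) * (R * R)) := Xr `*` Xr.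
have cX : compact X by apply: compact_setX; exact: compact_rect.
pose rest (v : (R * R) * (R * R)) : R := (v.1.1 - v.2.1) ^+ 2 / th + be * v.1.2 ^+ 2 + eta * v.1.1
  + N * Num.max (v.1.1 - t1) 0 ^+ 2 + N * Num.max (v.2.1 - t1) 0 ^+ 2.
pose g (v : (R * R) * (R * R)) : R := (v.1.2 - v.2.2) ^+ 2.
pose D := X `&` [set v | v.1.2 = v.2.2].
have ccoord : [/\ continuous (fun v : (R * R) * (R * R) => v.1.1), continuous (fun v : (R * R) * (R * R) => v.1.2),
    continuous (fun v : (R * R) * (R * R) => v.2.1) & continuous (fun v : (R * R) * (R * R) => v.2.2)].
  split=> v.
  - by apply: (@continuous_comp _ _ _ fst (fun y : R * R => y.1)); [exact: cvg_fst|exact: continuous_coord1].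
  - by apply: (@continuous_comp _ _ _ fst (fun y : R * R => y.2)); [exact: cvg_fst|exact: continuous_coord2].
  - by apply: (@continuous_comp _ _ _ snd (fun y : R * R => y.1)); [exact: cvg_snd|exact: continuous_coord1].
  by apply: (@continuous_comp _ _ _ snd (fun y : R * R => y.2)); [exact: cvg_snd|exact: continuous_coord2].
have [c11 c12 c21 c22] := ccoord.
have csq (f : (R * R) * (R * R) -> R) : continuous f -> continuous (fun v => f v ^+ 2).
  by move=> cf v; apply: (@continuous_at_sqr R _ f); exact: cf.
have cpos (f : (R * R) * (R * R) -> R) : continuous f -> continuous (fun v => Num.max (f v - t1) 0 ^+ 2).
  move=> cf; apply: csq => v; apply: (@continuous_max R _ (fun v => f v - t1 : R^o) (fun=> 0) v).
    by apply: cvgB; [exact: cf|exact: cvg_cst].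
  exact: cvg_cst.
have crest' : continuous rest.
  move=> v; repeat (apply: cvgD); try (apply: cvgM; try exact: cvg_cst).
  - by apply: csq => v'; apply: cvgB; [exact: c11|exact: c21].
  - exact: csq.
  - exact: c11.
  - exact: cpos.
  exact: cpos.
have cg : continuous g by apply: csq => v; apply: cvgB; [exact: c12|exact: c22].
have cD : compact D.
  apply: compact_closedI => //.
  have -> : [set v : (R * R) * (R * R) | v.1.2 = v.2.2] = (fun v => v.1.2 - v.2.2) @^-1` [set 0].
    by apply/seteqP; split=> v /=; [move->; rewrite subrr|move/eqP; rewrite subr_eq0 => /eqP].
  apply: closed_comp; last exact: closed_eq.
  by move=> v _; apply: cvgB; [exact: c12|exact: c22].
have uX y : Xr y -> usc u y /\ usc w y.
  by move=> /XrP[_ h _]; split; [apply: uu|apply: uw]; exact: le_lt_trans T2T.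
pose f0 v : R := u v.1 + w v.2 - rest v.
have uf0 v : X v -> usc f0 v.
  move=> [h1 h2]; apply: uscD; first exact: (usc_doubled0 (uX _ h1).1 (uX _ h2).2).
  by apply: continuous_usc; apply: cvgN; exact: crest'.
have Dt1 : D ((t1, x1), (t1, x1)).
  by split => //; split; apply/XrP; split=> //=; exact: ltW.
have [v0 [[/XrP[a1 a2 a3] /XrP[b1 b2 b3]] e0] hv0] := usc_compact_max cD (ex_intro _ _ Dt1) (fun v Dv => uf0 v Dv.1).
have v0X : X v0 by split; apply/XrP.
set M := f0 v0 in hv0.
have M0 : sg / 2 <= M.
  apply: le_trans (hv0 _ Dt1); rewrite /f0 /rest /= !subrr expr0n /= mul0r maxxx expr0n /= !mulr0 -/sg.
  by move: etaT bex sg0; clear; lra.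
have lt_T t : t <= T2 -> t < T by move=> h; exact: le_lt_trans T2T.
have Mle : M <= C * v0.1.1 + C * v0.2.1 - rest v0.
  have := bu v0.1.1 v0.1.2; have := bw v0.2.1 v0.2.2; rewrite a1 b1 !lt_T// -!surjective_pairing.
  by move=> /(_ isT) h1 /(_ isT); rewrite e0 /M /f0; move: h1; clear; lra.
have sq0 (x : R) : 0 <= x ^+ 2 := sqr_ge0 x.
have p1 : 0 <= N * Num.max (v0.1.1 - t1) 0 ^+ 2 by rewrite mulr_ge0// ltW.
have p2 : 0 <= N * Num.max (v0.2.1 - t1) 0 ^+ 2 by rewrite mulr_ge0// ltW.
have p3 : 0 <= be * v0.1.2 ^+ 2 by rewrite mulr_ge0// ltW.
have p4 : 0 <= eta * v0.1.1 by rewrite mulr_ge0// ltW.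
have p5 : 0 <= (v0.1.1 - v0.2.1) ^+ 2 / th by rewrite divr_ge0// ltW.
have CT : C * v0.1.1 + C * v0.2.1 <= B by have := CB _ a2; have := CB _ b2; clear; lra.
have restB : rest v0 <= B by move: Mle M0 CT sg0; clear; lra.
have top t : 0 <= t -> N * Num.max (t - t1) 0 ^+ 2 <= B -> t < T2.
  move=> t_ge0 h; rewrite ltNge; apply/negP => h2.
  have : N * (T2 - t1) ^+ 2 <= N * Num.max (t - t1) 0 ^+ 2.
    rewrite ler_pM2l// ler_pXn2r// ?nnegrE ?le_max ?lexx ?orbT ?subr_ge0 ?(ltW t1T2)//.
    by rewrite lerD2r h2.
  by rewrite NB; move: h; clear; lra.
have i1 : v0.1.1 < T2 by apply: top => //; move: restB p2 p3 p4 p5; rewrite /rest; clear; lra.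
have i2 : v0.2.1 < T2 by apply: top => //; move: restB p1 p3 p4 p5; rewrite /rest; clear; lra.
have Cth (s : R) : C * s - s ^+ 2 / th <= sg / 16.
  have : 0 <= (s - C * th / 2) ^+ 2 / th by rewrite divr_ge0// ltW.
  have -> : (s - C * th / 2) ^+ 2 / th = s ^+ 2 / th - C * s + C ^+ 2 * th / 4 by field; rewrite gt_eqF.
  by move: thC; clear; lra.
have i3 : 0 < v0.1.1.
  rewrite lt_neqAle a1 andbT; apply/eqP => e; have := Cth v0.2.1.
  move: Mle M0 p1 p2 p3 p4; rewrite /rest -e mulr0 sub0r sqrrN; move: sg0; clear; lra.
have i4 : 0 < v0.2.1.
  rewrite lt_neqAle b1 andbT; apply/eqP => e; have := Cth v0.1.1.
  move: Mle M0 p1 p2 p3 p4; rewrite /rest -e mulr0 subr0; move: sg0; clear; lra.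
have beX : be * v0.1.2 ^+ 2 <= B by move: restB p1 p2 p4 p5; rewrite /rest; clear; lra.
have i5 : `|v0.1.2| < rho - 1.
  rewrite ltNge; apply/negP => h; have : be * (rho - 1) <= be * v0.1.2 ^+ 2.
    rewrite ler_pM2l// -(real_normK (num_real v0.1.2)); move: h rho2; move: (`|v0.1.2|) => s; clear => *; nra.
  have : B + 1 <= be * (rho - 1) by rewrite mulrC -ler_pdivrMr.
  by move: beX; clear; lra.
have i6 : 2 * be * `|v0.1.2| <= d / 4.
  have : `|be * v0.1.2| <= d / 8.
    apply: sqr_le_norm; first by rewrite divr_ge0// ltW.
    apply: le_trans beB; rewrite exprMn [be ^+ 2]expr2 -mulrA ler_pM2l//.
    by move: beX; clear; lra.
  by rewrite normrM gtr0_norm// -mulrA; clear; lra.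
(* At nearby contacts - a1' lies below la - eta and a2' above la, up to small errors; mu sits
   halfway in the gap that the term eta t has created. *)
pose la := - (2 * (v0.1.1 - v0.2.1) / th); pose mu := la - eta / 2.
have [qR [cR cR']] := crit_exists p0R mu hhR.
have [qL' [cL cL']] := crit_exists (- p0L) mu (limit_hamiltonian_reflect hhL).
pose qL := - qL'.
pose e1 := Num.min (Num.min (Num.min (v0.1.1 / 2) ((T2 - v0.1.1) / 2)) (Num.min (v0.2.1 / 2) ((T2 - v0.2.1) / 2)))
  (Num.min (Num.min (d / 16) (eta / (16 * (1 + 2 / th)))) (Num.min (1 / 4) (if v0.1.2 == 0 then 1 else `|v0.1.2| / 4))).
have th2 : 0 < 1 + 2 / th by rewrite ltr_wpDr// divr_ge0// ltW.
have e10 : 0 < e1.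
  rewrite !lt_min !divr_gt0 ?subr_gt0 ?mulr_gt0//=.
  by case: eqVneq => // h; rewrite divr_gt0// normr_gt0.
have e1a : e1 <= v0.1.1 / 2 by rewrite !ge_min lexx.
have e1b : e1 <= (T2 - v0.1.1) / 2 by rewrite !ge_min lexx !orbT.
have e1c : e1 <= v0.2.1 / 2 by rewrite !ge_min lexx !orbT.
have e1d : e1 <= (T2 - v0.2.1) / 2 by rewrite !ge_min lexx !orbT.
have e1e : e1 <= d / 16 by rewrite !ge_min lexx !orbT.
have e1f : e1 * (1 + 2 / th) <= eta / 16.
  have : e1 <= eta / (16 * (1 + 2 / th)) by rewrite !ge_min lexx !orbT.
  by rewrite invfM mulrA ler_pdivlMr.
have e1g : e1 <= 1 / 4 by rewrite !ge_min lexx !orbT.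
have e1h : v0.1.2 != 0 -> e1 <= `|v0.1.2| / 4.
  by move=> h; rewrite !ge_min (negPf h) lexx !orbT.
clearbody e1.
pose f v : R := f0 v + (- kink qL qR v.1 + kink qL qR v.2).
have ck : continuous (fun v : (R * R) * (R * R) => - kink qL qR v.1 + kink qL qR v.2).
  move=> v; apply: cvgD.
    apply: cvgN; apply: (@continuous_comp _ _ _ fst (kink qL qR)); [exact: cvg_fst|exact: continuous_kink].
  apply: (@continuous_comp _ _ _ snd (kink qL qR)); [exact: cvg_snd|exact: continuous_kink].
have uf v : X v -> usc f v.
  by move=> Xv; apply: uscD; [exact: uf0|apply: continuous_usc; exact: ck].
have kinkE2 (y y' : R * R) : y.2 = y'.2 -> kink qL qR y = kink qL qR y' by rewrite /kink => ->.
have gz v : X v -> g v = 0 -> f v <= M.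
  move=> Xv /eqP; rewrite /g sqrf_eq0 subr_eq0 => /eqP h.
  by rewrite /f (kinkE2 _ _ h) addNr addr0; exact: hv0.
have e12 : 0 < e1 ^+ 2 by rewrite exprn_gt0.
have [n0 n00 hn0] := penalized_max cX uf cg (fun v => sqr_ge0 _) gz e12.
pose n := n0 + 1; have n_gt0 : 0 < n by rewrite /n; move: n00; clear; lra.
(* Makes the maximum return to v0, where the time slope defining mu was computed, and keeps the sign
   of the abscissas when v0 is off the junction. *)
pose S (v : (R * R) * (R * R)) : R := (v.1.1 - v0.1.1) ^+ 2 + (v.2.1 - v0.2.1) ^+ 2 + (v.1.2 - v0.1.2) ^+ 2.
have cS : continuous S.
  by move=> v; repeat (apply: cvgD); apply: csq => v'; apply: cvgB; try exact: cvg_cst;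
    [exact: c11|exact: c21|exact: c12].
have uPsi v : X v -> usc (fun v => f v + (- (n * g v) - S v)) v.
  move=> Xv; apply: uscD; first exact: uf.
  apply: continuous_usc; apply: cvgB; last exact: cS.
  by apply: cvgN; apply: cvgM; [exact: cvg_cst|exact: cg].
have [v Xv hv] := usc_compact_max cX (ex_intro _ _ v0X) uPsi.
have hMv : M <= f v - n * g v - S v.
  have := hv v0 v0X; rewrite /f (kinkE2 _ _ e0) addNr addr0 -/M.
  by rewrite /S /g e0 !subrr expr0n /= mulr0; clear; lra.
have := hn0 n0 v (lexx _) Xv => hfv.
have hgS : g v + S v <= e1 ^+ 2 by move: hMv hfv; rewrite /n; clear; lra.
have ge1 : [/\ `|v.1.1 - v0.1.1| <= e1, `|v.2.1 - v0.2.1| <= e1, `|v.1.2 - v0.1.2| <= e1 & `|v.1.2 - v.2.2| <= e1].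
  move: hgS; rewrite /g /S.
  have := sq0 (v.1.1 - v0.1.1); have := sq0 (v.2.1 - v0.2.1).
  have := sq0 (v.1.2 - v0.1.2); have := sq0 (v.1.2 - v.2.2).
  move=> h1 h2 h3 h4 h5; split; (apply: sqr_le_norm; first exact: ltW);
    by move: h1 h2 h3 h4 h5; clear; lra.
case: ge1 => g1 g2 g3 g4.
case: Xv => /XrP[c1 c2 c3] /XrP[c4 c5 c6].
have j1 : 0 < v.1.1 < T2.
  by move: g1 e1a e1b i3 i1; rewrite ler_norml; clear => /andP[? ?] *; apply/andP; split; lra.
have j2 : 0 < v.2.1 < T2.
  by move: g2 e1c e1d i4 i2; rewrite ler_norml; clear => /andP[? ?] *; apply/andP; split; lra.
have j3 : `|v.1.2| < rho.
  have := ler_distD v0.1.2 v.1.2 0; rewrite !subr0; move: g3 e1g i5; clear; lra.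
have j4 : `|v.2.2| < rho.
  have := ler_distD v.1.2 v.2.2 0; have := ler_distD v0.1.2 v.1.2 0.
  rewrite !subr0 [`|v.2.2 - _|]distrC; move: g3 g4 e1g i5; clear; lra.
have nX (z : R * R) : 0 < z.1 < T2 -> `|z.2| < rho -> \forall y \near z, Xr y.
  move=> /andP[z1 z2] z3; apply/nbhs_boxP.
  exists (Num.min (Num.min z.1 (T2 - z.1)) (rho - `|z.2|)); first by rewrite !lt_min !subr_gt0 z1 z2.
  move=> y; rewrite !le_min => /andP[/andP[h1 h2] _] /andP[_ h3]; apply/XrP; split.
  - by move: h1; rewrite ler_norml; clear; lra.
  - by move: h2; rewrite ler_norml; clear; lra.
  by have := ler_distD z.2 y.2 0; rewrite !subr0; move: h3; clear; lra.
pose m1 := Num.max (v.1.1 - t1) 0; pose m2 := Num.max (v.2.1 - t1) 0.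
have m10 : 0 <= m1 by rewrite le_max lexx orbT.
have m20 : 0 <= m2 by rewrite le_max lexx orbT.
pose a1' := 2 * (v.1.1 - v.2.1) / th + eta + N * (2 * m1) + 2 * (v.1.1 - v0.1.1).
pose r1 := 2 * be * v.1.2 + 2 * n * (v.1.2 - v.2.2) + 2 * (v.1.2 - v0.1.2).
pose a2' := - (2 * (v.1.1 - v.2.1) / th) + N * (2 * m2) + 2 * (v.2.1 - v0.2.1).
pose r2 := - (2 * n * (v.1.2 - v.2.2)).
have thi0 : 0 <= th^-1 by rewrite invr_ge0 ltW.
have J1 : qjet (fun y => u y - kink qL qR y) v.1 a1' r1.
  exists (th^-1 + be + N + n + 1); apply: filterS (nX _ j1 j3) => y Xy.
  have Xyv : X (y, v.2) by split => //; apply/XrP.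
  have := hv _ Xyv; rewrite /f /f0 /rest /g /S /=.
  have := ler_wpM2l (ltW N0) (posr_sqr_le (y.1 - t1) (v.1.1 - t1)); rewrite -/m1.
  have := mulr_ge0 thi0 (sq0 (y.2 - v.1.2)); have := mulr_ge0 (ltW be0) (sq0 (y.1 - v.1.1)).
  have := mulr_ge0 (ltW N0) (sq0 (y.2 - v.1.2)); have := mulr_ge0 (ltW n_gt0) (sq0 (y.1 - v.1.1)).
  rewrite /a1' /r1 /lin /sqd.
  move: (kink qL qR y) (kink qL qR v.1) (kink qL qR v.2) (u y) (u v.1) (w v.2) (Num.max (y.1 - t1) 0 ^+ 2) (Num.max (v.2.1 - t1) 0 ^+ 2).
  move: (m1) (y.1) (y.2) (v.1.1) (v.1.2) (v.2.1) (v.2.2) (v0.1.1) (v0.2.1) (v0.1.2) th^-1.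
  by clear => *; lra.
have J2 : qjet (fun y => w y + kink qL qR y) v.2 a2' r2.
  exists (th^-1 + N + n + 1); apply: filterS (nX _ j2 j4) => y Xy.
  have Xyv : X (v.1, y) by split => //; apply/XrP.
  have := hv _ Xyv; rewrite /f /f0 /rest /g /S /=.
  have := ler_wpM2l (ltW N0) (posr_sqr_le (y.1 - t1) (v.2.1 - t1)); rewrite -/m2.
  have := mulr_ge0 thi0 (sq0 (y.2 - v.2.2)); have := sq0 (y.2 - v.2.2).
  have := mulr_ge0 (ltW N0) (sq0 (y.2 - v.2.2)); have := mulr_ge0 (ltW n_gt0) (sq0 (y.1 - v.2.1)).
  rewrite /a2' /r2 /lin /sqd.
  move: (kink qL qR y) (kink qL qR v.1) (kink qL qR v.2) (w y) (w v.2) (u v.1) (Num.max (y.1 - t1) 0 ^+ 2) (Num.max (v.1.1 - t1) 0 ^+ 2).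
  move: (m2) (y.1) (y.2) (v.1.1) (v.1.2) (v.2.1) (v.2.2) (v0.1.1) (v0.2.1) (v0.1.2) th^-1.
  by clear => *; lra.
have Nm1 : 0 <= N * (2 * m1) by rewrite !mulr_ge0// ltW.
have Nm2 : 0 <= N * (2 * m2) by rewrite !mulr_ge0// ltW.
have g1' := g1; have g2' := g2; rewrite !ler_norml in g1' g2'.
case/andP: g1' => g1l g1r; case/andP: g2' => g2l g2r.
have dla : `|2 * (v.1.1 - v.2.1) / th + la| <= 2 * e1 * (2 / th).
  rewrite /la (_ : 2 * (v.1.1 - v.2.1) / th + - (2 * (v0.1.1 - v0.2.1) / th)
     = ((v.1.1 - v0.1.1) - (v.2.1 - v0.2.1)) * (2 / th)); last by ring.
  have th2p : 0 <= 2 / th by rewrite divr_ge0// ltW.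
  rewrite normrM (ger0_norm th2p); apply: ler_wpM2r => //; apply: le_trans (ler_normB _ _) _.
  by move: g1 g2; clear; lra.
rewrite ler_norml in dla; case/andP: dla => dl1 dl2.
have e1s : 2 * e1 * (2 / th) <= eta / 8.
  by have := e1f; have := e10; move: (2 / th) => s; clear; lra.
have e1t : 2 * e1 <= eta / 8.
  have : 0 <= e1 * (2 / th) by rewrite mulr_ge0 ?divr_ge0// ltW.
  by have := e1f; move: (2 / th) => s; clear; lra.
have le_La : - a1' <= 2 * T2 / th + 1.
  have : - (2 * (v.1.1 - v.2.1) / th) <= 2 * T2 / th.
    rewrite -mulNr ler_pM2r ?invr_gt0//; move: j1 j2; clear => /andP[? ?] /andP[? ?]; lra.
  move: eta0 Nm1 g1l e1g; rewrite /a1'; move: (2 * _ / th) (2 * T2 / th) (N * (2 * m1)) => A1 A2 A3.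
  by clear; lra.
have su1 : fl_sub_at hL hR (junction_fun A hL hR p0L p0R) u v.1.
  by apply: su; case/andP: j1 => -> h; rewrite (lt_trans h).
have sw1 : fl_super_at hL hR (junction_fun A hL hR p0L p0R) w v.2.
  by apply: sw; case/andP: j2 => -> h; rewrite (lt_trans h).
have x0pos : v0.1.2 != 0 -> 0 < v0.1.2 * v.1.2 /\ 0 < v0.1.2 * v.2.2.
  move=> /e1h h; have h2 : `|v.2.2 - v0.1.2| <= e1 + e1.
    have := ler_distD v.1.2 v.2.2 v0.1.2; rewrite [`|v.2.2 - v.1.2|]distrC.
    by move: g3 g4; clear; lra.
  move: g3 h2 h e10; rewrite !ler_norml; case: (ltrgt0P v0.1.2) => [h3|h3|->]; last by clear; lra.
    by clear -h3 => /andP[? ?] /andP[? ?] ? ?; split; apply: mulr_gt0 => //; lra.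
  by clear -h3 => /andP[? ?] /andP[? ?] ? ?; split; rewrite nmulr_rgt0//; lra.
apply: (fl_core su1 sw1 J1 J2 (ltW e4) (d := d) (mu := mu)).
- rewrite /a1' /a2'; move: Nm1 Nm2 e1t g1l g2l eta0; move: (2 * _ / th) (N * (2 * m1)) (N * (2 * m2)) => A1 A2 A3.
  by clear; lra.
- rewrite /a1' /mu; move: Nm1 e1t e1s g1l eta0 dl1 dl2; move: (2 * _ / th) (N * (2 * m1)) (2 * e1 * _) => A1 A2 A3.
  by clear; lra.
- rewrite /a2' /mu; move: Nm2 e1t e1s g2l eta0 dl1 dl2; move: (2 * _ / th) (N * (2 * m2)) (2 * e1 * _) => A1 A2 A3.
  by clear; lra.
- have -> : r1 + r2 = 2 * be * v0.1.2 + 2 * (be + 1) * (v.1.2 - v0.1.2).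
    by rewrite /r1 /r2; ring.
  apply: le_trans (ler_normD _ _) _.
  have : `|2 * be * v0.1.2| <= d / 4.
    by apply: le_trans i6; rewrite !normrM (gtr0_norm be0) normr_nat.
  have : `|2 * (be + 1) * (v.1.2 - v0.1.2)| <= 4 * e1.
    have be2 : 0 < 2 * (be + 1) by rewrite mulr_gt0// addr_gt0.
    by rewrite normrM (gtr0_norm be2); apply: ler_pM => //; [exact: ltW|move: be1; clear; lra].
  by move: e1e d0; clear; lra.
- by move=> p p' h1 h2; apply: hdR; [exact: le_trans le_La|exact: le_trans ddR].
- by move=> p p' h1 h2; apply: hdL; [exact: le_trans le_La|exact: le_trans ddL].
- by move=> p hp; exact: cR.
- by move=> p; exact: cR'.
- move=> p hp; rewrite /qL lerNl; apply: cL; last exact: argmin_refl.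
  by rewrite opprK.
- move=> p hp hq; rewrite -[p]opprK; apply: cL'; first exact: argmin_refl.
    by rewrite -incr_part_refl.
  by rewrite lerNl.
- move=> h1 h2; have [e|ne] := eqVneq v0.1.2 0; last first.
    by have [h3 h4] := x0pos ne; move: h1 h2 h3 h4; clear; nra.
  rewrite /r1 e subr0; have : 0 < be * v.1.2 by exact: mulr_gt0.
  have : 0 <= n * (v.1.2 - v.2.2) by apply: mulr_ge0; [exact: ltW|move: h1 h2; clear; lra].
  by move: h1; clear; lra.
- move=> h1 h2; have [e|ne] := eqVneq v0.1.2 0; last first.
    by have [h3 h4] := x0pos ne; move: h1 h2 h3 h4; clear; nra.
  rewrite /r1 e subr0; have : be * v.1.2 < 0 by rewrite pmulr_rlt0.
  have : 0 <= n * (v.2.2 - v.1.2) by apply: mulr_ge0; [exact: ltW|move: h1 h2; clear; lra].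
  by move: h1; clear; lra.
move=> h1; have [e|ne] := eqVneq v0.1.2 0; last first.
  by have [] := x0pos ne; rewrite h1 mulr0 ltxx.
have -> : r1 = - (2 * n * v.2.2) by rewrite /r1 h1 e; ring.
have -> : r2 = 2 * n * v.2.2 by rewrite /r2 h1; ring.
have n2 : 0 <= 2 * n by rewrite mulr_ge0// ltW.
split=> [|h2|h2|->]; first by rewrite opprK.
- by rewrite oppr_le0 mulr_ge0// ltW.
- by rewrite oppr_ge0 mulr_ge0_le0// ltW.
by rewrite mulr0 oppr0.
Qed.

End FluxLimitedComparison.

(** * Convergence *)

Section HalfRelaxedLimits.
Context {R : realType}.
Implicit Types (z y : R * R) (a b p q l eps : R) (w v : R * R -> R) (H : R -> R -> R -> R) (h : R -> R).

(* [U] consists of subsolutions and [W] of opposites of supersolutions of the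
   oscillating equations, extended by the initial datum to negative times. *)
Record oscillating_family H (T C : R) (u0 : R -> R) (U W : R -> R * R -> R) : Prop := OscillatingFamily {
  osc_uscU : \forall eps \near (0 : R)^'+, forall y, y.1 < T -> usc (U eps) y;
  osc_uscW : \forall eps \near (0 : R)^'+, forall y, y.1 < T -> usc (W eps) y;
  osc_sub : \forall eps \near (0 : R)^'+, qsub [set z | 0 < z.1 < T] (hscale H eps) 0 (U eps);
  osc_super : \forall eps \near (0 : R)^'+, qsub [set z | 0 < z.1 < T] (hneg (hscale H eps)) 0 (W eps);
  osc_ubU : \forall eps \near (0 : R)^'+, forall y, y.1 < T -> U eps y <= u0 y.2 + C * Num.max y.1 0;
  osc_ubW : \forall eps \near (0 : R)^'+, forall y, y.1 < T -> W eps y <= - u0 y.2 + C * Num.max y.1 0;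
  osc_sum : \forall eps \near (0 : R)^'+, forall y, y.1 < T -> 0 <= U eps y + W eps y }.

(* First order jets, as produced by C^1 test functions. *)
Definition fl_sub_c1 hL hR (F : R -> R -> R) u z : Prop :=
  [/\ 0 < z.2 -> forall a q, sjet u z a q -> a + hR q <= 0,
      z.2 < 0 -> forall a q, sjet u z a q -> a + hL q <= 0 &
      z.2 = 0 -> forall a pL pR, sjet (fun y => u y - kink pL pR y) z a 0 -> a + F pL pR <= 0].

Definition fl_super_c1 hL hR (F : R -> R -> R) w z : Prop :=
  [/\ 0 < z.2 -> forall a q, sjet w z a q -> a + hoppo hR q <= 0,
      z.2 < 0 -> forall a q, sjet w z a q -> a + hoppo hL q <= 0 &
      z.2 = 0 -> forall a pL pR, sjet (fun y => w y + kink pL pR y) z a 0 -> a <= F pL pR].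

Lemma fl_sub_c1_at hL hR F u z : fl_sub_c1 hL hR F u z -> fl_sub_at hL hR F u z.
Proof.
move=> [h1 h2 h3]; split => z0 a.
- by move=> q /qjet_sjet; exact: h1.
- by move=> q /qjet_sjet; exact: h2.
by move=> pL pR /qjet_sjet; exact: h3.
Qed.

Lemma fl_super_c1_at hL hR F w z : fl_super_c1 hL hR F w z -> fl_super_at hL hR F w z.
Proof.
move=> [h1 h2 h3]; split => z0 a.
- by move=> q /qjet_sjet; exact: h1.
- by move=> q /qjet_sjet; exact: h2.
by move=> pL pR /qjet_sjet; exact: h3.
Qed.

Lemma lipschitz_continuous (u0 : R -> R) (L : R) :
  (forall x x', u0 x - u0 x' <= L * `|x - x'|) ->
  continuous (fun y : R * R => u0 y.2).
Proof.
move=> hL y; apply/cvgrPdist_le => e e0; apply/nbhs_boxP.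
have L1 : 0 < `|L| + 1 by rewrite ltr_wpDl.
exists (e / (`|L| + 1)) => [|x _]; first exact: divr_gt0.
rewrite ler_pdivlMr// => h; rewrite ler_norml.
have LL : L * `|x.2 - y.2| <= `|x.2 - y.2| * (`|L| + 1).
  by rewrite mulrC ler_wpM2l//; have := ler_norm L; clear; lra.
have := hL x.2 y.2; have := hL y.2 x.2; rewrite [`|y.2 - x.2|]distrC.
by move: h LL; clear => *; apply/andP; split; lra.
Qed.

Lemma continuous_posr : continuous (fun y : R * R => Num.max y.1 0).
Proof.
move=> y; apply: (@continuous_max R _ (fun y : R * R => y.1 : R^o) (fun=> 0) y).
  exact: continuous_coord1.
exact: cvg_cst.
Qed.

Lemma osc_continuous (u0 : R -> R) (L s k : R) (hu0 : forall x x', u0 x - u0 x' <= L * `|x - x'|) :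
  continuous (fun y : R * R => s * u0 y.2 + k * Num.max y.1 0).
Proof.
move=> y; apply: cvgD; apply: cvgM; try exact: cvg_cst.
  exact: (lipschitz_continuous hu0).
exact: continuous_posr.
Qed.

Lemma near_time (T : R) z : z.1 < T -> \forall y \near z, y.1 < T.
Proof.
move=> zT; apply/nbhs_boxP; exists ((T - z.1) / 2); first by rewrite divr_gt0// subr_gt0.
by move=> y h _; move: h zT; rewrite ler_norml; clear => /andP[_]; lra.
Qed.

Lemma osc_bounded (H : R -> R -> R -> R) (T C : R) (u0 : R -> R) (U W : R -> R * R -> R) (L : R)
  (hu0 : forall x x', u0 x - u0 x' <= L * `|x - x'|) (fam : oscillating_family H T C u0 U W) z :
  z.1 < T -> exists r M : R, [/\ 0 < r,
  (\forall eps \near (0 : R)^'+, forall y, cbox z r y -> `|U eps y| <= M) &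
  (\forall eps \near (0 : R)^'+, forall y, cbox z r y -> `|W eps y| <= M)].
Proof.
move=> zT; have [r r0 hr] : exists2 r, 0 < r & forall y, cbox z r y -> y.1 < T.
  by have /nbhs_boxP[r r0 hr] := near_time zT; exists r => // y [y1 y2]; exact: hr.
have [M1 hM1] := usc_compact_bound (@compact_cbox R z r) (fun y _ => continuous_usc (@osc_continuous u0 L 1 C hu0 y)).
have [M2 hM2] := usc_compact_bound (@compact_cbox R z r) (fun y _ => continuous_usc (@osc_continuous u0 L (-1) C hu0 y)).
exists r, (Num.max M1 M2); split => //.
  move: (osc_ubU fam) (osc_ubW fam) (osc_sum fam); apply: filterS3 => eps h1 h2 h3 y yb.
  have yT := hr y yb; have := hM1 y yb; have := hM2 y yb; rewrite /=.
  have := h1 y yT; have := h2 y yT; have := h3 y yT.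
  have : M1 <= Num.max M1 M2 by rewrite le_max lexx.
  have : M2 <= Num.max M1 M2 by rewrite le_max lexx orbT.
  by rewrite ler_norml; clear => *; apply/andP; split; lra.
move: (osc_ubU fam) (osc_ubW fam) (osc_sum fam); apply: filterS3 => eps h1 h2 h3 y yb.
have yT := hr y yb; have := hM1 y yb; have := hM2 y yb; rewrite /=.
have := h1 y yT; have := h2 y yT; have := h3 y yT.
have : M1 <= Num.max M1 M2 by rewrite le_max lexx.
have : M2 <= Num.max M1 M2 by rewrite le_max lexx orbT.
by rewrite ler_norml; clear => *; apply/andP; split; lra.
Qed.

Lemma osc_locbd (H : R -> R -> R -> R) (T C : R) (u0 : R -> R) (U W : R -> R * R -> R) (L : R)
  (hu0 : forall x x', u0 x - u0 x' <= L * `|x - x'|) (fam : oscillating_family H T C u0 U W) z :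
  z.1 < T -> locbd (0 : R)^'+ U z /\ locbd (0 : R)^'+ W z.
Proof.
move=> zT; have [r [M [r0 h1 h2]]] := osc_bounded hu0 fam zT.
by split; [exact: locbd_bounded r0 h1|exact: locbd_bounded r0 h2].
Qed.

Lemma osc_limit_ub (H : R -> R -> R -> R) (T C : R) (u0 : R -> R) (U W : R -> R * R -> R) (L : R)
  (hu0 : forall x x', u0 x - u0 x' <= L * `|x - x'|) (fam : oscillating_family H T C u0 U W) z :
  z.1 < T ->
  rsup (0 : R)^'+ U z <= u0 z.2 + C * Num.max z.1 0 /\
  rsup (0 : R)^'+ W z <= - u0 z.2 + C * Num.max z.1 0.
Proof.
move=> zT; have [lU lW] := osc_locbd hu0 fam zT; split; apply/ler_addgt0Pr => e e0; apply: rsup_le => //.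
  have /cvgrPdist_lt /(_ e e0) hc := @osc_continuous u0 L 1 C hu0 z.
  exists ([set y | `|(1 * u0 z.2 + C * Num.max z.1 0) - (1 * u0 y.2 + C * Num.max y.1 0)| < e /\ y.1 < T],
    [set eps | forall y, y.1 < T -> U eps y <= u0 y.2 + C * Num.max y.1 0]).
    by split => /=; [move: hc (near_time zT); apply: filterS2|exact: osc_ubU fam].
  move=> [y eps] /= [[hy yT] hU]; have := hU y yT; move: hy; rewrite !mul1r ltr_norml.
  by clear => /andP[? ?] ?; lra.
have /cvgrPdist_lt /(_ e e0) hc := @osc_continuous u0 L (-1) C hu0 z.
exists ([set y | `|(-1 * u0 z.2 + C * Num.max z.1 0) - (-1 * u0 y.2 + C * Num.max y.1 0)| < e /\ y.1 < T],
  [set eps | forall y, y.1 < T -> W eps y <= - u0 y.2 + C * Num.max y.1 0]).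
  by split => /=; [move: hc (near_time zT); apply: filterS2|exact: osc_ubW fam].
move=> [y eps] /= [[hy yT] hU]; have := hU y yT; move: hy; rewrite !mulN1r ltr_norml.
by clear => /andP[? ?] ?; lra.
Qed.

Lemma osc_limit_sum (H : R -> R -> R -> R) (T C : R) (u0 : R -> R) (U W : R -> R * R -> R) (L : R)
  (hu0 : forall x x', u0 x - u0 x' <= L * `|x - x'|) (fam : oscillating_family H T C u0 U W) z :
  z.1 < T -> 0 <= rsup (0 : R)^'+ U z + rsup (0 : R)^'+ W z.
Proof.
move=> zT; have [lU lW] := osc_locbd hu0 fam zT.
rewrite leNgt; apply/negP => h; set d := rsup _ _ _ + _ in h.
have e0 : 0 < - d / 3 by rewrite divr_gt0// oppr_gt0.
have h1 : rsup (0 : R)^'+ U z < rsup (0 : R)^'+ U z + - d / 3 by rewrite ltrDl.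
have h2 : rsup (0 : R)^'+ W z < rsup (0 : R)^'+ W z + - d / 3 by rewrite ltrDl.
have [[A1 B1] /= [/nbhs_singleton z1 n1] s1] := rsup_near lU h1.
have [[A2 B2] /= [/nbhs_singleton z2 n2] s2] := rsup_near lW h2.
have /filter_ex[eps [b1 b2 b3]] : \forall eps \near (0 : R)^'+, [/\ B1 eps, B2 eps &
    forall y, y.1 < T -> 0 <= U eps y + W eps y].
  by move: n1 n2 (osc_sum fam); apply: filterS3.
have := s1 (z, eps) (conj z1 b1); have := s2 (z, eps) (conj z2 b2); have := b3 z zT.
by rewrite /=; move: h; rewrite /d; clear; lra.
Qed.

Lemma osc_box (H : R -> R -> R -> R) (T C : R) (u0 : R -> R) (U W : R -> R * R -> R)
  (fam : oscillating_family H T C u0 U W) z : 0 < z.1 < T -> exists r, [/\ 0 < r, forall y, cbox z r y -> 0 < y.1 < T,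
  (\forall eps \near (0 : R)^'+, forall y, cbox z r y -> usc (U eps) y),
  (\forall eps \near (0 : R)^'+, forall y, cbox z r y -> usc (W eps) y) &
  (\forall eps \near (0 : R)^'+, qsub (cbox z r) (hscale H eps) 0 (U eps)) /\
  (\forall eps \near (0 : R)^'+, qsub (cbox z r) (hneg (hscale H eps)) 0 (W eps))].
Proof.
move=> /andP[z0 zT]; pose r := Num.min (z.1 / 2) ((T - z.1) / 2).
have r1 : r <= z.1 / 2 by rewrite ge_min lexx.
have r2 : r <= (T - z.1) / 2 by rewrite ge_min lexx orbT.
have r0 : 0 < r by rewrite lt_min !divr_gt0// subr_gt0.
have hr y : cbox z r y -> 0 < y.1 < T.
  move=> [h _]; move: h r1 r2 z0 zT; rewrite ler_norml; clear => /andP[? ?] *.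
  by apply/andP; split; lra.
exists r; split => //.
- by apply: filterS (osc_uscU fam) => eps h y /hr/andP[_]; exact: h.
- by apply: filterS (osc_uscW fam) => eps h y /hr/andP[_]; exact: h.
split.
  by apply: filterS (osc_sub fam) => eps h y a q /hr; exact: h.
by apply: filterS (osc_super fam) => eps h y a q /hr; exact: h.
Qed.

(** Coercivity of the oscillating equations survives in the limit as a bound on the time slope at
    steep jets; it disposes of the contacts on the wrong side in [right_slope]. *)
Lemma osc_coercive (H : R -> R -> R -> R) (T C : R) (u0 : R -> R) (U W : R -> R * R -> R) (L : R)
  (hu0 : forall x x', u0 x - u0 x' <= L * `|x - x'|) (fam : oscillating_family H T C u0 U W) (M : R) :
  A3 H -> exists K : R, forall z b q, 0 < z.1 < T ->
  qjet (rsup (0 : R)^'+ U) z b q -> K <= `|q| -> b <= - M.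
Proof.
move=> hco; have [K hK] := hco M; exists (K + 1) => z b q zT hj hq.
have [r [r0 hr uU uW [sU sW]]] := osc_box fam zT; case/andP: (zT) => _ zT'.
have [lU _] := osc_locbd hu0 fam zT'.
have ht : touching (0 : R)^'+ U z (rsup (0 : R)^'+ U z) b q by apply: rsup_touching lU (qjet_sjet hj).
apply: (touching_le ht); first by exists r.
move=> e e0; exists (Num.min r 1); first by rewrite lt_min r0 ltr01.
have m1 : Num.min r 1 <= r by rewrite ge_min lexx.
have m2 : Num.min r 1 <= 1 by rewrite ge_min lexx orbT.
apply: filterS sU => eps hs y a' q' yb _ hq' _ hj'.
have := hs y a' q' (cbox_sub m1 yb) hj'; rewrite /hscale.
have Kq : K <= `|q'|.
  have := ler_distD q' q 0; rewrite !subr0 [`|q - q'|]distrC.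
  have := le_trans hq' m2.
  by move: hq; clear; lra.
have := hK q' Kq (y.1 / eps) (y.2 / eps).
by move: e0; clear; lra.
Qed.

(** On the subsolution side the maximum in [junction_fun] splits into three inequalities:
    [junction_Abar], [right_slope], and [right_slope] for the reflected function, which turns the
    increasing part into a decreasing one. *)
Lemma half_relaxed_limits (H : R -> R -> R -> R) (T C : R) (u0 : R -> R) (U W : R -> R * R -> R) (L : R)
  (hu0 : forall x x', u0 x - u0 x' <= L * `|x - x'|) (fam : oscillating_family H T C u0 U W)
  hL hR (p0L p0R : R) z : hamiltonian H -> A1 H -> effective H hL hR ->
  limit_hamiltonian hL -> limit_hamiltonian hR -> argmin hL p0L -> argmin hR p0R ->
  0 < z.1 < T ->
  fl_sub_c1 hL hR (junction_fun (Abar H) hL hR p0L p0R) (rsup (0 : R)^'+ U) z /\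
  fl_super_c1 hL hR (junction_fun (Abar H) hL hR p0L p0R) (rsup (0 : R)^'+ W) z.
Proof.
move=> hH pH he hhL hhR mL mR zT.
have [r [r0 hr uU uW [sU sW]]] := osc_box fam zT; case/andP: (zT) => _ zT'.
have lbd y : cbox z r y -> locbd (0 : R)^'+ U y /\ locbd (0 : R)^'+ W y.
  by move=> /hr/andP[_ h]; exact: osc_locbd hu0 fam _ h.
have [lU lW] := osc_locbd hu0 fam zT'.
have tU y a q : 0 < y.1 < T -> sjet (rsup (0 : R)^'+ U) y a q ->
    touching (0 : R)^'+ U y (rsup (0 : R)^'+ U y) a q.
  by move=> /andP[_ yT] hj; apply: rsup_touching hj; exact: (osc_locbd hu0 fam yT).1.
have tW y a q : 0 < y.1 < T -> sjet (rsup (0 : R)^'+ W) y a q ->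
    touching (0 : R)^'+ W y (rsup (0 : R)^'+ W y) a q.
  by move=> /andP[_ yT] hj; apply: rsup_touching hj; exact: (osc_locbd hu0 fam yT).2.
have inner y : 0 < y.1 < T -> forall a q, qjet (rsup (0 : R)^'+ U) y a q ->
    (0 < y.2 -> a + hR q <= 0) /\ (y.2 < 0 -> a + hL q <= 0).
  move=> yT a q /qjet_sjet hj; have [r' [r'0 _ uU' _ [sU' _]]] := osc_box fam yT.
  have ht := tU _ _ _ yT hj.
  split=> y0; first exact: (eff_R he r'0 y0 uU' sU' ht).
  exact: (effective_left (eff_L he) r'0 y0 uU' sU' ht).
split; split=> z0 a.
- by move=> q hj; exact: (eff_R he r0 z0 uU sU (tU _ _ _ zT hj)).
- by move=> q hj; exact: (effective_left (eff_L he) r0 z0 uU sU (tU _ _ _ zT hj)).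
- move=> pL pR; have zE : z = (z.1, 0) by rewrite -z0 -surjective_pairing.
  move: uU sU uW sW lbd; rewrite zE => uU' sU' uW' sW' lbd hj.
  have hjN : sjet (fun y => rsup (0 : R)^'+ U y + kink (- pL) (- pR) y) (z.1, 0) a 0.
    move=> e e0; apply: filterS (hj e e0) => y.
    by rewrite !kinkN.
  have hj' : touching (0 : R)^'+ (fun eps y => U eps y - kink pL pR y) (z.1, 0)
      (rsup (0 : R)^'+ U (z.1, 0)) a 0.
    have := touching_kink r0 (fun y yb => (lbd y yb).1) hjN.
    by congr (touching _ _ _ _ _ _); apply/funext => eps; apply/funext => y; rewrite kinkN.
  have nT : \forall y \near (z.1, (0 : R)), 0 < y.1 < T.
    apply: filterS (nbhs_cbox (z.1, 0) r0) => y; rewrite -zE; exact: hr.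
  have uV : \forall y \near (z.1, (0 : R)), usc (rsup (0 : R)^'+ U) y.
    apply: filterS nT => y yT; apply: usc_rsup.
    by have [] := osc_locbd hu0 fam (proj2 (andP yT)).
  have hA := junction_Abar hH pH r0 uU' sU' hj'.
  have hR1 : a + decr_part hR p0R pR <= 0.
    apply: (right_slope hhR mR uV _ _ hj).
      by apply: filterS nT => y yT y0 b q hjy; exact: (inner y yT b q hjy).1.
    move=> M; have [K hK] := osc_coercive hu0 fam M (ham_co hH); exists K.
    apply: filterS nT => y yT b q hjy hq; apply: hK yT hjy _.
    by rewrite -normrN; apply: le_trans (ler_norm _); move: hq; clear; lra.
  have hL1 : a + incr_part hL p0L pL <= 0.
    have refl_near (P : R * R -> Prop) : (\forall y \near (z.1, (0 : R)), P y) ->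
        \forall y \near (z.1, (0 : R)), P (refl y).
      move=> /nbhs_boxP[d d0 hd]; apply/nbhs_boxP; exists d => // y h1 h2.
      by apply: hd => //=; rewrite subr0 normrN -[y.2]subr0.
    have reflj y b q : qjet (fun y => rsup (0 : R)^'+ U (refl y)) y b q ->
        qjet (rsup (0 : R)^'+ U) (refl y) b (- q).
      by move=> hjy; apply: qjet_reflect; rewrite -/(refl (refl y)) reflK; apply: qjet_eq hjy.
    rewrite incr_part_refl.
    apply: (@right_slope R (fun y => rsup (0 : R)^'+ U (refl y)) _ (- p0L) z.1 a (- pR) (- pL)
      (limit_hamiltonian_reflect hhL) (argmin_refl mL)).
    - by apply: filterS (refl_near _ uV) => y; exact: usc_reflect.
    - apply: filterS (refl_near _ nT) => y yT y0 b q /reflj hjy.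
      by apply: (inner _ yT _ _ hjy).2; rewrite /= oppr_lt0.
    - move=> M; have [K hK] := osc_coercive hu0 fam M (ham_co hH); exists K.
      apply: filterS (refl_near _ nT) => y yT b q /reflj hjy hq; apply: hK yT hjy _.
      by apply: le_trans (ler_norm _); move: hq; clear; lra.
    move=> e e0; apply: filterS (refl_near _ (hj e e0)) => y.
    rewrite /refl /= oppr0 -[(y.1, - y.2)]/(refl y) !kink_refl !kink0.
    rewrite /lin /nrm1 /= !subr0 normrN !mul0r.
    by [].
  rewrite -lerBrDr sub0r lerNr; rewrite /junction_fun !ge_max.
  by apply/and3P; split; move: hA hR1 hL1; clear; lra.
- by move=> q hj; exact: (eff_Rn he r0 z0 uW sW (tW _ _ _ zT hj)).
- move=> q hj; apply: (@effective_left R (hneg H) (hoppo hL) W z r 0 _ a q (eff_Ln he) r0 z0 uW sW (tW _ _ _ zT hj)).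
move=> pL pR; have zE : z = (z.1, 0) by rewrite -z0 -surjective_pairing.
move: uW sW lbd; rewrite zE => uW' sW' lbd hj.
have := @junction_supersolution R H hL hR p0L p0R z.1 r (- a) pL pR W hH pH he hhL hhR mL mR r0 uW' sW'
  (fun y yb => (lbd y yb).2).
by rewrite opprK => /(_ hj); clear; lra.
Qed.

End HalfRelaxedLimits.

(** * Junction test functions and jets *)

Section FluxLimitedTestFunctions.
Context {R : realType}.
Implicit Types (z y : R * R) (a p : R) (u w phi : R * R -> R) (D : set (R * R)) (T : \bar R).

Lemma usc_env_near D u z (s e : R) : 0 < e -> (usc_env D u z <= s%:E)%E ->
  \forall y \near z, D y -> u y <= s + e.
Proof.
move=> e0 hs; have : (usc_env D u z < (s + e)%:E)%E.
  by apply: le_lt_trans hs _; rewrite lte_fin ltrDl.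
rewrite /usc_env /limf_esup => /ereal_inf_lt[_ [V hV <-] hlt].
have {}hV : \forall y \near z, D y -> V y by exact: hV.
apply: filterS hV => y hy Dy; rewrite -lee_fin; apply: le_trans (ltW hlt).
by apply: ereal_sup_ubound; exists y => //; exact: hy.
Qed.

Lemma usc_env_le D u z (s : R) : (\forall y \near z, D y -> u y <= s) ->
  (usc_env D u z <= s%:E)%E.
Proof.
move=> hs; rewrite /usc_env /limf_esup; apply: ge_ereal_inf.
exists (ereal_sup [set (EFin \o u) x | x in [set y | u y <= s]]).
  by exists [set y | u y <= s].
by apply: ge_ereal_sup => _ [y /= hy <-]; rewrite /= lee_fin.
Qed.

Lemma qjet_near u w z a p : (\forall y \near z, u y = w y) -> qjet u z a p -> qjet w z a p.
Proof.
move=> h [C hC]; exists C; have e := nbhs_singleton h.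
by move: h hC; apply: filterS2 => y <-; rewrite -e.
Qed.

Lemma open_open_strip T : open (open_strip T : set (R * R)).
Proof.
rewrite openE => z [z0 zT]; rewrite /interior; case: T zT => [t| |] zT.
- move: zT; rewrite lte_fin => zt; apply/nbhs_boxP; exists (Num.min (z.1 / 2) ((t - z.1) / 2)).
    by rewrite lt_min !divr_gt0// subr_gt0.
  move=> y; rewrite le_min ler_norml => /andP[/andP[h1 _] h2] _; split.
    by move: h1 z0; clear; lra.
  rewrite lte_fin; move: h2; rewrite ler_norml => /andP[_ h2].
  by move: h2 zt; clear; lra.
- apply/nbhs_boxP; exists (z.1 / 2); first by rewrite divr_gt0.
  move=> y; rewrite ler_norml => /andP[h1 _] _; split; last exact: ltry.
  by move: h1 z0; clear; lra.
by [].
Qed.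

Lemma open_strip_sub T : (open_strip T : set (R * R)) `<=` strip T.
Proof. by move=> z [z0 zT]; split => //; exact: ltW. Qed.

Lemma touches_below_opp D u phi z :
  touches_below D u phi z <-> touches_above D (fun y => - u y) (fun y => - phi y) z.
Proof.
have e y : lsc_env D u y = (- usc_env D (fun x => - u x)%R y)%E by exact: lsc_env_opp.
split=> -[h1 h2]; split.
- by apply: oppe_inj; rewrite -e h1 EFinN oppeK.
- by apply: filterS h2 => y h /h; rewrite e EFinN leeNr.
- by rewrite e h1 EFinN oppeK.
by apply: filterS h2 => y h /h; rewrite e EFinN leeNr.
Qed.

Lemma locally_boundedN D u : locally_bounded D u -> locally_bounded D (fun y => - u y).
Proof.
move=> lb y Dy; have [M [Mr hM]] := lb y Dy; exists M; split => // x /hM.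
by apply: filterS => t /=; rewrite normrN.
Qed.

(** The test function attached to a jet after removal of a kink. Subtracting the value of the kink
    at z makes the formula valid off the junction too, where only one of the slopes is seen. *)
Definition junction_quad z (c a pL pR C : R) y : R :=
  c + a * (y.1 - z.1) + (kink pL pR y - kink pL pR z) + C * sqd z y.

Lemma left_moves z : 0 < z.1 -> z.2 <= 0 -> forall d : R, 0 < d ->
  (exists h, [/\ h != 0, `|h| < d & left_half (h *: dir_t + z)]) /\
  (exists h, [/\ h != 0, `|h| < d & left_half (h *: dir_x + z)]).
Proof.
move=> z1 z2 d d0; have d2 : 0 < d / 2 by rewrite divr_gt0.
split.
  exists (d / 2); rewrite gt_eqF// gtr0_norm// dir_tE; split => //; first by lra.
  by split => //=; rewrite addr_gt0.
exists (- (d / 2)); rewrite oppr_eq0 gt_eqF// normrN gtr0_norm// dir_xE; split => //; first by lra.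
by split => //=; move: z2 d2; clear; lra.
Qed.

Lemma right_moves z : 0 < z.1 -> 0 <= z.2 -> forall d : R, 0 < d ->
  (exists h, [/\ h != 0, `|h| < d & right_half (h *: dir_t + z)]) /\
  (exists h, [/\ h != 0, `|h| < d & right_half (h *: dir_x + z)]).
Proof.
move=> z1 z2 d d0; have d2 : 0 < d / 2 by rewrite divr_gt0.
split; exists (d / 2); rewrite gt_eqF// gtr0_norm// ?dir_tE ?dir_xE; split => //.
- by lra.
- by split => //=; rewrite addr_gt0.
- by lra.
by split => //=; rewrite addr_ge0// ltW.
Qed.

Lemma kink_dir_t pL pR (h : R) y : kink pL pR (h *: dir_t + y) = kink pL pR y.
Proof. by rewrite dir_tE. Qed.

Lemma junction_quad_dir_t z c a pL pR C (h : R) y :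
  junction_quad z c a pL pR C (h *: dir_t + y) - junction_quad z c a pL pR C y =
  h * (a + 2 * C * (y.1 - z.1)) + C * h ^+ 2.
Proof. by rewrite /junction_quad kink_dir_t dir_tE /sqd /=; ring. Qed.

Lemma continuous_shift1 (a C z1 : R) : continuous (fun y : R * R => a + 2 * C * (y.1 - z1)).
Proof.
move=> y; apply: cvgD; first exact: cvg_cst.
apply: cvgM; first exact: cvg_cst.
by apply: cvgB; [exact: continuous_coord1|exact: cvg_cst].
Qed.

Lemma continuous_shift2 (a C z1 : R) : continuous (fun y : R * R => a + 2 * C * (y.2 - z1)).
Proof.
move=> y; apply: cvgD; first exact: cvg_cst.
apply: cvgM; first exact: cvg_cst.
by apply: cvgB; [exact: continuous_coord2|exact: cvg_cst].
Qed.

Lemma junction_quad_test z c a pL pR C : 0 < z.1 ->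
  junction_test (junction_quad z c a pL pR C) /\
  [/\ deriv_in (open_strip +oo) dir_t (junction_quad z c a pL pR C) z = a,
      z.2 <= 0 -> deriv_in left_half dir_x (junction_quad z c a pL pR C) z = pL &
      0 <= z.2 -> deriv_in right_half dir_x (junction_quad z c a pL pR C) z = pR].
Proof.
move=> z0; set phi := junction_quad _ _ _ _ _ _.
have [c1 d1] : C1_in left_half phi /\ forall y, left_half y ->
    deriv_in left_half dir_t phi y = a + 2 * C * (y.1 - z.1) /\
    deriv_in left_half dir_x phi y = pL + 2 * C * (y.2 - z.2).
  apply: (@quadratic_C1 R left_half phi _ _ C).
  - by move=> y [y1 y2] d d0; exact: (left_moves y1 y2 d0).1.
  - by move=> y [y1 y2] d d0; exact: (left_moves y1 y2 d0).2.
  - exact: continuous_shift1.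
  - exact: continuous_shift2.
  - by move=> y h _ _; exact: junction_quad_dir_t.
  move=> y h [_ y2]; rewrite dir_xE => -[_ /= y2h].
  by rewrite /phi /junction_quad !(kink_lt _ _ y2) (@kink_lt _ _ _ (y.1, y.2 + h))// /sqd /=; ring.
have [c2 d2] : C1_in right_half phi /\ forall y, right_half y ->
    deriv_in right_half dir_t phi y = a + 2 * C * (y.1 - z.1) /\
    deriv_in right_half dir_x phi y = pR + 2 * C * (y.2 - z.2).
  apply: (@quadratic_C1 R right_half phi _ _ C).
  - by move=> y [y1 y2] d d0; exact: (right_moves y1 y2 d0).1.
  - by move=> y [y1 y2] d d0; exact: (right_moves y1 y2 d0).2.
  - exact: continuous_shift1.
  - exact: continuous_shift2.
  - by move=> y h _ _; exact: junction_quad_dir_t.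
  move=> y h [_ y2]; rewrite dir_xE => -[_ /= y2h].
  by rewrite /phi /junction_quad !(kink_gt _ _ y2) (@kink_gt _ _ _ (y.1, y.2 + h))// /sqd /=; ring.
split; last split.
- split => //; apply: continuous_subspaceT => y; rewrite /phi /junction_quad.
  repeat (apply: cvgD); try exact: cvg_cst.
  + apply: cvgM; first exact: cvg_cst.
    by apply: cvgB; [exact: continuous_coord1|exact: cvg_cst].
  + exact: continuous_kink.
  by apply: cvgM; [exact: cvg_cst|exact: continuous_sqd].
- have Oz : (open_strip +oo : set (R * R)) z by split => //; exact: ltry.
  have PF : ProperFilter (within [set h : R | open_strip +oo (h *: dir_t + z)] 0^').
    by apply: within_proper => d d0; apply: open_moves => //; exact: open_open_strip.
  apply: (@quot_in_quadratic R _ _ _ _ a C PF _).2 => h _.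
  by rewrite /phi junction_quad_dir_t subrr mulr0 addr0.
- by move=> z2; have [_ ->] := d1 z (conj z0 z2); rewrite subrr mulr0 addr0.
by move=> z2; have [_ ->] := d2 z (conj z0 z2); rewrite subrr mulr0 addr0.
Qed.

Lemma deriv_in_dir_t E1 E2 phi z :
  (forall h : R, E1 (z.1 + h, z.2) <-> E2 (z.1 + h, z.2)) ->
  deriv_in E1 dir_t phi z = deriv_in E2 dir_t phi z.
Proof.
move=> h; rewrite /deriv_in /quot_in (_ : [set x | E1 _] = [set x | E2 (x *: dir_t + z)])//.
by apply/seteqP; split=> x /=; rewrite dir_tE; apply h.
Qed.

Lemma junction_expansion phi z (e : R) : junction_test phi -> 0 < z.1 -> 0 < e ->
  let a := deriv_in (open_strip +oo) dir_t phi z in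
  (0 <= z.2 -> \forall y \near z, 0 <= y.2 ->
     `|phi y - phi z - lin z a (deriv_in right_half dir_x phi z) y| <= e * nrm1 z y) /\
  (z.2 <= 0 -> \forall y \near z, y.2 <= 0 ->
     `|phi y - phi z - lin z a (deriv_in left_half dir_x phi z) y| <= e * nrm1 z y).
Proof.
move=> [_ cL cR] z0 e0 a.
have n0 : \forall y \near z, 0 < y.1.
  have Oz : open_strip +oo z by split => //; exact: ltry.
  by have := open_nbhs_nbhs (conj (@open_open_strip +oo) Oz); apply: filterS => y [].
have cT : order_convex [set t : R | 0 < t].
  by move=> s t r /= s0 t0 /andP[h _]; exact: lt_le_trans h.
split=> z2.
  have cX : order_convex [set x : R | 0 <= x].
    by move=> s t r /= s0 t0 /andP[h _]; exact: le_trans h.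
  have [d d0 hd] := @C1_expansion R [set t | 0 < t] [set x | 0 <= x] phi z e cT cX z0 z2 cR e0.
  move: n0 (nbhs_cbox z d0); apply: filterS2 => y y1 yb y2; have := hd y yb y1 y2.
  rewrite (_ : deriv_in _ dir_t phi z = a)//; apply: deriv_in_dir_t => h /=.
  by split=> -[h1 h2]; split => //; exact: ltry.
have cX : order_convex [set x : R | x <= 0].
  by move=> s t r /= s0 t0 /andP[_ h]; exact: le_trans t0.
have [d d0 hd] := @C1_expansion R [set t | 0 < t] [set x | x <= 0] phi z e cT cX z0 z2 cL e0.
move: n0 (nbhs_cbox z d0); apply: filterS2 => y y1 yb y2; have := hd y yb y1 y2.
rewrite (_ : deriv_in _ dir_t phi z = a)//; apply: deriv_in_dir_t => h /=.
by split=> -[h1 h2]; split => //; exact: ltry.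
Qed.

Lemma near_right z (P : R * R -> Prop) : (\forall y \near z, 0 <= y.2 -> P y) -> 0 < z.2 ->
  \forall y \near z, P y.
Proof.
move=> hP z2; have n2 : \forall y \near z, 0 <= y.2.
  apply/nbhs_boxP; exists z.2 => // y _ hy.
  by move: hy; rewrite ler_norml; clear; lra.
by move: hP n2; apply: filterS2 => y; apply.
Qed.

Lemma near_left z (P : R * R -> Prop) : (\forall y \near z, y.2 <= 0 -> P y) -> z.2 < 0 ->
  \forall y \near z, P y.
Proof.
move=> hP z2; have n2 : \forall y \near z, y.2 <= 0.
  apply/nbhs_boxP; exists (- z.2); first by rewrite oppr_gt0.
  by move=> y _ hy; move: hy; rewrite ler_norml; clear; lra.
by move: hP n2; apply: filterS2 => y; apply.
Qed.

Lemma fl_subsolution_at hL hR F u z : fl_subsolution hL hR F u -> 0 < z.1 ->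
  fl_sub_at hL hR F (env u) z.
Proof.
move=> [lb hs] z1; have Oz : (open_strip +oo : set (R * R)) z by split => //; exact: ltry.
have core a pL pR : qjet (fun y => env u y - kink pL pR y) z a 0 ->
    a + (if z.2 < 0 then hL pL else if 0 < z.2 then hR pR else F pL pR) <= 0.
  move=> [C hC]; have [ht [d1 d2 d3]] := junction_quad_test (env u z) a pL pR C z1.
  have := hs _ z ht Oz; rewrite /junction_op d1.
  have ta : touches_above (strip +oo) u (junction_quad z (env u z) a pL pR C) z.
    apply/(touches_above_interior _ (@open_open_strip +oo) (@open_strip_sub +oo) Oz lb).
    split; first by rewrite /junction_quad /sqd !subrr expr0n /= !(mulr0, addr0).
    apply: filterS hC => y; rewrite /junction_quad /lin mul0r addr0.
    by move: (kink _ _ y) (kink _ _ z) => A B; clear; lra.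
  move=> /(_ ta); case: (ltgtP z.2 0) => z2.
  - by rewrite (d2 (ltW z2)).
  - by rewrite (d3 (ltW z2)).
  by rewrite d2 ?d3 ?z2.
split=> z2 a.
- by move=> q /kink_flat/core; rewrite z2 ltNge (ltW z2).
- by move=> q /kink_flat/core; rewrite z2.
by move=> pL pR /core; rewrite z2 ltxx.
Qed.

Lemma fl_supersolution_at hL hR F u z : fl_supersolution hL hR F u -> 0 < z.1 ->
  fl_super_at hL hR F (env (fun y => - u y)) z.
Proof.
move=> [/locally_boundedN lb hs] z1; have Oz : (open_strip +oo : set (R * R)) z by split => //; exact: ltry.
set w := env _.
have core a pL pR : qjet (fun y => w y + kink pL pR y) z a 0 ->
    a <= if z.2 < 0 then hL pL else if 0 < z.2 then hR pR else F pL pR.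
  move=> [C hC]; have [ht [d1 d2 d3]] := junction_quad_test (- w z) (- a) pL pR (- C) z1.
  have := hs _ z ht Oz; rewrite /junction_op d1.
  have ta : touches_below (strip +oo) u (junction_quad z (- w z) (- a) pL pR (- C)) z.
    apply/touches_below_opp.
    apply/(touches_above_interior _ (@open_open_strip +oo) (@open_strip_sub +oo) Oz lb).
    split; first by rewrite /junction_quad /sqd !subrr expr0n /= !(mulr0, addr0) opprK.
    apply: filterS hC => y; rewrite /junction_quad /lin mul0r addr0 -/w.
    by move: (kink _ _ y) (kink _ _ z) => A B; clear; lra.
  move=> /(_ ta); rewrite addrC subr_ge0; case: (ltgtP z.2 0) => z2.
  - by rewrite (d2 (ltW z2)).
  - by rewrite (d3 (ltW z2)).
  by rewrite d2 ?d3 ?z2.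
have flat a q : qjet w z a q -> qjet (fun y => w y + kink (- q) (- q) y) z a 0.
  by move=> hj; apply: qjet_eq (kink_flat hj) => // y; rewrite kinkN.
split=> z2 a.
- by move=> q /flat/core; rewrite z2 ltNge (ltW z2) /= /hoppo subr_le0.
- by move=> q /flat/core; rewrite z2 /hoppo subr_le0.
by move=> pL pR /core; rewrite z2 ltxx.
Qed.

Lemma fl_sub_test hL hR F u : locally_bounded (strip +oo) u ->
  (forall z, 0 < z.1 -> fl_sub_c1 hL hR F (env u) z) -> fl_subsolution hL hR F u.
Proof.
move=> lb hu; split => // phi z ht Oz ta; have z1 : 0 < z.1 by case: Oz.
have [h1 h2] := (touches_above_interior phi (@open_open_strip +oo) (@open_strip_sub +oo) Oz lb).2 ta.
have [uR uL u0] := hu z z1.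
rewrite /junction_op; case: (ltgtP z.2 0) => z2.
- apply: uL => // e e0; have [_ /(_ (ltW z2)) /near_left /(_ z2)] := junction_expansion ht z1 e0.
  move: h2; apply: filterS2 => y h3; rewrite ler_norml h1 => /andP[_].
  by move: h3; clear; lra.
- apply: uR => // e e0; have [/(_ (ltW z2)) /near_right /(_ z2) + _] := junction_expansion ht z1 e0.
  move: h2; apply: filterS2 => y h3; rewrite ler_norml h1 => /andP[_].
  by move: h3; clear; lra.
apply: u0 => // e e0; have [] := junction_expansion ht z1 e0.
rewrite {1 2}z2 => /(_ (lexx _)) hr /(_ (lexx _)); move: h2 hr; apply: filterS3 => y h3 h4 h5.
rewrite (kink_lt _ _ (_ : z.2 <= 0)) ?z2// mulr0 subr0 h1 /lin mul0r addr0.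
case: (leP 0 y.2) => y2.
  rewrite kink_gt//; move: h3 (h4 y2); rewrite /lin z2 ler_norml => h3 /andP[_].
  by move: h3; clear; lra.
rewrite (kink_lt _ _ (ltW y2)); move: h3 (h5 (ltW y2)); rewrite /lin z2 ler_norml => h3 /andP[_].
by move: h3; clear; lra.
Qed.

Lemma fl_super_test hL hR F u : locally_bounded (strip +oo) u ->
  (forall z, 0 < z.1 -> fl_super_c1 hL hR F (env (fun y => - u y)) z) -> fl_supersolution hL hR F u.
Proof.
move=> lb hu; split => // phi z ht Oz /touches_below_opp ta; have z1 : 0 < z.1 by case: Oz.
have [h1 h2] := (touches_above_interior _ (@open_open_strip +oo) (@open_strip_sub +oo) Oz
  (locally_boundedN lb)).2 ta.
have [uR uL u0] := hu z z1; move: h1 h2 uR uL u0; set w := env _ => h1 h2 uR uL u0.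
rewrite /junction_op; set a := deriv_in (open_strip +oo) dir_t phi z.
set pL := deriv_in left_half dir_x phi z; set pR := deriv_in right_half dir_x phi z.
case: (ltgtP z.2 0) => z2.
- have : - a + hoppo hL (- pL) <= 0.
    apply: uL => // e e0; have [_ /(_ (ltW z2)) /near_left /(_ z2)] := junction_expansion ht z1 e0.
    move: h2; apply: filterS2 => y h3; rewrite ler_norml h1 -/a -/pL /lin => /andP[+ _].
    by move: h3; clear; lra.
  by rewrite /hoppo opprK; clear; lra.
- have : - a + hoppo hR (- pR) <= 0.
    apply: uR => // e e0; have [/(_ (ltW z2)) /near_right /(_ z2) + _] := junction_expansion ht z1 e0.
    move: h2; apply: filterS2 => y h3; rewrite ler_norml h1 -/a -/pR /lin => /andP[+ _].
    by move: h3; clear; lra.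
  by rewrite /hoppo opprK; clear; lra.
have : - a <= F pL pR; last by clear; lra.
apply: u0 => // e e0; have [] := junction_expansion ht z1 e0.
rewrite {1 2}z2 => /(_ (lexx _)) hr /(_ (lexx _)); move: h2 hr; apply: filterS3 => y h3 h4 h5.
rewrite (kink_lt _ _ (_ : z.2 <= 0)) ?z2// mulr0 addr0 h1 /lin mul0r addr0.
case: (leP 0 y.2) => y2.
  rewrite kink_gt//; move: h3 (h4 y2); rewrite /lin z2 ler_norml -/a -/pR => h3 /andP[+ _].
  by move: h3; clear; lra.
rewrite (kink_lt _ _ (ltW y2)); move: h3 (h5 (ltW y2)); rewrite /lin z2 ler_norml -/a -/pL => h3 /andP[+ _].
by move: h3; clear; lra.
Qed.

End FluxLimitedTestFunctions.

(** * Extension to negative times and barriers *)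

Section InitialTime.
Context {R : realType}.
Implicit Types (z y : R * R) (a p : R) (u w : R * R -> R) (T : \bar R) (h : R -> R) (H : R -> R -> R -> R).

(** Continuation by the datum makes t = 0 an interior time: the initial condition becomes
    semicontinuity across it, and half-relaxed limits can be taken on full neighbourhoods. *)
Definition ext (u0 : R -> R) u y : R := if 0 < y.1 then env u y else u0 y.2.

Lemma bdat_strip T u y : locally_bounded (strip T) u -> 0 < y.1 -> (y.1%:E < T)%E -> bdat u y.
Proof.
move=> lb y1 yT; apply: locally_bounded_bdat lb _.
by apply: (near_nbhs_in (@open_open_strip _ T)); [exact: open_strip_sub|split].
Qed.

Lemma ext_near (u0 : R -> R) u y : 0 < y.1 -> \forall x \near y, env u x = ext u0 u x.
Proof.
move=> y0; apply/nbhs_boxP; exists (y.1 / 2); first by rewrite divr_gt0.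
move=> x h _; rewrite /ext ifT//; move: h y0; rewrite ler_norml; clear => /andP[? _]; lra.
Qed.

Lemma ext_usc T (u0 : R -> R) (L : R) u : (forall x x', u0 x - u0 x' <= L * `|x - x'|) ->
  locally_bounded (strip T) u -> (forall x, (usc_env (strip T) u (0%R, x) <= (u0 x)%:E)%E) ->
  forall y, (y.1%:E < T)%E -> usc (ext u0 u) y.
Proof.
move=> hu0 lb hi y yT; have cu := lipschitz_continuous hu0.
case: (ltgtP 0 y.1) => y0.
- apply: usc_near (ext_near u0 u y0) _; apply: usc_envelope; exact: (bdat_strip lb).
- apply: (@usc_near _ _ (fun x : R * R => u0 x.2)); last exact: continuous_usc (cu y).
  apply/nbhs_boxP; exists (- y.1 / 2); first by rewrite divr_gt0// oppr_gt0.
  move=> x h _; rewrite /ext ifF//; apply/negbTE; rewrite -leNgt.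
  by move: h y0; rewrite ler_norml; clear => /andP[_ ?]; lra.
move=> e e0; have e2 : 0 < e / 2 by rewrite divr_gt0.
have yE : y = (0, y.2) by rewrite y0 -surjective_pairing.
have h1 : \forall x \near y, strip T x -> u x <= u0 y.2 + e / 2.
  by rewrite {1}yE; exact: usc_env_near (hi y.2).
have h2 : \forall x \near y, u0 x.2 < u0 y.2 + e by exact: continuous_usc (cu y) _ e0.
have h3 : \forall x \near y, (x.1%:E < T)%E.
  move: yT; rewrite -y0; case: T {lb hi h1} => [t| |] // ; rewrite ?lte_fin => t0.
    apply/nbhs_boxP; exists (t / 2); first by rewrite divr_gt0.
    by move=> x h _; rewrite lte_fin; move: h t0; rewrite -y0 subr0 ler_norml; clear => /andP[_ ?]; lra.
  by apply: filterS h2 => x _; exact: ltry.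
have h4 : \forall x \near y, [/\ strip T x -> u x <= u0 y.2 + e / 2, u0 x.2 < u0 y.2 + e & (x.1%:E < T)%E].
  by move: h1 h2 h3; apply: filterS3.
have e00 : ext u0 u y = u0 y.2 by rewrite /ext -y0 ltxx.
have [d d0 hd] := iffLR (nbhs_boxP y _) h4.
apply/nbhs_boxP; exists (d / 2); first by rewrite divr_gt0.
have d2 : 0 < d / 2 by rewrite divr_gt0.
have dd : d / 2 <= d by move: d0; clear; lra.
move=> x x1 x2; have [_ hx2 hx3] := hd x (le_trans x1 dd) (le_trans x2 dd).
rewrite e00 /ext; case: ifP => // x0.
have bx := bdat_strip lb x0 hx3.
apply: le_lt_trans (_ : u0 y.2 + e / 2 < _); last by rewrite ltrD2l; move: e0; clear; lra.
apply: env_le => //.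
have nx : \forall v \near x, 0 < v.1.
  apply/nbhs_boxP; exists (x.1 / 2); first by rewrite divr_gt0.
  by move=> v h _; move: h x0; rewrite ler_norml; clear => /andP[? _]; lra.
move: nx (nbhs_cbox x d2); apply: filterS2 => v v0 vb.
have [v1 v2] : cbox y d v by apply: cbox_trans (conj x1 x2) vb; lra.
by have [hv _ hv3] := hd v v1 v2; apply: hv; split => //; exact: ltW.
Qed.

(** The barrier is run up to S, while the envelope at times up to S sees values of the function at
    times up to S', still below T. *)
Lemma time_room T (t : R) : (t%:E < T)%E -> exists S S' : R, [/\ t < S, S < S' & (S'%:E < T)%E].
Proof.
case: T => [s| |] //; rewrite ?lte_fin => h; last first.
  by exists (t + 1), (t + 2); split; [lra|lra|exact: ltry].
exists (t + (s - t) / 3), (t + 2 * (s - t) / 3); rewrite lte_fin.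
by split; move: h; clear; lra.
Qed.

(** [M P] bounds the time slopes of jets of space slope at most P, with no monotonicity in P; the
    linear growth lets [cauchy_barrier] conclude with the single value M (L + 1). *)
Lemma ext_bound T (u0 : R -> R) (L : R) u (M : R -> R) : 0 <= L ->
  (forall x x', u0 x - u0 x' <= L * `|x - x'|) ->
  locally_bounded (strip T) u -> (forall x, (usc_env (strip T) u (0%R, x) <= (u0 x)%:E)%E) ->
  linear_growth T u -> 0 <= M (L + 1) ->
  (forall z a p P, open_strip T z -> `|p| <= P -> qjet (env u) z a p -> a <= M P) ->
  forall t x, 0 <= t -> (t%:E < T)%E -> ext u0 u (t, x) <= u0 x + M (L + 1) * t.
Proof.
move=> L0 hu0 lb hi hg M0 hj t x t0 tT.
have [S [S' [tS SS' S'T]]] := time_room tT.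
have ST (s : R) : s <= S' -> (s%:E < T)%E by move=> h; apply: le_lt_trans S'T; rewrite lee_fin.
have [C hC] := hg S' S'T.
pose A := 2 * `|C| + `|u0 0| + L; have A0 : 0 <= A by rewrite /A !addr_ge0// mulr_ge0.
apply: (@cauchy_barrier R (ext u0 u) u0 S L A M t x L0 A0 M0) => //.
- by rewrite t0.
- move=> y /andP[y1 y2]; apply: (ext_usc hu0 lb hi); apply: ST; exact: le_trans y2 (ltW SS').
- move=> s y /andP[s0 sS]; rewrite /ext /=; case: ifP => s1.
    have bs : bdat u (s, y) by apply: (bdat_strip lb) => //; apply: ST; exact: le_trans sS (ltW SS').
    apply: env_le => //; apply/nbhs_boxP.
    exists (Num.min (Num.min (s / 2) (S' - S)) 1); first by rewrite !lt_min divr_gt0// subr_gt0 SS' ltr01.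
    move=> v; rewrite !le_min => /andP[/andP[v1 v2] _] /andP[_ v3]; rewrite /= in v1 v2 v3.
    have v10 : 0 <= v.1 by move: v1 s1; rewrite ler_norml; clear => /andP[? _] ?; lra.
    have v1S : v.1 <= S' by move: v2 sS; rewrite ler_norml; clear => /andP[_ ?] ?; lra.
    have := hC v.1 v.2 v10 v1S; rewrite -surjective_pairing => hv.
    apply: le_trans (le_trans (ler_norm _) hv) _.
    have y2 : `|v.2| <= `|y| + 1 by have := ler_distD y v.2 0; rewrite !subr0; move: v3; clear; lra.
    have h1 : C * (1 + `|v.2|) <= `|C| * (1 + `|v.2|) by rewrite ler_wpM2r ?ler_norm// addr_ge0.
    have h2 : `|C| * (1 + `|v.2|) <= `|C| * (2 * (1 + `|y|)).
      by rewrite ler_wpM2l//; have := normr_ge0 y; move: y2; clear; lra.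
    have h3 : 0 <= (`|u0 0| + L) * (1 + `|y|) by rewrite mulr_ge0 ?addr_ge0.
    by rewrite /A; move: h1 h2 h3; clear; lra.
  have := hu0 y 0; rewrite subr0 => h; have := ler_norm (u0 0).
  have h3 : 0 <= (2 * `|C| + `|u0 0|) * `|y| by rewrite !mulr_ge0 ?addr_ge0// mulr_ge0.
  have h4 : 0 <= `|C| by [].
  by rewrite /A; move: h h3 h4 L0; clear; lra.
- by move=> y; rewrite /ext /= ltxx.
move=> s y a p P /andP[s0 sS] hp hjj; apply: (hj (s, y) a p P) => //.
  by split => //=; apply: ST; exact: ltW (lt_trans sS SS').
apply: qjet_near hjj; have := @ext_near u0 u (s, y) s0.
by apply: filterS => v ->.
Qed.

Lemma initial_opp T (u0 : R -> R) u : (forall x, ((u0 x)%:E <= lsc_env (strip T) u (0%R, x))%E) ->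
  forall x, (usc_env (strip T) (fun y => - u y)%R (0%R, x) <= (- u0 x)%R%:E)%E.
Proof. by move=> h x; have := h x; rewrite lsc_env_opp EFinN leeNr. Qed.

Lemma linear_growthN T u : linear_growth T u -> linear_growth T (fun y => - u y).
Proof.
move=> h T' hT; have [C hC] := h T' hT; exists C => t x t0 tT.
by rewrite normrN; exact: hC.
Qed.

Lemma lipschitzN (u0 : R -> R) (L : R) : (forall x x', u0 x - u0 x' <= L * `|x - x'|) ->
  forall x x', - u0 x - - u0 x' <= L * `|x - x'|.
Proof. by move=> h x x'; have := h x' x; rewrite distrC; clear; lra. Qed.

(** The sum [M] contains the absolute value of each quantity that may bound a time slope: the flux
    limiter and the minima of the Hamiltonians, and, for supersolutions, the values at P and - P,
    which dominate those in between by quasi-convexity. *)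
Lemma fl_bound hL hR (A p0L p0R L : R) (u0 : R -> R) v : 0 <= L ->
  (forall x x', u0 x - u0 x' <= L * `|x - x'|) ->
  limit_hamiltonian hL -> limit_hamiltonian hR -> argmin hL p0L -> argmin hR p0R ->
  fl_cauchy_solution hL hR (junction_fun A hL hR p0L p0R) u0 v ->
  exists2 C, 0 <= C & forall t x, 0 <= t -> ext u0 v (t, x) <= u0 x + C * t /\
    ext (fun x => - u0 x) (fun y => - v y) (t, x) <= - u0 x + C * t.
Proof.
move=> L0 hu0 hhL hhR mL mR [hs hp hi hg].
pose M (P : R) := `|A| + (`|hL p0L| + `|hR p0R|) + ((`|hL P| + `|hL (- P)|) + (`|hR P| + `|hR (- P)|)).
have M0 P : 0 <= M P by rewrite /M !addr_ge0.
have leM P (x : R) : x <= `|A| \/ x <= `|hL p0L| \/ x <= `|hR p0R| \/ x <= `|hL P| \/ x <= `|hL (- P)|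
    \/ x <= `|hR P| \/ x <= `|hR (- P)| -> x <= M P.
  have := normr_ge0 A; have := normr_ge0 (hL p0L); have := normr_ge0 (hR p0R).
  have := normr_ge0 (hL P); have := normr_ge0 (hL (- P)).
  have := normr_ge0 (hR P); have := normr_ge0 (hR (- P)); rewrite /M.
  move: (`|A|) (`|hL p0L|) (`|hR p0R|) (`|hL P|) (`|hL (- P)|) (`|hR P|) (`|hR (- P)|).
  by clear => *; lra.
have hM P p : `|p| <= P -> hL (- p) <= M P /\ hR (- p) <= M P.
  rewrite ler_norml => /andP[h1 h2]; have hq : - P <= - p <= P.
    by rewrite lerN2 h2 lerNl.
  have := lham_qc hhL hq; have := lham_qc hhR hq; rewrite !le_max => hR' hL'; split.
    by case/orP: hL' => h; apply: leM; have := le_trans h (ler_norm _); tauto.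
  by case/orP: hR' => h; apply: leM; have := le_trans h (ler_norm _); tauto.
have hN (h : R -> R) (p0 : R) (p : R) : argmin h p0 -> - h p <= `|h p0|.
  by move=> hm; have := hm p; have := ler_norm (- h p0); rewrite normrN; clear; lra.
have AM P : A <= M P by apply: leM; left; exact: ler_norm.
have AM' P : - A <= M P by apply: leM; left; rewrite -normrN ler_norm.
have lbN := locally_boundedN hs.1.
exists (M (L + 1)) => // t x t0; split.
  apply: (@ext_bound +oo u0 L v M) => //.
  - exact: hs.1.
  - by move=> y; exact: (hi y).1.
  - move=> z a p P [z1 _] hpP hj; have [sR sL s0] := fl_subsolution_at hs z1.
    case: (ltgtP z.2 0) => z2.
    + have := sL z2 a p hj; have : - hL p <= M P by apply: leM; have := hN hL p0L p mL; tauto.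
      by clear; lra.
    + have := sR z2 a p hj; have : - hR p <= M P by apply: leM; have := hN hR p0R p mR; tauto.
      by clear; lra.
    have := s0 z2 a p p (kink_flat hj); have : A <= junction_fun A hL hR p0L p0R p p.
      by rewrite /junction_fun le_max lexx.
    by have := AM' P; clear; lra.
  exact: ltry.
apply: (@ext_bound +oo (fun x => - u0 x) L (fun y => - v y) M L0 (lipschitzN hu0) lbN) => //.
- by apply: initial_opp => y; exact: (hi y).2.
- exact: linear_growthN.
- move=> z a p P [z1 _] hpP hj; have [sR sL s0] := fl_supersolution_at hp z1.
  have [hL1 hR1] := hM P p hpP.
  case: (ltgtP z.2 0) => z2.
  + by have := sL z2 a p hj; rewrite /hoppo; move: hL1; clear; lra.
  + by have := sR z2 a p hj; rewrite /hoppo; move: hR1; clear; lra.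
  have hj' : qjet (fun y => env (fun y => - v y) y + kink (- p) (- p) y) z a 0.
    by apply: qjet_eq (kink_flat hj) => // y; rewrite kinkN.
  apply: le_trans (s0 z2 a _ _ hj') _; rewrite /junction_fun !ge_max AM /=.
  have m1 : hL p0L <= M P by apply: leM; have := ler_norm (hL p0L); tauto.
  have m2 : hR p0R <= M P by apply: leM; have := ler_norm (hR p0R); tauto.
  by rewrite /incr_part /decr_part; case: ifP; case: ifP => _ _; rewrite ?m1 ?m2 ?hL1 ?hR1.
exact: ltry.
Qed.

(** The barrier of subsolutions comes from the lower bound of [H], that of supersolutions from the
    bound of [H] on slopes up to L + 1. Rescaling does not change the range of [H], so C does not
    depend on eps. *)
Lemma cauchy_family H (T L : R) (u0 : R -> R) (ueps : R -> R * R -> R) : 0 <= L ->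
  (forall x x', u0 x - u0 x' <= L * `|x - x'|) -> hamiltonian H ->
  (forall eps : R, 0 < eps -> cauchy_solution T%:E (hscale H eps) u0 (ueps eps)) ->
  exists C, oscillating_family H T C u0 (fun eps => ext u0 (ueps eps))
    (fun eps => ext (fun x => - u0 x) (fun y => - ueps eps y)).
Proof.
move=> L0 hu0 hH hu; have [C0 C00 hC0] := ham_lb hH.
have [M hM] := choice (ham_bd hH).
have M0 : 0 <= M (L + 1).
  by apply: le_trans (normr_ge0 _) (hM (L + 1) 0 0 0 _); rewrite normr0 addr_ge0.
have F0 : \forall eps \near (0 : R)^'+, 0 < eps by exact: nbhs_right_gt.
pose C := Num.max C0 (M (L + 1)).
have CC0 : C0 <= C by rewrite le_max lexx.
have CM : M (L + 1) <= C by rewrite le_max lexx orbT.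
have sub z : 0 < z.1 < T -> open_strip T%:E z by move=> /andP[h1 h2]; split; rewrite ?lte_fin.
have ub w (w0 : R -> R) (c : R) : (forall t x, 0 <= t -> (t%:E < T%:E)%E -> ext w0 w (t, x) <= w0 x + c * t) -> c <= C ->
    forall y, y.1 < T -> ext w0 w y <= w0 y.2 + C * Num.max y.1 0.
  move=> h cC y yT; have [y0|y0] := ltP 0 y.1.
    rewrite (surjective_pairing y) /=.
    have := h y.1 y.2 (ltW y0); rewrite lte_fin => /(_ yT) h1; apply: le_trans h1 _.
    by rewrite lerD2l ler_wpM2r// ltW.
  by rewrite /ext ltNge y0 /= mulr0 addr0.
exists C; split; apply: filterS F0 => eps e0; have [h1 h2 h3 h4] := hu eps e0.
- by move=> y yT; apply: (ext_usc hu0 h1.1) => [x|]; [exact: (h3 x).1|rewrite lte_fin].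
- move=> y yT; apply: (ext_usc (lipschitzN hu0) (locally_boundedN h2.1)); last by rewrite lte_fin.
  by apply: initial_opp => x; exact: (h3 x).2.
- move=> z a q zT hj; apply: (subsolution_qsub (@open_open_strip _ T%:E) (@open_strip_sub _ T%:E) h1 (sub z zT)).
  apply: qjet_near hj; have := @ext_near u0 (ueps eps) z (proj1 (andP zT)).
  by apply: filterS => v ->.
- move=> z a q zT hj; rewrite -[leRHS]oppr0.
  apply: (supersolution_qsub (@open_open_strip _ T%:E) (@open_strip_sub _ T%:E) h2 (sub z zT)).
  apply: qjet_near hj; have := @ext_near (fun x => - u0 x) (fun y => - ueps eps y) z (proj1 (andP zT)).
  by apply: filterS => v ->.
- apply: ub CC0; apply: (@ext_bound T%:E u0 L (ueps eps) (fun=> C0)) => //.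
  + exact: h1.1.
  + by move=> x; exact: (h3 x).1.
  move=> z a p P Oz _ hj.
  have := subsolution_qsub (@open_open_strip _ T%:E) (@open_strip_sub _ T%:E) h1 Oz hj.
  by have := hC0 (z.1 / eps) (z.2 / eps) p; rewrite /hscale; clear; lra.
- apply: ub CM; apply: (@ext_bound T%:E (fun x => - u0 x) L _ M L0 (lipschitzN hu0)) => //.
  + exact: locally_boundedN h2.1.
  + by apply: initial_opp => x; exact: (h3 x).2.
  + exact: linear_growthN.
  move=> z a p P Oz hp hj.
  have := supersolution_qsub (@open_open_strip _ T%:E) (@open_strip_sub _ T%:E) h2 Oz hj.
  have : `|- p| <= P by rewrite normrN.
  move=> /(hM P (z.1 / eps) (z.2 / eps)); rewrite ler_norml => /andP[_].
  by rewrite /hneg /hscale; clear; lra.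
move=> y yT; rewrite /ext; case: ifP => y0; last by rewrite subrr.
have yT' : (y.1%:E < T%:E)%E by rewrite lte_fin.
have b1 := bdat_strip h1.1 y0 yT'; have := env_ge b1; have := env_ge (bdatN b1).
by clear; lra.
Qed.

End InitialTime.

(** * From the assumptions to the working hypotheses *)

Section Assumptions.
Context {R : realType}.
Implicit Types (H Ha HL HR : R -> R -> R -> R) (t s x y p q e : R).

Lemma hreflK H : hrefl (hrefl H) = H.
Proof.
by apply/funext => t; apply/funext => x; apply/funext => p; rewrite /hrefl !opprK.
Qed.

Lemma hrefl_periodic H : Z2_periodic H -> Z2_periodic (hrefl H).
Proof.
move=> pH k j t x p; rewrite /hrefl (_ : - (x + j%:~R) = - x + (- j)%:~R) ?pH//.
by rewrite opprD rmorphN.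
Qed.

(** (A5) speaks of the unit cell shifted by large integers: a large x is the shift of a point of the
    cell, and periodicity brings any time into [0, 1]. *)
Lemma asymptotic_tail H HR : A1 H -> Z2_periodic HR ->
  (forall e : R, 0 < e -> exists N : int, forall k : int, N <= k ->
        forall t x p, t \in `[0, 1] -> x \in `[0, 1] ->
        `|H t (x + k%:~R) p - HR t x p| < e) -> asymptotic_right H HR.
Proof.
move=> pH pHR h e e0; have [N hN] := h e e0; exists (N%:~R + 2) => t x p hx.
have [m hm] := int_shift t 0; have [k hk] := int_shift x 0; rewrite add0r in hm hk.
have Nk : N <= - k.
  rewrite -(ler_int R) rmorphN /=; case/andP: hk => _; move: hx; clear; lra.
have -> : H t x p = H (t + m%:~R) ((x + k%:~R) + (- k)%:~R) p.
  by rewrite rmorphN /= addrK pH.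
have -> : HR t x p = HR (t + m%:~R) (x + k%:~R) p by rewrite pHR.
by apply/ltW/hN => //; rewrite in_itv.
Qed.

Lemma A5_right H HL HR : A1 H -> A5 H HL HR -> asymptotic_right H HR.
Proof. by move=> pH [_ h _ pR]; exact: asymptotic_tail. Qed.

Lemma A5_left H HL HR : A1 H -> A5 H HL HR -> asymptotic_right (hrefl H) (hrefl HL).
Proof.
move=> pH [h _ pL _]; apply: asymptotic_tail; [|exact: hrefl_periodic|].
  by move=> k t x p; rewrite /hrefl pH.
move=> e e0; have [N hN] := h e e0; exists (- N) => k kN t x p ht hx.
(* Reflection sends the cell [0, 1] to [-1, 0]; one more unit shift brings it back to [0, 1]. *)
have kN' : - k - 1 <= N by apply: le_trans (_ : - k <= N); rewrite ?gerBl// lerNl.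
have -> : hrefl HL t x p = HL t (1 - x) (- p).
  by rewrite /hrefl -(pL 0 1) /= addr0 addrC.
have -> : hrefl H t (x + k%:~R) p = H t ((1 - x) + (- k - 1)%:~R) (- p).
  rewrite /hrefl; congr H; rewrite intrB rmorphN /=; ring.
apply: hN => //; move: hx; rewrite !in_itv /=; clear => /andP[? ?]; apply/andP; split; lra.
Qed.

(** By periodicity [Ha] at x is approximated by [H] at x + k for large k, with one k for two
    abscissas and for all times and slopes, so each estimate passes over with a small loss. *)
Lemma hamiltonian_limit H Ha : hamiltonian H -> asymptotic_right H Ha -> Z2_periodic Ha ->
  hamiltonian Ha.
Proof.
move=> [h1 h2 h3 h4] hA pA.
have pk (k : int) t x p : Ha t (x + k%:~R) p = Ha t x p by rewrite -[in LHS](addr0 t) (pA 0 k).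
have apx e x y : 0 < e -> exists k : int, forall t p, `|H t (x + k%:~R) p - Ha t x p| <= e /\
    `|H t (y + k%:~R) p - Ha t y p| <= e.
  move=> e0; have [N hN] := hA e e0.
  have [k /andP[hk _]] := int_shift 0 (`|N| + `|x| + `|y|); exists k => t p.
  have := ler_norm N; have := ler_norm (- x); have := ler_norm (- y); rewrite !normrN => a1 a2 a3.
  have := normr_ge0 x; have := normr_ge0 y => b1 b2.
  by split; rewrite -[X in _ - X](pk k); apply: hN; move: hk a1 a2 a3 b1 b2; clear; lra.
split.
- move=> K; have [M hM] := h1 K; exists (M + 1) => t x p hp.
  have [k hk] := apx 1 x x ltr01; have [a _] := hk t p; have := hM t (x + k%:~R) p hp.
  by move: a; rewrite !ler_norml; clear => /andP[? ?] /andP[? ?]; apply/andP; split; lra.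
- move=> M; have [K hK] := h2 (M + 1); exists K => q hq t x.
  have [k hk] := apx 1 x x ltr01; have [a _] := hk t q; have := hK q hq t (x + k%:~R).
  by move: a; rewrite ler_norml; clear => /andP[? ?]; lra.
- move=> K e e0; have e3 : 0 < e / 3 by lra.
  have [d d0 hd] := h3 K _ e3; exists d => // t x y p q hp hx hq.
  have [k hk] := apx _ x y e3; have [a _] := hk t p; have [_ b] := hk t q.
  have := hd t (x + k%:~R) (y + k%:~R) p q hp; rewrite opprD addrACA subrr addr0 => /(_ hx hq).
  by move: a b; rewrite !ler_norml; clear => /andP[? ?] /andP[? ?] /andP[? ?]; apply/andP; split; lra.
move=> e e0; have e3 : 0 < e / 3 by lra.
have [d d0 hd] := h4 _ e3; exists (d / 2); first by rewrite divr_gt0.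
(* Replacing [Ha] by [H] inside the positive part adds at most n <= 1, and |t - s| n <= d / 2
   because |t - s| itself is at most d / 2. *)
move=> t s x p hts; pose n := Num.min 1 (e / 3).
have n0 : 0 < n by rewrite lt_min ltr01.
have n1 : n <= 1 by rewrite ge_min lexx.
have n2 : n <= e / 3 by rewrite ge_min lexx orbT.
have [k hk] := apx n x x n0; have [a _] := hk t p; have [b _] := hk s p.
have ts : `|t - s| <= d / 2.
  apply: le_trans hts; rewrite ler_peMr// lerDl le_max lexx orbT//.
have mm : Num.max (H s (x + k%:~R) p) 0 <= Num.max (Ha s x p) 0 + n.
  rewrite ge_max; apply/andP; split.
    have : Ha s x p <= Num.max (Ha s x p) 0 by rewrite le_max lexx.
    by move: b; rewrite ler_norml; clear => /andP[? ?]; lra.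
  by rewrite addr_ge0 ?le_max ?lexx ?orbT// ltW.
have : H t (x + k%:~R) p <= H s (x + k%:~R) p + e / 3.
  apply: hd; apply: le_trans (_ : `|t - s| * (1 + Num.max (Ha s x p) 0 + n) <= _).
    by rewrite ler_wpM2l// -addrA lerD2l.
  rewrite mulrDr; have : `|t - s| * n <= d / 2.
    by apply: le_trans ts; rewrite ler_piMr.
  by move: hts; clear; lra.
by move: a b n2; rewrite !ler_norml; clear => /andP[? ?] /andP[? ?]; lra.
Qed.

(** Beyond N the values of [H] at x and at x + k are both within e / 2 of the same value of the
    periodic [Ha]; k brings x into a fixed bounded interval, together with its neighbour y. *)
Lemma fold_far H Ha e : asymptotic_right H Ha -> Z2_periodic Ha -> 0 < e ->
  exists2 N : R, 0 <= N & forall x y, N + 1 <= x -> `|x - y| <= 1 ->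
  exists k : int, [/\ `|x + k%:~R| <= N + 3, `|y + k%:~R| <= N + 3 & forall t p,
    `|H t x p - H t (x + k%:~R) p| <= e /\ `|H t y p - H t (y + k%:~R) p| <= e].
Proof.
move=> hA pA e0; have e2 : 0 < e / 2 by rewrite divr_gt0.
have pk (k : int) t x p : Ha t (x + k%:~R) p = Ha t x p by rewrite -[in LHS](addr0 t) (pA 0 k).
have [N hN] := hA _ e2; exists `|N| => // x y hx hxy.
have [k /andP[k1 k2]] := int_shift x (`|N| + 1); exists k.
have N0 := normr_ge0 N; have N1 := ler_norm N; move: hxy; rewrite ler_norml => /andP[xy1 xy2].
have close t p (z : R) : N <= z -> N <= z + k%:~R -> `|H t z p - H t (z + k%:~R) p| <= e.
  move=> z1 z2; have := hN t z p z1; have := hN t (z + k%:~R) p z2; rewrite pk !ler_norml.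
  by clear => /andP[? ?] /andP[? ?]; apply/andP; split; lra.
split.
- by rewrite ler_norml; apply/andP; split; move: k1 k2 N0; clear; lra.
- by rewrite ler_norml; apply/andP; split; move: k1 k2 N0 xy1 xy2; clear; lra.
move=> t p; split; apply: close.
- by move: hx N1; clear; lra.
- by move: k1 N1; clear; lra.
- by move: hx N1 xy1 xy2; clear; lra.
by move: k1 N1 xy1 xy2; clear; lra.
Qed.

(** Up to an error e, any two nearby points can be moved together into a fixed bounded interval.
    Thus continuity on compact sets, all that (A0) offers, becomes uniform in x. *)
Lemma fold_line H HL HR e : asymptotic_right H HR -> Z2_periodic HR ->
  asymptotic_right (hrefl H) (hrefl HL) -> Z2_periodic HL -> 0 < e ->
  exists B : R, forall x y, `|x - y| <= 1 ->
  exists k : int, [/\ `|x + k%:~R| <= B, `|y + k%:~R| <= B & forall t p,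
    `|H t x p - H t (x + k%:~R) p| <= e /\ `|H t y p - H t (y + k%:~R) p| <= e].
Proof.
move=> aR pR aL pL e0; have [NR NR0 hR] := fold_far aR pR e0.
have [NL NL0 hL] := fold_far aL (hrefl_periodic pL) e0.
exists (NR + NL + 3) => x y hxy.
have [xR|xR] := leP (NR + 1) x.
  have [k [k1 k2 hk]] := hR x y xR hxy; exists k; split => //.
    by apply: le_trans k1 _; move: NL0; clear; lra.
  by apply: le_trans k2 _; move: NL0; clear; lra.
have [xL|xL] := leP (NL + 1) (- x).
  have hxy' : `|- x - - y| <= 1 by rewrite -opprD normrN.
  have [k [k1 k2 hk]] := hL (- x) (- y) xL hxy'; exists (- k).
  have kE (z : R) : - (- z + k%:~R) = z + (- k)%:~R by rewrite opprD opprK rmorphN.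
  rewrite -!kE !normrN; split.
  - by apply: le_trans k1 _; move: NR0; clear; lra.
  - by apply: le_trans k2 _; move: NR0; clear; lra.
  by move=> t p; have := hk t (- p); rewrite /hrefl !opprK !kE.
exists 0; rewrite mulr0z !addr0; have xb : `|x| <= NR + NL + 1.
  by rewrite ler_norml; apply/andP; split; move: xR xL NR0 NL0; clear; lra.
split.
- by apply: le_trans xb _; lra.
- have := ler_distD x y 0; rewrite !subr0 [`|y - x|]distrC; move: hxy xb; clear; lra.
by move=> t p; rewrite !subrr !normr0 ltW.
Qed.

Lemma A0_box H (B K : R) : A0 H -> (exists M : R, forall t x p, 0 <= t <= 1 -> `|x| <= B ->
    `|p| <= K -> `|H t x p| <= M) /\
  forall e, 0 < e -> exists2 d, 0 < d & forall t x y p q, 0 <= t <= 1 -> `|x| <= B -> `|p| <= K ->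
    `|x - y| <= d -> `|p - q| <= d -> `|H t x p - H t y q| <= e.
Proof.
move=> cH; pose X : set (R * R * R) := @rect R 0 1 (- B) B `*` `[- K, K].
have cX : compact X by apply: compact_setX; [exact: compact_rect|exact: segment_compact].
have XP t x p : 0 <= t <= 1 -> `|x| <= B -> `|p| <= K -> X ((t, x), p).
  by rewrite !ler_norml => h1 h2 h3; split; [split|]; rewrite /= in_itv.
split.
  have [M1 h1] := usc_compact_bound cX (fun z _ => continuous_usc (cH z)).
  have [M2 h2] := usc_compact_bound cX (fun z _ => continuous_usc (continuousN (cH z))).
  exists (Num.max M1 M2) => t x p ht hx hp; rewrite ler_norml.
  have := h1 _ (XP t x p ht hx hp); have := h2 _ (XP t x p ht hx hp); rewrite /=.
  have : M1 <= Num.max M1 M2 by rewrite le_max lexx.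
  have : M2 <= Num.max M1 M2 by rewrite le_max lexx orbT.
  by clear => *; apply/andP; split; lra.
move=> e e0; have e2 : 0 < e / 2 by rewrite divr_gt0.
have : \forall d \near (0 : R)^'+, X `<=` [set z | forall y q, `|z.1.2 - y| <= d -> `|z.2 - q| <= d ->
    `|H z.1.1 z.1.2 z.2 - H z.1.1 y q| <= e].
  apply: (iffLR (@compact_near_coveringP _ _) cX) => z _.
  have /cvgrPdist_le /(_ _ e2) /nbhs_ballP[d /= d0 hd] := cH z.
  exists (ball z (d / 2), [set d' | d' <= d / 3]) => /=.
    split; last by apply: nbhs_right_le; rewrite divr_gt0.
    by apply: nbhsx_ballx; rewrite divr_gt0.
  move=> [v d'] /= [[[v1 v2] v3] d'd] y q hy hq.
  move: v1 v2 v3; rewrite /ball /= => v1 v2 v3.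
  have hv : ball z d v.
    by split; [split|]; rewrite /ball /=; [move: v1|move: v2|move: v3]; move: d0; clear => /= ? ?; lra.
  have hw : ball z d ((v.1.1, y), q).
    split; [split|]; rewrite /ball /=.
    - by move: v1 d0; clear => /= ? ?; lra.
    - have := ler_distD v.1.2 z.1.2 y; move: v2 hy d'd d0; clear => /= *; lra.
    by have := ler_distD v.2 z.2 q; move: v3 hq d'd d0; clear => /= *; lra.
  have := hd _ hv; have := hd _ hw; rewrite /= !ler_norml.
  by clear => /andP[? ?] /andP[? ?]; apply/andP; split; lra.
have : \forall d \near (0 : R)^'+, 0 < d by exact: nbhs_right_gt.
move=> n0 n1; have /filter_ex[d [d0 hd]] : \forall d \near (0 : R)^'+, 0 < d /\
    X `<=` [set z | forall y q, `|z.1.2 - y| <= d -> `|z.2 - q| <= d ->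
    `|H z.1.1 z.1.2 z.2 - H z.1.1 y q| <= e].
  by move: n0 n1; apply: filterS2.
exists d => // t x y p q ht hx hp hy hq.
exact: (hd _ (XP t x p ht hx hp) y q hy hq).
Qed.

Lemma A_hamiltonian H HL HR : A0 H -> A1 H -> A2 H -> A3 H -> A5 H HL HR -> hamiltonian H.
Proof.
move=> h0 h1 h2 h3 h5; have aR := A5_right h1 h5; have aL := A5_left h1 h5.
have [_ _ pL pR] := h5; split => //.
- move=> K; have [B hB] := fold_line aR pR aL pL ltr01.
  have [[M hM] _] := A0_box B K h0; exists (M + 1) => t x p hp.
  have xx : `|x - x| <= 1 by rewrite subrr normr0.
  have [k [k1 _ hk]] := hB x x xx.
  have [m hm] := int_shift t 0; rewrite add0r in hm.
  have := hM _ _ _ hm k1 hp; have [] := hk t p; rewrite h1 !ler_norml.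
  by clear => /andP[? ?] _ /andP[? ?]; apply/andP; split; lra.
- move=> K e e0; have e3 : 0 < e / 3 by lra.
  have [B hB] := fold_line aR pR aL pL e3.
  have [_ hU] := A0_box B K h0; have [d d0 hd] := hU _ e3.
  exists (Num.min 1 d); first by rewrite lt_min ltr01.
  move=> t x y p q hp; rewrite !le_min => /andP[x1 xd] /andP[_ qd].
  have [k [k1 k2 hk]] := hB x y x1.
  have [m hm] := int_shift t 0; rewrite add0r in hm.
  have := hd (t + m%:~R) (x + k%:~R) (y + k%:~R) p q hm k1 hp.
  rewrite opprD addrACA subrr addr0 => /(_ xd qd); rewrite !h1.
  have [a _] := hk t p; have [_ b] := hk t q; move: a b; rewrite !ler_norml.
  by clear => /andP[? ?] /andP[? ?] /andP[? ?]; apply/andP; split; lra.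
have [om [[om0 _ omc] hom]] := h2.
move=> e e0; have /cvgrPdist_lt /(_ e e0) := omc.
rewrite /at_right near_withinE => /nbhs_ballP[d /= d0 hd].
exists (d / 2); first by rewrite divr_gt0.
move=> t s x p hts; rewrite -lerBlDl; apply: le_trans (hom t s x p) _.
set r := _ * _ in hts *.
have r0 : 0 <= r by rewrite /r mulr_ge0// addr_ge0// le_max lexx orbT.
have [rE|rne] := eqVneq r 0; first by rewrite rE om0 ltW.
have rp : 0 < r by rewrite lt_neqAle eq_sym rne.
have := hd r; rewrite /ball /= sub0r normrN gtr0_norm// => /(_ _ rp).
have rd : r < d by move: hts d0; clear => /= ? ?; lra.
by move=> /(_ rd); rewrite sub0r normrN => /ltW; exact: le_trans (ler_norm _).
Qed.

(** Reflected approximate correctors solve the reflected cell problem at the same level, and levels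
    are unique. Continuous approximate correctors are used so that reflection has no envelopes to
    commute with. *)
Lemma Hbar_refl H p : hamiltonian H -> Z2_periodic H -> Hbar (hrefl H) p = Hbar H (- p).
Proof.
move=> hH pH; have c1 := Hbar_spec p (ham_refl hH) (hrefl_periodic pH).
have [_ _ c2 _] := Hbar_spec (- p) hH pH.
have eH : hrefl (pshift H (- p)) = pshift (hrefl H) p.
  by apply/funext => t; apply/funext => x; apply/funext => q; rewrite /hrefl /pshift opprD.
have per (v : R * R -> R) : periodic2 v -> periodic2 (fun y : R * R => v (refl y)).
  move=> pv k j z; by rewrite /refl /= -(pv k (- j) (z.1, - z.2)) /= rmorphN /= opprD.
apply/le_anti/andP; split; apply/ler_addgt0Pr => e e0; have [v [v1 v2 v3 v4 v5]] := c2 e e0.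
  apply: (regular_level (Hbar H (- p) + e) c1 (per _ v1) (fun z => usc_reflect (v2 (refl z)))).1.
  by rewrite -eH; exact: qsub_refl.
have pN : periodic2 (fun y : R * R => - v y) by move=> k j z; rewrite v1.
have := (regular_level (- Hbar H (- p) + e) c1 (per _ pN) (fun z => usc_reflect (v3 (refl z)))).2.
have : qsub setT (hneg (pshift (hrefl H) p)) (- Hbar H (- p) + e) (fun y : R * R => - v (refl y)).
  by rewrite -eH; exact: (qsub_refl v5).
by move=> h /(_ h); clear; lra.
Qed.

Lemma A_effective H HL HR : hamiltonian H -> A1 H -> A5 H HL HR ->
  [/\ hamiltonian HL, hamiltonian HR, Z2_periodic HL, Z2_periodic HR &
      effective H (Hbar HL) (Hbar HR)].
Proof.
move=> hH h1 h5; have aR := A5_right h1 h5; have aL := A5_left h1 h5.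
have [_ _ pL pR] := h5.
have hR := hamiltonian_limit hH aR pR.
have hL' := hamiltonian_limit (ham_refl hH) aL (hrefl_periodic pL).
have hL : hamiltonian HL by rewrite -(hreflK HL); exact: ham_refl.
have [e1 e2] := asymptotic_effective hR pR aR.
have [e3 e4] := asymptotic_effective hL' (hrefl_periodic pL) aL.
have eL : Hbar (hrefl HL) = fun p => Hbar HL (- p) by apply/funext => p; exact: Hbar_refl.
by split => //; split => //; rewrite -eL.
Qed.

End Assumptions.

(** * Solutions of the oscillating problems by Perron's method *)

Section PerronFamily.
Context {R : realType}.
Implicit Types (z y : R * R) (a p : R) (u w v : R * R -> R) (h : R -> R) (H : R -> R -> R -> R).

Lemma barrier_jet (w0 : R -> R) (L k : R) z a p : (forall x x', w0 x - w0 x' <= L * `|x - x'|) ->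
  0 < z.1 -> qjet (fun y => w0 y.2 + k * Num.max y.1 0) z a p -> a = k /\ `|p| <= L.
Proof.
move=> hw z0 [C /nbhs_boxP[d d0 hd]]; have d1 : 0 < Num.min d z.1 by rewrite lt_min d0.
have m1 : Num.min d z.1 <= d by rewrite ge_min lexx.
have m2 : Num.min d z.1 <= z.1 by rewrite ge_min lexx orbT.
have mx (t : R) : 0 <= t -> Num.max t 0 = t by move=> h; apply/max_idPl.
split.
  apply/eqP; rewrite eq_sym -subr_eq0 -normr_le0.
  apply: (@slope_limit _ (k - a) 0 C _ d1) => s hs.
  have ts : 0 <= z.1 + s by move: (le_trans hs m2); rewrite ler_norml; clear => /andP[? _]; lra.
  have := hd (z.1 + s, z.2); rewrite /lin /sqd /= !subrr normr0 addrAC subrr add0r => /(_ (le_trans hs m1) (ltW d0)).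
  by rewrite !mx// ?(ltW z0)// expr0n /=; clear; lra.
rewrite -normrN; apply: (@slope_limit _ (- p) L C _ d1) => s hs.
have := hd (z.1, z.2 + s); rewrite /lin /sqd /= !subrr normr0 [z.2 + s - _]addrAC subrr add0r.
move=> /(_ (ltW d0) (le_trans hs m1)); rewrite expr0n /=.
have := hw z.2 (z.2 + s); rewrite opprD addrA subrr sub0r normrN.
by clear; lra.
Qed.

Lemma continuous_bdat u z : continuous u -> bdat u z.
Proof.
move=> cu; have /cvgrPdist_le /(_ 1 ltr01) /nbhs_boxP[d d0 hd] := cu z.
exists d, (`|u z| + 1); split => // y [y1 y2]; have := hd y y1 y2; rewrite distrC => h1.
have := ler_distD (u z) (u y) 0; rewrite !subr0; move: h1; clear; lra.
Qed.

Lemma continuous_barrier (w0 : R -> R) (L k : R) : (forall x x', w0 x - w0 x' <= L * `|x - x'|) ->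
  continuous (fun y : R * R => w0 y.2 + k * Num.max y.1 0).
Proof.
move=> hw y; apply: cvgD; first exact: (lipschitz_continuous hw).
by apply: cvgM; [exact: cvg_cst|exact: continuous_posr].
Qed.

Lemma env_continuous u : continuous u -> env u = u.
Proof.
by move=> cu; apply/funext => z; apply: env_usc; [exact: continuous_bdat|exact/continuous_usc/cu].
Qed.

Lemma perron_solution H (L C : R) (u0 : R -> R) : ucont H ->
  (forall x x', u0 x - u0 x' <= L * `|x - x'|) -> 0 <= C ->
  (forall t x p, `|p| <= L -> `|H t x p| <= C) ->
  exists v, [/\ forall y, u0 y.2 - C * Num.max y.1 0 <= v y <= u0 y.2 + C * Num.max y.1 0,
    qsub (open_strip +oo) H 0 (env v) & qsub (open_strip +oo) (hneg H) 0 (env (fun y => - v y))].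
Proof.
move=> hH hu C0 hC; have huN := lipschitzN hu.
pose f y := u0 y.2 + (- C) * Num.max y.1 0; pose g y := u0 y.2 + C * Num.max y.1 0.
have cf : continuous f by exact: continuous_barrier hu.
have cg : continuous g by exact: continuous_barrier hu.
have cgN : continuous (fun y => - g y) by move=> y; apply: cvgN; exact: cg.
have fg y : f y <= g y.
  have : 0 <= C * Num.max y.1 0 by rewrite mulr_ge0// le_max lexx orbT.
  by rewrite /f /g; clear; lra.
pose G z (r q : R) := 0 * r + H z.1 z.2 q - 0.
have bar : barriers (open_strip +oo) G f g.
  split.
  - exact: open_open_strip.
  - exact: jointly_continuous_ham.
  - by move=> z; exact: continuous_bdat.
  - by move=> z; exact: continuous_bdat.
  - exact: fg.
  - rewrite env_continuous// => z a p [z1 _] /(barrier_jet hu z1)[-> hp].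
    have := hC z.1 z.2 p hp; rewrite /G mul0r add0r subr0 ler_norml => /andP[_].
    by clear; lra.
  rewrite env_continuous// => z a p [z1 _] hj.
  have : qjet (fun y => - u0 y.2 + - C * Num.max y.1 0) z a p.
    by apply: qjet_eq hj => // y; rewrite /g opprD mulNr.
  move=> /(barrier_jet huN z1)[-> hp]; rewrite -normrN in hp.
  have := hC z.1 z.2 (- p) hp; rewrite /G mul0r add0r subr0 ler_norml => /andP[+ _].
  by clear; lra.
have [v [v1 v2 v3 _]] := perron bar; exists v; split.
- by move=> y; have := v1 y; rewrite /f /g mulNr.
- by move=> z a p Oz /(v2 z a p Oz); rewrite /G mul0r add0r subr0.
move=> z a p Oz /(v3 z a p Oz); rewrite /G mul0r add0r subr0 /hneg.
by clear; lra.
Qed.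

(** A family independent of the given solutions, and global in time: the limit has to be constructed
    on all positive times and before any solution of the oscillating problems on (0, T) is
    considered. The constant C bounds [H] on slopes up to L, those of the barriers. *)
Lemma perron_family H (L : R) (u0 : R -> R) : hamiltonian H ->
  (forall x x', u0 x - u0 x' <= L * `|x - x'|) ->
  exists C U W, 0 <= C /\ forall T : R, oscillating_family H T C u0 U W.
Proof.
move=> hH hu; have [M hM] := ham_bd hH L; pose C := `|M|.
have hC t x p : `|p| <= L -> `|H t x p| <= C.
  by move=> /(hM t x) h; apply: le_trans h (ler_norm _).
have sol eps : exists v, 0 < eps -> [/\ forall y, u0 y.2 - C * Num.max y.1 0 <= v y <= u0 y.2 + C * Num.max y.1 0,
    qsub (open_strip +oo) (hscale H eps) 0 (env v) &
    qsub (open_strip +oo) (hneg (hscale H eps)) 0 (env (fun y => - v y))].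
  have [e0|_] := ltP 0 eps; last by exists (fun=> 0).
  have [v hv] := perron_solution (ham_ucont (ham_scale e0 hH)) hu (normr_ge0 M : 0 <= C)
    (fun t x p => hC (t / eps) (x / eps) p).
  by exists v.
have [v hv] := choice sol.
have F0 : \forall eps \near (0 : R)^'+, 0 < eps by exact: nbhs_right_gt.
pose f y := u0 y.2 + (- C) * Num.max y.1 0; pose g y := u0 y.2 + C * Num.max y.1 0.
have cf : continuous f by exact: continuous_barrier hu.
have cg : continuous g by exact: continuous_barrier hu.
have cfN : continuous (fun y => - f y) by move=> y; apply: cvgN; exact: cf.
have bv eps z : 0 < eps -> bdat (v eps) z.
  move=> e0; have [h _ _] := hv eps e0.
  apply: (bdat_squeeze (@continuous_bdat f z cf) (@continuous_bdat g z cg)).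
  by apply/nbhs_boxP; exists 1 => // y _ _; have := h y; rewrite /f /g mulNr.
have sub z (T : R) : 0 < z.1 < T -> open_strip +oo z.
  by move=> /andP[z1 _]; split => //; exact: ltry.
exists C, (fun eps => env (v eps)), (fun eps => env (fun y => - v eps y)).
split=> [|T]; first exact: normr_ge0.
split; apply: filterS F0 => eps e0; have [h1 h2 h3] := hv eps e0.
- by move=> y _; apply: usc_envelope; exact: bv.
- by move=> y _; apply: usc_envelope; apply: bdatN; exact: bv.
- by move=> z a q /sub; exact: h2.
- by move=> z a q /sub; exact: h3.
- move=> y _; rewrite -[leRHS]/(g y) -(env_continuous cg).
  apply: env_mono; [exact: bv|exact: continuous_bdat|].
  by apply/nbhs_boxP; exists 1 => // x _ _; case/andP: (h1 x).
- move=> y _; have -> : - u0 y.2 + C * Num.max y.1 0 = - f y by rewrite /f opprD mulNr opprK.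
  rewrite -[leRHS]/((fun y => - f y) y) -(env_continuous cfN).
  apply: env_mono; [exact/bdatN/bv|exact: continuous_bdat|].
  by apply/nbhs_boxP; exists 1 => // x _ _; case/andP: (h1 x) => h _; rewrite lerN2 /f mulNr.
move=> y _; have := env_ge (bv eps y e0); have := env_ge (bdatN (bv eps y e0)).
by clear; lra.
Qed.

End PerronFamily.

(** * Existence, uniqueness and convergence *)

Section LimitProblem.
Context {R : realType}.
Implicit Types (z y : R * R) (a p : R) (u w v : R * R -> R) (h : R -> R) (H : R -> R -> R -> R) (T : \bar R).

Lemma sjet_near u w z a p : (\forall y \near z, u y = w y) -> sjet u z a p -> sjet w z a p.
Proof.
move=> h hj e e0; have e1 := nbhs_singleton h.
by move: h (hj e e0); apply: filterS2 => y <-; rewrite -e1.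
Qed.

Lemma fl_sub_c1_near hL hR F u w z : (\forall y \near z, u y = w y) ->
  fl_sub_c1 hL hR F u z -> fl_sub_c1 hL hR F w z.
Proof.
move=> h [h1 h2 h3]; have h' : \forall y \near z, w y = u y by apply: filterS h => y ->.
split=> z2 a.
- by move=> q /(sjet_near h'); exact: h1.
- by move=> q /(sjet_near h'); exact: h2.
move=> pL pR hj; apply: (h3 z2); apply: sjet_near hj.
by apply: filterS h' => y ->.
Qed.

Lemma fl_super_c1_near hL hR F u w z : (\forall y \near z, u y = w y) ->
  fl_super_c1 hL hR F u z -> fl_super_c1 hL hR F w z.
Proof.
move=> h [h1 h2 h3]; have h' : \forall y \near z, w y = u y by apply: filterS h => y ->.
split=> z2 a.
- by move=> q /(sjet_near h'); exact: h1.
- by move=> q /(sjet_near h'); exact: h2.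
move=> pL pR hj; apply: (h3 z2); apply: sjet_near hj.
by apply: filterS h' => y ->.
Qed.

Lemma fl_sub_at_near hL hR F u w z : (\forall y \near z, u y = w y) ->
  fl_sub_at hL hR F u z -> fl_sub_at hL hR F w z.
Proof.
move=> h [h1 h2 h3]; have h' : \forall y \near z, w y = u y by apply: filterS h => y ->.
split=> z2 a.
- by move=> q /(qjet_near h'); exact: h1.
- by move=> q /(qjet_near h'); exact: h2.
move=> pL pR hj; apply: (h3 z2); apply: qjet_near hj.
by apply: filterS h' => y ->.
Qed.

Lemma fl_super_at_near hL hR F u w z : (\forall y \near z, u y = w y) ->
  fl_super_at hL hR F u z -> fl_super_at hL hR F w z.
Proof.
move=> h [h1 h2 h3]; have h' : \forall y \near z, w y = u y by apply: filterS h => y ->.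
split=> z2 a.
- by move=> q /(qjet_near h'); exact: h1.
- by move=> q /(qjet_near h'); exact: h2.
move=> pL pR hj; apply: (h3 z2); apply: qjet_near hj.
by apply: filterS h' => y ->.
Qed.

Lemma locally_bounded_intro (D : set (R * R)) u :
  (forall z, D z -> exists M, \forall y \near z, D y -> `|u y| <= M) -> locally_bounded D u.
Proof.
move=> h z Dz; have [M hM] := h z Dz; exists M; split; first exact: num_real.
move=> N MN; apply: filterS hM => y hy Dy; exact: le_trans (hy Dy) (ltW MN).
Qed.

Lemma initial_upper T (u0 : R -> R) (L C : R) u : (forall x x', u0 x - u0 x' <= L * `|x - x'|) ->
  (forall y, 0 <= y.1 -> u y <= u0 y.2 + C * y.1) ->
  forall x, (usc_env (strip T) u (0%R, x) <= (u0 x)%:E)%E.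
Proof.
move=> hu h x; apply/lee_addgt0Pr => e e0; rewrite -EFinD; apply: usc_env_le.
have /cvgrPdist_lt /(_ e e0) := @continuous_barrier R u0 L C hu (0, x).
apply: filterS => y; rewrite /= maxxx mulr0 addr0 ltr_norml => /andP[h1 _] [y0 _].
by have := h y y0; move: h1; rewrite (max_idPl y0); clear; lra.
Qed.

Lemma ext_ge T (u0 : R -> R) u y : locally_bounded (strip T) u ->
  (forall x, (usc_env (strip T) u (0%R, x) <= (u0 x)%:E)%E) -> strip T y -> u y <= ext u0 u y.
Proof.
move=> lb hi [y0 yT]; rewrite /ext; case: ltP => y1; first exact: env_ge (bdat_strip lb y1 yT).
have yE : y = (0, y.2) by rewrite [LHS]surjective_pairing; congr (_, _); apply/le_anti; rewrite y0 y1.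
apply/ler_addgt0Pr => e e0; have := nbhs_singleton (usc_env_near e0 (hi y.2)).
by rewrite -yE; apply; split.
Qed.

Lemma lipschitz_bound (u0 : R -> R) : lipschitz u0 -> exists2 L : R, 0 <= L &
  forall x x', u0 x - u0 x' <= L * `|x - x'|.
Proof.
move=> [M [_ hM]]; exists (`|M| + 1); first by rewrite addr_ge0.
move=> x x'; have MM : M < `|M| + 1 by have := ler_norm M; lra.
by have := hM _ MM (x, x') (conj Logic.I Logic.I) => /=; apply: le_trans (ler_norm _).
Qed.

(** The sum u + w is nonnegative by construction and nonpositive by comparison; hence w is the
    opposite of u, and u inherits both inequalities and both barriers. *)
Lemma limit_solution H hL hR (p0L p0R L C : R) (u0 : R -> R) (U W : R -> R * R -> R) :
  hamiltonian H -> A1 H -> effective H hL hR ->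
  limit_hamiltonian hL -> limit_hamiltonian hR -> argmin hL p0L -> argmin hR p0R ->
  0 <= L -> (forall x x', u0 x - u0 x' <= L * `|x - x'|) -> 0 <= C ->
  (forall T : R, oscillating_family H T C u0 U W) ->
  let u := rsup (0 : R)^'+ U in
  (forall z, 0 <= z.1 -> rsup (0 : R)^'+ W z = - u z) /\
  fl_cauchy_solution hL hR (junction_fun (Abar H) hL hR p0L p0R) u0 u.
Proof.
move=> hH pH he hhL hhR mL mR L0 hu C0 fam u; set w := rsup (0 : R)^'+ W.
have T1 (t : R) : t < t + 1 by rewrite ltrDl.
have lbd z : locbd (0 : R)^'+ U z /\ locbd (0 : R)^'+ W z by exact: osc_locbd hu (fam _) _ (T1 z.1).
have uu z : usc u z by exact: usc_rsup (lbd z).1.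
have uw z : usc w z by exact: usc_rsup (lbd z).2.
have ub z : 0 <= z.1 -> u z <= u0 z.2 + C * z.1 /\ w z <= - u0 z.2 + C * z.1.
  by move=> z0; have := osc_limit_ub hu (fam _) (T1 z.1); rewrite (max_idPl z0).
have half z : 0 < z.1 -> fl_sub_c1 hL hR (junction_fun (Abar H) hL hR p0L p0R) u z /\
    fl_super_c1 hL hR (junction_fun (Abar H) hL hR p0L p0R) w z.
  move=> z0; apply: (half_relaxed_limits hu (fam (z.1 + 1))) => //.
  by rewrite z0 T1.
have wE z : 0 <= z.1 -> w z = - u z.
  move=> z0; have h1 := osc_limit_sum hu (fam _) (T1 z.1).
  have : u z + w z <= 0.
    rewrite (surjective_pairing z).
    apply: (@fl_comparison R hL hR (Abar H) p0L p0R C (z.1 + 1) u w u0) => //.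
    - by move=> t x /andP[t0 _]; have [] := ub (t, x) t0.
    - by move=> t x /andP[t0 _]; have [] := ub (t, x) t0.
    - by move=> y /andP[y0 _]; exact: fl_sub_c1_at (half y y0).1.
    - by move=> y /andP[y0 _]; exact: fl_super_c1_at (half y y0).2.
    by rewrite z0 T1.
  by move: h1; rewrite -/u -/w; clear; lra.
have lb y : 0 <= y.1 -> - (- u0 y.2 + C * y.1) <= u y.
  by move=> y0; have [_] := ub y y0; rewrite wE//; clear; lra.
have cb (k : R) : continuous (fun y : R * R => u0 y.2 + k * Num.max y.1 0) by exact: continuous_barrier hu.
have bd z : exists M, \forall y \near z, strip +oo y -> `|u y| <= M.
  have [r1 [M1 [r10 h1]]] := continuous_bdat z (cb C).
  have [r2 [M2 [r20 h2]]] := continuous_bdat z (cb (- C)).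
  exists (`|M1| + `|M2|); move: (nbhs_cbox z r10) (nbhs_cbox z r20); apply: filterS2 => y /h1 + /h2 + [y0 _].
  have := (ub y y0).1; have := lb y y0; rewrite (max_idPl y0) !ler_norml.
  have := ler_norm M1; have := ler_norm M2; have := normr_ge0 M1; have := normr_ge0 M2.
  by clear => ? ? ? ? ? ? /andP[? ?] /andP[? ?]; apply/andP; split; lra.
have lbu : locally_bounded (strip +oo) u by apply: locally_bounded_intro => z _; exact: bd.
have pos z : 0 < z.1 -> \forall y \near z, 0 < y.1.
  move=> z0; apply/nbhs_boxP; exists (z.1 / 2); first by rewrite divr_gt0.
  by move=> y hy _; move: hy z0; rewrite ler_norml; clear => /andP[? _]; lra.
have bdu y : 0 < y.1 -> bdat u y by move=> y0; apply: (bdat_strip lbu y0); exact: ltry.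
split => //; split.
- apply: fl_sub_test => // z z0; apply: fl_sub_c1_near (half z z0).1.
  by apply: filterS (pos z z0) => y y0; rewrite env_usc//; exact: bdu.
- apply: fl_super_test => // z z0; apply: fl_super_c1_near (half z z0).2.
  apply: filterS (pos z z0) => y y0; rewrite -(@env_usc R w y) //.
    apply: env_eq; first exact/bdatN/bdu.
    by apply: filterS (pos y y0) => x x0; rewrite wE// ltW.
  have [r [M [r_gt0 hr]]] := bdu y y0; have /nbhs_boxP[d d0 hd] := pos y y0.
  exists (Num.min r d), M; split; first by rewrite lt_min r_gt0.
  move=> x xb; have [x1 x2] : cbox y d x by apply: cbox_sub xb; rewrite ge_min lexx orbT.
  rewrite (wE x (ltW (hd x x1 x2))) normrN.
  by apply: hr; apply: cbox_sub xb; rewrite ge_min lexx.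
- move=> x; split.
    by apply: (initial_upper _ hu) => y y0; exact: (ub y y0).1.
  rewrite lsc_env_opp -leeNr -EFinN.
  apply: (@initial_upper _ (fun x => - u0 x) L C _ (lipschitzN hu)) => y y0.
  by rewrite -wE//; exact: (ub y y0).2.
move=> T' _; exists (`|u0 0| + L + C * `|T'|) => t x t0 tT.
have := ub (t, x) t0; have := lb (t, x) t0 => /= h1 [h2 _].
have := hu x 0; have := hu 0 x; rewrite sub0r subr0 normrN => h3 h4.
have h5 : C * t <= C * `|T'| by rewrite ler_wpM2l//; apply: le_trans tT (ler_norm _).
have h6 : 0 <= (`|u0 0| + C * `|T'|) * `|x| by rewrite mulr_ge0// addr_ge0// mulr_ge0.
have := ler_norm (u0 0); have := ler_norm (- u0 0); rewrite normrN ler_norml.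
by move: h1 h2 h3 h4 h5 h6 L0; clear => *; apply/andP; split; lra.
Qed.

(** A solution v is compared from both sides with the two limits of the Perron family, which
    coincide up to sign. The extension of v by the datum puts it in the form required by the
    comparison principle, and v itself lies between the extended envelopes. *)
Lemma fl_unique H hL hR (p0L p0R L C : R) (u0 : R -> R) (U W : R -> R * R -> R) v :
  hamiltonian H -> A1 H -> effective H hL hR ->
  limit_hamiltonian hL -> limit_hamiltonian hR -> argmin hL p0L -> argmin hR p0R ->
  0 <= L -> (forall x x', u0 x - u0 x' <= L * `|x - x'|) -> 0 <= C ->
  (forall T : R, oscillating_family H T C u0 U W) ->
  fl_cauchy_solution hL hR (junction_fun (Abar H) hL hR p0L p0R) u0 v ->
  forall z, 0 <= z.1 -> v z = rsup (0 : R)^'+ U z.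
Proof.
move=> hH pH he hhL hhR mL mR L0 hu C0 fam hv z z0.
have [wE _] := limit_solution hH pH he hhL hhR mL mR L0 hu C0 fam.
set u := rsup (0 : R)^'+ U in wE *; set w := rsup (0 : R)^'+ W in wE.
have T1 (t : R) : t < t + 1 by rewrite ltrDl.
have lbd y : locbd (0 : R)^'+ U y /\ locbd (0 : R)^'+ W y by exact: osc_locbd hu (fam _) _ (T1 y.1).
have ub y : 0 <= y.1 -> u y <= u0 y.2 + C * y.1 /\ w y <= - u0 y.2 + C * y.1.
  by move=> y0; have := osc_limit_ub hu (fam _) (T1 y.1); rewrite (max_idPl y0).
have half y : 0 < y.1 -> fl_sub_c1 hL hR (junction_fun (Abar H) hL hR p0L p0R) u y /\
    fl_super_c1 hL hR (junction_fun (Abar H) hL hR p0L p0R) w y.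
  move=> y0; apply: (half_relaxed_limits hu (fam (y.1 + 1))) => //.
  by rewrite y0 T1.
have [C' C'0 hC'] := fl_bound L0 hu hhL hhR mL mR hv.
have [hs hp hi _] := hv.
pose D := Num.max C C'; have CD : C <= D by rewrite le_max lexx.
have C'D : C' <= D by rewrite le_max lexx orbT.
have D0 : 0 <= D by exact: le_trans CD.
have up (c t : R) : 0 <= t -> c <= D -> c * t <= D * t by move=> t0 cD; rewrite ler_wpM2r.
have init1 x : (usc_env (strip +oo) v (0%R, x) <= (u0 x)%:E)%E by exact: (hi x).1.
have init2 := initial_opp (fun x => (hi x).2).
have cmp1 : ext u0 v z + w z <= 0.
  rewrite (surjective_pairing z).
  apply: (@fl_comparison R hL hR (Abar H) p0L p0R D (z.1 + 1) (ext u0 v) w u0) => //.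
  - by move=> y _; apply: (ext_usc hu hs.1 init1); exact: ltry.
  - by move=> y _; exact: usc_rsup (lbd y).2.
  - by move=> t x /andP[t0 _]; apply: le_trans (hC' t x t0).1 _; rewrite lerD2l up.
  - by move=> t x /andP[t0 _]; apply: le_trans (ub (t, x) t0).2 _; rewrite lerD2l up.
  - move=> y /andP[y0 _]; apply: fl_sub_at_near (ext_near u0 v y0) _; exact: fl_subsolution_at.
  - by move=> y /andP[y0 _]; exact: fl_super_c1_at (half y y0).2.
  by rewrite z0 T1.
have cmp2 : u z + ext (fun x => - u0 x) (fun y => - v y) z <= 0.
  rewrite (surjective_pairing z).
  apply: (@fl_comparison R hL hR (Abar H) p0L p0R D (z.1 + 1) u (ext (fun x => - u0 x) (fun y => - v y)) u0) => //.
  - by move=> y _; exact: usc_rsup (lbd y).1.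
  - move=> y _; apply: (ext_usc (lipschitzN hu) (locally_boundedN hp.1) init2); exact: ltry.
  - by move=> t x /andP[t0 _]; apply: le_trans (ub (t, x) t0).1 _; rewrite lerD2l up.
  - by move=> t x /andP[t0 _]; apply: le_trans (hC' t x t0).2 _; rewrite lerD2l up.
  - by move=> y /andP[y0 _]; exact: fl_sub_c1_at (half y y0).1.
  - move=> y /andP[y0 _]; apply: fl_super_at_near (ext_near _ _ y0) _; exact: fl_supersolution_at.
  by rewrite z0 T1.
have sz : strip +oo z by split => //; exact: ltry.
have g1 := ext_ge hs.1 init1 sz; have g2 := ext_ge (locally_boundedN hp.1) init2 sz.
by apply/le_anti/andP; split; move: cmp1 cmp2 g1 g2; rewrite wE//; clear; lra.
Qed.

Lemma uniform_convergence (K : set (R * R)) (f : R -> R * R -> R) u : compact K ->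
  (forall z e, K z -> 0 < e -> \forall y \near z & eps \near (0 : R)^'+, K y -> `|u y - f eps y| <= e) ->
  {uniform K, f eps @[eps --> (0 : R)^'+] --> u}.
Proof.
move=> cK h P /uniform_nbhs[E [entE hE]]; move: entE; rewrite -entourage_ballE => -[e /= e0 he].
have e2 : 0 < e / 2 by rewrite divr_gt0.
have : \forall eps \near (0 : R)^'+, K `<=` [set y | K y -> `|u y - f eps y| <= e / 2].
  apply: (iffLR (@compact_near_coveringP _ _) cK) => z Kz.
  have [[A B] /= [hA hB] hs] := h z (e / 2) Kz e2.
  by exists (A, B) => // -[y eps] /= [Ay Be]; exact: (hs (y, eps)).
apply: filterS => eps hK; apply: hE => y Ky; apply: he.
rewrite /ball /=; apply: le_lt_trans (hK y Ky Ky) _; move: e0; clear => /= ?; lra.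
Qed.

(** The half-relaxed limits of the given solutions are compared with u and its opposite, not with
    each other, so the limit is identified with the one already constructed. The resulting local
    estimates, valid near each point and up to t = 0, are made uniform by compactness. *)
Lemma cauchy_convergence H hL hR (p0L p0R L C T : R) (u0 : R -> R) (U W ueps : R -> R * R -> R) :
  hamiltonian H -> A1 H -> effective H hL hR ->
  limit_hamiltonian hL -> limit_hamiltonian hR -> argmin hL p0L -> argmin hR p0R ->
  0 <= L -> (forall x x', u0 x - u0 x' <= L * `|x - x'|) -> 0 <= C ->
  (forall T : R, oscillating_family H T C u0 U W) ->
  (forall eps : R, 0 < eps -> cauchy_solution T%:E (hscale H eps) u0 (ueps eps)) ->
  forall K : set (R * R), compact K -> K `<=` strip T%:E ->
  {uniform K, ueps eps @[eps --> (0 : R)^'+] --> rsup (0 : R)^'+ U}.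
Proof.
move=> hH pH he hhL hhR mL mR L0 hu C0 fam hue K cK KT.
have [wE _] := limit_solution hH pH he hhL hhR mL mR L0 hu C0 fam.
set u := rsup (0 : R)^'+ U in wE *; set w := rsup (0 : R)^'+ W in wE.
have T1 (t : R) : t < t + 1 by rewrite ltrDl.
have lbd y : locbd (0 : R)^'+ U y /\ locbd (0 : R)^'+ W y by exact: osc_locbd hu (fam _) _ (T1 y.1).
have uu z : usc u z by exact: usc_rsup (lbd z).1.
have uw z : usc w z by exact: usc_rsup (lbd z).2.
have ub y : 0 <= y.1 -> u y <= u0 y.2 + C * y.1 /\ w y <= - u0 y.2 + C * y.1.
  by move=> y0; have := osc_limit_ub hu (fam _) (T1 y.1); rewrite (max_idPl y0).
have half y : 0 < y.1 -> fl_sub_c1 hL hR (junction_fun (Abar H) hL hR p0L p0R) u y /\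
    fl_super_c1 hL hR (junction_fun (Abar H) hL hR p0L p0R) w y.
  move=> y0; apply: (half_relaxed_limits hu (fam (y.1 + 1))) => //.
  by rewrite y0 T1.
have [C' fam'] := cauchy_family L0 hu hH hue.
set Ue := fun eps => _ in fam'; set We := fun eps => ext _ _ in fam'.
have lbd' y : y.1 < T -> locbd (0 : R)^'+ Ue y /\ locbd (0 : R)^'+ We y by exact: osc_locbd hu fam' y.
pose D := Num.max C C'; have CD : C <= D by rewrite le_max lexx.
have C'D : C' <= D by rewrite le_max lexx orbT.
have D0 : 0 <= D by exact: le_trans CD.
have up (c t : R) : 0 <= t -> c <= D -> c * t <= D * t by move=> t0 cD; rewrite ler_wpM2r.
have ub' y : 0 <= y.1 -> y.1 < T -> rsup (0 : R)^'+ Ue y <= u0 y.2 + D * y.1 /\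
    rsup (0 : R)^'+ We y <= - u0 y.2 + D * y.1.
  move=> y0 yT; have := osc_limit_ub hu fam' yT; rewrite (max_idPl y0).
  by have := up C' _ y0 C'D; clear => ? [? ?]; split; lra.
have half' y : 0 < y.1 < T -> fl_sub_c1 hL hR (junction_fun (Abar H) hL hR p0L p0R) (rsup (0 : R)^'+ Ue) y /\
    fl_super_c1 hL hR (junction_fun (Abar H) hL hR p0L p0R) (rsup (0 : R)^'+ We) y.
  by move=> yT; exact: (half_relaxed_limits hu fam').
have cmp1 y : 0 <= y.1 -> y.1 < T -> rsup (0 : R)^'+ Ue y + w y <= 0.
  move=> y0 yT; rewrite (surjective_pairing y).
  apply: (@fl_comparison R hL hR (Abar H) p0L p0R D T _ w u0) => //.
  - by move=> z /lbd'[h _]; exact: usc_rsup.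
  - by move=> t x /andP[t0 tT]; have [] := ub' (t, x) t0 tT.
  - by move=> t x /andP[t0 _]; apply: le_trans (ub (t, x) t0).2 _; rewrite lerD2l up.
  - by move=> z zT; exact: fl_sub_c1_at (half' z zT).1.
  - by move=> z /andP[z0 _]; exact: fl_super_c1_at (half z z0).2.
  by rewrite y0.
have cmp2 y : 0 <= y.1 -> y.1 < T -> u y + rsup (0 : R)^'+ We y <= 0.
  move=> y0 yT; rewrite (surjective_pairing y).
  apply: (@fl_comparison R hL hR (Abar H) p0L p0R D T u _ u0) => //.
  - by move=> z /lbd'[_ h]; exact: usc_rsup.
  - by move=> t x /andP[t0 _]; apply: le_trans (ub (t, x) t0).1 _; rewrite lerD2l up.
  - by move=> t x /andP[t0 tT]; have [] := ub' (t, x) t0 tT.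
  - by move=> z /andP[z0 _]; exact: fl_sub_c1_at (half z z0).1.
  - by move=> z zT; exact: fl_super_c1_at (half' z zT).2.
  by rewrite y0.
apply: uniform_convergence => // z e Kz e0.
have [z0 zT] := KT z Kz; rewrite lte_fin in zT.
have e2 : 0 < e / 2 by rewrite divr_gt0.
have [lU lW] := lbd' z zT.
have h1 : rsup (0 : R)^'+ Ue z < u z + e / 2 by have := cmp1 z z0 zT; rewrite wE//; move: e0; clear; lra.
have h2 : rsup (0 : R)^'+ We z < - u z + e / 2 by have := cmp2 z z0 zT; move: e0; clear; lra.
have [[A1' B1] /= [hA1 hB1] hs1] := rsup_near lU h1.
have [[A2' B2] /= [hA2 hB2] hs2] := rsup_near lW h2.
have hA : \forall y \near z, [/\ A1' y, A2' y & u y < u z + e / 2 /\ w y < w z + e / 2].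
  have h3 : \forall y \near z, u y < u z + e / 2 /\ w y < w z + e / 2.
    by move: (uu z _ e2) (uw z _ e2); apply: filterS2.
  by move: hA1 hA2 h3; apply: filterS3.
have hB : \forall eps \near (0 : R)^'+, [/\ B1 eps, B2 eps & 0 < eps].
  have F0 : \forall eps \near (0 : R)^'+, 0 < eps by exact: nbhs_right_gt.
  by move: hB1 hB2 F0; apply: filterS3.
exists ([set y | [/\ A1' y, A2' y & u y < u z + e / 2 /\ w y < w z + e / 2]],
  [set eps | [/\ B1 eps, B2 eps & 0 < eps]]); first by split.
move=> [y eps] /= [[a1 a2 [uy wy]] [b1 b2 eps0]] Ky.
have sy := KT y Ky; have [y0 yT] := sy.
have [c1 c2 c3 _] := hue eps eps0.
have g1 := ext_ge c1.1 (fun x => (c3 x).1) sy.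
have g2 := ext_ge (locally_boundedN c2.1) (initial_opp (fun x => (c3 x).2)) sy.
have := hs1 (y, eps) (conj a1 b1); have := hs2 (y, eps) (conj a2 b2); rewrite /= /Ue /We.
move: uy wy g1 g2; rewrite (wE y y0) (wE z z0) ler_norml; clear => *; apply/andP; split; lra.
Qed.

End LimitProblem.

Theorem theorem1p7 (R : realType) (H HL HR : R -> R -> R -> R)
  (hA0 : A0 H) (hA1 : A1 H) (hA2 : A2 H) (hA3 : A3 H) (hA4 : A4 H)
  (hA5 : A5 H HL HR)
  (hB : (Bi HL /\ Bi HR) \/ (Bii HL /\ Bii HR))
  (p0L p0R : R)
  (hp0L : argmin (Hbar HL) p0L) (hp0R : argmin (Hbar HR) p0R)
  (T : R) (hT : 0 < T)
  (u0 : R -> R) (hu0 : lipschitz u0) :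
  exists u : R * R -> R,
    let F := junction_fun (Abar H) (Hbar HL) (Hbar HR) p0L p0R in
    [/\ fl_cauchy_solution (Hbar HL) (Hbar HR) F u0 u,
        forall v : R * R -> R,
          fl_cauchy_solution (Hbar HL) (Hbar HR) F u0 v ->
          forall z, 0 <= z.1 -> v z = u z &
        forall ueps : R -> R * R -> R,
          (forall eps : R, 0 < eps ->
             cauchy_solution T%:E (fun t x p => H (t / eps) (x / eps) p)
               u0 (ueps eps)) ->
          forall K : set (R * R), compact K -> K `<=` strip T%:E ->
            {uniform K, ueps eps @[eps --> 0^'+] --> u}].
Proof.
have hH := A_hamiltonian hA0 hA1 hA2 hA3 hA5.
have [hL hR pL pR he] := A_effective hH hA1 hA5.
have [bL bR] : (Bi HL \/ Bii HL) /\ (Bi HR \/ Bii HR) by case: hB => -[? ?]; split; auto.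
have lL := Hbar_limit_hamiltonian hL pL bL; have lR := Hbar_limit_hamiltonian hR pR bR.
have [L L0 hu] := lipschitz_bound hu0.
have [C [U [W [C0 fam]]]] := perron_family hH hu.
exists (rsup (0 : R)^'+ U) => F; split.
- exact: (limit_solution hH hA1 he lL lR hp0L hp0R L0 hu C0 fam).2.
- by move=> v hv z z0; exact: (fl_unique hH hA1 he lL lR hp0L hp0R L0 hu C0 fam hv).
by move=> ueps; exact: (cauchy_convergence hH hA1 he lL lR hp0L hp0R L0 hu C0 fam).
Qed.
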